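(* Assume $\frac56\le s<1$ and let $u$ be a weak solution of the stationary fractional Navier--Stokes equations $$(-\Delta)^su+u\cdot\nabla u+\nabla P=0,\qquad\nabla\cdot u=0\qquad\text{in }\mathbb{R}^3,$$ with $\int_{\mathbb{R}^3}|(-\Delta)^{\frac s2}u|^2dx<\infty$. Then $$\int_{\mathbb{R}^3}|(-\Delta)^{\frac s2} u|^2dx=-\liminf_{k\to-\infty}\Big\{\int_{\mathbb{R}^3}\sum_{l=k-1}^{k+2}\sum_{l'=l-2}^{k-1}\dot{S}_{l-2}\dot{S}_{k}u\cdot\nabla\dot{\Delta}_{l'}u\cdot\dot{\Delta}_lu^k\,dx+\int_{\mathbb{R}^3}\sum_{l=k-3}^{k}\dot{\Delta}_l\dot{S}_ku\cdot\nabla\dot{S}_ku\cdot\tilde{\dot{\Delta}}_lu^k\,dx+\int_{\mathbb{R}^3}\sum_{l=k-1}^{[\frac{k}{2}]}\dot{\Delta}_l u^k\cdot\nabla \dot{S}_ku\cdot\tilde{\dot{\Delta}}_lu^k\,dx\Big\},$$ where $k$ ranges over the integers.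
   Context: Fourier transform on $\mathcal{S}'(\mathbb{R}^3)$: $\hat f(\xi)=(2\pi)^{-3/2}\int_{\mathbb{R}^3} e^{-ix\cdot\xi}f(x)\,dx$, with inverse $\mathcal{F}^{-1}$; $(-\Delta)^{\sigma}f=\mathcal{F}^{-1}(|\xi|^{2\sigma}\hat f)$; $\|f\|_{\dot H^\sigma}=(\int_{\mathbb{R}^3}|\xi|^{2\sigma}|\hat f(\xi)|^2d\xi)^{1/2}$. Weak solution: a vector field $u\in\dot H^s(\mathbb{R}^3)$ is a weak solution of the stationary fractional Navier--Stokes equations $(-\Delta)^su+u\cdot\nabla u+\nabla P=0$, $\nabla\cdot u=0$ in $\mathbb{R}^3$ if $u$ is weakly divergence free and, for some $P\in\mathcal{S}'(\mathbb{R}^3)$ and all $\phi\in(C_0^\infty(\mathbb{R}^3))^3$, $$\int_{\mathbb{R}^3}(-\Delta)^{\frac s2}u\cdot(-\Delta)^{\frac s2}\phi\,dx=\int_{\mathbb{R}^3}(u\otimes u):\nabla\phi\,dx+\int_{\mathbb{R}^3}P\,\nabla\cdot\phi\,dx,$$ where $(\nabla\phi)_{i,j}=\partial_j\phi_i$ and the last integral is a duality pairing. Littlewood--Paley notation: $B_r=\{x\in\mathbb{R}^3:|x|\le r\}$. Fix a non-negative $\psi\in C_0^\infty(B_1)$ with $\psi(\xi)=1$ for $|\xi|\le\frac12$, and set $\varphi(\xi)=\psi(2^{-1}\xi)-\psi(\xi)$. For $k\in\mathbb{Z}$ put $\dot\Delta_ku=\mathcal{F}^{-1}(\varphi(2^{-k}\cdot)\hat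 u)$ and $\dot S_ku=\mathcal{F}^{-1}(\psi(2^{-k}\cdot)\hat u)$ (componentwise on vector fields). Also $u^k=u-\dot S_ku$ and $\tilde{\dot\Delta}_lu=\sum_{|l'-l|\le2}\dot\Delta_{l'}u$. For vector fields $a,b,c$: $a\cdot\nabla b\cdot c=\sum_{i,j=1}^3a_j\,\partial_jb_i\,c_i$. $[x]$ denotes the integer part (floor) of $x$. Empty sums are zero. *)

(* Defs.v *)
From HB Require Import structures.
From mathcomp Require Import all_boot all_order all_algebra.
From mathcomp Require Import all_classical all_reals all_analysis.
From mathcomp Require Import complex.

Set Implicit Arguments.
Unset Strict Implicit.
Unset Printing Implicit Defensive.

Import Order.TTheory GRing.Theory Num.Theory.
Import numFieldNormedType.Exports.

Local Open Scope classical_set_scope.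
Local Open Scope complex_scope.
Local Open Scope ring_scope.

(* R^3 as an iterated product, which carries the library's normed-module
   structure (used for derivatives) and product sigma-algebra.  The library
   norm of this type is the max norm; the Euclidean norm is [enorm]. *)
Notation R3 R := (R * R * R)%type (only parsing).

Definition coord (R : realType) (x : R3 R) (i : 'I_3) : R :=
  match val i with 0%N => x.1.1 | 1%N => x.1.2 | _ => x.2 end.

Definition std_basis (R : realType) (i : 'I_3) : R3 R :=
  ((val i == 0%N)%:R, (val i == 1%N)%:R, (val i == 2%N)%:R).

Definition dotp (R : realType) (x y : R3 R) : R :=
  \sum_(i < 3) coord x i * coord y i.

Definition enorm (R : realType) (x : R3 R) : R := Num.sqrt (dotp x x).

Definition eball (R : realType) (r : R) : set (R3 R) := [set x | enorm x <= r].

(* [measurableTypeR R] is R with its Borel sigma-algebra. *)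
Definition leb1 (R : realType) : {measure set (measurableTypeR R) -> \bar R} :=
  @lebesgue_measure R.

Definition leb3 (R : realType) :
  {measure set (measurableTypeR R * measurableTypeR R * measurableTypeR R)
     -> \bar R} :=
  ((@leb1 R \x @leb1 R) \x @leb1 R)%E.

Definition cintegral (R : realType) (f : R3 R -> R[i]) : R[i] :=
  (\int[@leb3 R]_x complex.Re (f x)) +i* (\int[@leb3 R]_x complex.Im (f x)).

Definition locally_integrable3 (R : realType) (g : R3 R -> R[i]) : Prop :=
  forall r : R,
    (@leb3 R).-integrable (eball r) (fun x => (complex.Re (g x))%:E) /\
    (@leb3 R).-integrable (eball r) (fun x => (complex.Im (g x))%:E).

Definition partial (R : realType) (i : 'I_3) (f : R3 R -> R) : R3 R -> R :=
  fun x => 'D_(std_basis R i) f x.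

Definition iter_partial (R : realType) (w : seq 'I_3) (f : R3 R -> R) :
  R3 R -> R := foldr (@partial R) f w.

Definition smooth (R : realType) (f : R3 R -> R) : Prop :=
  forall w : seq 'I_3,
    continuous (iter_partial w f) /\
    forall i x, derivable (iter_partial w f) x (std_basis R i).

Definition test_function (R : realType) (f : R3 R -> R) : Prop :=
  smooth f /\ exists r : R, forall x, r < enorm x -> f x = 0.

(* P holds of the real and the imaginary part of f. *)
Definition cpart (R : realType) (f : R3 R -> R[i]) (P : (R3 R -> R) -> Prop) :
  Prop := P (fun x => complex.Re (f x)) /\ P (fun x => complex.Im (f x)).

Definition cpartial (R : realType) (i : 'I_3) (f : R3 R -> R[i]) :
  R3 R -> R[i] :=
  fun x => partial i (fun y => complex.Re (f y)) x
        +i* partial i (fun y => complex.Im (f y)) x.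

(* p_N(f) = sup over |w| <= N and x of (1 + |x|)^N |d^w f(x)| *)
Definition schwartz_seminorm (R : realType) (N : nat) (f : R3 R -> R[i]) :
  \bar R :=
  ereal_sup [set z | exists (w : seq 'I_3) (x : R3 R), (size w <= N)%N /\
    z = ((1 + enorm x) ^+ N * Normc.normc (foldr (@cpartial R) f w x))%:E].

Definition schwartz (R : realType) (f : R3 R -> R[i]) : Prop :=
  cpart f (@smooth R) /\ forall N, (schwartz_seminorm N f < +oo)%E.

(* Elements of S'(R^3) are functionals satisfying [tempered]; only their
   values on Schwartz functions are meaningful. *)
Definition dist (R : realType) : Type := (R3 R -> R[i]) -> R[i].

Definition tempered (R : realType) (T : dist R) : Prop :=
  (forall (a : R[i]) (f g : R3 R -> R[i]), schwartz f -> schwartz g ->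
     T (fun x => a * f x + g x) = a * T f + T g) /\
  exists (N : nat) (c : R), forall f, schwartz f ->
    ((Normc.normc (T f))%:E <= c%:E * schwartz_seminorm N f)%E.

Definition real_dist (R : realType) (T : dist R) : Prop :=
  forall f : R3 R -> R, test_function f ->
    complex.Im (T (fun x => (f x)%:C)) = 0.

Definition dist_of (R : realType) (g : R3 R -> R[i]) : dist R :=
  fun f => cintegral (fun x => g x * f x).

Definition represents (R : realType) (T : dist R) (g : R3 R -> R[i]) : Prop :=
  locally_integrable3 g /\
  forall f, cpart f (@test_function R) -> T f = dist_of g f.

(* The locally integrable function that T is, when T is one; it is determined
   up to a null set, so that integrals of expressions in [fun_of T] do not
   depend on the choice. *)
Definition fun_of (R : realType) (T : dist R) : R3 R -> R[i] :=
  xget (fun=> 0) [set g | represents T g].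

Definition fourier (R : realType) (f : R3 R -> R[i]) : R3 R -> R[i] :=
  fun xi => ((2 * pi) `^ (- (3 / 2)))%:C *
    cintegral (fun x => (cos (dotp x xi) -i* sin (dotp x xi)) * f x).

Definition inv_fourier (R : realType) (f : R3 R -> R[i]) : R3 R -> R[i] :=
  fun x => ((2 * pi) `^ (- (3 / 2)))%:C *
    cintegral (fun xi => (cos (dotp x xi) +i* sin (dotp x xi)) * f xi).

Definition dfourier (R : realType) (T : dist R) : dist R :=
  fun f => T (fourier f).

Definition dinv_fourier (R : realType) (T : dist R) : dist R :=
  fun f => T (inv_fourier f).

Definition dmul (R : realType) (m : R3 R -> R) (T : dist R) : dist R :=
  fun f => T (fun x => (m x)%:C * f x).

Definition dpartial (R : realType) (i : 'I_3) (T : dist R) : dist R :=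
  fun f => - T (cpartial i f).

Definition hdot_norm (R : realType) (sigma : R) (T : dist R) : \bar R :=
  ((\int[@leb3 R]_xi (enorm xi `^ (2 * sigma) *
      Normc.normc (fun_of (dfourier T) xi) ^+ 2)%:E) `^ 2^-1)%E.

Definition Hdot (R : realType) (sigma : R) (T : dist R) : Prop :=
  [/\ tempered T, exists g, represents (dfourier T) g
    & (hdot_norm sigma T < +oo)%E].

(* |xi|^(2 sigma) is not smooth at 0, so it multiplies the function that the
   Fourier transform of T is, rather than a general distribution. *)
Definition frac_lap (R : realType) (sigma : R) (T : dist R) : dist R :=
  dinv_fourier (dist_of (fun xi =>
    (enorm xi `^ (2 * sigma))%:C * fun_of (dfourier T) xi)).

Definition weak_solution (R : realType) (s : R) (u : 'I_3 -> dist R) : Prop :=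
  [/\ forall i, Hdot s (u i),
      forall i, real_dist (u i),
      forall f, cpart f (@test_function R) ->
        \sum_(i < 3) dpartial i (u i) f = 0
    & exists P : dist R, tempered P /\
      forall phi : 'I_3 -> R3 R -> R, (forall i, test_function (phi i)) ->
        cintegral (fun x => \sum_(i < 3)
          fun_of (frac_lap (s / 2) (u i)) x *
          fun_of (frac_lap (s / 2) (dist_of (fun y => (phi i y)%:C))) x)
        = cintegral (fun x => \sum_(i < 3) \sum_(j < 3)
            fun_of (u i) x * fun_of (u j) x * (partial j (phi i) x)%:C)
          + P (fun x => (\sum_(i < 3) partial i (phi i) x)%:C)].

Definition lp_cutoff (R : realType) (psi : R3 R -> R) : Prop :=
  [/\ smooth psi,
      forall xi, 0 <= psi xi,
      forall xi, psi xi != 0 -> eball 1 xi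
    & forall xi, enorm xi <= 2^-1 -> psi xi = 1].

Definition lp_phi (R : realType) (psi : R3 R -> R) : R3 R -> R :=
  fun xi => psi ((2^-1 : R) *: xi) - psi xi.

Definition lp_Delta (R : realType) (psi : R3 R -> R) (k : int) (T : dist R) :
  dist R :=
  dinv_fourier (dmul (fun xi => lp_phi psi ((2 ^ (- k) : R) *: xi))
                     (dfourier T)).

Definition lp_S (R : realType) (psi : R3 R -> R) (k : int) (T : dist R) :
  dist R :=
  dinv_fourier (dmul (fun xi => psi ((2 ^ (- k) : R) *: xi)) (dfourier T)).

Definition lp_high (R : realType) (psi : R3 R -> R) (k : int) (T : dist R) :
  dist R := fun f => T f - lp_S psi k T f.

(* a, a+1, ..., b; empty when b < a *)
Definition zrange (a b : int) : seq int :=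
  if a <= b then [seq a + n%:Z | n <- iota 0 (absz (b - a)).+1] else [::].

Definition lp_tDelta (R : realType) (psi : R3 R -> R) (l : int) (T : dist R) :
  dist R := fun f => \sum_(l' <- zrange (l - 2) (l + 2)) lp_Delta psi l' T f.

(* a . grad b . c, pointwise *)
Definition trilin (R : realType) (a b c : 'I_3 -> dist R) (x : R3 R) : R[i] :=
  \sum_(i < 3) \sum_(j < 3)
    fun_of (a j) x * fun_of (dpartial j (b i)) x * fun_of (c i) x.

(* The sum of three integrals whose lower limit is taken.  It is complex because
   psi is not assumed even; it is real when psi is. *)
Definition flux (R : realType) (psi : R3 R -> R) (u : 'I_3 -> dist R)
  (k : int) : R[i] :=
  let S l (v : 'I_3 -> dist R) i := lp_S psi l (v i) in
  let D l (v : 'I_3 -> dist R) i := lp_Delta psi l (v i) in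
  let tD l (v : 'I_3 -> dist R) i := lp_tDelta psi l (v i) in
  let uk i := lp_high psi k (u i) in
  cintegral (fun x => \sum_(l <- zrange (k - 1) (k + 2))
    \sum_(l' <- zrange (l - 2) (k - 1))
      trilin (S (l - 2) (S k u)) (D l' u) (D l uk) x)
  + cintegral (fun x => \sum_(l <- zrange (k - 3) k)
      trilin (D l (S k u)) (S k u) (tD l uk) x)
  + cintegral (fun x => \sum_(l <- zrange (k - 1) (k %/ 2)%Z)
      trilin (D l uk) (S k u) (tD l uk) x).

Definition energy (R : realType) (s : R) (u : 'I_3 -> dist R) : \bar R :=
  \int[@leb3 R]_x
    (\sum_(i < 3) Normc.normc (fun_of (frac_lap (s / 2) (u i)) x) ^+ 2)%:E.

(* Main.v *)
From Pilot Require Import Defs.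
(* Let g be the Fourier transform of u.  Testing the equation with fields orthogonal to the
   frequency y, which kills the pressure, gives |y|^{2s} |g(y)|^2 as a quadratic convolution of g
   paired with g(-y), for almost every y.  Multiply by 1 - psi(2^{-k} y) and by a radial Lipschitz
   cutoff at |y| ~ N, and integrate over xi + eta + zeta = 0.  The part where eta and zeta are both
   high is antisymmetric under eta <-> zeta up to the difference of the cutoffs at eta and zeta; as
   N -> oo it vanishes, because min(|xi|,|eta|,|zeta|) |g(xi)| |g(eta)| |g(zeta)| is integrable at
   high frequencies for s >= 5/6.  What remains carries psi_k(eta) (1 - psi_k(zeta)).  By
   telescoping, the three paraproducts of the flux carry the same multiplier when |xi| < 2^[k/2];
   for larger |xi| the multiplier is bounded and the contribution is O(2^{[k/2]}). *)
From HB Require Import structures.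
From mathcomp Require Import all_boot all_order all_algebra.
From mathcomp Require Import all_classical all_reals all_analysis.
From mathcomp Require Import complex.
From mathcomp Require Import measurable_realfun.
From mathcomp Require Import ring lra zify.
Import Pilot.Defs.
Set Implicit Arguments.
Unset Strict Implicit.
Unset Printing Implicit Defensive.
Import Order.TTheory GRing.Theory Num.Theory.
Import numFieldNormedType.Exports.
Local Open Scope classical_set_scope.
Local Open Scope complex_scope.
Local Open Scope ring_scope.

(** Near frequency 0 the function [g] is only locally integrable, at infinity |y|^s g is square
    integrable; hence every integral is split between low and high frequencies, and [u] is a bounded
    function plus an L^2 one. The number 5/6: for a trilinear form carrying one factor |xi| of the
    smallest frequency and weights of degree 5/6 on each function, the remaining degree is 1 - 3 *
    5/6 = -3/2, whose square is the inverse volume of the ball |xi| <= |eta|. The cutoff at |y| ~ N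
    must be radial: eta and zeta = -xi - eta are nearly opposite, not nearly equal, when xi is
    small, and [psi] need not be even. The endpoint [k/2]: with r = 2^[k/2] the error lives on |xi|
    >= r and |eta| <= 2^k <= 2 r^2. Trading the two functions at xi and zeta for weighted ones costs
    r^-2, while the factor |eta| |g(eta)| integrates to O(r^3); the product is O(r). The bound s < 1
    gives |y| <= |y|^s near 0 and |y|^s <= 1 + |y| everywhere. The sequence of fluxes is shown to
    converge, so that its lower limit is a limit. *)

Notation mspace R := (measurableTypeR R * measurableTypeR R * measurableTypeR R)%type.
Notation cabs := Normc.normc.
Notation Re := complex.Re.
Notation Im := complex.Im.

(** * Complex-valued integrals *)

Section complex_numbers.
Variable R : realType.
Implicit Types z w : R[i].

Lemma cabs_ge0 z : 0 <= cabs z.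
Proof. by case: z => a b; exact: sqrtr_ge0. Qed.

Lemma cabsM z w : cabs (z * w) = cabs z * cabs w.
Proof. exact: Normc.normcM. Qed.

Lemma cabsD z w : cabs (z + w) <= cabs z + cabs w.
Proof. exact: le_normcD. Qed.

Lemma cabsN z : cabs (- z) = cabs z.
Proof. exact: normcN. Qed.

Lemma cabsB z w : cabs (z - w) <= cabs z + cabs w.
Proof. by rewrite -(cabsN w); exact: cabsD. Qed.

Lemma cabs0 : cabs (0 : R[i]) = 0. Proof. exact: Normc.normc0. Qed.

Lemma cabs1 : cabs (1 : R[i]) = 1. Proof. exact: Normc.normc1. Qed.

Lemma cabs_eq0 z : cabs z = 0 -> z = 0. Proof. exact: Normc.eq0_normc. Qed.

Lemma cabs_real (a : R) : cabs a%:C = `|a|.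
Proof. by rewrite /= expr0n /= addr0 sqrtr_sqr. Qed.

Lemma sqr_cabs z : cabs z ^+ 2 = Re z ^+ 2 + Im z ^+ 2.
Proof. by case: z => a b /=; rewrite sqr_sqrtr// addr_ge0// sqr_ge0. Qed.

Lemma Re_le_cabs z : `|Re z| <= cabs z.
Proof.
rewrite -[leLHS]ger0_norm// -[leRHS]ger0_norm ?cabs_ge0// -ler_sqr ?nnegrE//.
by rewrite !normr_id (ger0_norm (cabs_ge0 z)) sqr_cabs real_normK ?num_real// lerDl sqr_ge0.
Qed.

Lemma Im_le_cabs z : `|Im z| <= cabs z.
Proof.
rewrite -[leLHS]ger0_norm// -[leRHS]ger0_norm ?cabs_ge0// -ler_sqr ?nnegrE//.
by rewrite !normr_id (ger0_norm (cabs_ge0 z)) sqr_cabs real_normK ?num_real// lerDr sqr_ge0.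
Qed.

Lemma cabs_le_ReIm z : cabs z <= `|Re z| + `|Im z|.
Proof.
rewrite -ler_sqr ?nnegrE ?cabs_ge0 ?addr_ge0// sqr_cabs sqrrD !real_normK ?num_real//.
by rewrite lerD2r lerDl mulrn_wge0// mulr_ge0.
Qed.

Lemma cabs_conj z : cabs z^* = cabs z.
Proof. by case: z => a b /=; rewrite sqrrN. Qed.

Lemma mul_conj z : z * z^* = (cabs z ^+ 2)%:C.
Proof. by rewrite sqr_cabs; case: z => a b; simpc; congr (_ +i* _); ring. Qed.

Lemma cabs_sum (I : Type) (r : seq I) (P : pred I) (F : I -> R[i]) :
  cabs (\sum_(i <- r | P i) F i) <= \sum_(i <- r | P i) cabs (F i).
Proof.
elim/big_ind2: _ => [|x a y b xa yb|//]; first by rewrite cabs0.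
by rewrite (le_trans (cabsD _ _))// lerD.
Qed.

Lemma ReM z w : Re (z * w)
  = Re z * Re w - Im z * Im w.
Proof. by case: z; case: w. Qed.

Lemma ImM z w : Im (z * w)
  = Re z * Im w + Im z * Re w.
Proof. by case: z; case: w. Qed.

Lemma ReD z w : Re (z + w) = Re z + Re w.
Proof. by case: z; case: w. Qed.

Lemma ImD z w : Im (z + w) = Im z + Im w.
Proof. by case: z; case: w. Qed.

Lemma ReN z : Re (- z) = - Re z. Proof. by case: z. Qed.

Lemma ImN z : Im (- z) = - Im z. Proof. by case: z. Qed.

Lemma ReIm_eq z w : Re z = Re w -> Im z = Im w -> z = w.
Proof. by case: z; case: w => ? ? ? ? /= -> ->. Qed.

(** Convergence in C is phrased as a real null sequence, so that squeezing arguments stay in the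
    real field. *)
Definition ccvg (z_ : nat -> R[i]) z := (fun n => cabs (z_ n - z)) @ \oo --> (0 : R).

Lemma cabs_cvg0_unique z : (fun _ : nat => cabs z) @ \oo --> (0 : R) -> z = 0.
Proof.
move=> h; apply: cabs_eq0; apply: (cvg_unique _ _ h) => //; exact: cvg_cst.
Qed.

Lemma squeeze0 (a b : nat -> R) : (forall n, 0 <= a n) -> (forall n, a n <= b n) ->
  b @ \oo --> (0 : R) -> a @ \oo --> (0 : R).
Proof.
move=> a0 ab b0; apply: (@squeeze_cvgr _ _ _ _ (cst 0) b) => //; last exact: cvg_cst.
by apply: nearW => n; rewrite a0 ab.
Qed.

Lemma cvg0D (a b : nat -> R) : a @ \oo --> (0 : R) -> b @ \oo --> (0 : R) ->
  (fun n => a n + b n) @ \oo --> (0 : R).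
Proof. by move=> ha hb; rewrite -(addr0 (0 : R)); exact: cvgD. Qed.

Lemma cvg0Z (c : R) (a : nat -> R) : a @ \oo --> (0 : R) ->
  (fun n => c * a n) @ \oo --> (0 : R).
Proof. by move=> ha; rewrite -(mulr0 c); apply: cvgM => //; exact: cvg_cst. Qed.

Lemma ccvgD (z_ : nat -> R[i]) z (w_ : nat -> R[i]) w : ccvg z_ z -> ccvg w_ w -> ccvg (fun n => z_ n + w_ n) (z + w).
Proof.
move=> hz hw; apply: (@squeeze0 _ (fun n => cabs (z_ n - z) + cabs (w_ n - w))).
- by move=> n; exact: cabs_ge0.
- by move=> n; rewrite opprD addrACA cabsD.
- exact: cvg0D.
Qed.

Lemma ccvgZ (c : R[i]) (z_ : nat -> R[i]) z : ccvg z_ z -> ccvg (fun n => c * z_ n) (c * z).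
Proof.
move=> hz; rewrite /ccvg.
under eq_fun do rewrite -mulrBr cabsM.
exact: cvg0Z.
Qed.

Lemma ccvg_cst z : ccvg (fun=> z) z.
Proof. by rewrite /ccvg subrr cabs0; exact: cvg_cst. Qed.

Lemma ccvgN (z_ : nat -> R[i]) z : ccvg z_ z -> ccvg (fun n => - z_ n) (- z).
Proof. by move=> /(ccvgZ (-1)); rewrite mulN1r; under eq_fun do rewrite mulN1r. Qed.

Lemma ccvg_sum (I : Type) (r : seq I) (F_ : I -> nat -> R[i]) (F : I -> R[i]) :
  (forall i, ccvg (F_ i) (F i)) ->
  ccvg (fun n => \sum_(i <- r) F_ i n) (\sum_(i <- r) F i).
Proof.
move=> h; elim: r => [|i r IH].
  by rewrite big_nil; under eq_fun do rewrite big_nil; exact: ccvg_cst.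
by rewrite big_cons; under eq_fun do rewrite big_cons; exact: ccvgD.
Qed.

Lemma ccvg_unique (z_ : nat -> R[i]) z w : ccvg z_ z -> ccvg z_ w -> z = w.
Proof.
move=> hz hw; apply/eqP; rewrite -subr_eq0; apply/eqP; apply: cabs_cvg0_unique.
apply: (@squeeze0 _ (fun n => cabs (z_ n - z) + cabs (z_ n - w))).
- by move=> n; exact: cabs_ge0.
- by move=> n; rewrite -(cabsN (_ - z)) opprB (le_trans _ (cabsD _ _))// addrA subrK.
- exact: cvg0D.
Qed.

Lemma ccvg_Re (z_ : nat -> R[i]) z : ccvg z_ z -> (fun n => Re (z_ n)) @ \oo --> Re z.
Proof.
move=> hz; apply/cvgrPdist_le => e e0.
move/cvgrPdist_le : hz => /(_ _ e0); apply: filterS => n.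
rewrite sub0r normrN ger0_norm ?cabs_ge0//; apply: le_trans.
by rewrite distrC -ReN -ReD Re_le_cabs.
Qed.

End complex_numbers.

Section complex_integral.
Context d (T : measurableType d) (R : realType).
Implicit Types (mu : {measure set T -> \bar R}) (f g : T -> R[i]).

(** Measurability is read off the real and imaginary parts; no sigma-algebra on [R[i]] is
    involved. *)
Definition cmeas f := measurable_fun setT (fun x => Re (f x)) /\
  measurable_fun setT (fun x => Im (f x)).

Definition cL1 mu f := cmeas f /\ mu.-integrable setT (fun x => (cabs (f x))%:E).

Definition cint mu f : R[i] :=
  (\int[mu]_x Re (f x)) +i* (\int[mu]_x Im (f x)).

Lemma cmeas_cst (c : R[i]) : cmeas (fun _ => c).
Proof. by split; exact: measurable_cst. Qed.

Lemma cmeas_real (h : T -> R) : measurable_fun setT h -> cmeas (fun x => (h x)%:C).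
Proof. by move=> mh; split => //; exact: measurable_cst. Qed.

Lemma cmeasD f g : cmeas f -> cmeas g -> cmeas (fun x => f x + g x).
Proof.
move=> [fr fi] [gr gi]; split.
  by under eq_fun do rewrite ReD; exact: measurable_funD.
by under eq_fun do rewrite ImD; exact: measurable_funD.
Qed.

Lemma cmeasN f : cmeas f -> cmeas (fun x => - f x).
Proof.
move=> [fr fi]; split.
  by under eq_fun do rewrite ReN; exact: measurable_funN.
by under eq_fun do rewrite ImN; exact: measurable_funN.
Qed.

Lemma cmeasB f g : cmeas f -> cmeas g -> cmeas (fun x => f x - g x).
Proof. by move=> mf mg; apply: cmeasD => //; exact: cmeasN. Qed.

Lemma cmeasM f g : cmeas f -> cmeas g -> cmeas (fun x => f x * g x).
Proof.
move=> [fr fi] [gr gi]; split.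
  under eq_fun do rewrite ReM.
  by apply: measurable_funB; exact: measurable_funM.
under eq_fun do rewrite ImM.
by apply: measurable_funD; exact: measurable_funM.
Qed.

Lemma cmeas_conj f : cmeas f -> cmeas (fun x => (f x)^*).
Proof.
move=> [fr fi]; split.
  by rewrite (_ : (fun x => _) = (fun x => Re (f x)))//; apply/funext => x; case: (f x).
rewrite (_ : (fun x => _) = (fun x => - Im (f x))); first exact: measurable_funN.
by apply/funext => x; case: (f x).
Qed.

Lemma cmeas_sum (I : Type) (r : seq I) (F : I -> T -> R[i]) :
  (forall i, cmeas (F i)) -> cmeas (fun x => \sum_(i <- r) F i x).
Proof.
move=> h; elim: r => [|i r IH].
  by under eq_fun do rewrite big_nil; exact: cmeas_cst.
by under eq_fun do rewrite big_cons; exact: cmeasD.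
Qed.

Lemma measurable_cabs f : cmeas f -> measurable_fun setT (fun x => cabs (f x)).
Proof.
move=> [fr fi].
rewrite (_ : (fun x => _) = (fun x => (Re (f x) ^+ 2 + Im (f x) ^+ 2) `^ 2^-1)).
  apply: (measurableT_comp (measurable_powR _)).
  by apply: measurable_funD; exact: measurable_funX.
apply/funext => x; rewrite powR12_sqrt; last by rewrite addr_ge0// sqr_ge0.
by rewrite -sqr_cabs sqrtr_sqr ger0_norm// cabs_ge0.
Qed.

Lemma measurable_RE (h : T -> R) : measurable_fun setT h ->
  measurable_fun setT (fun x => (h x)%:E).
Proof. by move=> mh; apply/measurable_EFinP. Qed.

Lemma measurable_ecabs f : cmeas f -> measurable_fun setT (fun x => (cabs (f x))%:E).
Proof. by move=> mf; apply/measurable_EFinP; exact: measurable_cabs. Qed.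

Lemma cL1_dom mu f (h : T -> R) : cmeas f -> (forall x, cabs (f x) <= h x) ->
  mu.-integrable setT (fun x => (h x)%:E) -> cL1 mu f.
Proof.
move=> mf fh ih; split => //; apply: le_integrable ih => //.
  exact: measurable_ecabs.
move=> x _ /=; rewrite lee_fin ger0_norm ?cabs_ge0//.
by rewrite (le_trans (fh x))// ler_norm.
Qed.

Lemma cL1_lty mu f : cmeas f -> (\int[mu]_x (cabs (f x))%:E < +oo)%E -> cL1 mu f.
Proof.
move=> mf fo; split => //; apply/integrableP; split; first exact: measurable_ecabs.
by under eq_integral do rewrite gee0_abs ?lee_fin ?cabs_ge0//.
Qed.

Lemma cL1_fin mu f : cL1 mu f -> (\int[mu]_x (cabs (f x))%:E < +oo)%E.
Proof.
move=> [_ /integrableP[_]].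
by under eq_integral do rewrite gee0_abs ?lee_fin ?cabs_ge0//.
Qed.

Lemma cL1_le mu f g : cmeas f -> cL1 mu g -> (forall x, cabs (f x) <= cabs (g x)) -> cL1 mu f.
Proof. by move=> mf [mg ig] fg; exact: cL1_dom ig. Qed.

Lemma integrable_RD mu (f g : T -> R) : mu.-integrable setT (fun x => (f x)%:E) ->
  mu.-integrable setT (fun x => (g x)%:E) ->
  mu.-integrable setT (fun x => (f x + g x)%:E).
Proof. by move=> hf hg; under eq_fun do rewrite EFinD; exact: integrableD. Qed.

Lemma integrable_RZ mu c (f : T -> R) : mu.-integrable setT (fun x => (f x)%:E) ->
  mu.-integrable setT (fun x => (c * f x)%:E).
Proof. by move=> hf; under eq_fun do rewrite EFinM; exact: integrableZl. Qed.

Lemma cL1D mu f g : cL1 mu f -> cL1 mu g -> cL1 mu (fun x => f x + g x).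
Proof.
move=> [mf ilf] [mg ilg]; apply: (@cL1_dom _ _ (fun x => cabs (f x) + cabs (g x))).
- exact: cmeasD.
- by move=> x; exact: cabsD.
- exact: integrable_RD.
Qed.

Lemma cL1Z mu (c : R[i]) f : cL1 mu f -> cL1 mu (fun x => c * f x).
Proof.
move=> [mf ilf]; apply: (@cL1_dom _ _ (fun x => cabs c * cabs (f x))).
- by apply: cmeasM => //; exact: cmeas_cst.
- by move=> x; rewrite cabsM.
- exact: integrable_RZ.
Qed.

Lemma cL1N mu f : cL1 mu f -> cL1 mu (fun x => - f x).
Proof. by move=> /(cL1Z (-1)); under eq_fun do rewrite mulN1r. Qed.

Lemma cL1B mu f g : cL1 mu f -> cL1 mu g -> cL1 mu (fun x => f x - g x).
Proof. by move=> hf hg; apply: cL1D => //; exact: cL1N. Qed.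

Lemma cL10 mu : cL1 mu (fun _ => 0).
Proof.
apply: cL1_lty; first exact: cmeas_cst.
by rewrite integral0_eq// => x _; rewrite cabs0.
Qed.

Lemma cL1_sum mu (I : Type) (r : seq I) (F : I -> T -> R[i]) :
  (forall i, cL1 mu (F i)) -> cL1 mu (fun x => \sum_(i <- r) F i x).
Proof.
move=> h; elim: r => [|i r IH].
  by under eq_fun do rewrite big_nil; exact: cL10.
by under eq_fun do rewrite big_cons; exact: cL1D.
Qed.

Lemma cL1_Re mu f : cL1 mu f -> mu.-integrable setT (fun x => (Re (f x))%:E).
Proof.
move=> [[mr mi] ih]; apply: le_integrable ih => //; first exact/measurable_EFinP.
by move=> x _ /=; rewrite lee_fin (ger0_norm (cabs_ge0 _)) Re_le_cabs.
Qed.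

Lemma cL1_Im mu f : cL1 mu f -> mu.-integrable setT (fun x => (Im (f x))%:E).
Proof.
move=> [[mr mi] ih]; apply: le_integrable ih => //; first exact/measurable_EFinP.
by move=> x _ /=; rewrite lee_fin (ger0_norm (cabs_ge0 _)) Im_le_cabs.
Qed.

Lemma cL1_ReIm mu f : mu.-integrable setT (fun x => (Re (f x))%:E) ->
  mu.-integrable setT (fun x => (Im (f x))%:E) -> cL1 mu f.
Proof.
move=> ir ii.
apply: (@cL1_dom _ _ (fun x => `|Re (f x)| + `|Im (f x)|)).
- split; apply/measurable_EFinP; [exact: (measurable_int mu ir)|exact: (measurable_int mu ii)].
- by move=> x; exact: cabs_le_ReIm.
- apply: integrable_RD; first exact: (integrable_norm ir).
  exact: (integrable_norm ii).
Qed.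

Lemma cintD mu f g : cL1 mu f -> cL1 mu g ->
  cint mu (fun x => f x + g x) = cint mu f + cint mu g.
Proof.
move=> hf hg; apply: ReIm_eq; rewrite ?ReD ?ImD /=.
  under eq_Rintegral do rewrite ReD.
  by rewrite RintegralD//; exact: cL1_Re.
under eq_Rintegral do rewrite ImD.
by rewrite RintegralD//; exact: cL1_Im.
Qed.

Lemma cintZ mu (c : R[i]) f : cL1 mu f -> cint mu (fun x => c * f x) = c * cint mu f.
Proof.
move=> hf; have hr := cL1_Re hf; have hi := cL1_Im hf.
apply: ReIm_eq; rewrite ?ReM ?ImM /=.
  under eq_Rintegral do rewrite ReM.
  rewrite RintegralB//; [|exact: integrable_RZ..].
  by rewrite !RintegralZl.
under eq_Rintegral do rewrite ImM.
rewrite RintegralD//; [|exact: integrable_RZ..].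
by rewrite !RintegralZl.
Qed.

Lemma cintZr mu (c : R[i]) f : cL1 mu f -> cint mu (fun x => f x * c) = cint mu f * c.
Proof. by move=> hf; under eq_fun do rewrite mulrC; rewrite cintZ// mulrC. Qed.

Lemma cintN mu f : cL1 mu f -> cint mu (fun x => - f x) = - cint mu f.
Proof. by move=> hf; rewrite -mulN1r -cintZ//; congr cint; apply/funext => x; rewrite mulN1r. Qed.

Lemma cintB mu f g : cL1 mu f -> cL1 mu g ->
  cint mu (fun x => f x - g x) = cint mu f - cint mu g.
Proof. by move=> hf hg; rewrite cintD ?cintN//; exact: cL1N. Qed.

Lemma cint0 mu : cint mu (fun=> 0) = 0.
Proof. by rewrite /cint /Rintegral !integral0. Qed.

Lemma cint_sum mu (I : Type) (r : seq I) (F : I -> T -> R[i]) :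
  (forall i, cL1 mu (F i)) ->
  cint mu (fun x => \sum_(i <- r) F i x) = \sum_(i <- r) cint mu (F i).
Proof.
move=> h; elim: r => [|i r IH].
  by rewrite big_nil; under eq_fun do rewrite big_nil; exact: cint0.
rewrite big_cons; under eq_fun do rewrite big_cons.
by rewrite cintD ?IH//; exact: cL1_sum.
Qed.

(** A unimodular factor [a] rotates the integral to the nonnegative real axis; the bound then
    reduces to the real part of [a * f]. *)
Lemma cabs_cint mu f : cL1 mu f ->
  ((cabs (cint mu f))%:E <= \int[mu]_x (cabs (f x))%:E)%E.
Proof.
move=> hf; set z := cint mu f.
have [z0|z0] := eqVneq z 0.
  by rewrite z0 cabs0; apply: integral_ge0 => x _; rewrite lee_fin cabs_ge0.
have cz : cabs z != 0 by apply: contra_neq z0; exact: cabs_eq0.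
pose a := z^* * ((cabs z)^-1)%:C.
have ca : cabs a = 1.
  by rewrite cabsM cabs_conj cabs_real ger0_norm ?invr_ge0 ?cabs_ge0// divff.
have az : a * z = (cabs z)%:C.
  rewrite mulrAC (mulrC _ z) mul_conj -rmorphM /= expr2 mulfK//.
have <- : Re (cint mu (fun x => a * f x)) = cabs z by rewrite cintZ// az.
have haf := cL1Z a hf.
rewrite /= /Rintegral fineK; last exact: integrable_fin_num (cL1_Re haf).
apply: le_integral => //; first exact: cL1_Re.
  by case: hf.
by move=> x _; rewrite lee_fin (le_trans (ler_norm _))// (le_trans (Re_le_cabs _))// cabsM ca mul1r.
Qed.

Lemma cabs_cint_le mu f (h : T -> R) : cmeas f -> (forall x, cabs (f x) <= h x) ->
  mu.-integrable setT (fun x => (h x)%:E) ->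
  cabs (cint mu f) <= \int[mu]_x h x.
Proof.
move=> mf fh ih; have hf := cL1_dom mf fh ih.
rewrite -lee_fin (le_trans (cabs_cint hf))// /Rintegral fineK; last exact: integrable_fin_num.
apply: le_integral => //; first by case: hf.
by move=> x _; rewrite lee_fin.
Qed.

Lemma ae_eq_cint mu f g : cmeas f -> cmeas g -> {ae mu, forall x, f x = g x} ->
  cint mu f = cint mu g.
Proof.
move=> [fr fi] [gr gi] fg; rewrite /cint /Rintegral; congr (fine _ +i* fine _).
  apply: ae_eq_integral => //; [exact/measurable_EFinP..|].
  by apply: filterS fg => x + _ => ->.
apply: ae_eq_integral => //; [exact/measurable_EFinP..|].
by apply: filterS fg => x + _ => ->.
Qed.

Lemma cL1_ae mu f g : cmeas g -> {ae mu, forall x, f x = g x} -> cL1 mu f -> cL1 mu g.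
Proof.
move=> mg fg [mf lf]; apply: cL1_lty => //.
rewrite (@ae_eq_integral _ _ _ mu setT (fun x => (cabs (f x))%:E))//.
- by apply: cL1_fin; split.
- exact: measurable_ecabs.
- exact: measurable_ecabs.
- by apply: filterS fg => x + _ => ->.
Qed.

Lemma cdct mu (f_ : nat -> T -> R[i]) f (h : T -> R) :
  (forall n, cmeas (f_ n)) -> cmeas f ->
  {ae mu, forall x, ccvg (f_ ^~ x) (f x)} ->
  mu.-integrable setT (fun x => (h x)%:E) ->
  {ae mu, forall x n, cabs (f_ n x) <= h x} ->
  [/\ cL1 mu f,
      (fun n => \int[mu]_x (cabs (f_ n x - f x))%:E)%E @ \oo --> (0%E : \bar R)
    & ccvg (fun n => cint mu (f_ n)) (cint mu f)].
Proof.
move=> mf_ mf cf ih hf.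
have [N1 [mN1 N10 sub1]] := cf; have [N2 [mN2 N20 sub2]] := hf.
(* The limit inherits the dominating function, so that [2 * h] dominates the differences
   [f_ n - f]. *)
have fh : {ae mu, forall x, cabs (f x) <= h x}.
  apply: filterS2 cf hf => x cfx hfx.
  apply/ler_addgt0Pr => e e0.
  have /cvgrPdist_le/(_ _ e0) := cfx.
  move=> [N _ /(_ N (leqnn _))].
  rewrite sub0r normrN ger0_norm ?cabs_ge0// => hN.
  rewrite -[f x](subrK (f_ N x)) addrC (le_trans (cabsD _ _))// lerD//.
  by rewrite -cabsN opprB.
have hg : cL1 mu f.
  apply: cL1_lty => //; apply: le_lt_trans (_ : (\int[mu]_x `|(h x)%:E| < +oo)%E).
    apply: ae_ge0_le_integral => //.
    - by move=> x _; rewrite lee_fin cabs_ge0.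
    - exact: measurable_ecabs.
    - by apply: measurableT_comp => //; exact: measurable_int ih.
    - by apply: filterS fh => x fhx _; rewrite lee_fin (le_trans fhx)// ler_norm.
  by have /integrableP[] := ih.
have mh : measurable_fun setT (fun x => (h x)%:E) by exact: measurable_int ih.
have hg_ n : cL1 mu (f_ n).
  apply: cL1_lty => //; apply: le_lt_trans (_ : (\int[mu]_x `|(h x)%:E| < +oo)%E).
    apply: ae_ge0_le_integral => //.
    - by move=> x _; rewrite lee_fin cabs_ge0.
    - exact: measurable_ecabs.
    - by apply: measurableT_comp.
    - by apply: filterS hf => x fhx _; rewrite lee_fin (le_trans (fhx n))// ler_norm.
  by have /integrableP[] := ih.
have [_ _ cv] := @dominated_convergence _ _ _ mu setT measurableT
  (fun n x => (cabs (f_ n x - f x))%:E) (fun=> 0%:E) (fun x => (2 * h x)%:E)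
  (fun n => measurable_ecabs (cmeasB (mf_ n) mf)) (measurable_cst _)
  ltac:(by apply: filterS cf => x cfx _; apply: cvg_EFin => //; exact: nearW)
  ltac:(by exact: integrable_RZ)
  ltac:(by apply: filterS2 hf fh => x hfx fhx n _; rewrite gee0_abs ?lee_fin ?cabs_ge0//;
    rewrite (le_trans (cabsB _ _))// mulr2n mulrDl mul1r lerD).
rewrite integral0 in cv.
split => //.
have : (fun n => fine (\int[mu]_x (cabs (f_ n x - f x))%:E)%E) @ \oo --> (0 : R).
  by have /fine_cvgP[] := cv.
apply: squeeze0; first by move=> n; exact: cabs_ge0.
move=> n; rewrite -cintB// -lee_fin fineK; first by apply: cabs_cint; exact: cL1B.
by apply: integrable_fin_num => //; have [] := cL1B (hg_ n) hg.
Qed.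

End complex_integral.

Lemma cmeas_comp d1 d2 (T1 : measurableType d1) (T2 : measurableType d2) (R : realType)
    (f : T2 -> R[i]) (phi : T1 -> T2) :
  measurable_fun setT phi -> cmeas f -> cmeas (fun x => f (phi x)).
Proof. by move=> mphi [fr fi]; split; [exact: (measurableT_comp fr)|exact: (measurableT_comp fi)]. Qed.

(** * Fubini and Tonelli for complex-valued functions *)

Section fubini.
Context d1 d2 (T1 : measurableType d1) (T2 : measurableType d2) (R : realType).
Variables (m1 : {sigma_finite_measure set T1 -> \bar R})
  (m2 : {sigma_finite_measure set T2 -> \bar R}).

Lemma tonelli1 (h : T1 * T2 -> R) : measurable_fun setT h -> (forall x, 0 <= h x) ->
  (\int[m1 \x m2]_z (h z)%:E = \int[m1]_x \int[m2]_y (h (x, y))%:E)%E.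
Proof.
move=> mh h0; rewrite fubini_tonelli1//; first exact/measurable_EFinP.
Qed.

Lemma tonelli2 (h : T1 * T2 -> R) : measurable_fun setT h -> (forall x, 0 <= h x) ->
  (\int[m1 \x m2]_z (h z)%:E = \int[m2]_y \int[m1]_x (h (x, y))%:E)%E.
Proof.
move=> mh h0; rewrite fubini_tonelli2//; first exact/measurable_EFinP.
Qed.

(** Integrability is not at stake: the integrals of the positive and negative parts are measurable
    as extended reals, and [fine] turns their difference into a real function, with value 0 where it
    is infinite. *)
Lemma measurable_Rint2 (h : T1 * T2 -> R) : measurable_fun setT h ->
  measurable_fun setT (fun x => \int[m2]_y h (x, y)).
Proof.
move=> mh; rewrite /Rintegral; apply: (measurableT_comp (fine_measurable measurableT)) => //.
under eq_fun do rewrite integralE.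
have mH : measurable_fun setT (EFin \o h) by exact/measurable_EFinP.
apply: emeasurable_funB.
  rewrite (_ : (fun x => _) = fubini_F m2 ((EFin \o h)^\+)%E).
    by apply: measurable_fun_fubini_tonelli_F => //; exact: measurable_funepos.
  by apply/funext => x; apply: eq_integral => y _; rewrite !funeposE.
rewrite (_ : (fun x => _) = fubini_F m2 ((EFin \o h)^\-)%E).
  by apply: measurable_fun_fubini_tonelli_F => //; exact: measurable_funeneg.
by apply/funext => x; apply: eq_integral => y _; rewrite !funenegE.
Qed.

Lemma cmeas_cint2 (f : T1 * T2 -> R[i]) : cmeas f ->
  cmeas (fun x => cint m2 (fun y => f (x, y))).
Proof. by move=> [fr fi]; split; [exact: (measurable_Rint2 fr)|exact: (measurable_Rint2 fi)]. Qed.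

Lemma Rfubini1 (h : T1 * T2 -> R) : (m1 \x m2)%E.-integrable setT (fun z => (h z)%:E) ->
  \int[(m1 \x m2)%E]_z h z = \int[m1]_x \int[m2]_y h (x, y).
Proof.
move=> ih; have mh : measurable_fun setT h by apply/measurable_EFinP; exact: measurable_int ih.
rewrite /Rintegral -integral12_prod_meas1//; congr fine.
apply: ae_eq_integral => //.
- exact: (measurable_fubini_F ih).
- exact: (measurable_RE (measurable_Rint2 mh)).
- have := ae_integrable1 ih; apply: filterS => x ix _.
  by rewrite /fubini_F fineK//; exact: integrable_fin_num ix.
Qed.

Lemma cfubini1 (f : T1 * T2 -> R[i]) : cL1 (m1 \x m2)%E f ->
  cint (m1 \x m2)%E f = cint m1 (fun x => cint m2 (fun y => f (x, y))).
Proof.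
move=> hf; apply: ReIm_eq => /=; apply: Rfubini1; [exact: cL1_Re|exact: cL1_Im].
Qed.

Lemma cL1_cint2 (f : T1 * T2 -> R[i]) : cL1 (m1 \x m2)%E f ->
  cL1 m1 (fun x => cint m2 (fun y => f (x, y))).
Proof.
move=> hf; have [mf _] := hf; apply: cL1_lty; first exact: cmeas_cint2.
apply: le_lt_trans (cL1_fin hf).
rewrite tonelli1; [|exact: measurable_cabs|by move=> x; exact: cabs_ge0].
apply: ae_ge0_le_integral => //.
- by move=> x _; rewrite lee_fin cabs_ge0.
- by apply: measurable_ecabs; exact: cmeas_cint2.
- by move=> x _; apply: integral_ge0 => y _; rewrite lee_fin cabs_ge0.
- apply: (@measurable_fun_fubini_tonelli_F _ _ _ _ _ m2 (fun z => (cabs (f z))%:E)) => //.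
    exact: measurable_ecabs.
  by move=> x; rewrite lee_fin cabs_ge0.
- have [mc ic] := hf; have := ae_integrable1 ic; apply: filterS => x ix _.
  apply: cabs_cint; split => //.
  exact: (cmeas_comp (measurable_pair1 x) mf).
Qed.

End fubini.

Section fubini_swap.
Context d1 d2 (T1 : measurableType d1) (T2 : measurableType d2) (R : realType).
Variables (m1 : {sigma_finite_measure set T1 -> \bar R})
  (m2 : {sigma_finite_measure set T2 -> \bar R}).

Lemma cL1_swap (f : T1 * T2 -> R[i]) : cL1 (m1 \x m2)%E f ->
  cL1 (m2 \x m1)%E (fun z => f (z.2, z.1)).
Proof.
move=> hf; have [mf _] := hf.
have ms : cmeas (fun z : T2 * T1 => f (z.2, z.1)).
  apply: cmeas_comp mf; apply/measurable_fun_pairP; split => /=;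
    [exact: measurable_snd|exact: measurable_fst].
apply: cL1_lty => //.
rewrite tonelli2; [|exact: measurable_cabs|by move=> x; exact: cabs_ge0].
rewrite /= -(@tonelli1 _ _ _ _ _ m1 m2 (fun z => cabs (f z)));
  [|exact: measurable_cabs|by move=> x; exact: cabs_ge0].
exact: cL1_fin.
Qed.

Lemma Rfubini2 (h : T1 * T2 -> R) : (m1 \x m2)%E.-integrable setT (fun z => (h z)%:E) ->
  \int[(m1 \x m2)%E]_z h z = \int[m2]_y \int[m1]_x h (x, y).
Proof.
move=> ih; have mh : measurable_fun setT h by apply/measurable_EFinP; exact: measurable_int ih.
have ms : measurable_fun setT (fun z : T2 * T1 => h (z.2, z.1)).
  by apply: (measurableT_comp mh); apply/measurable_fun_pairP; split => /=;
    [exact: measurable_snd|exact: measurable_fst].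
rewrite /Rintegral -integral21_prod_meas1//; congr fine.
apply: ae_eq_integral => //.
- exact: (measurable_fubini_G ih).
- exact: (measurable_RE (@measurable_Rint2 _ _ _ _ _ m1 _ ms)).
- have := ae_integrable2 ih; apply: filterS => x ix _.
  by rewrite /fubini_G fineK//; exact: integrable_fin_num ix.
Qed.

Lemma cfubini2 (f : T1 * T2 -> R[i]) : cL1 (m1 \x m2)%E f ->
  cint (m1 \x m2)%E f = cint m2 (fun y => cint m1 (fun x => f (x, y))).
Proof.
move=> hf; apply: ReIm_eq => /=.
  exact: (Rfubini2 (cL1_Re hf)).
exact: (Rfubini2 (cL1_Im hf)).
Qed.

End fubini_swap.

Definition lam1 (R : realType) :
  {sigma_finite_measure set (measurableTypeR R) -> \bar R} := @lebesgue_measure R.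

Section sigma_finite_product.
Context d1 d2 (T1 : measurableType d1) (T2 : measurableType d2) (R : realType)
 (m1 : {sigma_finite_measure set T1 -> \bar R}) (m2 : {sigma_finite_measure set T2 -> \bar R}).

(** Sigma-finiteness must be propagated through products because Fubini is iterated: [lam3] is a
    product of a product, and [lam33] a product of two copies of [lam3]. *)
Lemma product_sigma_finite : sigma_finite setT (m1 \x m2)%E.
Proof.
have /sigma_finiteP[F [TF ndF Foo]] := sigma_finiteT m1.
have /sigma_finiteP[G [TG ndG Goo]] := sigma_finiteT m2.
exists (fun n => F n `*` G n).
  rewrite -setXTT TF TG predeqE => -[x y]; split.
    move=> [/= [n _ Fnx] [k _ Gky]]; exists (maxn n k) => //; split.
    - by move: x Fnx; exact/subsetPset/ndF/leq_maxl.
    - by move: y Gky; exact/subsetPset/ndG/leq_maxr.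
  by move=> [n _ []/= ? ?]; split; exists n.
move=> k; have [? ?] := Foo k; have [? ?] := Goo k.
split; first exact: measurableX.
by rewrite product_measure1E// lte_mul_pinfty// ge0_fin_numE.
Qed.

Let prod := (m1 \x m2)%E.

HB.instance Definition _ := Measure.on prod.

HB.instance Definition _ := Measure_isSigmaFinite.Build _ _ _ prod product_sigma_finite.

Definition sfprod : {sigma_finite_measure set (T1 * T2)%type -> \bar R} := prod.
End sigma_finite_product.
Definition lam3 (R : realType) :
  {sigma_finite_measure set (measurableTypeR R * measurableTypeR R * measurableTypeR R)%type
    -> \bar R} := sfprod (sfprod (lam1 R) (lam1 R)) (lam1 R).

Definition lam33 (R : realType) := sfprod (lam3 R) (lam3 R).

Lemma cintegralE (R : realType) f : cintegral f = cint (lam3 R) f.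
Proof. by []. Qed.

(** * Lebesgue measure under affine maps *)

Section scaling_maps.
Context d (T : measurableType d) (R : realType).
Implicit Types (mu : {measure set T -> \bar R}) (phi : T -> T) (c : R).

(** The change of variables formula, with inverse Jacobian [c], is itself the definition. Tested on
    nonnegative functions it passes to product maps by Tonelli, and to integrable functions through
    positive and negative parts. *)
Definition scales mu c phi := measurable_fun setT phi /\
  forall k : T -> \bar R, measurable_fun setT k -> (forall x, 0 <= k x)%E ->
    (\int[mu]_x k (phi x) = c%:E * \int[mu]_x k x)%E.

Lemma scales_integrable mu c phi (h : T -> R) : 0 < c -> scales mu c phi ->
  mu.-integrable setT (fun x => (h x)%:E) ->
  mu.-integrable setT (fun x => (h (phi x))%:E).
Proof.
move=> c0 [mphi hphi] /integrableP[mh ih]; apply/integrableP; split.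
  exact: (measurableT_comp mh mphi).
rewrite (hphi (fun x => `|(h x)%:E|%E))//; last exact: measurableT_comp.
by rewrite lte_mul_pinfty// lee_fin ltW.
Qed.

Lemma scales_integral mu c phi (h : T -> R) : 0 < c -> scales mu c phi ->
  mu.-integrable setT (fun x => (h x)%:E) ->
  (\int[mu]_x (h (phi x))%:E = c%:E * \int[mu]_x (h x)%:E)%E.
Proof.
move=> c0 [mphi hphi] ih; have mh := measurable_int mu ih.
rewrite [LHS]integralE [X in (_ * X)%E]integralE.
have -> : (\int[mu]_x (fun x => (h (phi x))%:E)^\+ x =
  \int[mu]_x ((fun x => (h x)%:E)^\+ (phi x)))%E.
  by apply: eq_integral => x _; rewrite !funeposE.
have -> : (\int[mu]_x (fun x => (h (phi x))%:E)^\- x =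
  \int[mu]_x ((fun x => (h x)%:E)^\- (phi x)))%E.
  by apply: eq_integral => x _; rewrite !funenegE.
rewrite !hphi//; [|exact: measurable_funeneg|exact: measurable_funepos].
have : ((\int[mu]_x (fun x => (h x)%:E)^\+ x) \is a fin_num)%E.
  rewrite ge0_fin_numE; first exact: integral_funepos_lt_pinfty.
  by apply: integral_ge0 => x _; exact: funepos_ge0.
set A := (\int[mu]_x (fun x => (h x)%:E)^\+ x)%E.
set B := (\int[mu]_x (fun x => (h x)%:E)^\- x)%E => Afin.
by apply/esym; apply: muleBr => //; exact: fin_num_adde_defr.
Qed.

Lemma scales_cL1 mu c phi f : 0 < c -> scales mu c phi -> cL1 mu f ->
  cL1 mu (fun x => f (phi x) : R[i]).
Proof.
move=> c0 h [mf lf]; split; first exact: (cmeas_comp (proj1 h) mf).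
exact: (scales_integrable c0 h lf).
Qed.

Lemma scales_cint mu c phi f : 0 < c -> scales mu c phi -> cL1 mu f ->
  cint mu (fun x => f (phi x)) = c%:C * cint mu f.
Proof.
move=> c0 h hf; apply: ReIm_eq; rewrite ?ReM ?ImM /= /Rintegral ?mul0r ?subr0 ?addr0.
  rewrite (scales_integral c0 h (cL1_Re hf)) fineM//.
  by apply: integrable_fin_num (cL1_Re hf).
rewrite (scales_integral c0 h (cL1_Im hf)) fineM//.
by apply: integrable_fin_num (cL1_Im hf).
Qed.

End scaling_maps.

Lemma scales_prod d1 d2 (T1 : measurableType d1) (T2 : measurableType d2) (R : realType)
  (m1 : {sigma_finite_measure set T1 -> \bar R}) (m2 : {sigma_finite_measure set T2 -> \bar R})
  (c1 c2 : R) (p1 : T1 -> T1) (p2 : T2 -> T2) : 0 <= c1 -> 0 <= c2 ->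
  scales m1 c1 p1 -> scales m2 c2 p2 ->
  scales (sfprod m1 m2) (c1 * c2) (fun z => (p1 z.1, p2 z.2)).
Proof.
move=> c10 c20 [mp1 h1] [mp2 h2].
have mp : measurable_fun setT (fun z : T1 * T2 => (p1 z.1, p2 z.2)).
  apply/measurable_fun_pairP; split => /=.
    exact: (measurableT_comp mp1 measurable_fst).
  exact: (measurableT_comp mp2 measurable_snd).
split => // k mk k0.
rewrite (fubini_tonelli1 (fun z => k (p1 z.1, p2 z.2)))//; last exact: (measurableT_comp mk mp).
rewrite fubini_tonelli1// /fubini_F /=.
transitivity (\int[m1]_x (c2%:E * (fubini_F m2 k) (p1 x)))%E.
  apply: eq_integral => x _; rewrite (h2 (fun y => k (p1 x, y)))//.
  exact: (measurableT_comp mk (measurable_pair1 _)).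
have mF := @measurable_fun_fubini_tonelli_F _ _ _ _ _ m2 k mk k0.
have F0 x : (0 <= fubini_F m2 k x)%E by apply: integral_ge0.
rewrite ge0_integralZl//; last exact: (measurableT_comp mF mp1).
by rewrite h1// muleA -EFinM mulrC.
Qed.

Section maps1.
Variable R : realType.

(** The image measure agrees with Lebesgue measure on half-open intervals, and these determine
    it. *)
Lemma scales1_shift (a : R) : scales (@lam1 R) 1 (fun x : measurableTypeR R => (x + a : R)).
Proof.
have mp : measurable_fun setT (fun x : measurableTypeR R => (x + a : R) : measurableTypeR R).
  by apply: measurable_funD => //; exact: measurable_cst.
split => // k mk k0.
rewrite mul1e -[LHS](@ge0_integral_pushforward _ _ _ _ _ _ mp (@lam1 R) setT k)//.
apply: eq_measure_integral => A mA _.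
apply/esym/lebesgue_measure_unique => //= _ [[u v]] _ <-.
rewrite /pushforward (_ : _ @^-1` _ = `]u - a, v - a]%classic).
  rewrite !lebesgue_measure_itv/= !lte_fin ltrD2r.
  by case: ifP => // _; rewrite -!EFinD; congr (_%:E); ring.
by apply/seteqP; split => x /=; rewrite !in_itv/= ltrBlDr lerBrDr.
Qed.

Lemma scales1_opp : scales (@lam1 R) 1 (fun x : measurableTypeR R => (- x : R)).
Proof.
have mp : measurable_fun setT (fun x : measurableTypeR R => (- x : R) : measurableTypeR R).
  exact: oppr_measurable.
split => // k mk k0.
rewrite mul1e -[LHS](@ge0_integral_pushforward _ _ _ _ _ _ mp (@lam1 R) setT k)//.
by apply: eq_measure_integral => A mA _; exact: lebesgue_measureN.
Qed.

Lemma scales1_mul (c : R) : 0 < c ->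
  scales (@lam1 R) c^-1 (fun x : measurableTypeR R => (c * x : R)).
Proof.
move=> c0.
have mp : measurable_fun setT (fun x : measurableTypeR R => (c * x : R) : measurableTypeR R).
  by apply: measurable_funM => //; exact: measurable_cst.
split => // k mk k0.
have E : (\int[@lam1 R]_x k x = c%:E * \int[@lam1 R]_x k ((c * x)%R : R))%E.
  rewrite -[X in (_ * X)%E](@ge0_integral_pushforward _ _ _ _ _ _ mp (@lam1 R) setT k)//.
  rewrite -(@ge0_integral_mscale _ _ _ (pushforward (@lam1 R) _) setT measurableT
    (NngNum (ltW c0)) k)//.
  apply: eq_measure_integral => A mA _.
  apply: lebesgue_measure_unique => //= _ [[u v]] _ <-.
  change (lebesgue_measure `]u, v]%classic =
    (c%:E * lebesgue_measure (( *%R c) @^-1` `]u, v]%classic))%E).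
  rewrite (_ : _ @^-1` _ = `]u / c, v / c]%classic).
    rewrite !lebesgue_measure_itv/= !lte_fin ltr_pM2r ?invr_gt0//.
    case: ifP => // _; rewrite ?mule0// -!EFinD -EFinM; congr (_%:E).
    by rewrite mulrBr !mulrA !(mulrC c) !mulfK ?gt_eqF.
  apply/seteqP; split => x /=; rewrite !in_itv/= ltr_pdivrMr// ler_pdivlMr//;
    by rewrite mulrC.
by rewrite E muleA -EFinM mulVf ?gt_eqF// mul1e.
Qed.

End maps1.

Section maps3.
Variable R : realType.
Notation V := (mspace R).
Implicit Types a x : R * R * R.

Lemma scales3_shift a : scales (@lam3 R) 1 (fun x : V => (x : R * R * R) + a).
Proof.
have := scales_prod (mulr_ge0 ler01 ler01) ler01 (scales_prod ler01 ler01
  (scales1_shift a.1.1) (scales1_shift a.1.2)) (scales1_shift a.2).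
by rewrite !mulr1; congr scales; apply/funext => -[[x y] z]; case: a => [[]].
Qed.

Lemma scales3_opp : scales (@lam3 R) 1 (fun x : V => - (x : R * R * R)).
Proof.
have := scales_prod (mulr_ge0 ler01 ler01) ler01 (scales_prod ler01 ler01
  (scales1_opp R) (scales1_opp R)) (scales1_opp R).
by rewrite !mulr1; congr scales; apply/funext => -[[x y] z].
Qed.

Lemma scales3_mul (c : R) : 0 < c ->
  scales (@lam3 R) (c ^- 3) (fun x : V => c *: (x : R * R * R)).
Proof.
move=> c0; have ci : 0 <= c^-1 by rewrite invr_ge0 ltW.
have := scales_prod (mulr_ge0 ci ci) ci (scales_prod ci ci
  (scales1_mul c0) (scales1_mul c0)) (scales1_mul c0).
by rewrite -!exprVn exprS expr2 mulrA; congr scales; apply/funext => -[[x y] z].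
Qed.

Lemma scales3_refl a : scales (@lam3 R) 1 (fun x : V => a - (x : R * R * R)).
Proof.
have [m1 h1] := scales3_shift a; have [m2 h2] := scales3_opp.
split => [|k mk k0].
  have := measurableT_comp m1 m2; congr measurable_fun; apply/funext => x /=.
  by rewrite addrC.
transitivity (\int[lam3 R]_x k ((- (x : R * R * R)) + a)%R)%E.
  by apply: eq_integral => x _; rewrite addrC.
rewrite (h2 (fun y => k ((y : R * R * R) + a)))//; last exact: (measurableT_comp mk m1).
by rewrite h1// mul1e.
Qed.

End maps3.

Section product_integrals.
Context d1 d2 (T1 : measurableType d1) (T2 : measurableType d2) (R : realType).
Variables (m1 : {sigma_finite_measure set T1 -> \bar R})
  (m2 : {sigma_finite_measure set T2 -> \bar R}).

Lemma sf_tonelli1 (h : T1 * T2 -> R) : measurable_fun setT h -> (forall x, 0 <= h x) ->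
  (\int[sfprod m1 m2]_z (h z)%:E = \int[m1]_x \int[m2]_y (h (x, y))%:E)%E.
Proof. exact: tonelli1. Qed.

Lemma sf_tonelli2 (h : T1 * T2 -> R) : measurable_fun setT h -> (forall x, 0 <= h x) ->
  (\int[sfprod m1 m2]_z (h z)%:E = \int[m2]_y \int[m1]_x (h (x, y))%:E)%E.
Proof. exact: tonelli2. Qed.

Lemma sf_cfubini1 (f : T1 * T2 -> R[i]) : cL1 (sfprod m1 m2) f ->
  cint (sfprod m1 m2) f = cint m1 (fun x => cint m2 (fun y => f (x, y))).
Proof. exact: cfubini1. Qed.

Lemma sf_cfubini2 (f : T1 * T2 -> R[i]) : cL1 (sfprod m1 m2) f ->
  cint (sfprod m1 m2) f = cint m2 (fun y => cint m1 (fun x => f (x, y))).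
Proof. exact: cfubini2. Qed.

Lemma sf_cL1_cint2 (f : T1 * T2 -> R[i]) : cL1 (sfprod m1 m2) f ->
  cL1 m1 (fun x => cint m2 (fun y => f (x, y))).
Proof. exact: cL1_cint2. Qed.

Lemma sf_cL1_cint1 (f : T1 * T2 -> R[i]) : cL1 (sfprod m1 m2) f ->
  cL1 m2 (fun y => cint m1 (fun x => f (x, y))).
Proof. by move=> hf; have := cL1_cint2 (cL1_swap hf). Qed.

Lemma integral_tensor (f : T1 -> R) (g : T2 -> R) :
  measurable_fun setT f -> measurable_fun setT g -> (forall x, 0 <= f x) -> (forall y, 0 <= g y) ->
  (\int[sfprod m1 m2]_z (f z.1 * g z.2)%:E =
   (\int[m1]_x (f x)%:E) * (\int[m2]_y (g y)%:E))%E.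
Proof.
move=> mf mg f0 g0.
rewrite (sf_tonelli1 (h := fun z => f z.1 * g z.2)); last 2 first.
- apply: measurable_funM; first exact: (measurableT_comp mf measurable_fst).
  exact: (measurableT_comp mg measurable_snd).
- by move=> z; rewrite mulr_ge0.
transitivity (\int[m1]_x ((f x)%:E * \int[m2]_y (g y)%:E))%E.
  apply: eq_integral => x _ /=; rewrite -ge0_integralZl//; [exact: measurable_RE|by move=> y _; rewrite lee_fin|by rewrite lee_fin].
rewrite ge0_integralZr//; [exact: measurable_RE|by move=> y _; rewrite lee_fin|].
by apply: integral_ge0 => y _; rewrite lee_fin.
Qed.

Lemma integrable_tensor (f : T1 -> R) (g : T2 -> R) :
  m1.-integrable setT (fun x => (f x)%:E) -> m2.-integrable setT (fun x => (g x)%:E) ->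
  (sfprod m1 m2).-integrable setT (fun z => (f z.1 * g z.2)%:E).
Proof.
move=> hf hg.
have mf : measurable_fun setT f by apply/measurable_EFinP; exact: measurable_int hf.
have mg : measurable_fun setT g by apply/measurable_EFinP; exact: measurable_int hg.
apply/integrableP; split.
  apply: measurable_RE; apply: measurable_funM.
    exact: (measurableT_comp mf measurable_fst).
  exact: (measurableT_comp mg measurable_snd).
rewrite (eq_integral (fun z => (`|f z.1| * `|g z.2|)%:E)); last first.
  by move=> z _ /=; rewrite normrM.
rewrite (integral_tensor (f := fun x => `|f x|) (g := fun x => `|g x|))//.
- apply: lte_mul_pinfty.
  + by apply: integral_ge0 => x _; rewrite lee_fin.
  + rewrite ge0_fin_numE; first by have /integrableP[] := hf.
    by apply: integral_ge0 => x _; rewrite lee_fin.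
  + by have /integrableP[] := hg.
- exact: (measurableT_comp _ mf).
- exact: (measurableT_comp _ mg).
Qed.

Lemma cint_tensor (f : T1 -> R[i]) (g : T2 -> R[i]) :
  cL1 m1 f -> cL1 m2 g ->
  cL1 (sfprod m1 m2) (fun z => f z.1 * g z.2) /\
  cint (sfprod m1 m2) (fun z => f z.1 * g z.2) = cint m1 f * cint m2 g.
Proof.
move=> [mf lf] [mg lg].
have h : cL1 (sfprod m1 m2) (fun z => f z.1 * g z.2).
  split.
    apply: cmeasM; first exact: (cmeas_comp measurable_fst mf).
    exact: (cmeas_comp measurable_snd mg).
  under eq_fun do rewrite cabsM.
  exact: (integrable_tensor lf lg).
split => //; rewrite sf_cfubini1//=.
under eq_fun do rewrite cintZ//.
by rewrite cintZr.
Qed.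

End product_integrals.

(** * An explicit Fourier pair on the line *)

Section one_dim.
Variable R : realType.

Definition cis (t : R) : R[i] := cos t +i* sin t.

Lemma cisD s t : cis (s + t) = cis s * cis t.
Proof. by rewrite /cis cosD sinD; simpc; congr (_ +i* _); ring. Qed.

Lemma cabs_cis t : cabs (cis t) = 1.
Proof. by rewrite /cis/= cos2Dsin2 sqrtr1. Qed.

Lemma cisN t : cis (- t) = (cis t)^*.
Proof. by rewrite /cis cosN sinN. Qed.

Definition cauchy1 (x : R) : R := (1 + x ^+ 2)^-1.

Lemma cauchy1_gt0 x : 0 < cauchy1 x.
Proof. by rewrite invr_gt0 ltr_pwDl// sqr_ge0. Qed.

Lemma continuous_cauchy1 : continuous cauchy1.
Proof. exact: continuous_oneDsqrV. Qed.

Lemma integral_cauchy1 : (\int[lam1 R]_x (cauchy1 x)%:E = pi%:E)%E.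
Proof.
rewrite ge0_symfun_integralT//.
- rewrite -set_itvcy integral0y_oneDsqr -EFinM; congr (_%:E).
  by rewrite mulrC divfK.
- by move=> x; exact/ltW/cauchy1_gt0.
- exact: continuous_cauchy1.
- by move=> x; rewrite /cauchy1 /= sqrrN.
Qed.

Lemma integrable_cauchy1 : (lam1 R).-integrable setT (fun x => (cauchy1 x)%:E).
Proof.
apply/integrableP; split.
  by apply: measurable_RE; apply: continuous_measurable_fun; exact: continuous_cauchy1.
have -> : (\int[lam1 R]_x `|(cauchy1 x)%:E| = \int[lam1 R]_x (cauchy1 x)%:E)%E.
  by apply: eq_integral => x _; rewrite gee0_abs// lee_fin ltW// cauchy1_gt0.
by rewrite integral_cauchy1 ltry.
Qed.

(** Together with [cauchy1] this is the Fourier pair exp(-|x|) and 2 / (1 + t^2). It takes the place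
    of the Gaussian as approximate identity in the inversion theorem, all integrals involved having
    elementary antiderivatives. *)
Definition eabs (x : R) : R := expR (- `|x|).

Lemma continuous_eabs : continuous eabs.
Proof.
move=> x; apply: (@continuous_comp _ _ _ (fun x : R => - `|x|) expR); last exact: continuous_expR.
by apply: continuousN; exact: norm_continuous.
Qed.

Lemma eabs_ge0 x : 0 <= eabs x. Proof. exact: expR_ge0. Qed.

(** Adding 1 to the cosine makes the integrand nonnegative, which is the setting of the fundamental
    theorem on a half-line; by symmetry the half-line suffices. The mass of [eabs] and its cosine
    transform both follow. *)
Lemma integral_eabs_aux t :
  (\int[lam1 R]_x (eabs x * (1 + cos (t * x)))%:E = (2 * (1 + (1 + t ^+ 2)^-1))%:E)%E.
Proof.
have ct : 0 < 1 + t ^+ 2 by rewrite ltr_pwDl// sqr_ge0.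
have cc : continuous (fun x : R => cos (t * x)).
  move=> x; apply: (@continuous_comp _ _ _ (fun x : R => t * x) cos); last exact: continuous_cos.
  exact: mulrl_continuous.
have h0 x : 0 <= eabs x * (1 + cos (t * x)).
  by rewrite mulr_ge0 ?eabs_ge0// -lerBlDl sub0r cos_geN1.
rewrite ge0_symfun_integralT//; last 2 first.
- move=> x; apply: continuousM; first exact: continuous_eabs.
  by apply: continuousD; [exact: cst_continuous|exact: cc].
- by move=> x /=; rewrite /eabs normrN mulrN cosN.
rewrite -set_itvcy.
pose F (x : R) := - expR (- x) + expR (- x) * (t * sin (t * x) - cos (t * x)) / (1 + t ^+ 2).
have dF x : is_derive x (1 : R) F (expR (- x) * (1 + cos (t * x))).
  rewrite /F; apply: is_derive_eq.
  rewrite /GRing.scale /=.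
  field.
  by rewrite gt_eqF.
have cF : continuous F.
  by move=> x; apply/differentiable_continuous/derivable1_diffP; case: (dF x).
rewrite (@ge0_continuous_FTC2y _ (fun x => eabs x * (1 + cos (t * x))) F 0 0)//.
- rewrite /F oppr0 expR0 mulr0 sin0 cos0 mulr0 sub0r mul1r -EFinD -EFinM; congr (_%:E).
  by field; rewrite gt_eqF.
- apply: continuous_subspaceT => x; apply: continuousM; first exact: continuous_eabs.
  by apply: continuousD; [exact: cst_continuous|exact: cc].
- have E : F =1 (fun x => expR (- x) * (-1 + (t * sin (t * x) - cos (t * x)) / (1 + t ^+ 2))).
    by move=> x; rewrite /F [RHS]mulrDr mulrN1 mulrA.
  have bd x : `|-1 + (t * sin (t * x) - cos (t * x)) / (1 + t ^+ 2)| <= 2 + `|t|.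
    rewrite (le_trans (ler_normD _ _))// normrN1 -addrA lerD2l normrM (ger0_norm (x := _^-1)); last by rewrite invr_ge0 ltW.
    rewrite ler_pdivrMr// (le_trans (ler_normB _ _))// normrM.
    have sb : `|sin (t * x)| <= 1 by rewrite ler_norml sin_geN1 sin_le1.
    have cb : `|cos (t * x)| <= 1 by rewrite ler_norml cos_geN1 cos_le1.
    rewrite (le_trans (_ : _ <= `|t| * 1 + 1))//; first by rewrite lerD// ler_wpM2l.
    rewrite mulr1 addrC ler_peMr ?addr_ge0// lerDl sqr_ge0//.
  apply/cvgrPdist_le => e e0.
  have : (fun x : R => expR (- x) * (2 + `|t|)) @ +oo --> (0 : R).
    rewrite -[X in _ --> X](mul0r (2 + `|t|)); apply: cvgM; last exact: cvg_cst.
    exact: cvgr_expR.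
  move/cvgrPdist_le => /(_ _ e0); apply: filterS => x.
  rewrite !sub0r !normrN E !normrM; apply: le_trans.
  by rewrite ler_wpM2l// (le_trans (bd x))// ler_norm.
- by apply: cvg_at_right_filter; exact: cF.
- move=> x; rewrite in_itv/= andbT => x0; rewrite derive1E; case: (dF x) => _ ->.
  by rewrite /eabs ger0_norm// ltW.
Qed.

Lemma integral_eabs : (\int[lam1 R]_x (eabs x)%:E = 2%:E)%E.
Proof.
have := integral_eabs_aux 0.
rewrite expr0n /= addr0 invr1 -[X in (2 * X)]/(2%:R) => h.
have E : (\int[lam1 R]_x (eabs x * (1 + cos (0 * x)))%:E = \int[lam1 R]_x (2%:E * (eabs x)%:E))%E.
  by apply: eq_integral => x _; rewrite mul0r cos0 -EFinM; congr (_%:E); rewrite mulrC.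
have m : measurable_fun setT (fun x : measurableTypeR R => (eabs x)%:E).
  by apply: measurable_RE; apply: continuous_measurable_fun; exact: continuous_eabs.
rewrite E ge0_integralZl// in h; last by move=> x _; rewrite lee_fin eabs_ge0.
move: h; case: (\int[lam1 R]_x (eabs x)%:E)%E => [r| |].
- by rewrite -EFinM => -[] /mulfI ->.
- by rewrite mulry gtr0_sg// mul1e.
- by rewrite mulrNy gtr0_sg// mul1e.
Qed.

Lemma measurable_eabs : measurable_fun setT (eabs : measurableTypeR R -> R).
Proof. by apply: continuous_measurable_fun; exact: continuous_eabs. Qed.

Lemma integrable_eabs : (lam1 R).-integrable setT (fun x => (eabs x)%:E).
Proof.
apply/integrableP; split; first exact: (measurable_RE measurable_eabs).
have -> : (\int[lam1 R]_x `|(eabs x)%:E| = \int[lam1 R]_x (eabs x)%:E)%E.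
  by apply: eq_integral => x _; rewrite gee0_abs// lee_fin eabs_ge0.
by rewrite integral_eabs ltry.
Qed.

Lemma measurable_cis (t : R) :
  cmeas (fun x : measurableTypeR R => cis (t * x)).
Proof.
split => /=; apply: continuous_measurable_fun => x.
  apply: (@continuous_comp _ _ _ (fun x : R => t * x) cos); last exact: continuous_cos.
  exact: mulrl_continuous.
apply: (@continuous_comp _ _ _ (fun x : R => t * x) sin); last exact: continuous_sin.
exact: mulrl_continuous.
Qed.

Lemma cL1_eabs_cis t : cL1 (lam1 R) (fun x => (eabs x)%:C * cis (t * x)).
Proof.
apply: (@cL1_dom _ _ _ _ _ (fun x : measurableTypeR R => eabs x)).
- by apply: cmeasM; [exact: cmeas_real measurable_eabs|exact: measurable_cis].
- by move=> x; rewrite cabsM cabs_cis mulr1 cabs_real ger0_norm ?eabs_ge0.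
- exact: integrable_eabs.
Qed.

Lemma cint_eabs_cis t :
  cint (lam1 R) (fun x => (eabs x)%:C * cis (t * x)) = (2 * cauchy1 t)%:C.
Proof.
have h := cL1_eabs_cis t.
have hr := cL1_Re h; have hi := cL1_Im h.
apply: ReIm_eq => /=.
  have E : \int[lam1 R]_x (eabs x * (1 + cos (t * x))) =
    \int[lam1 R]_x eabs x + \int[lam1 R]_x Re ((eabs x)%:C * cis (t * x)).
    rewrite -RintegralD//; last exact: integrable_eabs.
    by apply: eq_Rintegral => x _; rewrite mulrDr mulr1 /= mul0r subr0.
  move: E; rewrite /Rintegral integral_eabs integral_eabs_aux /= => E.
  by apply: (addrI 2); rewrite -E mulrDr mulr1.
have op := @scales_integral _ _ _ _ _ _ _ (@ltr01 R) (scales1_opp R) hi.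
rewrite mul1e in op.
(* The sine part is odd, so its integral equals its own opposite. *)
suff : (\int[lam1 R]_x (Im ((eabs x)%:C * cis (t * x)))%:E = -
   \int[lam1 R]_x (Im ((eabs x)%:C * cis (t * x)))%:E)%E.
  rewrite /Rintegral; case: (integral _ _ _) (integrable_fin_num measurableT hi) => //= r _ [] /eqP.
  by rewrite -addr_eq0 -mulr2n mulrn_eq0 /= => /eqP.
rewrite -[LHS]op -integralN; last first.
  by rewrite fin_num_adde_defr//; exact: integrable_pos_fin_num.
apply: eq_integral => x _; rewrite -EFinN; congr (_%:E).
by rewrite /eabs normrN mulrN !ImM /= sinN; ring.
Qed.

End one_dim.

(** * Tensor products of the one-dimensional kernels *)

Section three_dim.
Variable R : realType.
Implicit Types x y xi : R * R * R.

Lemma dotpE x y : dotp x y = x.1.1 * y.1.1 + x.1.2 * y.1.2 + x.2 * y.2.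
Proof. by rewrite /dotp !big_ord_recl big_ord0 addr0 addrA. Qed.

Lemma dotpC x y : dotp x y = dotp y x.
Proof. by rewrite !dotpE; ring. Qed.

Lemma dotpDl x y z : dotp (x + y) z = dotp x z + dotp y z.
Proof. by rewrite !dotpE /=; ring. Qed.

Lemma dotpNl x y : dotp (- x) y = - dotp x y.
Proof. by rewrite !dotpE /=; ring. Qed.

Lemma dotpZl (a : R) x y : dotp (a *: x) y = a * dotp x y.
Proof. by rewrite !dotpE /= /GRing.scale /=; ring. Qed.

Lemma dotpDr x y z : dotp z (x + y) = dotp z x + dotp z y.
Proof. by rewrite dotpC dotpDl !(dotpC z). Qed.

Lemma dotpNr x y : dotp y (- x) = - dotp y x.
Proof. by rewrite dotpC dotpNl dotpC. Qed.

Lemma dotpZr (a : R) x y : dotp y (a *: x) = a * dotp y x.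
Proof. by rewrite dotpC dotpZl dotpC. Qed.

(** A product of one-variable functions, so that its mass and its role as a transform tensorise. It
    is also the standard integrable majorant for functions decaying like (1 + |x|)^-6. *)
Definition cauchy3 x : R := cauchy1 x.1.1 * cauchy1 x.1.2 * cauchy1 x.2.

Definition eabs3 x : R := eabs x.1.1 * eabs x.1.2 * eabs x.2.

Lemma cauchy3_gt0 x : 0 < cauchy3 x.
Proof. by rewrite !mulr_gt0 ?cauchy1_gt0. Qed.

Lemma eabs3_ge0 x : 0 <= eabs3 x.
Proof. by rewrite !mulr_ge0 ?eabs_ge0. Qed.

Lemma integrable_cauchy3 : (lam3 R).-integrable setT (fun x => (cauchy3 x)%:E).
Proof.
exact: (integrable_tensor (integrable_tensor (integrable_cauchy1 R) (integrable_cauchy1 R))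
  (integrable_cauchy1 R)).
Qed.

Lemma integral_cauchy3 : (\int[lam3 R]_x (cauchy3 x)%:E = (pi ^+ 3)%:E)%E.
Proof.
have m : measurable_fun setT (@cauchy1 R : measurableTypeR R -> R).
  by apply: continuous_measurable_fun; exact: continuous_cauchy1.
have c0 (x : R) : 0 <= cauchy1 x by rewrite ltW// cauchy1_gt0.
rewrite (@integral_tensor _ _ _ _ _ (sfprod (lam1 R) (lam1 R)) (lam1 R)
  (fun z => cauchy1 z.1 * cauchy1 z.2) (@cauchy1 R))//.
- rewrite (@integral_tensor _ _ _ _ _ (lam1 R) (lam1 R) (@cauchy1 R) (@cauchy1 R))//.
  by rewrite integral_cauchy1 -!EFinM exprS expr2 mulrA.
- apply: measurable_funM; first exact: (measurableT_comp m measurable_fst).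
  exact: (measurableT_comp m measurable_snd).
- by move=> z; rewrite mulr_ge0.
Qed.

Lemma cint_eabs3_cis xi :
  cL1 (lam3 R) (fun x => (eabs3 x)%:C * cis (dotp xi x)) /\
  cint (lam3 R) (fun x => (eabs3 x)%:C * cis (dotp xi x)) = (8 * cauchy3 xi)%:C.
Proof.
have [h1 e1] := cint_tensor (cL1_eabs_cis xi.1.1) (cL1_eabs_cis xi.1.2).
have := cint_tensor h1 (cL1_eabs_cis xi.2).
rewrite e1 !cint_eabs_cis.
have -> : (fun z : measurableTypeR R * measurableTypeR R * measurableTypeR R =>
   (eabs z.1.1)%:C * cis (xi.1.1 * z.1.1) * ((eabs z.1.2)%:C * cis (xi.1.2 * z.1.2)) *
   ((eabs z.2)%:C * cis (xi.2 * z.2))) = (fun x => (eabs3 x)%:C * cis (dotp xi x)).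
  apply/funext => z; rewrite dotpE /eabs3 !cisD !rmorphM /=; ring.
move=> [h ->]; split => //.
by rewrite -!rmorphM; congr (_%:C); rewrite /cauchy3; ring.
Qed.

Lemma integrable_eabs3 : (lam3 R).-integrable setT (fun x => (eabs3 x)%:E).
Proof.
exact: (integrable_tensor (integrable_tensor (integrable_eabs R) (integrable_eabs R))
  (integrable_eabs R)).
Qed.

Notation V := (mspace R).
Notation VV := (V * V)%type.

Lemma tonelli33_2 (h : VV -> R) : measurable_fun setT h -> (forall z : VV, 0 <= h z) ->
  (\int[lam33 R]_z (h z)%:E = \int[lam3 R]_y \int[lam3 R]_x (h (x, y))%:E)%E.
Proof. exact: sf_tonelli2. Qed.

Lemma cfubini33_1 (f : VV -> R[i]) : cL1 (lam33 R) f ->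
  cint (lam33 R) f = cint (lam3 R) (fun x => cint (lam3 R) (fun y => f (x, y))).
Proof. exact: sf_cfubini1. Qed.

Lemma cfubini33_2 (f : VV -> R[i]) : cL1 (lam33 R) f ->
  cint (lam33 R) f = cint (lam3 R) (fun y => cint (lam3 R) (fun x => f (x, y))).
Proof. exact: sf_cfubini2. Qed.

Lemma cL1_cint33_2 (f : VV -> R[i]) : cL1 (lam33 R) f ->
  cL1 (lam3 R) (fun x => cint (lam3 R) (fun y => f (x, y))).
Proof. exact: sf_cL1_cint2. Qed.

Lemma cL1_cint33_1 (f : VV -> R[i]) : cL1 (lam33 R) f ->
  cL1 (lam3 R) (fun y => cint (lam3 R) (fun x => f (x, y))).
Proof. exact: sf_cL1_cint1. Qed.

Lemma cint_tensor33 (f g : V -> R[i]) : cL1 (lam3 R) f -> cL1 (lam3 R) g ->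
  cL1 (lam33 R) (fun z => f z.1 * g z.2) /\
  cint (lam33 R) (fun z => f z.1 * g z.2) = cint (lam3 R) f * cint (lam3 R) g.
Proof. exact: cint_tensor. Qed.

Lemma cmeas_cint33 (f : VV -> R[i]) : cmeas f ->
  cmeas (fun x => cint (lam3 R) (fun y => f (x, y))).
Proof. exact: cmeas_cint2. Qed.

End three_dim.

Lemma cint_dct d (T : measurableType d) (R : realType) (mu : {measure set T -> \bar R})
    (f_ : nat -> T -> R[i]) f (h : T -> R) :
  (forall n, cmeas (f_ n)) -> cmeas f ->
  mu.-integrable setT (fun x => (h x)%:E) ->
  (forall x, ccvg (f_ ^~ x) (f x)) ->
  (forall x n, cabs (f_ n x) <= h x) ->
  ccvg (fun n => cint mu (f_ n)) (cint mu f).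
Proof.
move=> mf_ mf ih cf fh.
by have [] := cdct mf_ mf (aeW _ cf) ih (aeW _ fh).
Qed.

Global Opaque lam3 lam33.

(** * Fourier inversion *)

Section fourier_inversion.
Variable R : realType.
Notation V := (mspace R).
Implicit Types (x y xi : R * R * R) (f g : R * R * R -> R[i]).

Definition c0 : R := (2 * pi) `^ (- (3 / 2)).

Lemma c0_gt0 : 0 < c0.
Proof. by apply: powR_gt0; rewrite mulr_gt0// pi_gt0. Qed.

(** The factor 8 comes from the transform of [eabs3] and pi^3 is the mass of [cauchy3]; with two
    normalising constants [c0] they cancel, which makes inversion exact. *)
Lemma sqr_c0 : c0 ^+ 2 * (8 * pi ^+ 3) = 1.
Proof.
have p0 : 0 < 2 * pi :> R by rewrite mulr_gt0// pi_gt0.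
rewrite /c0 -powR_mulrn ?powR_ge0// -powRrM (_ : - (3 / 2) * 2%:R = - 3%:R :> R); last by field.
rewrite powRN powR_mulrn ?ltW// (_ : (2 * pi) ^+ 3 = 8 * pi ^+ 3); last by ring.
by rewrite mulVf// gt_eqF// mulr_gt0// exprn_gt0// pi_gt0.
Qed.

Lemma inv_fourierE f x :
  inv_fourier f x = c0%:C * cint (lam3 R) (fun xi => cis (dotp x xi) * f xi).
Proof. by rewrite /inv_fourier cintegralE. Qed.

(** Only the inverse transform is studied directly; every fact on the forward transform is obtained
    through this reflection. *)
Lemma fourierE f xi : fourier f xi = inv_fourier f (- xi).
Proof.
rewrite inv_fourierE /fourier cintegralE; congr (_ * cint _ _).
by apply/funext => x; rewrite dotpNl cisN dotpC.
Qed.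

Lemma measurable_c1 : measurable_fun setT (fun x : V => x.1.1 : R).
Proof. exact: (measurableT_comp measurable_fst measurable_fst). Qed.

Lemma measurable_c2 : measurable_fun setT (fun x : V => x.1.2 : R).
Proof. exact: (measurableT_comp measurable_snd measurable_fst). Qed.

Lemma measurable_c3 : measurable_fun setT (fun x : V => x.2 : R).
Proof. exact: measurable_snd. Qed.

Lemma measurable_dotp_comp d (T : measurableType d) (p q : T -> V) :
  measurable_fun setT p -> measurable_fun setT q ->
  measurable_fun setT (fun z => dotp (p z : R * R * R) (q z) : R).
Proof.
move=> mp mq; under eq_fun do rewrite dotpE.
apply: measurable_funD; [apply: measurable_funD|]; apply: measurable_funM.
- exact: (measurableT_comp measurable_c1 mp).
- exact: (measurableT_comp measurable_c1 mq).
- exact: (measurableT_comp measurable_c2 mp).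
- exact: (measurableT_comp measurable_c2 mq).
- exact: (measurableT_comp measurable_c3 mp).
- exact: (measurableT_comp measurable_c3 mq).
Qed.

Lemma cmeas_cis_comp d (T : measurableType d) (h : T -> R) :
  measurable_fun setT h -> cmeas (fun z => cis (h z)).
Proof.
move=> mh; split => /=.
  apply: (measurableT_comp _ mh); apply: continuous_measurable_fun; exact: continuous_cos.
apply: (measurableT_comp _ mh); apply: continuous_measurable_fun; exact: continuous_sin.
Qed.

Lemma cmeas_cis_dotp : cmeas (fun z : V * V => cis (dotp (z.1 : R * R * R) z.2)).
Proof. by apply: cmeas_cis_comp; apply: measurable_dotp_comp. Qed.

Lemma cmeas_cis_dot x : cmeas (fun xi : V => cis (dotp x xi)).
Proof. by apply: cmeas_cis_comp; apply: measurable_dotp_comp => //; exact: measurable_cst. Qed.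

Lemma cL1_cis x f : cL1 (lam3 R) f -> cL1 (lam3 R) (fun xi => cis (dotp x xi) * f xi).
Proof.
move=> hf; have [mf _] := hf; apply: (cL1_le _ hf).
  by apply: cmeasM => //; exact: cmeas_cis_dot.
by move=> xi; rewrite cabsM cabs_cis mul1r.
Qed.

Lemma cmeas_inv_fourier f : cmeas (f : V -> R[i]) -> cmeas (inv_fourier f : V -> R[i]).
Proof.
move=> mf; rewrite (_ : inv_fourier f = fun x =>
  c0%:C * cint (lam3 R) (fun xi => cis (dotp x xi) * f xi)); last exact/funext/inv_fourierE.
apply: (cmeasM (cmeas_cst _ _)).
apply: (@cmeas_cint33 _ (fun z : V * V => cis (dotp (z.1 : R * R * R) z.2) * f z.2)).
by apply: cmeasM; [exact: cmeas_cis_dotp|exact: (cmeas_comp measurable_snd mf)].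
Qed.

Lemma inv_fourier_bound f x : cL1 (lam3 R) f ->
  cabs (inv_fourier f x) <= c0 * \int[lam3 R]_xi cabs (f xi).
Proof.
move=> hf; rewrite inv_fourierE cabsM cabs_real ger0_norm ?(ltW c0_gt0)//.
rewrite ler_wpM2l ?(ltW c0_gt0)//; apply: cabs_cint_le.
- by have [] := cL1_cis x hf.
- by move=> xi; rewrite cabsM cabs_cis mul1r.
- by case: hf.
Qed.

Lemma inv_fourierD f g x : cL1 (lam3 R) f -> cL1 (lam3 R) g ->
  inv_fourier (fun xi => f xi + g xi) x = inv_fourier f x + inv_fourier g x.
Proof.
move=> hf hg; rewrite !inv_fourierE -mulrDr -cintD; [|exact: cL1_cis..].
by congr (_ * cint _ _); apply/funext => xi; rewrite mulrDr.
Qed.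

Lemma inv_fourierZ c f x : cL1 (lam3 R) f ->
  inv_fourier (fun xi => c * f xi) x = c * inv_fourier f x.
Proof.
move=> hf; rewrite !inv_fourierE mulrCA -[X in _ = _ * X]cintZ; last exact: cL1_cis.
by congr (_ * cint _ _); apply/funext => xi; rewrite mulrCA.
Qed.

Lemma cL1_tensor_cis f g : cL1 (lam3 R) f -> cL1 (lam3 R) g ->
  cL1 (lam33 R) (fun z => cis (dotp z.1 z.2) * (f z.1 * g z.2)).
Proof.
move=> hf hg; have [h _] := cint_tensor33 hf hg; have [mh _] := h.
apply: (cL1_le _ h).
  by apply: cmeasM => //; exact: cmeas_cis_dotp.
by move=> z; rewrite cabsM cabs_cis mul1r.
Qed.

Lemma fourier_mult f g : cL1 (lam3 R) f -> cL1 (lam3 R) g ->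
  cint (lam3 R) (fun x => inv_fourier f x * g x) =
  cint (lam3 R) (fun x => f x * inv_fourier g x).
Proof.
move=> hf hg.
have h := cL1_tensor_cis hf hg.
transitivity (c0%:C * cint (lam33 R) (fun z => cis (dotp z.1 z.2) * (f z.1 * g z.2))).
  rewrite cfubini33_2// -cintZ; last exact: (cL1_cint33_1 h).
  congr cint; apply/funext => x /=; rewrite inv_fourierE -mulrA; congr (_ * _).
  rewrite -cintZr; last exact: cL1_cis.
  by congr cint; apply/funext => xi; rewrite dotpC mulrA.
rewrite cfubini33_1// -cintZ; last exact: (cL1_cint33_2 h).
congr cint; apply/funext => x /=; rewrite inv_fourierE mulrCA; congr (_ * _).
rewrite -cintZ; last exact: cL1_cis.
by congr cint; apply/funext => xi; rewrite mulrCA.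
Qed.

Lemma inv_fourier_eabs3 (n : nat) x :
  cL1 (lam3 R) (fun xi => (eabs3 (n.+1%:R^-1 *: xi))%:C) /\
  inv_fourier (fun xi => (eabs3 (n.+1%:R^-1 *: xi))%:C) x =
  (c0 * n.+1%:R ^+ 3 * 8 * cauchy3 (n.+1%:R *: x))%:C.
Proof.
have n0 : 0 < n.+1%:R^-1 :> R by rewrite invr_gt0.
have k0 : 0 < (n.+1%:R^-1) ^- 3 :> R by rewrite invr_gt0 exprn_gt0.
have me : measurable_fun setT (fun x : V => eabs3 x).
  by apply/measurable_EFinP; exact: measurable_int (integrable_eabs3 R).
have he : cL1 (lam3 R) (fun xi => (eabs3 xi)%:C).
  apply: (@cL1_dom _ _ _ _ _ (fun x : V => eabs3 x)).
  - exact: cmeas_real.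
  - by move=> xi; rewrite cabs_real ger0_norm// eabs3_ge0.
  - exact: integrable_eabs3.
split; first exact: (scales_cL1 k0 (scales3_mul n0) he).
have [h e] := cint_eabs3_cis (n.+1%:R *: x).
have := scales_cint k0 (scales3_mul n0) h.
rewrite e inv_fourierE => E.
transitivity (c0%:C * ((n.+1%:R^-1 ^- 3)%:C * (8 * cauchy3 (n.+1%:R *: x))%:C)).
  congr (_ * _); rewrite -E; congr cint; apply/funext => xi.
  by rewrite dotpZl dotpZr mulrA divff ?pnatr_eq0// mul1r mulrC.
by rewrite -!rmorphM /= exprVn invrK; congr (_%:C); ring.
Qed.

(** Abel summation: a slowly varying factor [eabs3] is inserted, and [fourier_mult] moves the
    transform onto it, where it becomes a concentrated [cauchy3]. Dominated convergence on both
    sides yields the value at 0; after rescaling, continuity along the rays y / (n + 1) is what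
    enters. *)
Lemma fourier_inversion0 f (B : R) : cL1 (lam3 R) f -> cL1 (lam3 R) (inv_fourier f) ->
  (forall x, cabs (f x) <= B) ->
  (forall y, ccvg (fun n => f (n.+1%:R^-1 *: y)) (f 0)) ->
  c0%:C * cint (lam3 R) (inv_fourier f) = f 0.
Proof.
move=> hf hF fB fc; have [mf _] := hf; have [mF lF] := hF.
have me : measurable_fun setT (fun x : V => eabs3 x).
  by apply/measurable_EFinP; exact: measurable_int (integrable_eabs3 R).
have en (n : nat) : cmeas (fun xi : V => (eabs3 (n.+1%:R^-1 *: (xi : R * R * R)))%:C).
  by have [[]] := inv_fourier_eabs3 n 0.
pose a (n : nat) := cint (lam3 R) (fun xi => inv_fourier f xi * (eabs3 (n.+1%:R^-1 *: xi))%:C).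
have a1 : ccvg a (cint (lam3 R) (inv_fourier f)).
  have e1 x : 0 <= eabs3 x <= 1.
    rewrite eabs3_ge0/= /eabs3.
    have l1 (t : R) : eabs t <= 1 by rewrite /eabs -expR0 ler_expR oppr_le0.
    by rewrite !mulr_ile1 ?mulr_ge0 ?eabs_ge0.
  apply: (@cint_dct _ _ _ (lam3 R) (fun n xi => inv_fourier f xi * (eabs3 (n.+1%:R^-1 *: xi))%:C)
    (inv_fourier f) (fun xi => cabs (inv_fourier f xi))).
  - by move=> n; exact: cmeasM (mF) (en n).
  - exact: mF.
  - exact: lF.
  - move=> xi.
    have : (fun n => cabs (inv_fourier f xi) * (`| eabs3 (n.+1%:R^-1 *: xi) - 1 |)) @ \oo --> (0 : R).
      apply: cvg0Z.
      have ce (t : R) : (fun n => eabs (n.+1%:R^-1 * t)) @ \oo --> (1 : R).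
        rewrite -[X in _ --> X]expR0 -[X in expR X]oppr0 -[X in - X](@normr0 _ R) -/(eabs 0).
        apply: continuous_cvg; first exact: continuous_eabs.
        by rewrite -(mul0r t); apply: cvgM; [exact: cvg_harmonic|exact: cvg_cst].
      have c3 : (fun n => eabs3 (n.+1%:R^-1 *: xi)) @ \oo --> (1 * 1 * 1 : R).
        exact: (cvgM (cvgM (ce xi.1.1) (ce xi.1.2)) (ce xi.2)).
      rewrite !mulr1 in c3.
      have c4 : (fun n => eabs3 (n.+1%:R^-1 *: xi) - 1) @ \oo --> (1 - 1 : R).
        by apply: cvgB c3 _; exact: cvg_cst.
      by rewrite subrr in c4; rewrite -(@normr0 _ R); exact: cvg_norm c4.
    rewrite /ccvg => h; rewrite (_ : (fun n => _) =
      (fun n => cabs (inv_fourier f xi) * `|eabs3 (n.+1%:R^-1 *: xi) - 1|))//.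
    apply/funext => n; rewrite -[X in _ - X]mulr1 -mulrBr cabsM.
    by rewrite -(rmorphB (real_complex R)) cabs_real.
  - move=> xi n; rewrite cabsM cabs_real ger0_norm ?eabs3_ge0//.
    by rewrite ler_piMr ?cabs_ge0//; have /andP[] := e1 (n.+1%:R^-1 *: xi).
have a2 n : a n = (8 * c0)%:C * cint (lam3 R) (fun y => (cauchy3 y)%:C * f (n.+1%:R^-1 *: y)).
  have [he _] := inv_fourier_eabs3 n 0.
  rewrite /a fourier_mult//.
  have n0 : 0 < n.+1%:R :> R by [].
  have k0 : 0 < n.+1%:R ^- 3 :> R by rewrite invr_gt0 exprn_gt0.
  have mc : cmeas (fun y : V => (cauchy3 y)%:C).
    by apply: cmeas_real; apply/measurable_EFinP; exact: measurable_int (integrable_cauchy3 R).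
  have hc : cL1 (lam3 R) (fun y => (cauchy3 y)%:C * f (n.+1%:R^-1 *: y)).
    apply: (@cL1_dom _ _ _ _ _ (fun x : V => B * cauchy3 x)).
    - apply: cmeasM => //; apply: (cmeas_comp _ mf).
      by have [] := @scales3_mul R (n.+1%:R^-1) ltac:(by rewrite invr_gt0).
    - move=> x; rewrite cabsM cabs_real ger0_norm; last exact/ltW/cauchy3_gt0.
      by rewrite mulrC ler_wpM2r// ltW// cauchy3_gt0.
    - by apply: integrable_RZ; exact: integrable_cauchy3.
  have hc2 := scales_cL1 k0 (scales3_mul n0) hc.
  have E := scales_cint k0 (scales3_mul n0) hc.
  have -> : cint (lam3 R) (fun y => (cauchy3 y)%:C * f (n.+1%:R^-1 *: y)) =
    (n.+1%:R ^+ 3)%:C * cint (lam3 R) (fun x => (cauchy3 (n.+1%:R *: x))%:C * f x).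
    rewrite (_ : (fun x => (cauchy3 (n.+1%:R *: x))%:C * f x) =
      (fun x => (cauchy3 (n.+1%:R *: x))%:C * f (n.+1%:R^-1 *: (n.+1%:R *: x)))); last first.
      by apply/funext => x; rewrite scalerA mulVf ?scale1r// pnatr_eq0.
    have nz : n.+1%:R ^+ 3 != 0 :> R by rewrite expf_neq0// pnatr_eq0.
    by rewrite E mulrA -(rmorphM (real_complex R)) /= divff// rmorph1 mul1r.
  rewrite mulrA -rmorphM /= -cintZ; last first.
    move: hc2; congr cL1; apply/funext => x.
    by rewrite scalerA mulVf ?scale1r// pnatr_eq0.
  congr cint; apply/funext => x; have [_ ->] := inv_fourier_eabs3 n x.
  by rewrite mulrC mulrA -rmorphM; congr (_%:C * _); ring.
have a3 : ccvg a ((8 * c0)%:C * ((pi ^+ 3)%:C * f 0)).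
  rewrite (funext a2 : a = _).
  apply: ccvgZ.
  have mc : cmeas (fun y : V => (cauchy3 y)%:C).
    by apply: cmeas_real; apply/measurable_EFinP; exact: measurable_int (integrable_cauchy3 R).
  have -> : (pi ^+ 3)%:C * f 0 = cint (lam3 R) (fun y => (cauchy3 y)%:C * f 0).
    rewrite cintZr; last first.
      apply: (@cL1_dom _ _ _ _ _ (fun x : V => cauchy3 x)) => //; last exact: integrable_cauchy3.
      by move=> x; rewrite cabs_real ger0_norm//; exact/ltW/cauchy3_gt0.
    congr (_ * _); apply: ReIm_eq => /=; last by rewrite /Rintegral integral0.
    by rewrite /Rintegral integral_cauchy3.
  apply: (@cint_dct _ _ _ (lam3 R) (fun n y => (cauchy3 y)%:C * f (n.+1%:R^-1 *: y))
    (fun y => (cauchy3 y)%:C * f 0) (fun y : V => B * cauchy3 y)).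
  - move=> n; apply: (cmeasM mc); apply: (cmeas_comp _ mf).
    by have [] := @scales3_mul R (n.+1%:R^-1) ltac:(by rewrite invr_gt0).
  - by apply: (cmeasM mc); exact: cmeas_cst.
  - by apply: integrable_RZ; exact: integrable_cauchy3.
  - by move=> y; apply: ccvgZ; exact: fc.
  - move=> y n; rewrite cabsM cabs_real ger0_norm; last exact/ltW/cauchy3_gt0.
    by rewrite mulrC ler_wpM2r// ltW// cauchy3_gt0.
rewrite (ccvg_unique a1 a3) !mulrA -!rmorphM /=.
rewrite (_ : c0 * (8 * c0) * pi ^+ 3 = 1) ?mul1r//.
by transitivity (c0 ^+ 2 * (8 * pi ^+ 3) : R); [ring|exact: sqr_c0].
Qed.

Lemma fourier_inversion f (B : R) x : cL1 (lam3 R) f -> cL1 (lam3 R) (inv_fourier f) ->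
  (forall x, cabs (f x) <= B) ->
  (forall y, ccvg (fun n => f (x + n.+1%:R^-1 *: y)) (f x)) ->
  fourier (inv_fourier f) x = f x.
Proof.
move=> hf hF fB fc.
have hs := scales_cL1 ltr01 (scales3_shift x) hf.
have E xi : inv_fourier (fun y => f (y + x)) xi = cis (dotp (- x) xi) * inv_fourier f xi.
  rewrite !inv_fourierE mulrCA; congr (_ * _).
  have h2 := scales_cint ltr01 (scales3_shift x) (cL1_cis xi hf).
  rewrite mul1r in h2; rewrite -h2 -cintZ.
    congr cint; apply/funext => y.
    by rewrite mulrA -cisD; congr (cis _ * _); rewrite !dotpE /=; ring.
  exact: (scales_cL1 ltr01 (scales3_shift x) (cL1_cis xi hf)).
rewrite fourierE inv_fourierE -[RHS]/(f x) -[in RHS](add0r x).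
rewrite -(@fourier_inversion0 (fun y => f (y + x)) B)//.
- by congr (_ * cint _ _); apply/funext => xi; rewrite E.
- rewrite (_ : inv_fourier _ = fun xi => cis (dotp (- x) xi) * inv_fourier f xi).
    exact: cL1_cis.
  by apply/funext => xi; rewrite E.
- move=> y; rewrite add0r (_ : (fun n => _) = (fun n => f (x + n.+1%:R^-1 *: y)))//.
  by apply/funext => n; rewrite addrC.
Qed.

End fourier_inversion.

Global Opaque inv_fourier fourier cintegral.

(** * Smooth and Schwartz functions *)

Section real_smooth.
Variable R : realType.
Notation E3 := (R * R * R)%type.
Implicit Types (f g : E3 -> R) (i j : 'I_3).

Lemma is_deriveP (f : E3 -> R) x v l : is_derive x v f l <->
  (fun h : R => h^-1 * (f (h *: v + x) - f x)) @ (0 : R)^' --> l.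
Proof.
split => [[df <-]|h]; first exact: df.
have df : derivable f x v by apply/cvg_ex; exists l.
by apply: DeriveDef => //; exact: cvg_lim h.
Qed.

Lemma partial_is_derive f i x l : is_derive x (std_basis R i) f l -> partial i f x = l.
Proof. by case. Qed.

Lemma smooth_partialP f i x : smooth f -> is_derive x (std_basis R i) f (partial i f x).
Proof. by move=> /(_ [::])[_ /(_ i x) h]; exact: DeriveDef. Qed.

Lemma smooth_continuous f : smooth f -> continuous f.
Proof. by move=> /(_ [::])[]. Qed.

Lemma iter_partial_rcons w i f : iter_partial (rcons w i) f = iter_partial w (partial i f).
Proof. by rewrite /iter_partial foldr_rcons. Qed.

Lemma smooth_partial f i : smooth f -> smooth (partial i f).
Proof. by move=> sf w; rewrite -iter_partial_rcons; exact: sf. Qed.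

(** Smoothness quantifies over all words of derivatives. A class stable under each single partial
    derivative gives them all at once, without a formula for iterated derivatives. *)
Lemma smooth_coind (A : (E3 -> R) -> Prop) :
  (forall f, A f -> [/\ continuous f,
     (forall i x, exists l, is_derive x (std_basis R i) f l) & forall i, A (partial i f)]) ->
  forall f, A f -> smooth f.
Proof.
move=> hA f Af w.
have Aw : A (iter_partial w f).
  by elim: w => [//|i w IH] /=; have [_ _] := hA _ IH; apply.
have [cf df _] := hA _ Aw; split => // i x.
by have [l []] := df i x.
Qed.

(** Maps carrying each coordinate line to a multiple of a coordinate line. For them a partial
    derivative of a composite is a multiple of one partial derivative of [f], so that total
    differentiability does not intervene. Dilations, reflections and slab maps are of this kind. *)
Definition axis_affine (L : E3 -> E3) := continuous L /\
  exists (c : 'I_3 -> R) (s : 'I_3 -> 'I_3), forall x j h,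
    L (h *: std_basis R j + x) = (h * c j) *: std_basis R (s j) + L x.

(** The smallest class with these closure properties contains the partial derivatives of its
    members, so [smooth_coind] applies to it and all closure properties of smooth functions follow
    together. *)
Inductive smooth_alg : (E3 -> R) -> Prop :=
| smooth_alg_smooth f : smooth f -> smooth_alg f
| smooth_algD f g : smooth_alg f -> smooth_alg g -> smooth_alg (fun x => f x + g x)
| smooth_algM f g : smooth_alg f -> smooth_alg g -> smooth_alg (fun x => f x * g x)
| smooth_alg_cst k : smooth_alg (fun _ => k)
| smooth_alg_coord i : smooth_alg (fun x => coord x i)
| smooth_alg_comp f L : axis_affine L -> smooth_alg f -> smooth_alg (fun x => f (L x)).

Lemma coordD (x y : E3) i : coord (x + y) i = coord x i + coord y i.
Proof. by case: i => [[|[|]]]. Qed.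

Lemma coordZ (k : R) (x : E3) i : coord (k *: x) i = k * coord x i.
Proof. by case: i => [[|[|]]]. Qed.

Lemma coord_std i j : coord (std_basis R i) j = (i == j)%:R.
Proof. by case: i => [[|[|[|//]]]] ?; case: j => [[|[|[|//]]]] ?. Qed.

Lemma continuous_coord i : continuous (fun x : E3 => coord x i).
Proof.
case: i => [[|[|[|//]]]] ? /= x.
- exact: (@cvg_comp _ _ _ (@fst (R * R) R) (@fst R R) _ _ _ (@cvg_fst _ _ _ _ _) (@cvg_fst _ _ _ _ _)).
- exact: (@cvg_comp _ _ _ (@fst (R * R) R) (@snd R R) _ _ _ (@cvg_fst _ _ _ _ _) (@cvg_snd _ _ _ _ _)).
- exact: (@cvg_snd _ _ _ _ _).
Qed.

Lemma is_derive_coord i j x : is_derive x (std_basis R i) (fun x : E3 => coord x j) (i == j)%:R.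
Proof.
apply/is_deriveP; apply: cvg_near_cst; near=> h.
have h0 : h != 0 by near: h; exact: nbhs_dnbhs_neq.
by rewrite coordD coordZ coord_std addrK mulKf.
Unshelve. all: by end_near. Qed.

Lemma is_derive_comp_affine f (L : E3 -> E3) (x v w : E3) (c l : R) :
  (forall h, L (h *: v + x) = (h * c) *: w + L x) ->
  is_derive (L x) w f l -> is_derive x v (fun x => f (L x)) (c * l).
Proof.
move=> hL /is_deriveP hf; apply/is_deriveP => /=.
have [c0|c0] := eqVneq c 0.
  rewrite c0 mul0r.
  rewrite (_ : (fun h : R => _) = fun=> 0); first exact: cvg_cst.
  by apply/funext => h; rewrite hL c0 mulr0 scale0r add0r subrr mulr0.
have e : (fun h : R => h^-1 * (f (L (h *: v + x)) - f (L x))) =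
  (fun h : R => c * ((h * c)^-1 * (f ((h * c) *: w + L x) - f (L x)))).
  apply/funext => h; rewrite hL; have [->|h0] := eqVneq h 0.
    by rewrite mul0r invr0 !mul0r mulr0.
  by rewrite mulrA invfM mulrCA divff// mulr1.
rewrite e; apply: cvgM; first exact: cvg_cst.
apply: (@cvg_comp _ _ _ (fun h : R => h * c) (fun k : R => k^-1 * (f (k *: w + L x) - f (L x)))
  _ ((0 : R)^') _ _ hf).
move=> P [e0 /= e00 he].
exists (e0 / `|c|) => /=; first by rewrite divr_gt0// normr_gt0.
move=> h /= h1 h2; apply: he => /=; last by rewrite mulf_neq0.
move: h1; rewrite !sub0r !normrN normrM ltr_pdivlMr// normr_gt0//.
Qed.

Lemma smooth_alg_step f : smooth_alg f -> [/\ continuous f,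
  (forall i x, exists l, is_derive x (std_basis R i) f l) &
  forall i, smooth_alg (partial i f)].
Proof.
elim => {f}.
- move=> f sf; split.
  + exact: smooth_continuous.
  + by move=> i x; exists (partial i f x); exact: smooth_partialP.
  + by move=> i; apply: smooth_alg_smooth; exact: smooth_partial.
- move=> f g sf [cf df pf] sg [cg dg pg]; split.
  + by move=> x; apply: continuousD; [exact: cf|exact: cg].
  + move=> i x; have [l hl] := df i x; have [m hm] := dg i x; exists (l + m).
    exact: (is_deriveD hl hm).
  + move=> i; rewrite (_ : partial i _ = fun x => partial i f x + partial i g x); first exact: smooth_algD.
    apply/funext => x; have [l hl] := df i x; have [m hm] := dg i x.
    by rewrite (partial_is_derive hl) (partial_is_derive hm) (partial_is_derive (is_deriveD hl hm)).
- move=> f g sf [cf df pf] sg [cg dg pg]; split.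
  + by move=> x; apply: continuousM; [exact: cf|exact: cg].
  + move=> i x; have [l hl] := df i x; have [m hm] := dg i x; exists (f x *: m + g x *: l).
    exact: (is_deriveM hl hm).
  + move=> i; rewrite (_ : partial i _ = fun x => f x * partial i g x + g x * partial i f x).
      by apply: smooth_algD; exact: smooth_algM.
    apply/funext => x; have [l hl] := df i x; have [m hm] := dg i x.
    by rewrite (partial_is_derive hl) (partial_is_derive hm) (partial_is_derive (is_deriveM hl hm)).
- move=> k; split.
  + by move=> x; exact: cst_continuous.
  + by move=> i x; exists 0; exact: is_derive_cst.
  + move=> i; rewrite (_ : partial i _ = fun=> 0); first exact: smooth_alg_cst.
    by apply/funext => x; apply: partial_is_derive; exact: is_derive_cst.
- move=> j; split.
  + exact: continuous_coord.
  + by move=> i x; exists (i == j)%:R; exact: is_derive_coord.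
  + move=> i; rewrite (_ : partial i _ = fun=> (i == j)%:R); first exact: smooth_alg_cst.
    by apply/funext => x; apply: partial_is_derive; exact: is_derive_coord.
- move=> f L aL sf [cf df pf]; have [cL [c [s hs]]] := aL; split.
  + by move=> x; apply: continuous_comp; [exact: cL|exact: cf].
  + move=> i x; have [l hl] := df (s i) (L x); exists (c i * l).
    exact: (is_derive_comp_affine (fun h => hs x i h) hl).
  + move=> i; rewrite (_ : partial i _ = fun x => c i * partial (s i) f (L x)).
      by apply: smooth_algM; [exact: smooth_alg_cst|exact: smooth_alg_comp].
    apply/funext => x; have [l hl] := df (s i) (L x).
    rewrite (partial_is_derive hl); apply: partial_is_derive.
    exact: (is_derive_comp_affine (fun h => hs x i h) hl).
Qed.

Lemma smooth_algP f : smooth_alg f -> smooth f.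
Proof. exact: smooth_coind smooth_alg_step _. Qed.

Lemma smoothD f g : smooth f -> smooth g -> smooth (fun x => f x + g x).
Proof. by move=> sf sg; apply/smooth_algP/smooth_algD; exact: smooth_alg_smooth. Qed.

Lemma smoothM f g : smooth f -> smooth g -> smooth (fun x => f x * g x).
Proof. by move=> sf sg; apply/smooth_algP/smooth_algM; exact: smooth_alg_smooth. Qed.

Lemma smooth_cst k : smooth (fun=> k : R).
Proof. exact/smooth_algP/smooth_alg_cst. Qed.

Lemma smoothN f : smooth f -> smooth (fun x => - f x).
Proof.
move=> sf; rewrite (_ : (fun x => _) = fun x => (-1) * f x).
  by apply: smoothM => //; exact: smooth_cst.
by apply/funext => x; rewrite mulN1r.
Qed.

Lemma smoothB f g : smooth f -> smooth g -> smooth (fun x => f x - g x).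
Proof. by move=> sf sg; apply: smoothD => //; exact: smoothN. Qed.

Lemma smooth_coord i : smooth (fun x : E3 => coord x i).
Proof. exact/smooth_algP/smooth_alg_coord. Qed.

Lemma smooth_comp_affine f L : axis_affine L -> smooth f -> smooth (fun x => f (L x)).
Proof. by move=> aL sf; apply/smooth_algP/smooth_alg_comp => //; exact: smooth_alg_smooth. Qed.

Lemma smoothX f n : smooth f -> smooth (fun x => f x ^+ n).
Proof.
move=> sf; elim: n => [|n IH]; first by under eq_fun do rewrite expr0; exact: smooth_cst.
by under eq_fun do rewrite exprS; exact: smoothM.
Qed.

Lemma partialD f g i x : smooth f -> smooth g ->
  partial i (fun x => f x + g x) x = partial i f x + partial i g x.
Proof.
move=> sf sg; exact: partial_is_derive (is_deriveD (smooth_partialP i x sf) (smooth_partialP i x sg)).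
Qed.

Lemma partialM f g i x : smooth f -> smooth g ->
  partial i (fun x => f x * g x) x = partial i f x * g x + f x * partial i g x.
Proof.
move=> sf sg.
rewrite (partial_is_derive (is_deriveM (smooth_partialP i x sf) (smooth_partialP i x sg))).
by rewrite addrC [X in X + _]mulrC.
Qed.

Lemma partial_cst (k : R) i x : partial i (fun=> k) x = 0.
Proof. by apply: partial_is_derive; exact: is_derive_cst. Qed.

Lemma partial_coord i j x : partial i (fun x : E3 => coord x j) x = (i == j)%:R.
Proof. by apply: partial_is_derive; exact: is_derive_coord. Qed.

Lemma axis_affine_scale (k : R) (a : E3) : axis_affine (fun x => k *: x + a).
Proof.
split.
  by move=> x; apply: continuousD; [exact: scaler_continuous|exact: cst_continuous].
by exists (fun=> k), id => x j h; rewrite scalerDr scalerA addrA (mulrC k).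
Qed.

Lemma partial_scale f i (k : R) x : smooth f ->
  partial i (fun x => f (k *: x)) x = k * partial i f (k *: x).
Proof.
move=> sf; apply: partial_is_derive.
apply: is_derive_comp_affine (smooth_partialP i _ sf) => h.
by rewrite scalerDr scalerA mulrC.
Qed.

Lemma iter_partial_scale f w (k : R) x : smooth f ->
  iter_partial w (fun x => f (k *: x)) x = k ^+ size w * iter_partial w f (k *: x).
Proof.
move=> sf; elim: w x => [|i w IH] x /=; first by rewrite mul1r.
rewrite (_ : iter_partial w _ = fun x => k ^+ size w * iter_partial w f (k *: x)); last exact/funext/IH.
have sw : smooth (iter_partial w f).
  by move=> v; have := sf (v ++ w); rewrite /iter_partial foldr_cat.
have sw2 : smooth (fun x => iter_partial w f (k *: x)).
  have := smooth_comp_affine (axis_affine_scale k 0) sw.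
  by under eq_fun do rewrite addr0.
rewrite partialM//; last exact: smooth_cst.
by rewrite partial_cst mul0r add0r partial_scale// exprS mulrCA mulrA.
Qed.

Lemma enorm_ge0 (x : E3) : 0 <= enorm x. Proof. exact: sqrtr_ge0. Qed.

Lemma enorm_sqr (x : E3) : enorm x ^+ 2 = x.1.1 ^+ 2 + x.1.2 ^+ 2 + x.2 ^+ 2.
Proof. by rewrite sqr_sqrtr dotpE -!expr2// !addr_ge0// sqr_ge0. Qed.

Lemma coord_le_enorm (x : E3) : [/\ `|x.1.1| <= enorm x, `|x.1.2| <= enorm x & `|x.2| <= enorm x].
Proof.
split; rewrite -ler_sqr ?nnegrE ?enorm_ge0// real_normK ?num_real// enorm_sqr.
- by rewrite -addrA lerDl addr_ge0// sqr_ge0.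
- by rewrite addrAC lerDr addr_ge0// sqr_ge0.
- by rewrite lerDr addr_ge0// sqr_ge0.
Qed.

Lemma test_function_bounded f : test_function f -> exists B, forall x, `|f x| <= B.
Proof.
move=> [sf [r hr]].
have cf := smooth_continuous sf.
pose K : set E3 := (`[- r, r]%classic `*` `[- r, r]%classic) `*` `[- r, r]%classic.
have cK : compact K by apply: compact_setX; [apply: compact_setX|]; exact: segment_compact.
have : bounded_set [set f x | x in K].
  by apply: compact_bounded; apply: continuous_compact => //; apply: continuous_subspaceT.
move=> [M [Mr hM]].
have [B [B0 hB]] : exists B : R, 0 <= B /\ forall x, K x -> `|f x| <= B.
  exists (`|M| + 1); split; first by rewrite addr_ge0.
  by move=> x Kx; apply: (hM (`|M| + 1)); [rewrite ltr_pwDr// ler_norm|exists x].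
exists B => x; have [xr|rx] := leP (enorm x) r; last by rewrite hr// normr0.
apply: hB; have [h1 h2 h3] := coord_le_enorm x.
by split; [split|] => /=; rewrite in_itv/= -ler_norml (le_trans _ xr).
Qed.

Lemma continuous_enorm : continuous (@enorm R).
Proof.
move=> y; apply: continuous_comp; last exact: sqrt_continuous.
rewrite (_ : (fun x => dotp x x) = (fun x => coord x ord0 * coord x ord0 +
   coord x (inord 1) * coord x (inord 1) + coord x ord_max * coord x ord_max)).
  by apply: continuousD; [apply: continuousD|]; apply: continuousM; exact: continuous_coord.
by apply/funext => z; rewrite dotpE /coord /= inordK.
Qed.

Lemma open_enorm_gt r : open [set x : E3 | r < enorm x].
Proof.
apply: (@open_comp _ _ (@enorm R) [set t | r < t]); last exact: open_gt.
by move=> x _; exact: continuous_enorm.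
Qed.

Lemma open_enorm_lt r : open [set x : E3 | enorm x < r].
Proof.
apply: (@open_comp _ _ (@enorm R) [set t | t < r]); last exact: open_lt.
by move=> x _; exact: continuous_enorm.
Qed.

Lemma partial_open0 (U : set E3) f i : open U -> (forall y, U y -> f y = 0) ->
  forall y, U y -> partial i f y = 0.
Proof.
move=> oU fU y Uy; apply: partial_is_derive; apply/is_deriveP; apply: cvg_near_cst.
have cl : (fun h : R => h *: std_basis R i + y) @ (0 : R) --> y.
  rewrite -[X in _ --> X]add0r -[X in X + y](scale0r (std_basis R i)).
  apply: (@cvgD _ _ _ (nbhs (0 : R))); last exact: cvg_cst.
  exact: scalel_continuous.
have : \forall h \near (0 : R), U (h *: std_basis R i + y).
  by apply: cl; exact: open_nbhs_nbhs.
move=> /nbhs_dnbhs; apply: filterS => h hh /=.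
by rewrite !fU// subrr mulr0.
Qed.

Lemma iter_partial_open0 (U : set E3) f w : open U -> (forall y, U y -> f y = 0) ->
  forall y, U y -> iter_partial w f y = 0.
Proof.
by move=> oU fU; elim: w => [//|i w IH] y Uy /=; exact: (partial_open0 i oU IH).
Qed.

Lemma test_function_partial f i : test_function f -> test_function (partial i f).
Proof.
move=> [sf [r hr]]; split; first exact: smooth_partial.
by exists r => x rx; apply: (partial_open0 i (@open_enorm_gt r)) => //.
Qed.

Lemma test_function_derivs_bounded f N : test_function f ->
  exists B, 0 <= B /\ forall w x, (size w <= N)%N -> `|iter_partial w f x| <= B.
Proof.
elim: N f => [|N IH] f tf.
  have [B hB] := test_function_bounded tf; exists B; split; first exact: le_trans (hB 0).
  by move=> [|//] x _; exact: hB.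
have [B0 hB0] := test_function_bounded tf.
have h i : exists B, 0 <= B /\ forall w x, (size w <= N)%N -> `|iter_partial w (partial i f) x| <= B.
  by apply: IH; exact: test_function_partial.
have [B hB] := choice h.
have B0ge : 0 <= B0 by exact: le_trans (hB0 0).
have Bge i : 0 <= B i by have [] := hB i.
exists (B0 + \sum_i B i); split; first by rewrite addr_ge0// sumr_ge0.
move=> w; case/lastP: w => [|w i] x.
  by move=> _; rewrite (le_trans (hB0 x))// lerDl sumr_ge0.
rewrite size_rcons ltnS => sw; rewrite iter_partial_rcons.
have [_ hi] := hB i; rewrite (le_trans (hi w x sw))// (bigD1 i)//= addrCA lerDl addr_ge0// sumr_ge0//.
Qed.

End real_smooth.

Global Opaque smooth partial.

(** * Complex smooth functions, Schwartz bounds and tempered distributions *)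

Section complex_smooth.
Variable R : realType.
Notation E3 := (R * R * R)%type.
Implicit Types (f g : E3 -> R[i]) (i j : 'I_3) (x : E3) (w v : seq 'I_3).

Record csmooth f : Prop := CSmooth {
  csmooth_re : smooth (fun x => Re (f x));
  csmooth_im : smooth (fun x => Im (f x)) }.

Definition cD w f : E3 -> R[i] := foldr (@cpartial R) f w.

Lemma Re_cD w f : (fun x => Re (cD w f x)) = iter_partial w (fun x => Re (f x)).
Proof. by elim: w => [//|i w IH] /=; rewrite -IH. Qed.

Lemma Im_cD w f : (fun x => Im (cD w f x)) = iter_partial w (fun x => Im (f x)).
Proof. by elim: w => [//|i w IH] /=; rewrite -IH. Qed.

Lemma cD_rcons w i f : cD (rcons w i) f = cD w (cpartial i f).
Proof. by rewrite /cD foldr_rcons. Qed.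

Lemma csmooth_cpartial f i : csmooth f -> csmooth (cpartial i f).
Proof. by move=> [fr fi]; split; [exact: (smooth_partial i fr)|exact: (smooth_partial i fi)]. Qed.

Lemma csmoothD f g : csmooth f -> csmooth g -> csmooth (fun x => f x + g x).
Proof.
move=> [fr fi] [gr gi]; split.
  by under eq_fun do rewrite ReD; exact: smoothD.
by under eq_fun do rewrite ImD; exact: smoothD.
Qed.

Lemma csmoothM f g : csmooth f -> csmooth g -> csmooth (fun x => f x * g x).
Proof.
move=> [fr fi] [gr gi]; split.
  by under eq_fun do rewrite ReM; apply: smoothB; exact: smoothM.
by under eq_fun do rewrite ImM; apply: smoothD; exact: smoothM.
Qed.

Lemma csmooth_cst c : csmooth (fun=> c).
Proof. by split; exact: smooth_cst. Qed.

Lemma csmooth_real (h : E3 -> R) : smooth h -> csmooth (fun x => (h x)%:C).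
Proof. by move=> sh; split; [exact: sh|exact: smooth_cst]. Qed.

Lemma csmooth_coord i : csmooth (fun x => (coord x i)%:C).
Proof. by apply: csmooth_real; exact: smooth_coord. Qed.

Lemma csmoothZ c f : csmooth f -> csmooth (fun x => c * f x).
Proof. by move=> sf; exact: csmoothM (csmooth_cst c) sf. Qed.

Lemma cpartialD f g i x : csmooth f -> csmooth g ->
  cpartial i (fun x => f x + g x) x = cpartial i f x + cpartial i g x.
Proof.
move=> [fr fi] [gr gi]; apply: ReIm_eq; rewrite ?ReD ?ImD.
  have E : (fun y => Re (f y + g y)) = (fun y => Re (f y) + Re (g y)).
    by apply/funext => y; exact: ReD.
  by rewrite [LHS]/= E; exact: (partialD i x fr gr).
have E : (fun y => Im (f y + g y)) = (fun y => Im (f y) + Im (g y)).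
  by apply/funext => y; exact: ImD.
by rewrite [LHS]/= E; exact: (partialD i x fi gi).
Qed.

Lemma partialB (f g : E3 -> R) i x : smooth f -> smooth g ->
  partial i (fun x => f x - g x) x = partial i f x - partial i g x.
Proof.
move=> sf sg; exact: partial_is_derive (is_deriveB (smooth_partialP i x sf) (smooth_partialP i x sg)).
Qed.

Lemma cpartialM f g i x : csmooth f -> csmooth g ->
  cpartial i (fun x => f x * g x) x = cpartial i f x * g x + f x * cpartial i g x.
Proof.
move=> [fr fi] [gr gi]; apply: ReIm_eq; rewrite ?ReD ?ImD ?ReM ?ImM.
  have E : (fun y => Re (f y * g y)) =
    (fun y => Re (f y) * Re (g y) - Im (f y) * Im (g y)).
    by apply/funext => y; exact: ReM.
  rewrite [LHS]/= E (partialB i x (smoothM fr gr) (smoothM fi gi)).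
  by rewrite (partialM i x fr gr) (partialM i x fi gi) opprD addrACA.
have E : (fun y => Im (f y * g y)) =
  (fun y => Re (f y) * Im (g y) + Im (f y) * Re (g y)).
  by apply/funext => y; exact: ImM.
rewrite [LHS]/= E (partialD i x (smoothM fr gi) (smoothM fi gr)).
by rewrite (partialM i x fr gi) (partialM i x fi gr) addrACA.
Qed.

Lemma cpartial_cst (c : R[i]) i : cpartial i (fun _ : E3 => c) = fun=> 0.
Proof. by apply/funext => x; rewrite /cpartial !partial_cst. Qed.

Lemma cpartial_real (h : E3 -> R) i x : cpartial i (fun x => (h x)%:C) x = (partial i h x)%:C.
Proof. by rewrite /cpartial /= partial_cst. Qed.

Lemma cpartial_coord i j : cpartial i (fun x => (coord x j)%:C) = fun=> (i == j)%:R.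
Proof. by apply/funext => x; rewrite cpartial_real partial_coord; case: (i == j). Qed.

Lemma cpartialZ c f i x : csmooth f -> cpartial i (fun x => c * f x) x = c * cpartial i f x.
Proof.
by move=> sf; rewrite (cpartialM i x (csmooth_cst c) sf) cpartial_cst mul0r add0r.
Qed.

Lemma csmooth_cD w f : csmooth f -> csmooth (cD w f).
Proof. by move=> sf; elim: w => [//|i w IH]; exact: csmooth_cpartial. Qed.

Lemma cD_D w f g x : csmooth f -> csmooth g ->
  cD w (fun x => f x + g x) x = cD w f x + cD w g x.
Proof.
move=> sf sg; elim: w x => [//|i w IH] x /=.
rewrite (_ : cD w (fun x => f x + g x) = fun x => cD w f x + cD w g x); last exact/funext/IH.
exact: (cpartialD i x (csmooth_cD w sf) (csmooth_cD w sg)).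
Qed.

Lemma cDZ w c f x : csmooth f -> cD w (fun x => c * f x) x = c * cD w f x.
Proof.
move=> sf; elim: w x => [//|i w IH] x /=.
rewrite (_ : cD w (fun x => c * f x) = fun x => c * cD w f x); last exact/funext/IH.
exact: (cpartialZ c i x (csmooth_cD w sf)).
Qed.

Lemma cD_cst w (c : R[i]) : cD w (fun _ : E3 => c) = fun=> (if w is [::] then c else 0).
Proof.
case/lastP: w => [//|w i]; rewrite cD_rcons cpartial_cst.
rewrite [RHS](_ : _ = fun=> 0); last by case: w.
elim: w => [//|j w IH] /=; by rewrite IH cpartial_cst.
Qed.

Lemma cD_open0 (U : set E3) f w : open U -> (forall y, U y -> f y = 0) ->
  forall y, U y -> cD w f y = 0.
Proof.
move=> oU fU y Uy; apply: ReIm_eq => /=.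
  rewrite -[LHS]/((fun x => Re (cD w f x)) y) Re_cD.
  by apply: (iter_partial_open0 w oU) => // z Uz; rewrite fU.
rewrite -[LHS]/((fun x => Im (cD w f x)) y) Im_cD.
by apply: (iter_partial_open0 w oU) => // z Uz; rewrite fU.
Qed.

(** A bound is enough, so instead of the binomial formula the last derivative of the word is
    distributed by the product rule; each induction step doubles the number of terms, whence 2^n. *)
Lemma cD_leibniz (n : nat) f g x (a b : R) : csmooth f -> csmooth g ->
  (forall v, (size v <= n)%N -> cabs (cD v f x) <= a) ->
  (forall v, (size v <= n)%N -> cabs (cD v g x) <= b) ->
  forall w, (size w <= n)%N -> cabs (cD w (fun x => f x * g x) x) <= 2 ^+ n * (a * b).
Proof.
move=> sf sg ha hb.
have ab h k : cabs (cD h f x) <= a -> cabs (cD k g x) <= b -> 0 <= a * b.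
  by move=> h1 h2; apply: mulr_ge0; [exact: (le_trans (cabs_ge0 _) h1)|exact: (le_trans (cabs_ge0 _) h2)].
have ab0 : 0 <= a * b by apply: (ab [::] [::]); [exact: ha|exact: hb].
clear ab; elim: n f g sf sg ha hb => [|n IH] f g sf sg ha hb.
  case=> // _; rewrite /= expr0 mul1r cabsM ler_pM ?cabs_ge0//.
    exact: (ha [::]).
  exact: (hb [::]).
move=> w; case/lastP: w => [_|w i].
  rewrite /= cabsM; apply: le_trans (_ : a * b <= _); last by rewrite ler_peMl// exprn_ege1// ler1n.
  by rewrite ler_pM ?cabs_ge0//; [exact: (ha [::])|exact: (hb [::])].
rewrite size_rcons ltnS => sw; rewrite cD_rcons.
have -> : cpartial i (fun x => f x * g x) = fun x => cpartial i f x * g x + f x * cpartial i g x.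
  by apply/funext => y; exact: cpartialM.
have sfi := csmooth_cpartial i sf; have sgi := csmooth_cpartial i sg.
rewrite cD_D; [|exact: csmoothM..].
rewrite (le_trans (cabsD _ _))// exprS -mulrA mulr2n mulrDl mul1r lerD//.
  apply: IH => // v sv; last by apply: hb; rewrite leqW.
  by rewrite -cD_rcons; apply: ha; rewrite size_rcons.
apply: IH => // v sv; first by apply: ha; rewrite leqW.
by rewrite -cD_rcons; apply: hb; rewrite size_rcons.
Qed.

Lemma cD_coord_bound w i x : cabs (cD w (fun x => (coord x i)%:C) x) <= 1 + enorm x.
Proof.
case/lastP: w => [|w j].
  change (cabs (coord x i)%:C <= 1 + enorm x); rewrite cabs_real; have [h1 h2 h3] := coord_le_enorm x.
  have e0 := enorm_ge0 x.
  by case: i => [[|[|[|//]]]] ? /=; rewrite (le_trans _ (_ : enorm x <= _)) ?lerDr.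
rewrite cD_rcons cpartial_coord cD_cst.
have h0 := enorm_ge0 x.
case: w => [|_ _]; last by rewrite cabs0 addr_ge0.
by case: (j == i); rewrite ?cabs1 ?cabs0 ?lerDl ?addr_ge0.
Qed.

(** The N-th Schwartz seminorm is at most [c]: an explicit real bound instead of an extended
    supremum, which makes sums, products and limits elementary. [csch_schwartz] relates the two
    formulations. *)
Definition csbd N f c := forall w, (size w <= N)%N -> forall x,
  (1 + enorm x) ^+ N * cabs (cD w f x) <= c.

Definition csch f := csmooth f /\ forall N, exists c, csbd N f c.

Lemma one_enorm_gt0 x : 0 < 1 + enorm x.
Proof. by rewrite ltr_pwDl// enorm_ge0. Qed.

Lemma one_enorm_ge1 x : 1 <= 1 + enorm x.
Proof. by rewrite lerDl enorm_ge0. Qed.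

Lemma csbd_ge0 N f c : csbd N f c -> 0 <= c.
Proof.
move=> /(_ [::] isT 0); apply: le_trans.
by rewrite mulr_ge0 ?cabs_ge0// exprn_ge0// ltW// one_enorm_gt0.
Qed.

Lemma csbd_le N f c c' : c <= c' -> csbd N f c -> csbd N f c'.
Proof. by move=> cc h w sw x; rewrite (le_trans (h w sw x)). Qed.

Lemma csbd_mono N M f c : (N <= M)%N -> csbd M f c -> csbd N f c.
Proof.
move=> NM h w sw x; apply: le_trans (h w (leq_trans sw NM) x).
by rewrite ler_wpM2r ?cabs_ge0// ler_weXn2l// one_enorm_ge1.
Qed.

Lemma csbdD N f g c c' : csmooth f -> csmooth g -> csbd N f c -> csbd N g c' ->
  csbd N (fun x => f x + g x) (c + c').
Proof.
move=> sf sg hf hg w sw x; rewrite cD_D//.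
apply: le_trans (_ : (1 + enorm x) ^+ N * (cabs (cD w f x) + cabs (cD w g x)) <= _).
  by rewrite ler_wpM2l ?cabsD// exprn_ge0// ltW// one_enorm_gt0.
by rewrite mulrDr lerD//; [exact: hf|exact: hg].
Qed.

Lemma csbdZ N a f c : csmooth f -> csbd N f c -> csbd N (fun x => a * f x) (cabs a * c).
Proof.
move=> sf hf w sw x; rewrite cDZ// cabsM mulrCA ler_wpM2l ?cabs_ge0//.
exact: hf.
Qed.

Lemma csbd_cpartial N i f c : csbd N.+1 f c -> csbd N (cpartial i f) c.
Proof.
move=> hf w sw x; rewrite -cD_rcons.
apply: le_trans (hf (rcons w i) _ x); last by rewrite size_rcons.
by rewrite ler_wpM2r ?cabs_ge0// ler_weXn2l// one_enorm_ge1.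
Qed.

Lemma csbd_coordM N i f c : csmooth f -> csbd N.+1 f c ->
  csbd N (fun x => (coord x i)%:C * f x) (2 ^+ N * c).
Proof.
move=> sf hf w sw x; have e0 := one_enorm_gt0 x.
have := @cD_leibniz N (fun x => (coord x i)%:C) f x (1 + enorm x) (c / (1 + enorm x) ^+ N.+1)
  (csmooth_coord i) sf _ _ w sw.
have h1 v : (size v <= N)%N -> cabs (cD v (fun x => (coord x i)%:C) x) <= 1 + enorm x.
  by move=> _; exact: cD_coord_bound.
have h2 v : (size v <= N)%N -> cabs (cD v f x) <= c / (1 + enorm x) ^+ N.+1.
  move=> sv; rewrite ler_pdivlMr ?exprn_gt0// mulrC.
  by apply: hf; rewrite leqW.
move=> /(_ h1 h2) h; rewrite mulrC -ler_pdivlMr ?exprn_gt0//; apply: le_trans h _.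
rewrite -!mulrA ler_wpM2l ?exprn_ge0// exprS invfM mulrCA.
by rewrite [X in c * X](_ : _ = ((1 + enorm x) ^+ N)^-1)// mulVKf// gt_eqF.
Qed.

Lemma cschD f g : csch f -> csch g -> csch (fun x => f x + g x).
Proof.
move=> [sf hf] [sg hg]; split; first exact: csmoothD.
by move=> N; have [c hc] := hf N; have [c' hc'] := hg N; exists (c + c'); exact: csbdD.
Qed.

Lemma cschZ a f : csch f -> csch (fun x => a * f x).
Proof.
move=> [sf hf]; split; first exact: csmoothZ.
by move=> N; have [c hc] := hf N; exists (cabs a * c); exact: csbdZ.
Qed.

Lemma cschB f g : csch f -> csch g -> csch (fun x => f x - g x).
Proof.
move=> hf hg; have := cschD hf (cschZ (-1) hg).
by congr csch; apply/funext => x; rewrite mulN1r.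
Qed.

Lemma csch_cpartial i f : csch f -> csch (cpartial i f).
Proof.
move=> [sf hf]; split; first exact: csmooth_cpartial.
by move=> N; have [c hc] := hf N.+1; exists c; exact: csbd_cpartial.
Qed.

Lemma csch_coordM i f : csch f -> csch (fun x => (coord x i)%:C * f x).
Proof.
move=> [sf hf]; split; first exact: (csmoothM (csmooth_coord i) sf).
by move=> N; have [c hc] := hf N.+1; exists (2 ^+ N * c); exact: csbd_coordM.
Qed.

Lemma ctest_derivs_bounded f N : cpart f (@test_function R) ->
  exists B, 0 <= B /\ forall w x, (size w <= N)%N -> cabs (cD w f x) <= B.
Proof.
move=> [tr ti]; have [B1 [B10 h1]] := test_function_derivs_bounded N tr.
have [B2 [B20 h2]] := test_function_derivs_bounded N ti.
exists (B1 + B2); split; first exact: addr_ge0.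
move=> w x sw; rewrite (le_trans (cabs_le_ReIm _))// lerD//.
  by rewrite -[Re _]/((fun x => Re (cD w f x)) x) Re_cD h1.
by rewrite -[Im _]/((fun x => Im (cD w f x)) x) Im_cD h2.
Qed.

Lemma ctest_support f : cpart f (@test_function R) ->
  exists r, 0 <= r /\ forall x, r < enorm x -> f x = 0.
Proof.
move=> [[_ [r1 h1]] [_ [r2 h2]]]; exists (Num.max 0 (Num.max r1 r2)); split; first by rewrite le_max lexx.
move=> x; rewrite !gt_max => /andP[_ /andP[hr1 hr2]].
by apply: ReIm_eq; [exact: h1|exact: h2].
Qed.

Lemma csch_test f : cpart f (@test_function R) -> csch f.
Proof.
move=> tf; split; first by case: tf => [[? _] [? _]].
move=> N; have [B [B0 hB]] := ctest_derivs_bounded N tf.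
have [r [r0 hr]] := ctest_support tf.
exists ((1 + r) ^+ N * B) => w sw x; have [xr|rx] := leP (enorm x) r.
  rewrite ler_pM ?cabs_ge0 ?hB//; first by rewrite exprn_ge0// ltW// one_enorm_gt0.
  by rewrite lerXn2r ?nnegrE ?lerD2l// ?addr_ge0 ?enorm_ge0.
rewrite (cD_open0 w (@open_enorm_gt _ r) hr)// cabs0 mulr0 mulr_ge0// exprn_ge0// addr_ge0//.
Qed.

Lemma seminorm_csbd N f c : csbd N f c -> (schwartz_seminorm N f <= c%:E)%E.
Proof.
move=> h; apply: ge_ereal_sup => _ [w [x [sw ->]]].
by rewrite lee_fin; exact: h.
Qed.

Lemma csch_schwartz f : csch f <-> schwartz f.
Proof.
split => -[[sr si] hf]; (split; first exact: (conj sr si) || exact: CSmooth sr si) => N.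
  by have [c /seminorm_csbd h] := hf N; exact: le_lt_trans h (ltry _).
have := hf N; have ge0 : (0 <= schwartz_seminorm N f)%E.
  apply: (@le_trans _ _ ((1 + enorm (0 : E3)) ^+ N * Normc.normc (foldr (@cpartial R) f [::] 0))%:E).
    by rewrite lee_fin mulr_ge0 ?cabs_ge0// exprn_ge0// ltW// one_enorm_gt0.
  by apply: ereal_sup_ubound; exists [::], 0.
case: (schwartz_seminorm N f) (@ereal_sup_ubound _ _ : ubound _ (schwartz_seminorm N f)) ge0 => [r| |] // ub _ _.
exists r => w sw x; rewrite -lee_fin; apply: ub.
by exists w, x.
Qed.

(** Convergence to 0 in the topology of the Schwartz space. *)
Definition csnull (f_ : nat -> E3 -> R[i]) := forall N, exists c_ : nat -> R,
  c_ @ \oo --> (0 : R) /\ forall n, csbd N (f_ n) (c_ n).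

Lemma csnull_cpartial (f_ : nat -> E3 -> R[i]) i : csnull f_ -> csnull (fun n => cpartial i (f_ n)).
Proof.
by move=> h N; have [c [c0 hc]] := h N.+1; exists c; split => // n; exact: csbd_cpartial.
Qed.

Lemma tempered_bound (T : dist R) : tempered T -> exists N c, 0 <= c /\
  forall f b, csch f -> csbd N f b -> cabs (T f) <= c * b.
Proof.
move=> [_ [N [c hc]]]; exists N, (Num.max 0 c); split; first by rewrite le_max lexx.
move=> f b sf hb; rewrite -lee_fin.
have b0 := csbd_ge0 hb.
apply: le_trans (hc f _) _; first exact/csch_schwartz.
have s0 : (0 <= schwartz_seminorm N f)%E.
  apply: (@le_trans _ _ ((1 + enorm (0 : E3)) ^+ N * Normc.normc (foldr (@cpartial R) f [::] 0))%:E).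
    by rewrite lee_fin mulr_ge0 ?cabs_ge0// exprn_ge0// ltW// one_enorm_gt0.
  by apply: ereal_sup_ubound; exists [::], 0.
apply: (@le_trans _ _ ((Num.max 0 c)%:E * schwartz_seminorm N f)%E).
  by rewrite lee_wpmul2r// lee_fin le_max lexx orbT.
by rewrite EFinM lee_wpmul2l ?seminorm_csbd// lee_fin le_max lexx.
Qed.

Lemma tempered_lin (T : dist R) a f g : tempered T -> csch f -> csch g ->
  T (fun x => a * f x + g x) = a * T f + T g.
Proof. by move=> [lT _] /csch_schwartz sf /csch_schwartz sg; exact: lT. Qed.

Lemma temperedB (T : dist R) f g : tempered T -> csch f -> csch g ->
  T (fun x => f x - g x) = T f - T g.
Proof.
move=> tT sf sg; have := tempered_lin (-1) tT sg sf.
rewrite mulN1r addrC => <-; congr T; apply/funext => x.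
by rewrite mulN1r addrC.
Qed.

Lemma tempered_cvg (T : dist R) (f_ : nat -> E3 -> R[i]) f : tempered T ->
  (forall n, csch (f_ n)) -> csch f -> csnull (fun n x => f_ n x - f x) ->
  ccvg (fun n => T (f_ n)) (T f).
Proof.
move=> tT sf_ sf nf; have [N [c [c0 hc]]] := tempered_bound tT; have [e [e0 he]] := nf N.
apply: (@squeeze0 _ _ (fun n => c * e n)).
- by move=> n; exact: cabs_ge0.
- by move=> n; rewrite -temperedB//; apply: hc => //; exact: cschB.
- exact: cvg0Z.
Qed.

End complex_smooth.

(** * Measurability of continuous functions and integrability of Schwartz functions *)

Section measurability.
Variable R : realType.
Notation E3 := (R * R * R)%type.
Notation V := (mspace R).

(** Rounding down to the lattice of mesh 1 / (n + 1). Composed with it any function takes countably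
    many values on boxes, hence is measurable for the product sigma-algebra, and continuous
    functions are pointwise limits of such composites. *)
Definition grid (n : nat) (x : E3) : E3 :=
  ((Num.floor (n.+1%:R * x.1.1))%:~R / n.+1%:R, (Num.floor (n.+1%:R * x.1.2))%:~R / n.+1%:R,
   (Num.floor (n.+1%:R * x.2))%:~R / n.+1%:R).

Lemma measurable_floor_eq (h : V -> R) (n : nat) (a : int) : measurable_fun setT h ->
  measurable [set x : V | Num.floor (n.+1%:R * h x) = a].
Proof.
move=> mh; rewrite (_ : [set x | _] = h @^-1` `[a%:~R / n.+1%:R, (a + 1)%:~R / n.+1%:R[%classic).
  by rewrite -[X in measurable X]setTI; apply: mh => //; exact: measurable_itv.
apply/seteqP; split => x /=; rewrite in_itv/= ler_pdivrMr// ltr_pdivlMr// ![h x * _]mulrC.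
  by move=> <-; exact: floor_itv.
exact: floor_def.
Qed.

Lemma measurable_grid (f : E3 -> R) n : measurable_fun setT (fun x : V => f (grid n x)).
Proof.
move=> _ B mB; rewrite setTI.
pose P (p : int * int * int) : set V := [set x | [/\ f (p.1.1%:~R / n.+1%:R, p.1.2%:~R / n.+1%:R, p.2%:~R / n.+1%:R) \in B,
  Num.floor (n.+1%:R * x.1.1) = p.1.1, Num.floor (n.+1%:R * x.1.2) = p.1.2 & Num.floor (n.+1%:R * x.2) = p.2]].
rewrite (_ : _ @^-1` B = \bigcup_p P p).
  apply: countable_bigcupT_measurable; first exact: countableP.
  move=> [[a b] c]; rewrite /P /=.
  have [fB|fB] := boolP (f (a%:~R / n.+1%:R, b%:~R / n.+1%:R, c%:~R / n.+1%:R) \in B).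
    rewrite (_ : [set x | _] = [set x : V | Num.floor (n.+1%:R * x.1.1) = a] `&`
      [set x : V | Num.floor (n.+1%:R * x.1.2) = b] `&` [set x : V | Num.floor (n.+1%:R * x.2) = c]).
      apply: measurableI; [apply: measurableI|]; apply: measurable_floor_eq.
      + exact: measurable_c1.
      + exact: measurable_c2.
      + exact: measurable_c3.
    by apply/seteqP; split => x /=; [case=> _ -> -> ->|case=> [[-> ->] ->]].
  by rewrite (_ : [set x | _] = set0)//; apply/seteqP; split => x //= [].
apply/seteqP; split => x /=.
  move=> Bx; exists (Num.floor (n.+1%:R * x.1.1), Num.floor (n.+1%:R * x.1.2), Num.floor (n.+1%:R * x.2)) => //.
  by split => //; apply/mem_set.
by move=> [[[a b] c] _ [/= /set_mem hB ha hb hc]]; rewrite /grid ha hb hc.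
Qed.

Lemma cvg_grid (x : E3) : (fun n => grid n x) @ \oo --> x.
Proof.
have h (t : R) : (fun n => (Num.floor (n.+1%:R * t))%:~R / n.+1%:R) @ \oo --> t.
  apply/cvgrPdist_le => e e0.
  have := @cvg_harmonic R; move/cvgrPdist_le => /(_ _ e0); apply: filterS => n.
  rewrite sub0r normrN /= ger0_norm ?invr_ge0// => ne.
  have /andP[h1 h2] := floor_itv (n.+1%:R * t).
  move: h1 h2; set a := (Num.floor _)%:~R => h1; rewrite intrD -/a => h2.
  have n0 : 0 < n.+1%:R :> R by [].
  rewrite ger0_norm; last by rewrite subr_ge0 ler_pdivrMr// mulrC.
  apply: le_trans ne; rewrite lerBlDr -[X in X + _]mul1r -mulrDl ler_pdivlMr// mulrC addrC.
  exact: ltW.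
by case: x => [[a b] c]; exact: (cvg_pair (cvg_pair (h a) (h b)) (h c)).
Qed.

Lemma measurable_continuous3 (f : E3 -> R) : continuous f -> measurable_fun setT (f : V -> R).
Proof.
move=> cf; apply: (@measurable_fun_cvg _ _ _ _ (fun n (x : V) => f (grid n x))).
  by move=> n; exact: measurable_grid.
by move=> x _; apply: continuous_cvg; [exact: cf|exact: cvg_grid].
Qed.

Lemma cmeas_csmooth (f : E3 -> R[i]) : csmooth f -> cmeas (f : V -> R[i]).
Proof.
by move=> [fr fi]; split; apply: measurable_continuous3;
  [exact: (smooth_continuous fr)|exact: (smooth_continuous fi)].
Qed.

(** Each coordinate satisfies 1 + t^2 <= (1 + |x|)^2, and three coordinates give the exponent 6.
    This is the origin of the six additional weights that integrability costs in later estimates. *)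
Lemma cauchy3_enorm (x : E3) : ((1 + enorm x) ^+ 6)^-1 <= cauchy3 x.
Proof.
have [h1 h2 h3] := coord_le_enorm x; have e0 := enorm_ge0 x.
have h (t : R) : `|t| <= enorm x -> ((1 + enorm x) ^+ 2)^-1 <= cauchy1 t.
  move=> ht; rewrite /cauchy1 lef_pV2 ?posrE; last 2 first.
  - by rewrite exprn_gt0// one_enorm_gt0.
  - by rewrite ltr_pwDl// sqr_ge0.
  have ht2 : t ^+ 2 <= enorm x ^+ 2 by rewrite -(real_normK (num_real t)) lerXn2r ?nnegrE.
  by rewrite sqrrD expr1n mul1r -addrA lerD2l (le_trans ht2)// lerDr mulrn_wge0.
have -> : (1 + enorm x) ^+ 6 = (1 + enorm x) ^+ 2 * (1 + enorm x) ^+ 2 * (1 + enorm x) ^+ 2.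
  by rewrite -!exprD.
rewrite !invfM /cauchy3.
set a := (1 + enorm x)^-1 / _.
have i0 : 0 <= ((1 + enorm x) ^+ 2)^-1 by rewrite invr_ge0 sqr_ge0.
have -> : a = ((1 + enorm x) ^+ 2)^-1 by rewrite expr2 invfM.
by rewrite !ler_pM ?mulr_ge0// h.
Qed.

Lemma csbd_cauchy3 (f : E3 -> R[i]) c x : csbd 6 f c -> cabs (f x) <= c * cauchy3 x.
Proof.
move=> h; have c0 := csbd_ge0 h; have := h [::] isT x; rewrite mulrC -ler_pdivlMr.
  by move=> /le_trans; apply; rewrite ler_wpM2l// cauchy3_enorm.
by rewrite exprn_gt0// one_enorm_gt0.
Qed.

Lemma csbd_cL1 (f : E3 -> R[i]) c : csmooth f -> csbd 6 f c -> cL1 (lam3 R) f.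
Proof.
move=> sf h; apply: (@cL1_dom _ _ _ _ _ (fun x : V => c * cauchy3 x)).
- exact: cmeas_csmooth.
- by move=> x; exact: csbd_cauchy3.
- by apply: integrable_RZ; exact: integrable_cauchy3.
Qed.

Lemma csch_cL1 (f : E3 -> R[i]) : csch f -> cL1 (lam3 R) f.
Proof. by move=> [sf /(_ 6)[c hc]]; exact: csbd_cL1 hc. Qed.

Lemma csbd_sup0 N (f : E3 -> R[i]) c x : csbd N f c -> cabs (f x) <= c.
Proof.
by move=> h; have := (csbd_mono (leq0n N) h) [::] isT x; rewrite expr0 mul1r.
Qed.

Lemma csbd_inv_fourier_sup (f : E3 -> R[i]) c x : csmooth f -> csbd 6 f c ->
  cabs (inv_fourier f x) <= (c0 R * pi ^+ 3) * c.
Proof.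
move=> sf hf; have f1 := csbd_cL1 sf hf.
apply: le_trans (inv_fourier_bound x f1) _; rewrite -mulrA ler_wpM2l ?(ltW (c0_gt0 R))//.
have ic := integrable_cauchy3 R.
have -> : pi ^+ 3 * c = \int[lam3 R]_x (c * cauchy3 x).
  by rewrite RintegralZl// /Rintegral integral_cauchy3 mulrC.
apply: le_Rintegral => //; first by case: f1.
  exact: integrable_RZ.
by move=> y _; exact: csbd_cauchy3.
Qed.

End measurability.

(** * Truncation by dilated cutoffs *)

Section cutoff.
Variable R : realType.
Notation E3 := (R * R * R)%type.
Variables (psi : E3 -> R) (hpsi : lp_cutoff psi).

Lemma cutoff_smooth : smooth psi. Proof. by case: hpsi. Qed.

Lemma cutoff_ge0 x : 0 <= psi x. Proof. by case: hpsi. Qed.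

Lemma cutoff_eq1 x : enorm x <= 2^-1 -> psi x = 1. Proof. by case: hpsi => _ _ _; exact. Qed.

Lemma cutoff_eq0_gt x : 1 < enorm x -> psi x = 0.
Proof.
case: hpsi => _ _ h _ x1; apply/eqP; apply: contraPT x1 => /h.
by rewrite /eball /= => xle; apply/negP; rewrite -leNgt.
Qed.

Lemma cutoff_test : test_function psi.
Proof. by split; [exact: cutoff_smooth|exists 1; exact: cutoff_eq0_gt]. Qed.

Lemma cutoff_bounded : exists B, 1 <= B /\ forall x, psi x <= B.
Proof.
have [B hB] := test_function_bounded cutoff_test.
exists B; split; last by move=> x; rewrite (le_trans (ler_norm _)).
by apply: le_trans (hB 0); rewrite cutoff_eq1 ?normr1// /enorm dotpE /= !mul0r !addr0 sqrtr0 invr_ge0.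
Qed.

Lemma enormZ (k : R) (x : E3) : enorm (k *: x) = `|k| * enorm x.
Proof.
rewrite /enorm dotpZl dotpZr mulrA -expr2 sqrtrM ?sqr_ge0// sqrtr_sqr//.
Qed.

Definition cutoffn (n : nat) (x : E3) : R[i] := (psi (n.+1%:R^-1 *: x))%:C.

Lemma csmooth_cutoffn n : csmooth (cutoffn n).
Proof.
apply: csmooth_real.
have := smooth_comp_affine (axis_affine_scale n.+1%:R^-1 0) cutoff_smooth.
by under eq_fun do rewrite addr0.
Qed.

Lemma cutoffn_test n : test_function (fun x => psi (n.+1%:R^-1 *: x)).
Proof.
split; first by case: (csmooth_cutoffn n).
exists n.+1%:R => x nx; apply: cutoff_eq0_gt.
by rewrite enormZ ger0_norm ?invr_ge0// mulrC ltr_pdivlMr ?mul1r.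
Qed.

Lemma cutoffn_derivs N : exists B, 0 <= B /\ forall n w x, (size w <= N)%N ->
  cabs (cD w (fun y => cutoffn n y - 1) x) <= B.
Proof.
have [B [B0 hB]] := test_function_derivs_bounded N cutoff_test.
exists (B + 1); split; first by rewrite addr_ge0.
move=> n w x sw.
rewrite (cD_D w x (csmooth_cutoffn n) (csmooth_cst (-1 : R[i]))).
rewrite (le_trans (cabsD _ _))// lerD//; last first.
  by rewrite cD_cst; case: w {sw} => [|_ _]; rewrite ?cabsN ?cabs1 ?cabs0.
have -> : cD w (cutoffn n) x = (iter_partial w (fun y => psi (n.+1%:R^-1 *: y)) x)%:C.
  apply: ReIm_eq.
    by rewrite -[LHS]/((fun x => Re (cD w (cutoffn n) x)) x) Re_cD.
  rewrite -[LHS]/((fun x => Im (cD w (cutoffn n) x)) x) Im_cD /=.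
  exact: (@iter_partial_open0 R setT (fun=> 0) w openT).
rewrite cabs_real (iter_partial_scale _ _ _ cutoff_smooth) normrM.
rewrite -[leRHS]mul1r ler_pM//; last exact: hB.
by rewrite ger0_norm ?exprn_ge0// exprn_ile1// invf_le1// ler1n.
Qed.

(** The factor [cutoffn n - 1] vanishes for |x| < (n + 1) / 2 and has derivatives bounded uniformly
    in [n]. Outside that ball one additional weight of [f] is worth at most 2 / (n + 1). *)
Lemma csnull_cutoff f : csch f -> csnull (fun n x => cutoffn n x * f x - f x).
Proof.
move=> [sf hf] N; have [B [B0 hB]] := cutoffn_derivs N; have [c hc] := hf N.+1.
exists (fun n => (2 ^+ N * B * c * 2) * n.+1%:R^-1); split.
  by apply: cvg0Z; exact: cvg_harmonic.
move=> n w sw x.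
have e0 := one_enorm_gt0 x; have c0 := csbd_ge0 hc.
have s1 : csmooth (fun y => cutoffn n y - 1).
  exact: csmoothD (csmooth_cutoffn n) (csmooth_cst (-1 : R[i])).
have -> : (fun y => cutoffn n y * f y - f y) = (fun y => (cutoffn n y - 1) * f y).
  by apply/funext => y; rewrite mulrBl mul1r.
have n0 : 0 < n.+1%:R :> R by [].
have [xn|nx] := ltP (enorm x) (n.+1%:R / 2).
  rewrite (cD_open0 w (@open_enorm_lt _ (n.+1%:R / 2)))//.
    by rewrite cabs0 mulr0 !mulr_ge0// ?invr_ge0 ?exprn_ge0.
  move=> y /= yn; rewrite /cutoffn cutoff_eq1 ?subrr ?mul0r//.
  by rewrite enormZ ger0_norm ?invr_ge0// mulrC ler_pdivrMr// mulrC ltW.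
have h2 v : (size v <= N)%N -> cabs (cD v f x) <= c / (1 + enorm x) ^+ N.+1.
  by move=> sv; rewrite ler_pdivlMr ?exprn_gt0// mulrC; apply: hc; rewrite leqW.
have h := @cD_leibniz _ N _ f x B _ s1 sf (fun v => hB n v x) h2 w sw.
rewrite mulrC -ler_pdivlMr ?exprn_gt0//; apply: le_trans h _.
rewrite -!mulrA ler_wpM2l ?exprn_ge0// ler_wpM2l// ler_wpM2l//.
rewrite mulrA exprS invfM ler_wpM2r ?invr_ge0 ?exprn_ge0 ?(ltW e0)//.
rewrite ler_pdivlMr// ler_pdivrMl// -ler_pdivrMr//.
by rewrite (le_trans nx)// lerDr.
Qed.

Lemma csch_cutoffM n f : csch f -> csch (fun x => cutoffn n x * f x).
Proof.
move=> hf; have [sf _] := hf; split; first exact: csmoothM (csmooth_cutoffn n) sf.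
move=> N; have [c [_ hc]] := csnull_cutoff hf N.
have [b hb] := (proj2 hf) N.
exists (c n + b).
have := csbdD _ sf (hc n) hb.
rewrite (_ : (fun x => cutoffn n x * f x - f x + f x) = fun x => cutoffn n x * f x); last first.
  by apply/funext => x; rewrite subrK.
apply; have := csmoothM (csmooth_cutoffn n) sf; move=> h.
have := csmoothD h (csmoothZ (-1) sf).
by congr csmooth; apply/funext => x; rewrite mulN1r.
Qed.

Lemma ctest_cutoffM n f : csmooth f -> cpart (fun x => cutoffn n x * f x) (@test_function R).
Proof.
move=> sf; have [hr hi] := csmoothM (csmooth_cutoffn n) sf.
by split; (split; first by []); exists n.+1%:R => x nx;
  have [_ [r _]] := cutoffn_test n;
  rewrite /cutoffn cutoff_eq0_gt ?mul0r// enormZ ger0_norm ?invr_ge0// mulrC ltr_pdivlMr ?mul1r.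
Qed.

End cutoff.

(** * Taylor estimates for the exponential *)

Section cis_estimates.
Variable R : realType.

Lemma mvt_bound (phi dphi : R -> R) K t : (forall x, is_derive x (1 : R) phi (dphi x)) ->
  (forall x, `|x| <= `|t| -> `|dphi x| <= K) -> `|phi t - phi 0| <= K * `|t|.
Proof.
move=> hd hK; have cphi : continuous phi.
  by move=> x; apply/differentiable_continuous/derivable1_diffP; case: (hd x).
have [t0|t0] := leP 0 t.
  have [|c] := @MVT_segment _ phi dphi 0 t t0 (fun x _ => hd x).
    exact: continuous_subspaceT.
  rewrite in_itv/= => /andP[c0 ct] ->; rewrite subr0 normrM ler_wpM2r//.
  by apply: hK; rewrite !ger0_norm.
have [|c] := @MVT_segment _ phi dphi t 0 (ltW t0) (fun x _ => hd x).
  exact: continuous_subspaceT.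
rewrite in_itv/= => /andP[c0 ct]; rewrite distrC => ->; rewrite sub0r normrM normrN ler_wpM2r//.
by apply: hK; rewrite !ler0_norm ?lerN2// ltW.
Qed.

Lemma norm_sin_le (t : R) : `|sin t| <= `|t|.
Proof.
have := @mvt_bound sin cos 1 t (fun x => is_derive_sin x).
rewrite sin0 subr0 mul1r; apply => x _.
by rewrite ler_norml cos_geN1 cos_le1.
Qed.

Lemma norm_cos_sub1 (t : R) : `|cos t - 1| <= `|t| ^+ 2.
Proof.
have := @mvt_bound cos (fun x => - sin x) `|t| t (fun x => is_derive_cos x).
rewrite cos0 -expr2; apply => x xt.
by rewrite normrN (le_trans (norm_sin_le x)).
Qed.

Lemma norm_cos_sub1_lin (t : R) : `|cos t - 1| <= `|t|.
Proof.
have := @mvt_bound cos (fun x => - sin x) 1 t (fun x => is_derive_cos x).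
rewrite cos0 mul1r; apply => x _.
by rewrite normrN ler_norml sin_geN1 sin_le1.
Qed.

Lemma norm_sin_sub (t : R) : `|sin t - t| <= `|t| ^+ 3.
Proof.
have hd (x : R) : is_derive x (1 : R) (fun x => sin x - x) (cos x - 1) by apply: is_deriveB.
have := @mvt_bound (fun x => sin x - x) (fun x => cos x - 1) (`|t| ^+ 2) t hd.
rewrite sin0 !subr0 -exprSr; apply => x xt.
by rewrite (le_trans (norm_cos_sub1 x))// lerXn2r ?nnegrE.
Qed.

Definition ii : R[i] := 0 +i* 1.

Lemma cabs_ii : cabs ii = 1.
Proof. by rewrite /ii /= expr0n expr1n add0r sqrtr1. Qed.

Lemma cabs_cis_sub1 (t : R) : cabs (cis t - 1) <= 2 * `|t|.
Proof.
rewrite (le_trans (cabs_le_ReIm _))// mulr_natl mulr2n lerD//=.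
  exact: norm_cos_sub1_lin.
by rewrite subr0 norm_sin_le.
Qed.

(** For |t| > 1 the linear bound 3 |t| is already below 3 |t|^2, so the expansion has to be examined
    only for |t| <= 1. *)
Lemma cabs_cis_taylor (t : R) : cabs (cis t - 1 - ii * t%:C) <= 3 * `|t| ^+ 2.
Proof.
have [t1|t1] := leP `|t| 1.
  have -> : 3 * `|t| ^+ 2 = `|t| ^+ 2 + 2 * `|t| ^+ 2 by ring.
  rewrite (le_trans (cabs_le_ReIm _))// lerD//=.
    by rewrite !(mul0r, mul1r, mulr0, subr0) norm_cos_sub1.
  rewrite !(mul0r, mul1r, add0r, subr0) (le_trans (norm_sin_sub t))// exprS.
  by rewrite ler_wpM2r ?exprn_ge0// (le_trans t1)// ler1n.
rewrite (le_trans (cabsB _ _))// cabsM cabs_ii mul1r cabs_real.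
apply: le_trans (_ : 3 * `|t| <= _).
  have -> : 3 * `|t| = 2 * `|t| + `|t| by ring.
  by rewrite lerD2r cabs_cis_sub1.
by rewrite ler_wpM2l// expr2 ler_peMl// ltW.
Qed.

End cis_estimates.

Section euclidean_norm.
Variable R : realType.
Notation E3 := (R * R * R)%type.
Implicit Types x y : E3.

Lemma dotp_le x y : dotp x y <= enorm x * enorm y.
Proof.
have [d0|d0] := leP (dotp x y) 0.
  by rewrite (le_trans d0)// mulr_ge0 ?enorm_ge0.
rewrite -ler_sqr ?nnegrE ?mulr_ge0 ?enorm_ge0 ?(ltW d0)// exprMn !enorm_sqr dotpE.
case: x y {d0} => [[a b] c] [[p q] r] /=.
rewrite -subr_ge0.
have -> : (a ^+ 2 + b ^+ 2 + c ^+ 2) * (p ^+ 2 + q ^+ 2 + r ^+ 2) - (a * p + b * q + c * r) ^+ 2 =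
  (a * q - b * p) ^+ 2 + (a * r - c * p) ^+ 2 + (b * r - c * q) ^+ 2 by ring.
by rewrite !addr_ge0// sqr_ge0.
Qed.

Lemma enormD x y : enorm (x + y) <= enorm x + enorm y.
Proof.
rewrite -ler_sqr ?nnegrE ?addr_ge0 ?enorm_ge0// sqrrD !enorm_sqr.
have := dotp_le x y; rewrite dotpE.
move: (enorm x * enorm y) => m.
by case: x y => [[a b] c] [[p q] r] /= h; lra.
Qed.

Lemma enormN x : enorm (- x) = enorm x.
Proof. by rewrite /enorm dotpNl dotpNr opprK. Qed.

Lemma enormB x y : enorm (x - y) <= enorm x + enorm y.
Proof. by rewrite -(enormN y); exact: enormD. Qed.

Lemma enorm0 : enorm (0 : E3) = 0.
Proof. by rewrite /enorm dotpE /= !mul0r !addr0 sqrtr0. Qed.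

Lemma enorm_eq0 x : enorm x = 0 -> x = 0.
Proof.
move=> x0; have [] := coord_le_enorm x; rewrite x0 !normr_le0.
by case: x {x0} => [[a b] c] /= /eqP -> /eqP -> /eqP ->.
Qed.

Lemma enorm_le_sum x : enorm x <= \sum_j `|coord x j|.
Proof.
rewrite -ler_sqr ?nnegrE ?enorm_ge0 ?sumr_ge0// enorm_sqr !big_ord_recl big_ord0 addr0 /coord /=.
rewrite -(real_normK (num_real x.1.1)) -(real_normK (num_real x.1.2)) -(real_normK (num_real x.2)).
move: (normr_ge0 x.1.1) (normr_ge0 x.1.2) (normr_ge0 x.2).
move: `|x.1.1| `|x.1.2| `|x.2| => a b c a0 b0 c0.
have h1 := mulr_ge0 a0 b0; have h2 := mulr_ge0 a0 c0; have h3 := mulr_ge0 b0 c0.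
by rewrite -subr_ge0 (_ : _ - _ = 2 * (a * b + a * c + b * c)); [rewrite mulr_ge0// !addr_ge0|ring].
Qed.

Lemma norm_coord_le x j : `|coord x j| <= enorm x.
Proof. by have [h1 h2 h3] := coord_le_enorm x; case: j => [[|[|[|//]]]] ?. Qed.

Lemma dotp_std (h : R) j x : dotp (h *: std_basis R j) x = h * coord x j.
Proof.
rewrite dotpZl; congr (_ * _); rewrite /dotp (bigD1 j)//= coord_std eqxx mul1r big1 ?addr0// => i ij.
by rewrite coord_std eq_sym (negbTE ij) mul0r.
Qed.

Lemma enorm_std j : enorm (std_basis R j) = 1.
Proof.
have := dotp_std 1 j (std_basis R j).
by rewrite scale1r mul1r coord_std eqxx /enorm => ->; rewrite sqrtr1.
Qed.

End euclidean_norm.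

Section derivative_criteria.
Variable R : realType.
Notation E3 := (R * R * R)%type.

Lemma is_derive_sq (f : E3 -> R) x v l K :
  (forall h, `|f (h *: v + x) - f x - h * l| <= K * `|h| ^+ 2) -> is_derive x v f l.
Proof.
move=> hK; apply/is_deriveP/cvgrPdist_le => e e0.
have K0 : 0 <= K by have := hK 1; rewrite normr1 expr1n mulr1; exact: le_trans.
have K1 : 0 < K + 1 by rewrite ltr_wpDl.
near=> h.
have h0 : h != 0 by near: h; exact: nbhs_dnbhs_neq.
rewrite distrC -[l](mulKf h0) -mulrBr normrM normfV ler_pdivrMl ?normr_gt0//.
apply: le_trans (hK h) _; rewrite expr2 mulrCA ler_wpM2l//.
have : `|h| <= e / (K + 1).
  by near: h; apply: dnbhs0_le; rewrite divr_gt0.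
rewrite ler_pdivlMr// => he; apply: le_trans he.
by rewrite mulrC ler_wpM2l// lerDl.
Unshelve. all: by end_near. Qed.

Lemma continuous_lip (f : E3 -> R) K :
  (forall x y, `|f x - f y| <= K * \sum_j `|coord (x - y) j|) -> continuous f.
Proof.
move=> hK y; apply/cvgrPdist_le => e e0.
have : (fun x => K * \sum_j `|coord x j - coord y j|) @ y --> K * \sum_(j < 3) (0 : R).
  apply: cvgM; first exact: cvg_cst.
  rewrite !big_ord_recl !big_ord0.
  under eq_fun do rewrite !big_ord_recl big_ord0.
  have h j : (fun x : E3 => `|coord x j - coord y j|) @ y --> (0 : R).
    rewrite -(@normr0 _ R) -(subrr (coord y j)); apply: cvg_norm; apply: cvgB; last exact: cvg_cst.
    exact: continuous_coord.
  by apply: cvgD; [exact: h|apply: cvgD; [exact: h|apply: cvgD; [exact: h|exact: cvg_cst]]].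
rewrite big1// mulr0 => /cvgrPdist_le /(_ _ e0); apply: filterS => x.
rewrite sub0r normrN => hx; rewrite distrC; apply: le_trans (hK x y) _.
apply: le_trans hx; rewrite (le_trans _ (ler_norm _))//.
rewrite (eq_bigr (fun j => `|coord x j - coord y j|))// => j _.
by rewrite coordD -scaleN1r coordZ mulN1r.
Qed.

Lemma is_derive_line (f : E3 -> R) j (y : E3) (t : R) : smooth f ->
  is_derive t (1 : R) (fun t : R => f (t *: std_basis R j + y))
    (partial j f (t *: std_basis R j + y)).
Proof.
move=> sf; have /is_deriveP h := smooth_partialP j (t *: std_basis R j + y) sf.
have E : (fun h0 : R => h0^-1 *: (((fun t : R => f (t *: std_basis R j + y)) \o shift t) (h0 *: (1 : R)) -
   f (t *: std_basis R j + y))) =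
  (fun h0 => h0^-1 * (f (h0 *: std_basis R j + (t *: std_basis R j + y)) - f (t *: std_basis R j + y))).
  apply/funext => k; have -> : k *: (1 : R) = k by rewrite /GRing.scale /= mulr1.
  by rewrite /= scalerDl addrA.
have df : derivable (fun t : R => f (t *: std_basis R j + y)) t 1.
  by apply/cvg_ex; exists (partial j f (t *: std_basis R j + y)); rewrite E.
exact: DeriveDef df (etrans (congr1 (fun F : R -> R => lim (F @ 0^')) E) (cvg_lim (@Rhausdorff R) h)).
Qed.

Lemma norm_diff_line (f : E3 -> R) j (y : E3) (t K : R) : smooth f -> 0 <= t ->
  (forall s, 0 <= s <= t -> `|partial j f (s *: std_basis R j + y)| <= K) ->
  `|f (t *: std_basis R j + y) - f y| <= K * t.
Proof.
move=> sf t0 hK.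
have hd (s : R) := is_derive_line j y s sf.
have [|c] := @MVT_segment _ (fun t : R => f (t *: std_basis R j + y))
   (fun s => partial j f (s *: std_basis R j + y)) 0 t t0 (fun x _ => hd x).
  apply: continuous_subspaceT => x.
  by apply/differentiable_continuous/derivable1_diffP; case: (hd x).
rewrite in_itv/= scale0r add0r subr0 => hc ->.
by rewrite normrM (ger0_norm t0) ler_wpM2r// hK.
Qed.

End derivative_criteria.

(** * Derivatives and the Fourier transform of Schwartz functions *)

Section schwartz_fourier.
Variable R : realType.
Notation E3 := (R * R * R)%type.
Notation V := (mspace R).
Implicit Types (f g : E3 -> R[i]) (x y : E3) (j : 'I_3).

Lemma csbd_weight N f c x : csbd (6 + N) f c ->
  (1 + enorm x) ^+ N * cabs (f x) <= c * cauchy3 x.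
Proof.
move=> h; have c0 := csbd_ge0 h; have := h [::] isT x; rewrite exprD -mulrA mulrC -ler_pdivlMr.
  by move=> /le_trans; apply; rewrite ler_wpM2l// cauchy3_enorm.
by rewrite exprn_gt0// one_enorm_gt0.
Qed.

Lemma inv_fourier_cauchy3 f C x : cmeas (f : V -> R[i]) -> (forall xi, cabs (f xi) <= C * cauchy3 xi) ->
  cabs (inv_fourier f x) <= c0 R * pi ^+ 3 * C.
Proof.
move=> mf hf; have ic := integrable_cauchy3 R.
rewrite inv_fourierE cabsM cabs_real (ger0_norm (ltW (c0_gt0 R))) -mulrA ler_wpM2l ?(ltW (c0_gt0 R))//.
have -> : pi ^+ 3 * C = \int[lam3 R]_x (C * cauchy3 x).
  by rewrite RintegralZl// /Rintegral integral_cauchy3 mulrC.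
apply: cabs_cint_le; last exact: integrable_RZ.
  by apply: cmeasM => //; exact: cmeas_cis_dot.
by move=> xi; rewrite cabsM cabs_cis mul1r.
Qed.

Lemma inv_fourierB f g x : cL1 (lam3 R) f -> cL1 (lam3 R) g ->
  inv_fourier (fun xi => f xi - g xi) x = inv_fourier f x - inv_fourier g x.
Proof.
move=> hf hg; rewrite -mulN1r -inv_fourierZ// -inv_fourierD//; last exact: cL1Z.
by congr (inv_fourier _ x); apply/funext => xi; rewrite mulN1r.
Qed.

Definition mulX j f : E3 -> R[i] := fun x => ii R * ((coord x j)%:C * f x).

Lemma csch_mulX j f : csch f -> csch (mulX j f).
Proof. by move=> sf; apply: cschZ; exact: csch_coordM. Qed.

(** The Taylor expansion of the exponential is applied under the integral. Of the order 8, two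
    weights absorb the quadratic remainder in the frequency and six pay for integrability; in
    [inv_fourier_lip] the count is 7 = 6 + 1. *)
Lemma inv_fourier_increment f j x (h c : R) : csch f -> csbd 8 f c ->
  cabs (inv_fourier f (h *: std_basis R j + x) - inv_fourier f x - h%:C * inv_fourier (mulX j f) x)
  <= c0 R * pi ^+ 3 * (3 * c) * `|h| ^+ 2.
Proof.
move=> sf hc.
have f1 := csch_cL1 sf; have Xf1 := csch_cL1 (csch_mulX j sf).
have m1 : cmeas (fun xi : V => cis (h * coord (xi : E3) j)).
  apply: cmeas_cis_comp; apply: measurable_continuous3 => y.
  by apply: cvgM; [exact: cvg_cst|exact: continuous_coord].
have cf1 : cL1 (lam3 R) (fun xi : V => cis (h * coord (xi : E3) j) * f xi).
  apply: cL1_le f1 _; first by apply: cmeasM => //; exact: cmeas_csmooth (proj1 sf).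
  by move=> xi; rewrite cabsM cabs_cis mul1r.
have -> : inv_fourier f (h *: std_basis R j + x) =
    inv_fourier (fun xi => cis (h * coord xi j) * f xi) x.
  rewrite !inv_fourierE; congr (_ * cint _ _); apply/funext => xi.
  by rewrite dotpDl dotp_std addrC cisD mulrA.
rewrite -(inv_fourierZ h%:C x Xf1) -(inv_fourierB x cf1 f1) -(inv_fourierB x (cL1B cf1 f1) (cL1Z h%:C Xf1)).
rewrite -mulrA; set C := 3 * c * _; apply: inv_fourier_cauchy3 => [|xi].
  by apply: cmeasB; [apply: cmeasB; [case: cf1|case: f1]|apply: (cL1Z _ Xf1).1].
have -> : cis (h * coord xi j) * f xi - f xi - h%:C * mulX j f xi =
    (cis (h * coord xi j) - 1 - ii R * (h * coord xi j)%:C) * f xi.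
  by rewrite /mulX rmorphM /=; ring.
rewrite cabsM; apply: le_trans (_ : 3 * `|h| ^+ 2 * ((1 + enorm xi) ^+ 2 * cabs (f xi)) <= _).
  rewrite [leRHS]mulrA ler_wpM2r ?cabs_ge0//; apply: le_trans (cabs_cis_taylor _) _.
  rewrite -mulrA ler_pM2l// normrM exprMn ler_wpM2l ?exprn_ge0//.
  rewrite lerXn2r ?nnegrE ?addr_ge0 ?enorm_ge0//.
  by apply: le_trans (norm_coord_le _ _) _; rewrite lerDr.
have -> : C * cauchy3 xi = 3 * `|h| ^+ 2 * (c * cauchy3 xi) by rewrite /C; ring.
by rewrite ler_wpM2l ?mulr_ge0 ?exprn_ge0//; exact: csbd_weight hc.
Qed.

Lemma inv_fourier_lip f x y c : csch f -> csbd 7 f c ->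
  cabs (inv_fourier f x - inv_fourier f y) <= c0 R * pi ^+ 3 * (2 * c) * \sum_j `|coord (x - y) j|.
Proof.
move=> sf hc; have f1 := csch_cL1 sf.
set S := \sum_j _; have S0 : 0 <= S by apply: sumr_ge0.
have m1 : cmeas (fun xi : V => cis (dotp (x - y) xi)) by exact: cmeas_cis_dot.
have cf1 : cL1 (lam3 R) (fun xi : V => cis (dotp (x - y) xi) * f xi) by exact: cL1_cis.
have -> : inv_fourier f x = inv_fourier (fun xi => cis (dotp (x - y) xi) * f xi) y.
  rewrite !inv_fourierE; congr (_ * cint _ _); apply/funext => xi.
  by rewrite mulrA -cisD -dotpDl subrKC.
rewrite -inv_fourierB// -mulrA; apply: inv_fourier_cauchy3 => [|xi].
  by apply: cmeasB; [case: cf1|case: f1].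
rewrite -[X in _ - X]mul1r -mulrBl cabsM.
apply: le_trans (_ : 2 * S * ((1 + enorm xi) ^+ 1 * cabs (f xi)) <= _).
  rewrite expr1 [leRHS]mulrA ler_wpM2r ?cabs_ge0//; apply: le_trans (cabs_cis_sub1 _) _.
  rewrite -mulrA ler_pM2l// mulr_suml; apply: le_trans (ler_norm_sum _ _ _) _.
  apply: ler_sum => j _; rewrite normrM ler_wpM2l//.
  by apply: le_trans (norm_coord_le _ _) _; rewrite lerDr.
have -> : 2 * c * S * cauchy3 xi = 2 * S * (c * cauchy3 xi) by ring.
by rewrite ler_wpM2l ?mulr_ge0//; exact: csbd_weight hc.
Qed.

Lemma Re_affine (z w v : R[i]) (a : R) :
  Re (z - w - a%:C * v) = Re z - Re w - a * Re v.
Proof. by case: z w v => [? ?] [? ?] [? ?] /=; ring. Qed.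

Lemma Im_affine (z w v : R[i]) (a : R) :
  Im (z - w - a%:C * v) = Im z - Im w - a * Im v.
Proof. by case: z w v => [? ?] [? ?] [? ?] /=; ring. Qed.

Lemma Re_inv_fourier_is_derive f j x : csch f ->
  is_derive x (std_basis R j) (fun x => Re (inv_fourier f x))
    (Re (inv_fourier (mulX j f) x)).
Proof.
move=> sf; have [c hc] := sf.2 8%N; apply: is_derive_sq => h.
by rewrite -Re_affine; apply: le_trans (Re_le_cabs _) _; exact: inv_fourier_increment sf hc.
Qed.

Lemma Im_inv_fourier_is_derive f j x : csch f ->
  is_derive x (std_basis R j) (fun x => Im (inv_fourier f x))
    (Im (inv_fourier (mulX j f) x)).
Proof.
move=> sf; have [c hc] := sf.2 8%N; apply: is_derive_sq => h.
by rewrite -Im_affine; apply: le_trans (Im_le_cabs _) _; exact: inv_fourier_increment sf hc.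
Qed.

Lemma cpartial_inv_fourier f j : csch f -> cpartial j (inv_fourier f) = inv_fourier (mulX j f).
Proof.
move=> sf; apply/funext => x; apply: ReIm_eq => /=; apply: partial_is_derive.
  exact: Re_inv_fourier_is_derive.
exact: Im_inv_fourier_is_derive.
Qed.

Lemma inv_fourier_continuous f : csch f ->
  continuous (fun x => Re (inv_fourier f x)) /\
  continuous (fun x => Im (inv_fourier f x)).
Proof.
move=> sf; have [c hc] := sf.2 7%N; split;
  apply: (@continuous_lip _ _ (c0 R * pi ^+ 3 * (2 * c))) => x y.
  by rewrite -[X in _ - X]opprK -ReN opprK -ReD; apply: le_trans (Re_le_cabs _) (inv_fourier_lip _ _ sf hc).
by rewrite -[X in _ - X]opprK -ImN opprK -ImD; apply: le_trans (Im_le_cabs _) (inv_fourier_lip _ _ sf hc).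
Qed.

Lemma csmooth_inv_fourier f : csch f -> csmooth (inv_fourier f).
Proof.
move=> sf; suff h (h0 : E3 -> R) : (exists f, csch f /\
    ((forall x, h0 x = Re (inv_fourier f x)) \/ (forall x, h0 x = Im (inv_fourier f x)))) -> smooth h0.
  by split; apply: h; exists f; split => //; [left|right].
(* The real and imaginary parts of transforms of Schwartz functions form a stable class: a
   derivative of a transform is the transform of [mulX]. *)
apply: (smooth_coind (A := fun h0 : E3 -> R => exists f, csch f /\
    ((forall x, h0 x = Re (inv_fourier f x)) \/ (forall x, h0 x = Im (inv_fourier f x))))).
move=> {sf}f' [{}f [sf [] /funext->]].
  have D i x := Re_inv_fourier_is_derive i x sf.
  split; first exact: (inv_fourier_continuous sf).1.
    by move=> i x; exists (Re (inv_fourier (mulX i f) x)); exact: D.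
  move=> i; exists (mulX i f); split; first exact: csch_mulX.
  by left => x; exact: partial_is_derive (D i x).
have D i x := Im_inv_fourier_is_derive i x sf.
split; first exact: (inv_fourier_continuous sf).2.
  by move=> i x; exists (Im (inv_fourier (mulX i f) x)); exact: D.
move=> i; exists (mulX i f); split; first exact: csch_mulX.
by right => x; exact: partial_is_derive (D i x).
Qed.

Lemma taylor_line (f : E3 -> R) j (y : E3) (t K : R) : smooth f -> 0 <= t ->
  (forall s, 0 <= s <= t -> `|partial j (partial j f) (s *: std_basis R j + y)| <= K) ->
  `|f (t *: std_basis R j + y) - f y - t * partial j f y| <= K * t ^+ 2.
Proof.
move=> sf t0 hK.
have hd (s : R) := is_derive_line j y s sf.
have [|c] := @MVT_segment _ (fun t : R => f (t *: std_basis R j + y))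
   (fun s => partial j f (s *: std_basis R j + y)) 0 t t0 (fun s _ => hd s).
  apply: continuous_subspaceT => s.
  by apply/differentiable_continuous/derivable1_diffP; case: (hd s).
rewrite in_itv/= scale0r add0r subr0 => /andP[c0 ct] ->.
rewrite mulrC -mulrBr normrM (ger0_norm t0) mulrC expr2 mulrA ler_wpM2r//.
apply: (@le_trans _ _ (K * c)); last first.
  by rewrite ler_wpM2l//; apply: le_trans (hK 0 _); rewrite ?lexx.
apply: (norm_diff_line (smooth_partial j sf) c0).
by move=> s /andP[s0 sc]; apply: hK; rewrite s0 (le_trans sc).
Qed.

Lemma enorm_shift_le (y : E3) j (s : R) : 0 <= s <= 1 ->
  1 + enorm y <= 2 * (1 + enorm (s *: std_basis R j + y)).
Proof.
move=> /andP[s0 s1]; have e : y = (s *: std_basis R j + y) - s *: std_basis R j by rewrite addrAC subrr add0r.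
have := enormB (s *: std_basis R j + y) (s *: std_basis R j).
rewrite -e enormZ enorm_std mulr1 ger0_norm//; have := enorm_ge0 (s *: std_basis R j + y).
lra.
Qed.

(** A shift of length at most 1 changes 1 + |y| by a factor of at most 2, so the sixth power
    contributes 64; adding real and imaginary parts doubles it to 128. *)
Lemma csch_taylor f j (y : E3) t c : csch f -> csbd 6 (cD [:: j; j] f) c -> 0 <= t <= 1 ->
  cabs (f (t *: std_basis R j + y) - f y - t%:C * cpartial j f y) <= (128 * c) * t ^+ 2 * cauchy3 y.
Proof.
move=> sf hc /andP[t0 t1].
have B s : 0 <= s <= t -> cabs (cD [:: j; j] f (s *: std_basis R j + y)) <= 64 * c * cauchy3 y.
  move=> /andP[s0 st]; have := hc [::] isT (s *: std_basis R j + y); rewrite /= => {}hc.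
  apply: le_trans (_ : 64 * c * ((1 + enorm y) ^+ 6)^-1 <= _); last first.
    by rewrite ler_wpM2l ?mulr_ge0 ?cauchy3_enorm//; apply: le_trans hc; rewrite mulr_ge0 ?cabs_ge0// exprn_ge0// addr_ge0// enorm_ge0.
  rewrite ler_pdivlMr ?exprn_gt0 ?one_enorm_gt0//.
  apply: le_trans (_ : cabs (cD [:: j; j] f (s *: std_basis R j + y)) * (2 * (1 + enorm (s *: std_basis R j + y))) ^+ 6 <= _).
    rewrite ler_wpM2l ?cabs_ge0//; rewrite lerXn2r ?nnegrE ?mulr_ge0// ?(ltW (one_enorm_gt0 _))//.
    by apply: enorm_shift_le; rewrite s0 (le_trans st).
  rewrite exprMn mulrCA; have -> : (2 : R) ^+ 6 = 64 by ring.
  by rewrite ler_pM2l// mulrC.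
apply: le_trans (cabs_le_ReIm _) _; rewrite Re_affine Im_affine.
have -> : 128 * c * t ^+ 2 * cauchy3 y = 64 * c * cauchy3 y * t ^+ 2 + 64 * c * cauchy3 y * t ^+ 2 by ring.
apply: lerD.
  apply: (taylor_line (csmooth_re sf.1) t0) => s hs; apply: le_trans (B s hs).
  exact: le_trans (Re_le_cabs _).
apply: (taylor_line (csmooth_im sf.1) t0) => s hs; apply: le_trans (B s hs).
exact: le_trans (Im_le_cabs _).
Qed.

Lemma small_quadratic (a C : R) : 0 <= C -> (forall t, 0 < t <= 1 -> a * t <= C * t ^+ 2) -> a <= 0.
Proof.
move=> C0 h; rewrite leNgt; apply/negP => a0.
have d0 : 0 < a + C + 1 by lra.
(* At this [t] the quantity [C * t] is smaller than [a], contradicting the assumed inequality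
   divided by [t]. *)
have /h : 0 < a / (a + C + 1) <= 1 by rewrite divr_gt0//= ler_pdivrMr//; lra.
set t := a / _; have t0 : 0 < t by rewrite divr_gt0.
have e : t * (a + C + 1) = a by rewrite divfK// gt_eqF.
by clearbody t; rewrite expr2 mulrA ler_pM2r// => ht; nra.
Qed.

Lemma inv_fourier_shift f (a x : E3) : cL1 (lam3 R) f ->
  inv_fourier (fun xi => f (xi + a)) x = cis (- dotp x a) * inv_fourier f x.
Proof.
move=> f1; rewrite !inv_fourierE mulrCA; congr (_ * _).
rewrite -cintZ; last exact: cL1_cis.
have := scales_cint ltr01 (scales3_shift a) (cL1Z (cis (- dotp x a)) (cL1_cis x f1)).
rewrite mul1r => <-; congr (cint _ _); apply/funext => xi /=.
by rewrite mulrA -cisD dotpDr; congr (cis _ * _); ring.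
Qed.

(** No integration by parts is performed. Translating [f] by t multiplies its transform by a phase;
    the translated function and the phase both have first-order expansions with error O(t^2), so the
    two linear coefficients coincide by [small_quadratic]. *)
Lemma inv_fourier_cpartial f j x : csch f ->
  inv_fourier (cpartial j f) x = - ii R * ((coord x j)%:C * inv_fourier f x).
Proof.
move=> sf; have f1 := csch_cL1 sf; have pf1 := csch_cL1 (csch_cpartial j sf).
have [c hc] := (csch_cpartial j (csch_cpartial j sf)).2 6%N.
set z := inv_fourier _ x; set w := _ * _; apply/eqP; rewrite -subr_eq0; apply/eqP/cabs_eq0/le_anti.
rewrite cabs_ge0 andbT.
set A := c0 R * pi ^+ 3 * (128 * c); set B := 3 * `|coord x j| ^+ 2 * cabs (inv_fourier f x).
have c0' : 0 <= c by exact: csbd_ge0 hc.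
apply: (@small_quadratic _ (A + B)).
  by rewrite addr_ge0 ?mulr_ge0 ?exprn_ge0 ?pi_ge0 ?cabs_ge0 ?(ltW (c0_gt0 R))//.
move=> t /andP[t0 t1].
have e : inv_fourier (fun xi => f (t *: std_basis R j + xi) - f xi - t%:C * cpartial j f xi) x =
    cis (- (t * coord x j)) * inv_fourier f x - inv_fourier f x - t%:C * z.
  have s1 : cL1 (lam3 R) (fun xi : V => f (t *: std_basis R j + (xi : E3))).
    have := scales_cL1 ltr01 (scales3_shift (t *: std_basis R j)) f1.
    by congr (cL1 _ _); apply/funext => xi; rewrite addrC.
  rewrite !inv_fourierB ?inv_fourierZ//; [|exact: cL1B|exact: cL1Z].
  congr (_ - _ - _); rewrite -dotp_std dotpC -inv_fourier_shift//.
  by congr (inv_fourier _ x); apply/funext => xi; rewrite addrC.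
have h1 : cabs (cis (- (t * coord x j)) * inv_fourier f x - inv_fourier f x - t%:C * z) <= A * t ^+ 2.
  rewrite -e /A -mulrA; apply: inv_fourier_cauchy3 => [|xi].
    have s1 : cL1 (lam3 R) (fun xi : V => f (t *: std_basis R j + (xi : E3))).
      have := scales_cL1 ltr01 (scales3_shift (t *: std_basis R j)) f1.
      by congr (cL1 _ _); apply/funext => xi; rewrite addrC.
    exact: (cL1B (cL1B s1 f1) (cL1Z _ pf1)).1.
  by apply: csch_taylor hc _ => //; rewrite (ltW t0).
have h2 : cabs (cis (- (t * coord x j)) * inv_fourier f x - inv_fourier f x - t%:C * w) <= B * t ^+ 2.
  have -> : cis (- (t * coord x j)) * inv_fourier f x - inv_fourier f x - t%:C * w =
      (cis (- (t * coord x j)) - 1 - ii R * (- (t * coord x j))%:C) * inv_fourier f x.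
    by rewrite /w rmorphN rmorphM /=; ring.
  rewrite cabsM; apply: le_trans (ler_wpM2r (cabs_ge0 _) (cabs_cis_taylor _)) _.
  by rewrite normrN normrM (gtr0_norm t0) /B exprMn; set u := _ ^+ 2; set v := _ ^+ 2; rewrite le_eqVlt; apply/orP; left; apply/eqP; ring.
have -> : cabs (z - w) * t = cabs (t%:C * z - t%:C * w).
  by rewrite -mulrBr cabsM cabs_real gtr0_norm// mulrC.
rewrite mulrDl; set q := cis _ * _ - _ in h1 h2.
have -> : t%:C * z - t%:C * w = (q - t%:C * w) - (q - t%:C * z) by ring.
by apply: le_trans (cabsB _ _) _; rewrite addrC lerD.
Qed.

End schwartz_fourier.

Section schwartz_bounds.
Variable R : realType.
Notation E3 := (R * R * R)%type.
Notation V := (mspace R).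
Implicit Types (f g : E3 -> R[i]) (x y : E3) (j : 'I_3) (w : seq 'I_3).

(** One more weight 1 + |x| is bounded by 1 plus the three |x_j|, and multiplication by x_j becomes
    a derivative of [f]. These four terms account for the factor 4 in the constant. *)
Lemma inv_fourier_weight N : exists C, 0 <= C /\ forall f c x, csch f -> csbd (6 + N) f c ->
  (1 + enorm x) ^+ N * cabs (inv_fourier f x) <= C * c.
Proof.
elim: N => [|N [C [C0 IH]]].
  exists (c0 R * pi ^+ 3); split; first by rewrite mulr_ge0 ?exprn_ge0 ?pi_ge0 ?(ltW (c0_gt0 R)).
  by move=> f c x sf hc; rewrite expr0 mul1r; exact: csbd_inv_fourier_sup sf.1 hc.
exists (4 * C); split; first by rewrite mulr_ge0.
move=> f c x sf; rewrite addnS => hc.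
have hx : (1 + enorm x) * cabs (inv_fourier f x) <=
    cabs (inv_fourier f x) + \sum_j cabs (inv_fourier (cpartial j f) x).
  rewrite mulrDl mul1r lerD2l; apply: le_trans (ler_wpM2r (cabs_ge0 _) (enorm_le_sum x)) _.
  rewrite mulr_suml; apply: ler_sum => j _.
  rewrite (inv_fourier_cpartial j x sf); move: (inv_fourier f x) => z.
  by rewrite !cabsM cabsN cabs_ii mul1r cabs_real.
rewrite exprSr -mulrA; apply: le_trans (ler_wpM2l _ hx) _.
  by rewrite exprn_ge0// ltW// one_enorm_gt0.
rewrite mulrDr mulr_sumr -mulrA.
have -> : 4 * (C * c) = C * c + \sum_(j < 3) C * c by rewrite !big_ord_recl big_ord0; ring.
apply: lerD; first by apply: IH => //; exact: csbd_mono hc.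
apply: ler_sum => j _; apply: IH; first exact: csch_cpartial.
exact: csbd_cpartial.
Qed.

Lemma csch_mulXs w f : csch f -> csch (foldr (@mulX R) f w).
Proof. by elim: w => // j w IH sf; apply: csch_mulX; exact: IH. Qed.

Lemma cD_inv_fourier w f : csch f -> cD w (inv_fourier f) = inv_fourier (foldr (@mulX R) f w).
Proof.
move=> sf; elim: w => // j w IH.
by rewrite -[LHS]/(cpartial j (cD w _)) IH cpartial_inv_fourier//; exact: csch_mulXs.
Qed.

Lemma csbd_mulXs w f K c : csch f -> csbd (K + size w) f c ->
  csbd K (foldr (@mulX R) f w) (2 ^+ ((K + size w) * size w) * c).
Proof.
move=> sf; elim: w K => [|j w IH] K /=; first by rewrite addn0 muln0 expr0 mul1r.
rewrite addnS -addSn => /IH h; have := csbd_ge0 h.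
have sm : csmooth (fun x => (coord x j)%:C * foldr (@mulX R) f w x) by apply: csmoothM; [exact: csmooth_coord|exact: (csch_mulXs w sf).1].
move: h => /(csbd_coordM j (csch_mulXs w sf).1) h; have {h} := csbdZ (ii R) sm h; rewrite cabs_ii mul1r mulrA -exprD => h.
rewrite pmulr_rge0 ?exprn_gt0// => c0; apply: csbd_le h.
by rewrite ler_wpM2r// ler_weXn2l// ?ler1n// mulnS leq_add2r addSn -addnS leq_addr.
Qed.

(** The order 6 + N + N has three sources: N derivatives of the transform cost N factors x_j, N
    weights cost N derivatives, and six weights make the function integrable. *)
Lemma csbd_inv_fourier N : exists C, 0 <= C /\ forall f c, csch f -> csbd (6 + N + N) f c ->
  csbd N (inv_fourier f) (C * c).
Proof.
have [C [C0 hC]] := inv_fourier_weight N.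
exists (C * 2 ^+ ((6 + N + N) * N)); split; first by rewrite mulr_ge0// exprn_ge0.
move=> f c sf hc w wN x; rewrite cD_inv_fourier//.
have c0 := csbd_ge0 hc.
have := csbd_mulXs sf (csbd_mono (leq_add (leqnn (6 + N)) wN) hc).
move=> /hC -/(_ x (csch_mulXs w sf)) /le_trans; apply.
by rewrite -mulrA ler_wpM2l// ler_wpM2r// ler_weXn2l ?ler1n// leq_mul// leq_add2l.
Qed.

Lemma csch_inv_fourier f : csch f -> csch (inv_fourier f).
Proof.
move=> sf; split; first exact: csmooth_inv_fourier.
move=> N; have [C [_ hC]] := csbd_inv_fourier N; have [c hc] := sf.2 (6 + N + N)%N.
by exists (C * c); exact: hC.
Qed.

Lemma csnull_inv_fourier (f_ : nat -> E3 -> R[i]) : (forall n, csch (f_ n)) -> csnull f_ ->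
  csnull (fun n => inv_fourier (f_ n)).
Proof.
move=> sf nf N; have [C [_ hC]] := csbd_inv_fourier N; have [c_ [c0 hc]] := nf (6 + N + N)%N.
by exists (fun n => C * c_ n); split; [exact: cvg0Z|move=> n; exact: hC].
Qed.

Lemma csmooth_opp f : csmooth f -> csmooth (fun x => f (- x)).
Proof.
move=> [sr si]; have -> : (fun x => f (- x)) = (fun x => f ((-1) *: x + 0)).
  by apply/funext => x; rewrite scaleN1r addr0.
have hL := axis_affine_scale (-1) (0 : E3).
by split; [exact: (smooth_comp_affine hL sr)|exact: (smooth_comp_affine hL si)].
Qed.

Lemma cD_opp w f x : csmooth f -> cD w (fun x => f (- x)) x = ((-1) ^+ size w)%:C * cD w f (- x).
Proof.
move=> [sr si].
have e (h : E3 -> R) : smooth h -> iter_partial w (fun x => h (- x)) x = (-1) ^+ size w * iter_partial w h (- x).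
  move=> sh; have := iter_partial_scale w (-1) x sh; rewrite scaleN1r => <-.
  by congr (iter_partial w _ x); apply/funext => z; rewrite scaleN1r.
have re := congr1 (fun F => F (- x)) (Re_cD w f); have im := congr1 (fun F => F (- x)) (Im_cD w f).
have := e _ sr; have := e _ si.
rewrite -(congr1 (fun F => F x) (Re_cD w (fun x => f (- x)))) -(congr1 (fun F => F x) (Im_cD w (fun x => f (- x)))) /=.
rewrite -re -im /= => h1 h2; apply: ReIm_eq; first by rewrite h2 ReM /= mul0r subr0.
by rewrite h1 ImM /= mul0r addr0.
Qed.

Lemma csbd_opp N f c : csmooth f -> csbd N f c -> csbd N (fun x => f (- x)) c.
Proof.
move=> sf hc w wN x; rewrite cD_opp// cabsM cabs_real normrX normrN1 expr1n mul1r.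
by rewrite -(enormN x); exact: hc.
Qed.

Lemma csch_opp f : csch f -> csch (fun x => f (- x)).
Proof.
by move=> [sf h]; split => [|N]; [exact: csmooth_opp|have [c hc] := h N; exists c; exact: csbd_opp].
Qed.

Lemma fourier_opp f : fourier f = fun xi => inv_fourier f (- xi).
Proof. by apply/funext => xi; exact: fourierE. Qed.

Lemma inv_fourier_opp f x : cL1 (lam3 R) f -> inv_fourier (fun xi => f (- xi)) x = inv_fourier f (- x).
Proof.
move=> f1; rewrite !inv_fourierE; congr (_ * _).
have := scales_cint ltr01 (scales3_opp R) (cL1_cis (- x) f1); rewrite mul1r => <-.
by congr (cint _ _); apply/funext => xi; rewrite dotpNl dotpNr opprK.
Qed.

Lemma csch_fourier f : csch f -> csch (fourier f).
Proof. by move=> sf; rewrite fourier_opp; apply: csch_opp; exact: csch_inv_fourier. Qed.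

Lemma csnull_fourier (f_ : nat -> E3 -> R[i]) : (forall n, csch (f_ n)) -> csnull f_ ->
  csnull (fun n => fourier (f_ n)).
Proof.
move=> sf /(csnull_inv_fourier sf) h N; have [c_ [c0 hc]] := h N.
exists c_; split => // n; rewrite fourier_opp; apply: csbd_opp => //.
exact: csmooth_inv_fourier.
Qed.

Lemma ccvg_ReIm (z_ : nat -> R[i]) z : (fun n => Re (z_ n)) @ \oo --> Re z ->
  (fun n => Im (z_ n)) @ \oo --> Im z -> ccvg z_ z.
Proof.
move=> hr hi; have h (a : nat -> R) l : a @ \oo --> l -> (fun n => `|a n - l|) @ \oo --> (0 : R).
  move=> ha; rewrite -(normr0 R) -(subrr l); apply: cvg_norm; apply: cvgB => //; exact: cvg_cst.
apply: squeeze0 (cvg0D (h _ _ hr) (h _ _ hi)) => n; first exact: cabs_ge0.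
by apply: le_trans (cabs_le_ReIm _) _; rewrite !ReD !ImD !ReN !ImN.
Qed.

Lemma csmooth_ccvg f x y : csmooth f -> ccvg (fun n => f (x + n.+1%:R^-1 *: y)) (f x).
Proof.
move=> sf.
have hx : (fun n : nat => x + n.+1%:R^-1 *: y) @ \oo --> x.
  have c : (fun n : nat => x + n.+1%:R^-1 *: y) @ \oo --> x + (0 : R) *: y.
    apply: cvgD; first exact: cvg_cst.
    by apply: cvgZ; [exact: cvg_harmonic|exact: cvg_cst].
  by move: c; rewrite scale0r addr0.
apply: ccvg_ReIm.
  apply: (@continuous_cvg _ _ _ _ _ (fun n : nat => x + n.+1%:R^-1 *: y) (fun z : E3 => Re (f z))) hx.
  exact: smooth_continuous (csmooth_re sf) x.
apply: (@continuous_cvg _ _ _ _ _ (fun n : nat => x + n.+1%:R^-1 *: y) (fun z : E3 => Im (f z))) hx.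
  exact: smooth_continuous (csmooth_im sf) x.
Qed.

Lemma fourierK f : csch f -> fourier (inv_fourier f) = f.
Proof.
move=> sf; apply/funext => x; have [c hc] := sf.2 0%N.
apply: (fourier_inversion (B := c)) => //.
- exact: csch_cL1.
- exact/csch_cL1/csch_inv_fourier.
- by move=> z; exact: csbd_sup0 hc.
- by move=> y; exact: csmooth_ccvg sf.1.
Qed.

Lemma inv_fourierK f : csch f -> inv_fourier (fourier f) = f.
Proof.
move=> sf; rewrite -[RHS](fourierK sf) fourier_opp [RHS]fourier_opp; apply/funext => x.
by rewrite inv_fourier_opp//; exact/csch_cL1/csch_inv_fourier.
Qed.

End schwartz_bounds.

(** * Density of test functions *)

Section nonneg_integrals.
Context d (T : measurableType d) (R : realType) (mu : {measure set T -> \bar R}).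
Implicit Types h k : T -> R.

Definition nint h : \bar R := (\int[mu]_x (h x)%:E)%E.

Lemma nint_le h k : measurable_fun setT h -> measurable_fun setT k ->
  (forall x, 0 <= h x <= k x) -> (nint h <= nint k)%E.
Proof.
move=> mh mk hk; apply: ge0_le_integral => //; try exact: measurable_RE.
- by move=> x _; rewrite lee_fin; case/andP: (hk x).
- by move=> x _; rewrite lee_fin; case/andP: (hk x).
Qed.

Lemma nintD h k : measurable_fun setT h -> measurable_fun setT k ->
  (forall x, 0 <= h x) -> (forall x, 0 <= k x) ->
  nint (fun x => h x + k x) = (nint h + nint k)%E.
Proof.
move=> mh mk h0 k0; rewrite /nint; under eq_integral do rewrite EFinD.
by rewrite ge0_integralD//; try exact: measurable_RE; move=> x _; rewrite lee_fin.
Qed.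

Lemma nintZ h (c : R) : measurable_fun setT h -> (forall x, 0 <= h x) -> 0 <= c ->
  nint (fun x => c * h x) = (c%:E * nint h)%E.
Proof.
move=> mh h0 c0; rewrite /nint; under eq_integral do rewrite EFinM.
by rewrite ge0_integralZl//; [exact: measurable_RE|move=> x _; rewrite lee_fin].
Qed.

Lemma nint_ge0 h : (forall x, 0 <= h x) -> (0 <= nint h)%E.
Proof. by move=> h0; apply: integral_ge0 => x _; rewrite lee_fin. Qed.

Lemma cabs_realB (a b : R) : cabs (a%:C - b%:C) = `|a - b|.
Proof. by rewrite -cabs_real rmorphB. Qed.

Lemma dct_eps (f_ : nat -> T -> R) (f h : T -> R) (e : R) : (forall n, measurable_fun setT (f_ n)) ->
  measurable_fun setT f -> mu.-integrable setT (fun x => (h x)%:E) ->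
  (forall x, f_ ^~ x @ \oo --> f x) -> (forall x n, `|f_ n x| <= h x) -> 0 < e ->
  exists n, (nint (fun x => `|f_ n x - f x|%R) <= e%:E)%E.
Proof.
move=> mf_ mf ih hc hh e0.
have := @cdct _ _ _ mu (fun n x => (f_ n x)%:C) (fun x => (f x)%:C) h.
case.
- by move=> n; exact: cmeas_real.
- exact: cmeas_real.
- by apply: aeW => x; apply: ccvg_ReIm; [exact: hc|exact: cvg_cst].
- exact: ih.
- by apply: aeW => x n; rewrite cabs_real.
move=> _ /fine_cvgP[fin /cvgrPdist_le /(_ _ e0) c] _.
near \oo => n; exists n.
have F : nint (fun x => `|f_ n x - f x|) = (\int[mu]_x (cabs ((f_ n x)%:C - (f x)%:C))%:E)%E.
  by apply: eq_integral => x _; rewrite cabs_realB.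
have fn : nint (fun x => `|f_ n x - f x|) \is a fin_num.
  by rewrite F; near: n.
rewrite -(fineK fn) lee_fin (le_trans (ler_norm _))// F -normrN -(add0r (- _)).
by near: n.
Unshelve. all: by end_near. Qed.

End nonneg_integrals.

(** * Approximation of measurable functions in a weighted L^1 distance *)

Section smooth_approximation.
Variable R : realType.
Notation E3 := (R * R * R)%type.
Notation M := (measurableTypeR R).
Notation V := (M * M * M)%type.
Variables (psi : E3 -> R) (hpsi : lp_cutoff psi).
Variable rho : V -> R.
Hypotheses (rho0 : forall x, 0 <= rho x) (irho : (lam3 R).-integrable setT (fun x => (rho x)%:E)).

Lemma weight_measurable : measurable_fun setT rho.
Proof. by have /measurable_int /measurable_EFinP := irho. Qed.

Definition wdist (f g : V -> R) : \bar R := nint (lam3 R) (fun x => rho x * `|f x - g x|).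

Lemma measurable_wdist (f g : V -> R) : measurable_fun setT f -> measurable_fun setT g ->
  measurable_fun setT (fun x => rho x * `|f x - g x|).
Proof.
move=> mf mg; apply: measurable_funM; first exact: weight_measurable.
by apply: measurableT_comp => //; exact: measurable_funB.
Qed.

Lemma wdist_le (f g f1 g1 f2 g2 : V -> R) (a b c e1 e2 : R) :
  measurable_fun setT f -> measurable_fun setT g ->
  measurable_fun setT f1 -> measurable_fun setT g1 ->
  measurable_fun setT f2 -> measurable_fun setT g2 -> 0 <= a -> 0 <= b ->
  (forall x, `|f x - g x| <= a * `|f1 x - g1 x| + b * `|f2 x - g2 x|) ->
  (wdist f1 g1 <= e1%:E)%E -> (wdist f2 g2 <= e2%:E)%E -> a * e1 + b * e2 <= c ->
  (wdist f g <= c%:E)%E.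
Proof.
move=> mf mg mf1 mg1 mf2 mg2 a0 b0 h h1 h2 hc.
have m1 := measurable_wdist mf1 mg1; have m2 := measurable_wdist mf2 mg2.
apply: (@le_trans _ _ (nint (lam3 R) (fun x => a * (rho x * `|f1 x - g1 x|) + b * (rho x * `|f2 x - g2 x|)))).
  apply: nint_le; first exact: measurable_wdist.
    by apply: measurable_funD; exact: measurable_funM.
  move=> x; rewrite mulr_ge0//= mulrCA [b * _]mulrCA -mulrDr; exact: ler_wpM2l.
rewrite nintD//; try exact: measurable_funM; last 2 first.
- by move=> x; rewrite !mulr_ge0.
- by move=> x; rewrite !mulr_ge0.
rewrite !nintZ//; try by move=> x; rewrite mulr_ge0.
rewrite -lee_fin EFinD !EFinM in hc; apply: le_trans hc; apply: leeD; exact: lee_wpmul2l.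
Qed.

(** Approximation for the distance weighted by the fixed integrable [rho]. Keeping the approximants
    between 0 and 1 makes the property stable under unions of sets and under dominated limits. *)
Definition appr (A : V -> R) := measurable_fun setT A /\ forall e, 0 < e ->
  exists f : E3 -> R, [/\ smooth f, forall x, 0 <= f x <= 1 & (wdist A f <= e%:E)%E].

Lemma smooth_measurable (f : E3 -> R) : smooth f -> measurable_fun setT (f : V -> R).
Proof. by move=> sf; apply: measurable_continuous3; exact: smooth_continuous. Qed.

Lemma wdist0 f : wdist f f = 0%E.
Proof. by rewrite /wdist /nint integral0_eq// => x _; rewrite subrr normr0 mulr0. Qed.

Lemma appr_smooth (f : E3 -> R) : smooth f -> (forall x, 0 <= f x <= 1) -> appr f.
Proof.
move=> sf f01; split; first exact: smooth_measurable.
by move=> e e0; exists f; split => //; rewrite wdist0 lee_fin ltW.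
Qed.

Lemma appr_compl A : appr A -> appr (fun x => 1 - A x).
Proof.
move=> [mA hA]; split; first exact: measurable_funB.
move=> e /hA[f [sf f01 fe]]; exists (fun x => 1 - f x); split.
- exact: smoothB (smooth_cst 1) sf.
- by move=> x; have /andP[] := f01 x; lra.
- apply: le_trans fe; rewrite le_eqVlt; apply/orP; left; apply/eqP.
  by apply: eq_integral => x _; congr ((_ * _)%:E); rewrite distrC; congr `|_|; ring.
Qed.

Lemma appr_limit A : measurable_fun setT A ->
  (forall e, 0 < e -> exists B, appr B /\ (wdist A B <= e%:E)%E) -> appr A.
Proof.
move=> mA h; split => // e e0; have e2 : 0 < e / 2 by rewrite divr_gt0.
have [B [[mB hB] AB]] := h _ e2; have [f [sf f01 fe]] := hB _ e2.
exists f; split => //; apply: (wdist_le (a := 1) (b := 1)) AB fe _ => //; try exact: smooth_measurable.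
  by move=> x; rewrite !mul1r ler_distD.
by rewrite !mul1r -splitr.
Qed.

Lemma appr_join A B : appr A -> appr B -> (forall x, 0 <= A x <= 1) -> (forall x, 0 <= B x <= 1) ->
  appr (fun x => A x + B x - A x * B x).
Proof.
move=> [mA hA] [mB hB] A01 B01.
have m : measurable_fun setT (fun x => A x + B x - A x * B x).
  by apply: measurable_funB; [exact: measurable_funD|exact: measurable_funM].
split => // e e0; have e2 : 0 < e / 2 by rewrite divr_gt0.
have [f [sf f01 fe]] := hA _ e2; have [g [sg g01 ge]] := hB _ e2.
have sh : smooth (fun x => f x + g x - f x * g x).
  by apply: smoothB; [exact: smoothD|exact: smoothM].
exists (fun x => f x + g x - f x * g x); split => //.
  by move=> x; have /andP[? ?] := f01 x; have /andP[? ?] := g01 x; nra.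
apply: (wdist_le (a := 1) (b := 1)) fe ge _ => //; try exact: smooth_measurable.
  move=> x; have /andP[? ?] := f01 x; have /andP[? ?] := B01 x.
  (* In this form each error is multiplied by a factor lying in [0, 1]. *)
  have -> : A x + B x - A x * B x - (f x + g x - f x * g x) =
    (A x - f x) * (1 - B x) + (B x - g x) * (1 - f x) by ring.
  apply: le_trans (ler_normD _ _) _; rewrite !mul1r; apply: lerD.
    by rewrite normrM ler_piMr// ger0_norm; lra.
  by rewrite normrM ler_piMr// ger0_norm; lra.
by rewrite !mul1r -splitr.
Qed.

Lemma appr_dct (A_ : nat -> V -> R) (A : V -> R) : (forall n, appr (A_ n)) -> measurable_fun setT A ->
  (forall n x, 0 <= A_ n x <= 1) -> (forall x, A_ ^~ x @ \oo --> A x) -> appr A.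
Proof.
move=> hA mA A01 c; apply: appr_limit => // e e0.
have [|||x|x n||n hn] := @dct_eps _ _ _ (lam3 R) (fun n x => rho x * A_ n x) (fun x => rho x * A x) rho e.
- by move=> n; apply: measurable_funM; [exact: weight_measurable|case: (hA n)].
- by apply: measurable_funM => //; exact: weight_measurable.
- exact: irho.
- by apply: cvgM; [exact: cvg_cst|exact: c].
- have /andP[? ?] := A01 n x.
  by rewrite normrM (ger0_norm (rho0 x)) ler_piMr// ger0_norm.
- exact: e0.
exists (A_ n); split => //; apply: le_trans hn; rewrite le_eqVlt; apply/orP; left; apply/eqP.
by apply: eq_integral => x _; rewrite -mulrBr normrM (ger0_norm (rho0 x)) distrC.
Qed.

Definition apprset (E : set V) := measurable E /\ appr (\1_E).

Lemma indic01 (E : set V) x : 0 <= (\1_E x : R) <= 1.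
Proof. by rewrite indicE; case: (x \in E); rewrite ?lexx ?ler01. Qed.

Lemma apprset_setC E : apprset E -> apprset (~` E).
Proof.
move=> [mE aE]; split; first exact: measurableC.
have -> : \1_(~` E) = (fun x => 1 - \1_E x) :> (V -> R).
  apply/funext => x; rewrite !indicE; have [h|h] := pselect (E x).
    by rewrite (mem_set h) memNset ?subrr// => /(_ h).
  by rewrite (memNset h) mem_set ?subr0.
exact: appr_compl.
Qed.

Lemma apprset_setU E F : apprset E -> apprset F -> apprset (E `|` F).
Proof.
move=> [mE aE] [mF aF]; split; first exact: measurableU.
have -> : \1_(E `|` F) = (fun x => \1_E x + \1_F x - \1_E x * \1_F x) :> (V -> R).
  by apply/funext => x; rewrite !indicE in_setU; case: (x \in E); case: (x \in F) => /=; ring.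
by apply: appr_join => //; exact: indic01.
Qed.

Lemma apprset0 : apprset set0.
Proof.
split => //; rewrite indic0; apply: appr_smooth; first exact: smooth_cst.
by move=> x; rewrite lexx ler01.
Qed.

Lemma apprset_bigcup (F : nat -> set V) : (forall n, apprset (F n)) -> apprset (\bigcup_n F n).
Proof.
move=> hF; have mF : measurable (\bigcup_n F n) by apply: bigcupT_measurable => n; case: (hF n).
split => //.
have hB n : apprset (\big[setU/set0]_(i < n) F i).
  elim: n => [|n IH]; first by rewrite big_ord0; exact: apprset0.
  by rewrite big_ord_recr; exact: apprset_setU.
apply: (@appr_dct (fun n => \1_(\big[setU/set0]_(i < n) F i))).
- by move=> n; case: (hB n).
- exact: measurable_indic.
- by move=> n x; exact: indic01.
move=> x; rewrite [X in _ --> X]indicE; have [/set_mem[n _ Fn]|hx] := boolP (x \in \bigcup_n F n).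
  apply: cvg_near_cst; near=> m; rewrite indicE mem_set//.
  have nm : (n < m)%N by near: m; exact: nbhs_infty_gt.
  by rewrite -bigcup_mkord; exists n.
apply: cvg_near_cst; near=> m; rewrite indicE memNset//.
rewrite -bigcup_mkord => -[n _ Fn]; move/negP: hx; apply; apply/mem_set; by exists n.
Unshelve. all: by end_near. Qed.

(** The smooth powers (1 - f)^n decrease to the indicator of the zero set of [f], and the complement
    of an approximable set is approximable. *)
Lemma apprset_smooth_neq0 (f : E3 -> R) : smooth f -> (forall x, 0 <= f x <= 1) ->
  apprset [set x | f x != 0].
Proof.
move=> sf f01; have mf := smooth_measurable sf.
have mE : measurable [set x : V | f x != 0].
  have -> : [set x : V | f x != 0] = ~` (f @^-1` [set 0]).
    by apply/seteqP; split => x /= /eqP.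
  by apply: measurableC; rewrite -[X in measurable X]setTI; exact: mf.
rewrite -[X in apprset X]setCK; apply: apprset_setC.
have mE' : measurable (~` [set x : V | f x != 0]) by exact: measurableC.
split => //; apply: (@appr_dct (fun n x => (1 - f x) ^+ n)).
- move=> n; apply: appr_smooth.
    exact: smoothX (smoothB (smooth_cst 1) sf).
  by move=> x; have /andP[? ?] := f01 x; rewrite exprn_ge0 ?exprn_ile1//; lra.
- exact: measurable_indic.
- by move=> n x; have /andP[? ?] := f01 x; rewrite exprn_ge0 ?exprn_ile1//; lra.
move=> x; have /andP[f0 f1] := f01 x; rewrite [X in _ --> X]indicE.
have [fx|fx] := eqVneq (f x) 0.
  rewrite mem_set//=; last by rewrite fx eqxx.
  by apply: cvg_near_cst; near=> n; rewrite fx subr0 expr1n.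
rewrite memNset/=; last by move=> h; apply: h.
by apply: cvg_expr; rewrite ger0_norm; [have := fx; rewrite neq_lt ltNge f0 /=; lra|lra].
Unshelve. all: by end_near. Qed.

(** The approximable sets form a sigma-algebra, so a family of generators has to be treated and
    nothing more. *)
Lemma apprset_gen (T : Type) (phi : V -> T) (G : set (set T)) :
  (forall A, G A -> apprset (phi @^-1` A)) -> forall A, <<s G >> A -> apprset (phi @^-1` A).
Proof.
move=> hG A; apply: (@smallest_sub _ _ _ [set A | apprset (phi @^-1` A)]) => //; split => /=.
- by rewrite preimage_set0; exact: apprset0.
- by move=> B hB; rewrite setTD; exact: apprset_setC.
- by move=> F hF; rewrite preimage_bigcup; exact: apprset_bigcup.
Qed.

Lemma axis_affine_slab i (n c : R) :
  axis_affine (fun x : E3 => (n * (coord x i - c)) *: std_basis R ord0).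
Proof.
split.
  move=> x; apply: cvgZr_tmp; apply: cvgM; first exact: cvg_cst.
  by apply: cvgB; [exact: continuous_coord|exact: cvg_cst].
exists (fun j => n * (j == i)%:R), (fun=> ord0) => x j h.
by rewrite coordD coordZ coord_std -scalerDl; congr (_ *: _); ring.
Qed.

Lemma apprset_slab i (n c : R) :
  apprset [set x | psi ((n * (coord x i - c)) *: std_basis R ord0) != 0].
Proof.
have [B [B1 hB]] := cutoff_bounded hpsi; have B0 : 0 < B by apply: lt_le_trans B1.
have := @apprset_smooth_neq0 (fun x => B^-1 * psi ((n * (coord x i - c)) *: std_basis R ord0)).
have -> : [set x : E3 | B^-1 * psi ((n * (coord x i - c)) *: std_basis R ord0) != 0] =
          [set x : E3 | psi ((n * (coord x i - c)) *: std_basis R ord0) != 0].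
  by apply/seteqP; split => x /=; rewrite mulf_eq0 invr_eq0 (gt_eqF B0).
apply; first exact: smoothM (smooth_cst _) (smooth_comp_affine (axis_affine_slab i n c) (cutoff_smooth hpsi)).
move=> x; rewrite mulr_ge0 ?invr_ge0 ?(ltW B0) ?(cutoff_ge0 hpsi)//=.
by rewrite ler_pdivrMl// mulr1.
Qed.

(** The bump function at hand is [psi], whose composites with affine functions of one coordinate
    have slabs as nonvanishing sets. The centre is shifted by (k + 3) / (2 (n + 1)): as (k + 3) / 2
    > 1 the slab stays in the half-space, and choosing k + 3 as the integer part of 2 (n + 1) (x_i -
    a) puts the argument in [0, 1/2), where [psi] is 1. *)
Lemma halfspace_slabs i (a : R) : [set x : E3 | a < coord x i] =
  \bigcup_n \bigcup_k [set x : E3 |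
    psi ((n.+1%:R * (coord x i - (a + (k + 3)%:R / (2 * n.+1%:R)))) *: std_basis R ord0) != 0].
Proof.
have N0 (n : nat) : 0 < (n.+1%:R : R) by rewrite ltr0n.
have e (n k : nat) (t : R) : n.+1%:R * (t - (a + (k + 3)%:R / (2 * n.+1%:R))) =
    (2 * n.+1%:R * (t - a) - (k + 3)%:R) / 2.
  by move: (n.+1%:R : R) (N0 n) => m m0; field; exact: lt0r_neq0.
apply/seteqP; split => x /=.
  move=> ax; have d0 : 0 < coord x i - a by rewrite subr_gt0.
  have [n hn] : exists n : nat, 3 <= 2 * n.+1%:R * (coord x i - a).
    exists (Num.truncn (3 / (coord x i - a))).
    have := truncnS_gt (3 / (coord x i - a)); rewrite ltr_pdivrMr// => /ltW h.
    by rewrite -mulrA; move: (_.+1%:R * _) h => m h; lra.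
  have t0 : 0 <= 2 * n.+1%:R * (coord x i - a) by apply: le_trans hn.
  exists n => //; exists (Num.truncn (2 * n.+1%:R * (coord x i - a)) - 3)%N => //=.
  have /andP[h1 h2] := truncn_itv t0.
  have k3 : (3 <= Num.truncn (2 * n.+1%:R * (coord x i - a)))%N by rewrite truncn_ge_nat.
  rewrite (cutoff_eq1 hpsi) ?oner_eq0// enormZ enorm_std mulr1 e subnK// normrM ger0_norm ?subr_ge0//.
  rewrite -[(Num.truncn _).+1%:R]natr1 in h2; rewrite ger0_norm ?invr_ge0//.
  by set t := 2 * _ * _ in h2 *; lra.
move=> [n _ [k _ /=]]; have [|h] := leP (enorm ((n.+1%:R * (coord x i - (a + (k + 3)%:R / (2 * n.+1%:R)))) *: std_basis R ord0)) 1; last first.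
  by rewrite (cutoff_eq0_gt hpsi h) eqxx.
rewrite enormZ enorm_std mulr1 e ler_norml => /andP[h _] _.
rewrite ler_pdivlMr// natrD in h.
have : 0 < 2 * n.+1%:R * (coord x i - a) by have := ler0n R k; lra.
by rewrite pmulr_rgt0 ?mulr_gt0// subr_gt0.
Qed.

Lemma apprset_measurable (E : set V) : measurable E -> apprset E.
Proof.
have hc i (A : set M) : measurable A -> apprset [set x : V | A (coord (x : E3) i)].
  rewrite (@RGenOInfty.measurableE R); apply: (apprset_gen (phi := fun x : V => coord (x : E3) i)).
  move=> B [a ->]; have -> : (fun x : V => coord (x : E3) i) @^-1` `]a, +oo[%classic =
      [set x : V | a < coord (x : E3) i].
    by apply/seteqP; split => x /=; rewrite in_itv/= andbT.
  rewrite halfspace_slabs; apply: apprset_bigcup => n; apply: apprset_bigcup => k.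
  exact: apprset_slab.
have h2 (A : set (M * M)) : measurable A -> apprset [set x : V | A x.1].
  apply: (apprset_gen (phi := fst)) => B [] [C mC <-]; rewrite setTI.
    exact: (hc ord0 C mC).
  exact: (hc (lift ord0 ord0) C mC).
apply: (apprset_gen (phi := id)) => B [] [C mC <-]; rewrite setTI; first exact: h2.
exact: (hc ord_max C mC).
Qed.

Lemma appr_half A B : appr A -> appr B -> appr (fun x => 2^-1 * (A x + B x)).
Proof.
move=> [mA hA] [mB hB].
have m : measurable_fun setT (fun x => 2^-1 * (A x + B x)).
  by apply: measurable_funM => //; exact: measurable_funD.
split => // e e0; have [f [sf f01 fe]] := hA _ e0; have [g [sg g01 ge]] := hB _ e0.
have sh : smooth (fun x => 2^-1 * (f x + g x)) by exact: smoothM (smooth_cst _) (smoothD sf sg).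
exists (fun x => 2^-1 * (f x + g x)); split => //.
  by move=> x; have /andP[? ?] := f01 x; have /andP[? ?] := g01 x; lra.
apply: (wdist_le (a := 2^-1) (b := 2^-1)) fe ge _ => //; try exact: smooth_measurable.
  move=> x; have -> : 2^-1 * (A x + B x) - 2^-1 * (f x + g x) = 2^-1 * (A x - f x) + 2^-1 * (B x - g x) by ring.
  by apply: le_trans (ler_normD _ _) _; rewrite !normrM ger0_norm.
by rewrite -mulrDl -[2^-1]mul1r -splitr mul1r.
Qed.

Lemma appr_measurable (A : V -> R) : measurable_fun setT A -> (forall x, 0 <= A x <= 1) -> appr A.
Proof.
move=> mA A01.
(* Binary expansion: the first digit of [A] is the indicator of A >= 1/2, an approximable function,
   and the induction hypothesis treats the doubled remainder. After n digits the uniform error is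
   2^-n. *)
have digits n : forall A : V -> R, measurable_fun setT A -> (forall x, 0 <= A x <= 1) ->
    exists B, appr B /\ forall x, `|A x - B x| <= 2^-1 ^+ n.
  elim: n => [|n IH] {}A {}mA {}A01.
    exists (fun=> 0); split; first by apply: appr_smooth => [|x]; [exact: smooth_cst|rewrite lexx ler01].
    by move=> x; have /andP[? ?] := A01 x; rewrite subr0 expr0 ger0_norm.
  set E := [set x | 2^-1 <= A x].
  have mE : measurable E.
    have -> : E = A @^-1` `[2^-1, +oo[%classic by apply/seteqP; split => x /=; rewrite in_itv/= andbT.
    by rewrite -[X in measurable X]setTI; exact: mA.
  have [||B [aB hB]] := IH (fun x => 2 * A x - \1_E x).
  - by apply: measurable_funB; [exact: measurable_funM|exact: measurable_indic].
  - move=> x; have /andP[? ?] := A01 x; rewrite indicE.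
    have [h|h] := pselect (E x); [rewrite (mem_set h)|rewrite (memNset h)]; rewrite /E/= in h.
      by move: h => /=; lra.
    by move/negP: h; rewrite -ltNge /=; lra.
  exists (fun x => 2^-1 * (\1_E x + B x)); split.
    by apply: appr_half => //; case: (apprset_measurable mE).
  move=> x; have -> : A x - 2^-1 * (\1_E x + B x) = 2^-1 * (2 * A x - \1_E x - B x) by field.
  by rewrite normrM ger0_norm// exprS ler_wpM2l.
apply: appr_limit => // e e0.
have fin : nint (lam3 R) rho \is a fin_num.
  rewrite ge0_fin_numE ?nint_ge0//; case/integrableP: (irho) => _; apply: le_lt_trans.
  by rewrite /nint le_eqVlt; apply/orP; left; apply/eqP/eq_integral => x _; rewrite /= ger0_norm.
set I := fine (nint (lam3 R) rho).
have I0 : 0 <= I by exact/fine_ge0/nint_ge0.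
have c0 : (fun n : nat => 2^-1 ^+ n : R) @ \oo --> (0 : R) by apply: cvg_expr; rewrite ger0_norm// invf_lt1//; lra.
have d0 : 0 < e / (I + 1) by rewrite divr_gt0// ltr_wpDl.
have [n hn] : exists n : nat, 2^-1 ^+ n <= e / (I + 1).
  move/cvgrPdist_le: c0 => /(_ _ d0) [n _ h]; exists n; have := h n (leqnn n).
  by rewrite sub0r normrN ger0_norm// exprn_ge0.
have [B [aB hB]] := digits n A mA A01.
exists B; split => //; have mB : measurable_fun setT B by case: aB.
apply: (@le_trans _ _ (nint (lam3 R) (fun x => e / (I + 1) * rho x))).
  apply: nint_le; first exact: measurable_wdist.
    by apply: measurable_funM => //; exact: weight_measurable.
  move=> x; rewrite mulr_ge0//= mulrC ler_wpM2r//; exact: le_trans (hB x) hn.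
rewrite nintZ//; [|exact: weight_measurable|exact: ltW].
rewrite -(fineK fin) -EFinM lee_fin -/I mulrAC ler_pdivrMr ?ltr_wpDl//.
by rewrite ler_pM2l// lerDl.
Qed.

End smooth_approximation.

Section density.
Variable R : realType.
Notation E3 := (R * R * R)%type.
Notation V := (mspace R).
Variables (psi : E3 -> R) (hpsi : lp_cutoff psi).

Lemma small_eq0 (x : \bar R) : (forall e : R, 0 < e -> (`|x| <= e%:E)%E) -> x = 0%E.
Proof.
move=> h; apply/eqP; rewrite -abse_eq0 eq_le abse_ge0 andbT; apply/lee_addgt0Pr => e e0.
by rewrite add0e; exact: h.
Qed.

(** The weight is |k| itself: the weighted distance between an indicator and a smooth function then
    bounds directly the difference of their integrals against [k]. *)
Lemma eq0_of_smooth_integrals (k : V -> R) : (lam3 R).-integrable setT (fun x => (k x)%:E) ->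
  (forall f : E3 -> R, smooth f -> (forall x, 0 <= f x <= 1) ->
     (\int[lam3 R]_x (k x * f x)%:E = 0)%E) ->
  {ae lam3 R, forall x, k x = 0}.
Proof.
move=> ik hk; have mk : measurable_fun setT k by have /measurable_int /measurable_EFinP := ik.
have iak : (lam3 R).-integrable setT (fun x => (`|k x|)%:E) by have := integrable_abse ik.
suff : ae_eq (lam3 R) setT (fun x => (k x)%:E) (cst 0%E).
  by apply: filterS => x /(_ I) [].
apply: integral_ae_eq => // E _ mE; rewrite integral0 integral_mkcond; apply: small_eq0 => e e0.
have [_ /(_ e e0) [f [sf f01 fe]]] := (apprset_measurable hpsi (fun x => normr_ge0 (k x)) iak mE).2.
have mf := smooth_measurable sf; have m1 : measurable_fun setT (\1_E : V -> R) by exact: measurable_indic.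
have ikf : (lam3 R).-integrable setT (fun x => (k x * f x)%:E).
  apply: (le_integrable measurableT _ _ iak); first exact/measurable_EFinP/measurable_funM.
  move=> x _; have /andP[? ?] := f01 x; rewrite /= lee_fin normrM normr_id ler_piMr// ger0_norm//.
have ik1 : (lam3 R).-integrable setT (fun x => (k x * (\1_E x - f x))%:E).
  apply: (le_integrable measurableT _ _ iak).
    by apply/measurable_EFinP/measurable_funM => //; exact: measurable_funB.
  move=> x _; have /andP[? ?] := f01 x; have /andP[? ?] := @indic01 R E x.
  rewrite /= lee_fin normrM normr_id ler_piMr// ler_norml; apply/andP; split; lra.
have -> : (\int[lam3 R]_x ((fun x => (k x)%:E) \_ E) x =
    \int[lam3 R]_x ((k x * (\1_E x - f x))%:E + (k x * f x)%:E))%E.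
  by rewrite epatch_indic; apply: eq_integral => x _; rewrite /= -EFinM -EFinD -mulrDr subrK.
rewrite integralD// (hk f sf f01) adde0; apply: le_trans fe.
apply: le_trans (le_abse_integral _ _ _) _ => //; first by case/integrableP: ik1.
by rewrite /wdist /nint le_eqVlt; apply/orP; left; apply/eqP/eq_integral => x _; rewrite /= normrM.
Qed.

Lemma measurable_eball r : measurable (eball r : set V).
Proof.
have -> : (eball r : set V) = (fun x : V => enorm (x : E3)) @^-1` `]-oo, r]%classic.
  by apply/seteqP; split => x /=; rewrite in_itv.
by rewrite -[X in measurable X]setTI; apply: measurable_continuous3 => //; exact: continuous_enorm.
Qed.

Lemma loc_integrable_mulr (h : V -> R) (chi : V -> R) (r B : R) :
  (lam3 R).-integrable (eball r) (fun x => (h x)%:E) -> measurable_fun setT chi ->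
  (forall x, `|chi x| <= B) -> (forall x : E3, r < enorm x -> chi x = 0) ->
  (lam3 R).-integrable setT (fun x => (h x * chi x)%:E).
Proof.
move=> ih mchi Bchi chi0.
have me := measurable_eball r.
have /(integrable_mkcond _ me) ih' := ih.
have B0 : 0 <= B := le_trans (normr_ge0 _) (Bchi 0).
have e : (fun x => (h x)%:E) \_ (eball r) = fun x => (patch (fun=> 0) (eball r) h x)%:E.
  by apply/funext => x; rewrite /patch; case: ifP.
rewrite e in ih'.
have mh : measurable_fun setT (patch (fun=> 0) (eball r) h : V -> R) by have /measurable_int /measurable_EFinP := ih'.
have -> : (fun x : V => (h x * chi x)%:E) = (fun x : V => (patch (fun=> 0) (eball r) h x * chi x)%:E).
  apply/funext => x; rewrite /patch; case: ifPn => // /negP hx.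
  by rewrite chi0 ?mulr0// ltNge; apply/negP => hle; apply: hx; rewrite in_setE.
apply: (le_integrable measurableT _ _ (integrable_RZ B ih')).
  exact/measurable_EFinP/measurable_funM.
by move=> x _; rewrite /= lee_fin !normrM (ger0_norm B0) mulrC ler_wpM2r.
Qed.

Lemma lint3_mulr (g : E3 -> R[i]) (chi : E3 -> R) (r B : R) :
  locally_integrable3 g -> measurable_fun setT (chi : V -> R) ->
  (forall x, `|chi x| <= B) -> (forall x : E3, r < enorm x -> chi x = 0) ->
  cL1 (lam3 R) (fun x => g x * (chi x)%:C).
Proof.
move=> lg mchi Bchi chi0; have [gr gi] := lg r.
have er x : Re (g x * (chi x)%:C) = Re (g x) * chi x by rewrite ReM /= mulr0 subr0.
have ei x : Im (g x * (chi x)%:C) = Im (g x) * chi x by rewrite ImM /= mulr0 add0r.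
apply: cL1_ReIm.
  by under eq_fun do rewrite er; exact: loc_integrable_mulr gr mchi Bchi chi0.
by under eq_fun do rewrite ei; exact: loc_integrable_mulr gi mchi Bchi chi0.
Qed.

Lemma lint3_test (g : E3 -> R[i]) (f : E3 -> R) :
  locally_integrable3 g -> test_function f -> cL1 (lam3 R) (fun x => g x * (f x)%:C).
Proof.
move=> lg tf; have [B hB] := test_function_bounded tf; have [sf [r hr]] := tf.
by apply: (lint3_mulr lg (smooth_measurable sf) hB hr).
Qed.

Lemma test_functionM (f g : E3 -> R) : smooth f -> test_function g -> test_function (fun x => f x * g x).
Proof.
move=> sf [sg [r hr]]; split; first exact: smoothM.
by exists r => x /hr ->; rewrite mulr0.
Qed.

(** Multiplying [g] by the cutoffs [chi n] makes it integrable, and a smooth function times [chi n]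
    is a test function. At each point some cutoff equals 1. *)
Lemma lint3_unique (g : E3 -> R[i]) : locally_integrable3 g ->
  (forall f : E3 -> R, test_function f -> cint (lam3 R) (fun x => g x * (f x)%:C) = 0) ->
  {ae lam3 R, forall x, g x = 0}.
Proof.
move=> lg hg.
have er (t : R) z : Re (z * t%:C) = Re z * t by rewrite ReM /= mulr0 subr0.
have ei (t : R) z : Im (z * t%:C) = Im z * t by rewrite ImM /= mulr0 add0r.
pose chi (n : nat) (x : E3) := psi (n.+1%:R^-1 *: x).
have tchi n : test_function (chi n) by exact: cutoffn_test.
have key n : {ae lam3 R, forall x, Re (g x) * chi n x = 0} /\
             {ae lam3 R, forall x, Im (g x) * chi n x = 0}.
  have l1 := lint3_test lg (tchi n).
  split; apply: eq0_of_smooth_integrals.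
  - by have := cL1_Re l1; under eq_fun do rewrite er.
  - move=> f sf f01; have tf := test_functionM sf (tchi n).
    have lf := lint3_test lg tf; have := hg _ tf.
    move=> /(congr1 (@Re R)) /= h; have := cL1_Re lf; under eq_fun do rewrite er mulrCA mulrC.
    move=> ii0; rewrite -[LHS]fineK ?integrable_fin_num//; congr (_%:E); rewrite -[RHS]h /Rintegral.
    by congr fine; apply: eq_integral => x _; rewrite er mulrCA mulrC.
  - by have := cL1_Im l1; under eq_fun do rewrite ei.
  - move=> f sf f01; have tf := test_functionM sf (tchi n).
    have lf := lint3_test lg tf; have := hg _ tf.
    move=> /(congr1 (@Im R)) /= h; have := cL1_Im lf; under eq_fun do rewrite ei mulrCA mulrC.
    move=> ii0; rewrite -[LHS]fineK ?integrable_fin_num//; congr (_%:E); rewrite -[RHS]h /Rintegral.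
    by congr fine; apply: eq_integral => x _; rewrite ei mulrCA mulrC.
have k1 := ae_foralln (fun n => (key n).1); have k2 := ae_foralln (fun n => (key n).2).
move: k1 k2; apply: filterS2 => x h1 h2.
pose n := Num.truncn (2 * enorm x).
have c1 : chi n x = 1.
  apply: (cutoff_eq1 hpsi); rewrite enormZ ger0_norm ?invr_ge0// ler_pdivrMl ?ltr0n//.
  by have := truncnS_gt (2 * enorm x); rewrite -/n; set m := n.+1%:R; lra.
by apply: ReIm_eq => /=; [have := h1 n|have := h2 n]; rewrite c1 mulr1.
Qed.

(** [A] is rescaled to take values in [0, 1], approximated there, rescaled back and multiplied by
    [rho], which is 1 on the ball of radius [r]. The bound [C] is independent of [e]; in
    [density_L12] this turns L^1 closeness into L^2 closeness. *)
Lemma bounded_density (A : V -> R) (N r : R) : measurable_fun setT A -> 0 < N -> 0 < r ->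
  (forall x, `|A x| <= N) -> (forall x : E3, r < enorm x -> A x = 0) ->
  exists C, 0 <= C /\ forall e, 0 < e -> exists f : E3 -> R, [/\ test_function f, forall x, `|f x| <= C
    & (nint (lam3 R) (fun x => `|A x - f x|%R) <= e%:E)%E].
Proof.
move=> mA N0 r0 hN hr; have [B [B1 hB]] := cutoff_bounded hpsi.
pose rho (x : E3) := psi ((2 * r)^-1 *: x).
have d0 : 0 < (2 * r)^-1 by rewrite invr_gt0 mulr_gt0.
have trho : test_function rho.
  split.
    have -> : rho = fun x => psi ((2 * r)^-1 *: x + 0) by apply/funext => x; rewrite addr0.
    exact: smooth_comp_affine (axis_affine_scale _ 0) (cutoff_smooth hpsi).
  exists (2 * r) => x hx; apply: (cutoff_eq0_gt hpsi).
  by rewrite enormZ (gtr0_norm d0) ltr_pdivlMl ?mulr1// mulr_gt0.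
have rho0 x : 0 <= rho x by exact: (cutoff_ge0 hpsi).
have irho : (lam3 R).-integrable setT (fun x : V => (rho x)%:E).
  have : cpart (fun x => (rho x)%:C) (@test_function R).
    by split => //=; split; [exact: smooth_cst|exists 0].
  by move=> /csch_test/csch_cL1/cL1_Re.
have mrho := smooth_measurable trho.1.
pose P (x : V) := (2 * N)^-1 * (A x + N).
have mP : measurable_fun setT P by apply: measurable_funM => //; exact: measurable_funD.
have N2 : 0 < 2 * N by rewrite mulr_gt0.
have P01 x : 0 <= P x <= 1.
  have := hN x; rewrite ler_norml => /andP[? ?]; apply/andP; split.
    by rewrite mulr_ge0 ?invr_ge0 ?(ltW N2)//; lra.
  by rewrite ler_pdivrMl//; lra.
have [_ ap] := appr_measurable hpsi rho0 irho mP P01.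
exists (N * B); split; first by rewrite mulr_ge0 ?(ltW N0)// (le_trans _ B1).
move=> e e0; have [|h [sh h01 he]] := ap (e / (2 * N)); first by rewrite divr_gt0.
have tf : test_function (fun x => N * (2 * h x - 1) * rho x).
  exact: (test_functionM (smoothM (smooth_cst N) (smoothB (smoothM (smooth_cst 2) sh) (smooth_cst 1))) trho).
exists (fun x => N * (2 * h x - 1) * rho x); split => //.
  move=> x; have /andP[? ?] := h01 x; rewrite !normrM (gtr0_norm N0) -mulrA ler_pM2l//.
  rewrite (ger0_norm (rho0 x)) -[leRHS]mul1r ler_pM//; last exact: hB.
  by rewrite ler_norml; apply/andP; split; lra.
have -> : e%:E = ((2 * N)%:E * (e / (2 * N))%:E)%E by rewrite -EFinM mulrCA divff ?mulr1// gt_eqF.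
apply: le_trans (lee_wpmul2l _ he); last by rewrite lee_fin ltW.
have mh := smooth_measurable sh.
rewrite /wdist -nintZ//; last 3 first.
- by apply: measurable_wdist.
- by move=> x; rewrite mulr_ge0.
- exact: ltW.
apply: nint_le.
- apply: measurableT_comp => //; apply: measurable_funB => //.
  exact: smooth_measurable tf.1.
- by apply: measurable_funM => //; exact: measurable_wdist.
move=> x; rewrite normr_ge0/=.
have Ar : A x = A x * rho x.
  have [hx|hx] := leP (enorm x) r; last by rewrite hr// mul0r.
  rewrite /rho (cutoff_eq1 hpsi) ?mulr1// enormZ (gtr0_norm d0) ler_pdivrMl ?mulr_gt0//; lra.
rewrite {1}Ar -mulrBl normrM (ger0_norm (rho0 x)) mulrC mulrCA ler_wpM2l//.
rewrite -{1}(gtr0_norm N2) -normrM le_eqVlt; apply/orP; left; apply/eqP; congr `|_|.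
by rewrite /P; field; rewrite gt_eqF.
Qed.

End density.

Section fatou_dct.
Context d (T : measurableType d) (R : realType) (mu : {measure set T -> \bar R}).
Implicit Types h k : T -> R.

Lemma nint_integrable h c : measurable_fun setT h -> (forall x, 0 <= h x) -> (nint mu h <= c%:E)%E ->
  mu.-integrable setT (fun x => (h x)%:E) /\ \int[mu]_x h x <= c.
Proof.
move=> mh h0 hc.
have ih : mu.-integrable setT (fun x => (h x)%:E).
  apply/integrableP; split; first exact: measurable_RE.
  apply: le_lt_trans (ltry c); apply: le_trans hc; rewrite /nint le_eqVlt; apply/orP; left.
  by apply/eqP/eq_integral => x _; rewrite /= ger0_norm.
split => //; rewrite -lee_fin /Rintegral fineK//; exact: integrable_fin_num.
Qed.

Lemma nint_Rintegral h : mu.-integrable setT (fun x => (h x)%:E) -> nint mu h = (\int[mu]_x h x)%:E.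
Proof. by move=> ih; rewrite /Rintegral fineK//; exact: integrable_fin_num. Qed.

Lemma fatou_le (f_ : nat -> T -> R) (f : T -> R) (c : R) : (forall n, measurable_fun setT (f_ n)) ->
  measurable_fun setT f -> (forall n x, 0 <= f_ n x) -> (forall x, 0 <= f x) ->
  {ae mu, forall x, f_ ^~ x @ \oo --> f x} -> (forall n, (nint mu (f_ n) <= c%:E)%E) ->
  (nint mu f <= c%:E)%E.
Proof.
move=> mf_ mf f_0 f0 cf hc.
have mE n : measurable_fun setT (fun x => (f_ n x)%:E) by exact: measurable_RE.
have := @fatou _ _ _ mu setT measurableT (fun n x => (f_ n x)%:E) mE (fun n x _ => _).
have mL : measurable_fun setT (fun x => limn_einf (fun n => (f_ n x)%:E)).
  apply: (@emeasurable_fun_cvg _ T R setT (fun n x => einfs (fun n => (f_ n x)%:E) n)).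
    by move=> n; exact: (measurable_fun_einfs mE).
  by move=> x _; rewrite limn_einf_lim; exact: is_cvg_einfs.
have E : (\int[mu]_x limn_einf (fun n => (f_ n x)%:E) = nint mu f)%E.
  apply: ae_eq_integral => //; try exact: measurable_RE.
  apply: filterS cf => x cx _.
  have cE : (fun n => (f_ n x)%:E) @ \oo --> (f x)%:E by apply: cvg_EFin => //; near=> n.
  by rewrite (cvg_limn_einf_sup cE).
rewrite E => H; apply: le_trans (H _) _.
  by move=> n x; rewrite lee_fin.
rewrite limn_einf_lim; apply: lime_le; first exact: is_cvg_einfs.
near=> n; apply: le_trans (hc n); rewrite /einfs; apply: ereal_inf_lbound.
by exists n => //=.
Unshelve. all: by end_near. Qed.

Lemma Rdct (f_ : nat -> T -> R) (f h : T -> R) : (forall n, measurable_fun setT (f_ n)) ->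
  measurable_fun setT f -> mu.-integrable setT (fun x => (h x)%:E) ->
  {ae mu, forall x, f_ ^~ x @ \oo --> f x} -> {ae mu, forall x n, `|f_ n x| <= h x} ->
  (fun n => \int[mu]_x f_ n x) @ \oo --> \int[mu]_x f x.
Proof.
move=> mf_ mf ih cf hf.
have [||||| _ _ c] := @cdct _ _ _ mu (fun n x => (f_ n x)%:C) (fun x => (f x)%:C) h.
- by move=> n; exact: cmeas_real.
- exact: cmeas_real.
- by apply: filterS cf => x c; apply: ccvg_ReIm; [exact: c|exact: cvg_cst].
- exact: ih.
- by apply: filterS hf => x hx n; rewrite cabs_real.
exact: ccvg_Re c.
Qed.

End fatou_dct.

(** * Square integrable functions and Plancherel *)

Section square_integrable.
Variable R : realType.
Notation E3 := (R * R * R)%type.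
Notation V := (mspace R).
Implicit Types f g h : V -> R[i].

Definition cL2 f := cmeas f /\ (lam3 R).-integrable setT (fun x => (cabs (f x) ^+ 2)%:E).

Definition N2 f : R := \int[lam3 R]_x cabs (f x) ^+ 2.

Lemma measurable_sqr f : cmeas f -> measurable_fun setT (fun x => cabs (f x) ^+ 2).
Proof. by move=> mf; apply: measurable_funX; exact: measurable_cabs. Qed.

Lemma cL2_nint f c : cmeas f -> (nint (lam3 R) (fun x => cabs (f x) ^+ 2)%R <= c%:E)%E -> cL2 f /\ N2 f <= c.
Proof.
move=> mf hc; have [|i1 i2] := nint_integrable (measurable_sqr mf) _ hc.
  by move=> x; rewrite exprn_ge0// cabs_ge0.
by split.
Qed.

Lemma N2_ge0 f : 0 <= N2 f.
Proof. by apply: Rintegral_ge0 => x _; rewrite exprn_ge0// cabs_ge0. Qed.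

Lemma sqr_cabsD (z w : R[i]) : cabs (z + w) ^+ 2 <= 2 * cabs z ^+ 2 + 2 * cabs w ^+ 2.
Proof.
have := cabsD z w; have := cabs_ge0 (z + w); have := cabs_ge0 z; have := cabs_ge0 w.
move: (cabs _) (cabs _) (cabs _) => a b c c0 b0 a0 h.
have h2 : a ^+ 2 <= (b + c) ^+ 2 by rewrite lerXn2r ?nnegrE ?addr_ge0.
by have := sqr_ge0 (b - c); nra.
Qed.

Lemma cL2_le f (h : V -> R) : cmeas f -> (forall x, cabs (f x) ^+ 2 <= h x) ->
  (lam3 R).-integrable setT (fun x => (h x)%:E) -> cL2 f.
Proof.
move=> mf hf ih; split => //; apply: (le_integrable measurableT _ _ ih).
  by apply/measurable_EFinP; exact: measurable_sqr.
move=> x _; rewrite /= lee_fin ger0_norm ?exprn_ge0 ?cabs_ge0//.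
exact: le_trans (hf x) (ler_norm _).
Qed.

Lemma cL2D f g : cL2 f -> cL2 g -> cL2 (fun x => f x + g x) /\
  N2 (fun x => f x + g x) <= 2 * N2 f + 2 * N2 g.
Proof.
move=> [mf if2] [mg ig2]; have m := cmeasD mf mg.
have i1 := integrable_RZ 2 if2; have i2 := integrable_RZ 2 ig2; have i12 := integrable_RD i1 i2.
have l2 : cL2 (fun x => f x + g x) by apply: cL2_le m (fun x => sqr_cabsD _ _) i12.
split => //; apply: le_trans (le_Rintegral measurableT l2.2 i12 (fun x _ => sqr_cabsD _ _)) _.
by rewrite RintegralD// !RintegralZl.
Qed.

Lemma cL2N f : cL2 f -> cL2 (fun x => - f x).
Proof. by move=> [mf h]; split; [exact: cmeasN|under eq_fun do rewrite cabsN]. Qed.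

Lemma N2N f : N2 (fun x => - f x) = N2 f.
Proof. by rewrite /N2; under eq_Rintegral do rewrite cabsN. Qed.

Lemma cL2B f g : cL2 f -> cL2 g -> cL2 (fun x => f x - g x).
Proof. by move=> hf /cL2N hg; exact: (cL2D hf hg).1. Qed.

Lemma N2B f g : cL2 f -> cL2 g -> N2 (fun x => f x - g x) <= 2 * N2 f + 2 * N2 g.
Proof. by move=> hf hg; rewrite -[N2 g]N2N; exact: (cL2D hf (cL2N hg)).2. Qed.

Lemma cL2_conj f : cL2 f -> cL2 (fun x => (f x)^*).
Proof. by move=> [mf h]; split; [exact: cmeas_conj|under eq_fun do rewrite cabs_conj]. Qed.

Lemma cL2_opp f : cL2 f -> cL2 (fun x : V => f (- (x : E3))).
Proof.
move=> [mf h]; have [mo _] := scales3_opp R; split; first exact: (cmeas_comp mo mf).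
exact: (scales_integrable ltr01 (scales3_opp R) h).
Qed.

Lemma N2_opp f : cL2 f -> N2 (fun x : V => f (- (x : E3))) = N2 f.
Proof.
move=> [mf h]; rewrite /N2 /Rintegral; congr fine.
by have := scales_integral ltr01 (scales3_opp R) h; rewrite mul1e.
Qed.

(** The substitute for the Cauchy-Schwarz inequality throughout; the free parameter [t] is tuned at
    each use. *)
Lemma mul_amgm (a b t : R) : 0 < t -> a * b <= t * a ^+ 2 + t^-1 * b ^+ 2.
Proof.
move=> t0; have ti : 0 < t^-1 by rewrite invr_gt0.
have e : t * t^-1 = 1 by rewrite divff// gt_eqF.
have := sqr_ge0 (t * a - 2^-1 * b) => h; rewrite -(ler_pM2l t0) mulrDr !mulrA e mul1r.
have := sqr_ge0 b; nra.
Qed.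

Lemma cL2M f g : cL2 f -> cL2 g -> cL1 (lam3 R) (fun x => f x * g x).
Proof.
move=> [mf h] [mg k]; apply: cL1_dom; first exact: cmeasM; last first.
  exact: integrable_RD (integrable_RZ 1 h) (integrable_RZ 1^-1 k).
by move=> x /=; rewrite cabsM; exact: mul_amgm.
Qed.

Lemma cint_amgm f g t : cL2 f -> cL2 g -> 0 < t ->
  cabs (cint (lam3 R) (fun x => f x * g x)) <= t * N2 f + t^-1 * N2 g.
Proof.
move=> [mf h] [mg k] t0; have ih := integrable_RZ t h; have ik := integrable_RZ t^-1 k.
rewrite /N2 -!RintegralZl// -RintegralD//; apply: cabs_cint_le; first exact: cmeasM.
  by move=> x /=; rewrite cabsM; exact: mul_amgm.
exact: integrable_RD.
Qed.

Lemma cint_small f (h_ : nat -> V -> R[i]) : cL2 f -> (forall n, cL2 (h_ n)) ->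
  (fun n => N2 (h_ n)) @ \oo --> (0 : R) ->
  (fun n => cabs (cint (lam3 R) (fun x => f x * h_ n x))) @ \oo --> (0 : R).
Proof.
move=> hf hh c; apply/cvgrPdist_le => e e0.
(* This [t] makes [t * N2 f] at most e / 2; the other term is then small for large [n]. *)
pose t := e / (2 * (N2 f + 1)); have d0 : 0 < 2 * (N2 f + 1) by rewrite mulr_gt0// ltr_wpDl// N2_ge0.
have t0 : 0 < t by rewrite divr_gt0.
have te : 0 < t * (e / 2) by rewrite mulr_gt0 ?divr_gt0.
move/cvgrPdist_le : c => /(_ _ te); apply: filterS => n.
rewrite !sub0r !normrN (ger0_norm (N2_ge0 _)) (ger0_norm (cabs_ge0 _)) => hn.
apply: le_trans (cint_amgm hf (hh n) t0) _.
have h1 : t * N2 f <= e / 2.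
  by rewrite /t mulrAC ler_pdivrMr//; have := N2_ge0 f; nra.
have h2 : t^-1 * N2 (h_ n) <= e / 2 by rewrite ler_pdivrMl.
by rewrite [leRHS]splitr lerD.
Qed.

Lemma csch_cL2 (f : E3 -> R[i]) : csch f -> cL2 f.
Proof.
move=> sf; have f1 := csch_cL1 sf; have [c hc] := sf.2 0%N.
apply: (@cL2_le _ (fun x => c * cabs (f x))); first by case: f1.
  by move=> x; rewrite expr2 ler_wpM2r ?cabs_ge0//; exact: csbd_sup0 hc.
by apply: integrable_RZ; case: f1.
Qed.

End square_integrable.

Section plancherel.
Variable R : realType.
Notation E3 := (R * R * R)%type.
Notation V := (mspace R).
Variables (psi : E3 -> R) (hpsi : lp_cutoff psi).
Implicit Types A B G H : V -> R[i].

Lemma smooth_conj (f : E3 -> R[i]) : csch f -> csch (fun x => (f x)^*).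
Proof.
move=> [[sr si] hf].
have e w x : cD w (fun x => (f x)^*) x = (cD w f x)^*.
  have := congr1 (fun F => F x) (Re_cD w (fun x => (f x)^*)).
  have := congr1 (fun F => F x) (Im_cD w (fun x => (f x)^*)).
  rewrite /=.
  have -> : (fun x => Re (f x)^*) = (fun x => Re (f x)) by apply/funext => y; case: (f y).
  have -> : (fun x => Im (f x)^*) = (fun x => -1 * Im (f x)).
    by apply/funext => y; rewrite mulN1r; case: (f y).
  have hi : iter_partial w (fun x => -1 * Im (f x)) x = - iter_partial w (fun x => Im (f x)) x.
    have := cDZ w (-1) x (csmooth_real si) => /(congr1 (@Re R)).
    have := congr1 (fun F => F x) (Re_cD w (fun x => -1 * (Im (f x))%:C)).
    have := congr1 (fun F => F x) (Re_cD w (fun x => (Im (f x))%:C)) => /=.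
    have -> : (fun x => Re (-1 * (Im (f x))%:C)) = (fun x => -1 * Im (f x)).
      by apply/funext => y; rewrite ReM /= mulr0 subr0.
    by move=> h1 h2; rewrite h2 ReM /= mulNr mul1r oppr0 mul0r subr0 h1.
  rewrite hi; rewrite -(congr1 (fun F => F x) (Re_cD w f)) -(congr1 (fun F => F x) (Im_cD w f)) /=.
  by move=> h1 h2; apply: ReIm_eq; rewrite ?h1 ?h2; case: (cD w f x).
split; last by move=> N; have [c hc] := hf N; exists c => w wN x; rewrite e cabs_conj; exact: hc.
split.
  have -> : (fun x => Re (f x)^*) = (fun x => Re (f x)) by apply/funext => y; case: (f y).
  exact: sr.
have -> : (fun x => Im (f x)^*) = (fun x => - Im (f x)) by apply/funext => y; case: (f y).
exact: smoothN si.
Qed.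

Lemma conj_real (a : R) : (a%:C)^* = a%:C.
Proof. by apply: ReIm_eq; rewrite //= oppr0. Qed.

Lemma cint_conj (f : V -> R[i]) : cL1 (lam3 R) f ->
  (cint (lam3 R) f)^* = cint (lam3 R) (fun x => (f x)^*).
Proof.
move=> l; apply: ReIm_eq => /=; first by congr fine; apply: eq_integral => y _; case: (f y).
have := @RintegralZl _ _ _ (lam3 R) setT _ (-1) measurableT (cL1_Im l); rewrite mulN1r => <-.
by congr fine; apply: eq_integral => y _; rewrite mulN1r; case: (f y).
Qed.

Lemma conj_inv_fourier (f : E3 -> R[i]) x : cL1 (lam3 R) f ->
  (inv_fourier f x)^* = inv_fourier (fun xi => (f (- xi))^*) x.
Proof.
move=> f1; have [mf if1] := f1.
have fc : cL1 (lam3 R) (fun xi => (f xi)^*).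
  by split; [exact: cmeas_conj|under eq_fun do rewrite cabs_conj].
rewrite (inv_fourier_opp x fc) !inv_fourierE rmorphM /= conj_real; congr (_ * _).
rewrite cint_conj; last exact: cL1_cis.
by congr (cint _ _); apply/funext => xi; rewrite dotpNl cisN rmorphM.
Qed.

Lemma cint_sqr (f : V -> R[i]) : cL2 f -> cint (lam3 R) (fun x => f x * (f x)^*) = (N2 f)%:C.
Proof.
move=> _; apply: ReIm_eq => /=; first by congr fine; apply: eq_integral => x _; rewrite mul_conj.
by rewrite /Rintegral integral0_eq//= => x _; rewrite mul_conj.
Qed.

Lemma inv_fourier_inv_fourier (f : E3 -> R[i]) x : csch f -> inv_fourier (inv_fourier f) x = f (- x).
Proof. by move=> sf; rewrite -[in RHS](fourierK sf) fourier_opp opprK. Qed.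

Lemma inv_fourier_mult_schwartz A (f : E3 -> R[i]) : cL1 (lam3 R) A -> csch f ->
  cint (lam3 R) (fun x => inv_fourier A x * inv_fourier f x) = cint (lam3 R) (fun x : V => A x * f (- (x : E3))).
Proof.
move=> lA sf; rewrite fourier_mult//; last exact/csch_cL1/csch_inv_fourier.
by congr (cint _ _); apply/funext => x; rewrite inv_fourier_inv_fourier.
Qed.

(** The conjugate of the transform of [f] is the transform of the reflected conjugate of [f], so the
    square norm is a pairing of two transforms, to which the multiplication formula and inversion
    apply. *)
Lemma plancherel_schwartz (f : E3 -> R[i]) : csch f -> N2 (inv_fourier f) = N2 f.
Proof.
move=> sf; have f1 := csch_cL1 sf.
have /(congr1 (@Re R)) /= -> // : (N2 (inv_fourier f))%:C = (N2 f)%:C.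
rewrite -!cint_sqr; [|exact: csch_cL2|exact/csch_cL2/csch_inv_fourier].
have sg : csch (fun x => (f (- x))^*) by apply: smooth_conj; exact: csch_opp.
transitivity (cint (lam3 R) (fun x => inv_fourier f x * inv_fourier (fun x => (f (- x))^*) x)).
  by congr (cint _ _); apply/funext => x; rewrite conj_inv_fourier.
rewrite inv_fourier_mult_schwartz//; congr (cint _ _); apply/funext => x; by rewrite opprK.
Qed.

Definition trunc (n : nat) A : V -> R[i] := fun x => if enorm (x : E3) <= n%:R then A x else 0.

Lemma truncE n A x : trunc n A x = (\1_(eball n%:R) x : R)%:C * A x.
Proof.
rewrite /trunc indicE; case: ifPn => h; first by rewrite mem_set// mul1r.
by rewrite memNset ?mul0r//; exact/negP.
Qed.

Lemma cmeas_trunc n A : cmeas A -> cmeas (trunc n A).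
Proof.
move=> mA; have -> : trunc n A = fun x => (\1_(eball n%:R) x : R)%:C * A x by apply/funext => x; exact: truncE.
by apply: cmeasM => //; apply: cmeas_real; exact: measurable_indic (measurable_eball _).
Qed.

Lemma cabs_trunc n A x : cabs (trunc n A x) <= cabs (A x).
Proof. by rewrite /trunc; case: ifP => // _; rewrite cabs0 cabs_ge0. Qed.

Lemma cL2_dom A B : cmeas A -> cL2 B -> (forall x, cabs (A x) <= cabs (B x)) -> cL2 A.
Proof.
move=> mA [mB hB] h; apply: cL2_le mA _ hB => x.
by rewrite lerXn2r ?nnegrE ?cabs_ge0.
Qed.

Lemma cL2_trunc n A : cL2 A -> cL2 (trunc n A).
Proof. by move=> hA; apply: (cL2_dom _ hA (cabs_trunc n A)); apply: cmeas_trunc; case: hA. Qed.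

Lemma integrable_indic_eball r : (lam3 R).-integrable setT (fun x : V => (\1_(eball r) x : R)%:E).
Proof.
pose t := 2 * (`|r| + 1); have t0 : 0 < t by rewrite mulr_gt0// ltr_wpDl.
have := @csch_test _ (fun x : E3 => (psi (t^-1 *: x))%:C); case.
  split => /=; last by split; [exact: smooth_cst|exists 0].
  split.
    have -> : (fun x => psi (t^-1 *: x)) = (fun x => psi (t^-1 *: x + 0)) by apply/funext => x; rewrite addr0.
    exact: smooth_comp_affine (axis_affine_scale _ 0) (cutoff_smooth hpsi).
  exists t => x hx; apply: (cutoff_eq0_gt hpsi).
  by rewrite enormZ ger0_norm ?invr_ge0 ?(ltW t0)// ltr_pdivlMl ?mulr1.
move=> sp hp; have /csch_cL1/cL1_Re /= ip := conj sp hp.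
apply: (le_integrable measurableT _ _ ip).
  by apply/measurable_EFinP; exact: measurable_indic (measurable_eball _).
move=> x _; rewrite /= lee_fin indicE; have [h|h] := pselect (eball r x); last by rewrite (memNset h) normr0.
rewrite (mem_set h) (cutoff_eq1 hpsi)// enormZ ger0_norm ?invr_ge0 ?(ltW t0)// ler_pdivrMl//.
by have := ler_norm r; move: h; rewrite /eball /= /t; lra.
Qed.

Lemma cL1_trunc n A : cL2 A -> cL1 (lam3 R) (trunc n A).
Proof.
move=> [mA hA]; apply: cL1_dom; first exact: cmeas_trunc; last first.
  exact: integrable_RD (integrable_indic_eball n%:R) hA.
move=> x /=; rewrite truncE cabsM cabs_real indicE; have := sqr_ge0 (cabs (A x) - 2^-1).
by case: (x \in _) => /=; rewrite ?normr1 ?normr0 ?mul0r ?mul1r; have := cabs_ge0 (A x); nra.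
Qed.

Lemma trunc_cvg A x : forall m, enorm (x : E3) <= m%:R -> forall n, (m <= n)%N -> trunc n A x = A x.
Proof. by move=> m hm n mn; rewrite /trunc (le_trans hm)// ler_nat. Qed.

Lemma enorm_le_nat (x : E3) : exists m : nat, enorm x <= m%:R.
Proof. by exists (Num.truncn (enorm x)).+1; apply/ltW/truncnS_gt. Qed.

Lemma N2_trunc A : cL2 A -> (fun n => N2 (fun x => trunc n A x - A x)) @ \oo --> (0 : R).
Proof.
move=> hA; have [mA iA] := hA.
have -> : (0 : R) = \int[lam3 R]_x (0 : R) by rewrite /Rintegral integral0.
apply: (@Rdct _ _ _ (lam3 R) (fun n x => cabs (trunc n A x - A x) ^+ 2) (fun=> 0) (fun x => cabs (A x) ^+ 2)) => //.
- by move=> n; apply: measurable_sqr; apply: cmeasB => //; exact: cmeas_trunc.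
- apply: aeW => x; apply: cvg_near_cst; have [m hm] := enorm_le_nat x.
  near=> n; rewrite (trunc_cvg A hm) ?subrr ?cabs0 ?expr0n//.
  by near: n; exact: nbhs_infty_ge.
- apply: aeW => x n; rewrite ger0_norm ?exprn_ge0 ?cabs_ge0// lerXn2r ?nnegrE ?cabs_ge0//.
  by rewrite /trunc; case: ifP => _; rewrite ?subrr ?sub0r ?cabsN ?cabs0 ?cabs_ge0.
Unshelve. all: by end_near. Qed.

End plancherel.

Section square_integrable_fourier.
Variable R : realType.
Notation E3 := (R * R * R)%type.
Notation V := (mspace R).
Variables (psi : E3 -> R) (hpsi : lp_cutoff psi).
Implicit Types A B G H : V -> R[i].

(** Truncation both in space and in size: the result is bounded with bounded support, as
    [bounded_density] requires. *)
Definition cut (n : nat) A : V -> R[i] := fun x => if cabs (A x) <= n%:R then trunc n A x else 0.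

Lemma cmeas_cut n A : cmeas A -> cmeas (cut n A).
Proof.
move=> mA; set E := [set x | cabs (A x) <= n%:R].
have mE : measurable E.
  have -> : E = (fun x => cabs (A x)) @^-1` `]-oo, n%:R]%classic by apply/seteqP; split => x /=; rewrite in_itv.
  by rewrite -[X in measurable X]setTI; exact: measurable_cabs.
have -> : cut n A = fun x => (\1_E x : R)%:C * trunc n A x.
  apply/funext => x; rewrite /cut indicE; case: ifPn => h; first by rewrite mem_set// mul1r.
  by rewrite memNset ?mul0r//; exact/negP.
by apply: cmeasM; [apply: cmeas_real; exact: measurable_indic|exact: cmeas_trunc].
Qed.

Lemma cut_cvg A (x : V) : \forall n \near \oo, cut n A x = A x.
Proof.
have [m hm] := enorm_le_nat x; pose k := (Num.truncn (cabs (A x))).+1.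
have hk : cabs (A x) <= k%:R by apply/ltW/truncnS_gt.
near=> n.
have mn : (m <= n)%N by near: n; exact: nbhs_infty_ge.
have kn : (k <= n)%N by near: n; exact: nbhs_infty_ge.
by rewrite /cut (le_trans hk) ?ler_nat// (trunc_cvg A hm).
Unshelve. all: by end_near. Qed.

Lemma cabs_sub_cut n A x : cabs (A x - cut n A x) <= cabs (A x).
Proof. by rewrite /cut /trunc; case: ifP => _; [case: ifP => _|]; rewrite ?subrr ?subr0 ?cabs0 ?cabs_ge0. Qed.

(** One approximant serves both norms: L^1 closeness gives pointwise convergence of the transforms,
    L^2 closeness controls their norms. The function is cut first, and then the real and imaginary
    parts are approximated separately. *)
Lemma density_L12 A (e : R) : cL1 (lam3 R) A -> cL2 A -> 0 < e ->
  exists f : E3 -> R[i], [/\ csch f, \int[lam3 R]_x cabs (A x - f x) <= e & N2 (fun x => A x - f x) <= e].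
Proof.
move=> [mA iA1] [_ iA2] e0; have e8 : 0 < e / 8 by rewrite divr_gt0.
have mc n : cmeas (fun x => A x - cut n A x) by apply: cmeasB => //; exact: cmeas_cut.
have [|||x|x n||n hn] := @dct_eps _ _ _ (lam3 R)
  (fun n x => cabs (A x - cut n A x) + cabs (A x - cut n A x) ^+ 2) (fun=> 0)
  (fun x => cabs (A x) + cabs (A x) ^+ 2) (e / 8).
- by move=> n; apply: measurable_funD; [exact: measurable_cabs|exact: measurable_sqr].
- exact: measurable_cst.
- exact: integrable_RD.
- apply: cvg_near_cst; near=> n.
  have -> : cut n A x = A x by near: n; exact: cut_cvg.
  by rewrite subrr cabs0 expr0n addr0.
- rewrite ger0_norm ?addr_ge0 ?exprn_ge0 ?cabs_ge0//; apply: lerD; first exact: cabs_sub_cut.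
  by rewrite lerXn2r ?nnegrE ?cabs_ge0//; exact: cabs_sub_cut.
- exact: e8.
pose N : R := n.+1%:R; have N0 : 0 < N by rewrite ltr0n.
have [mr mi] := cmeas_cut n mA.
have cN x : cabs (cut n A x) <= N.
  rewrite /cut; case: ifPn => h; last by rewrite cabs0 ltW.
  by apply: le_trans (cabs_trunc _ _ _) (le_trans h _); rewrite ler_nat.
have c0 (x : E3) : N < enorm x -> cut n A x = 0.
  move=> h; rewrite /cut /trunc; case: ifP => // _; case: ifPn => // h'.
  by move: (lt_le_trans h h'); rewrite ltr_nat ltnNge leqnSn.
have [Cr [Cr0 hr]] := bounded_density hpsi mr N0 N0 (fun x => le_trans (Re_le_cabs _) (cN x))
  (fun x h => congr1 (@Re R) (c0 x h)).
have [Ci [Ci0 hi]] := bounded_density hpsi mi N0 N0 (fun x => le_trans (Im_le_cabs _) (cN x))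
  (fun x h => congr1 (@Im R) (c0 x h)).
(* [K] absorbs both the linear and the quadratic error: a difference of quantities bounded by N and
   by Cr or Ci has its square at most the sum of these bounds times its modulus. *)
pose K := 1 + (N + Cr) + (N + Ci); have K1 : 1 <= K by rewrite /K -addrA lerDl !addr_ge0// ltW.
have K0 : 0 < K := lt_le_trans ltr01 K1.
have d0 : 0 < e / (8 * K) by rewrite divr_gt0// mulr_gt0.
have [fr [tr br er]] := hr _ d0; have [fi [ti bi ei]] := hi _ d0.
pose f (x : E3) : R[i] := fr x +i* fi x.
have tf : cpart f (@test_function R) by split.
have sf := csch_test tf; have mf := cmeas_csmooth sf.1.
have mAf : cmeas (fun x : V => A x - f x) by exact: cmeasB.
pose dr (x : V) := `|Re (cut n A x) - fr x|; pose di (x : V) := `|Im (cut n A x) - fi x|.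
have mdr : measurable_fun setT dr.
  by apply: measurableT_comp => //; apply: measurable_funB => //; exact: smooth_measurable tr.1.
have mdi : measurable_fun setT di.
  by apply: measurableT_comp => //; apply: measurable_funB => //; exact: smooth_measurable ti.1.
pose g (x : V) := cabs (A x - cut n A x) + cabs (A x - cut n A x) ^+ 2.
have mg : measurable_fun setT g by apply: measurable_funD; [exact: measurable_cabs|exact: measurable_sqr].
have g0 x : 0 <= g x by rewrite addr_ge0 ?exprn_ge0 ?cabs_ge0.
pose b (x : V) := 2 * g x + (2 * K * dr x + 2 * K * di x).
have hb x : cabs (A x - f x) + cabs (A x - f x) ^+ 2 <= b x.
  have dr0 : 0 <= dr x by exact: normr_ge0. have di0 : 0 <= di x by exact: normr_ge0.
  have -> : A x - f x = (A x - cut n A x) + (cut n A x - f x) by rewrite addrA subrK.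
  have h1 := cabsD (A x - cut n A x) (cut n A x - f x).
  have h2 := sqr_cabsD (A x - cut n A x) (cut n A x - f x).
  have h3 : cabs (cut n A x - f x) <= dr x + di x.
    by apply: le_trans (cabs_le_ReIm _) _; rewrite ReD ImD ReN ImN.
  have h4 : cabs (cut n A x - f x) ^+ 2 <= (N + Cr) * dr x + (N + Ci) * di x.
    rewrite sqr_cabs ReD ImD ReN ImN /=.
    have B (a c u v : R) : `|a| <= u -> `|c| <= v -> (a - c) ^+ 2 <= (u + v) * `|a - c|.
      move=> ha hc; rewrite -real_normK ?num_real// expr2 ler_wpM2r//.
      by apply: le_trans (ler_normB _ _) (lerD ha hc).
    apply: lerD; apply: B => //.
      exact: le_trans (Re_le_cabs _) (cN x).
    exact: le_trans (Im_le_cabs _) (cN x).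
  have h5 := cabs_ge0 (A x - cut n A x); rewrite /b /g /K.
  clear -h1 h2 h3 h4 h5 dr0 di0 Cr0 Ci0 N0; nra.
have mb : measurable_fun setT b.
  by apply: measurable_funD; [exact: measurable_funM|apply: measurable_funD; exact: measurable_funM].
have K20 : 0 <= 2 * K by rewrite mulr_ge0// ltW.
have nb : (nint (lam3 R) b <= e%:E)%E.
  rewrite /b nintD//; [|exact: measurable_funM|by apply: measurable_funD; exact: measurable_funM
    |by move=> x; rewrite mulr_ge0|by move=> x; rewrite addr_ge0// mulr_ge0// normr_ge0].
  rewrite nintD//; [|exact: measurable_funM|exact: measurable_funM
    |by move=> x; rewrite mulr_ge0// normr_ge0|by move=> x; rewrite mulr_ge0// normr_ge0].
  rewrite !nintZ//; try by move=> x; rewrite normr_ge0.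
  apply: (@le_trans _ _ (2%:E * (e / 8)%:E + ((2 * K)%:E * (e / (8 * K))%:E + (2 * K)%:E * (e / (8 * K))%:E))%E).
    apply: leeD; last by apply: leeD; apply: lee_wpmul2l; rewrite ?lee_fin.
    apply: lee_wpmul2l; rewrite ?lee_fin//; apply: le_trans hn.
    rewrite le_eqVlt; apply/orP; left; apply/eqP; apply: eq_integral => x _.
    by rewrite subr0 ger0_norm//; exact: g0.
  rewrite -!EFinM -!EFinD lee_fin.
  have -> : 2 * K * (e / (8 * K)) = e / 4 by field; rewrite gt_eqF.
  by clear -e0; lra.
exists f; split => //.
- have [|||_ h] := @nint_integrable _ _ _ (lam3 R) (fun x => cabs (A x - f x)) e.
  + exact: measurable_cabs.
  + by move=> x; exact: cabs_ge0.
  + apply: le_trans nb; apply: nint_le => //; first exact: measurable_cabs.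
    by move=> x; rewrite cabs_ge0/=; apply: le_trans (hb x); rewrite lerDl exprn_ge0// cabs_ge0.
  + exact: h.
- apply: (cL2_nint mAf _).2; apply: le_trans nb; apply: nint_le => //; first exact: measurable_sqr.
  move=> x; rewrite exprn_ge0 ?cabs_ge0//=; by apply: le_trans (hb x); rewrite lerDr cabs_ge0.
Unshelve. all: by end_near. Qed.

Lemma cvg_invn_scale (K : R) (a : nat -> R) : (forall n, 0 <= a n <= K * n.+1%:R^-1) ->
  a @ \oo --> (0 : R).
Proof.
move=> h; apply: (squeeze0 (b := fun n => K * n.+1%:R^-1)).
- by move=> n; have /andP[] := h n.
- by move=> n; have /andP[] := h n.
- by apply: cvg0Z; exact: cvg_harmonic.
Qed.

(** Fatou's lemma along Schwartz approximants, whose transforms converge pointwise and have their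
    norms given by [plancherel_schwartz]. The factor 2 stems from the crude bound on the norm of a
    sum; equality is recovered in [ft2_norm]. *)
Lemma inv_fourier_cL2 A : cL1 (lam3 R) A -> cL2 A ->
  cL2 (inv_fourier A) /\ N2 (inv_fourier A) <= 2 * N2 A.
Proof.
move=> A1 A2; have mI : cmeas (inv_fourier A : V -> R[i]) by apply: cmeas_inv_fourier; case: A1.
suff h (d : R) : 0 < d -> (nint (lam3 R) (fun x => cabs (inv_fourier A x) ^+ 2)%R <= (2 * N2 A + 2 * d)%:E)%E.
  split; first by have [] := cL2_nint mI (h 1 ltr01).
  apply/ler_addgt0Pr => e e0; have e2 : 0 < e / 2 by rewrite divr_gt0.
  by have [_ /le_trans] := cL2_nint mI (h _ e2); apply; rewrite mulrCA divff ?mulr1.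
move=> d0; have dn n : 0 < d * n.+1%:R^-1 by rewrite mulr_gt0// invr_gt0 ltr0n.
pose F n := projT1 (cid (density_L12 A1 A2 (dn n))).
have hF n : [/\ csch (F n), \int[lam3 R]_x cabs (A x - F n x) <= d * n.+1%:R^-1
     & N2 (fun x => A x - F n x) <= d * n.+1%:R^-1] by rewrite /F; case: cid.
have sF n : csch (F n) by case: (hF n).
apply: (@fatou_le _ _ _ (lam3 R) (fun n x => cabs (inv_fourier (F n) x) ^+ 2)).
- by move=> n; apply: measurable_sqr; apply: cmeas_csmooth; exact: csmooth_inv_fourier.
- exact: measurable_sqr.
- by move=> n x; rewrite exprn_ge0// cabs_ge0.
- by move=> x; rewrite exprn_ge0// cabs_ge0.
- apply: aeW => x.
  have c : (fun n => cabs (inv_fourier (F n) x)) @ \oo --> cabs (inv_fourier A x).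
    apply/subr_cvg0; apply/norm_cvg0P.
    apply: (@cvg_invn_scale (c0 R * d)) => n; rewrite normr_ge0/=.
    apply: (@le_trans _ _ (cabs (inv_fourier (fun xi => A xi - F n xi) x))).
      rewrite inv_fourierB//; last exact: csch_cL1.
      have h (z w : R[i]) : `|cabs z - cabs w| <= cabs (w - z).
        rewrite ler_norml; apply/andP; split.
          by rewrite lerNl opprB lerBlDr; have := cabsD (w - z) z; rewrite subrK.
        by rewrite lerBlDr; have := cabsD (z - w) w; rewrite subrK -(cabsN (z - w)) opprB.
      exact: h.
    apply: le_trans (inv_fourier_bound _ _) _; first by apply: cL1B => //; exact: csch_cL1.
    by rewrite -mulrA ler_wpM2l ?(ltW (c0_gt0 R))//; case: (hF n).
  by rewrite expr2; under eq_fun do rewrite expr2; exact: cvgM.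
- move=> n; rewrite nint_Rintegral; last by case: (csch_cL2 (csch_inv_fourier (sF n))).
  rewrite lee_fin -[X in X <= _]/(N2 _) (plancherel_schwartz (sF n)).
  have [h1 h2] := cL2D A2 (cL2N (cL2B A2 (csch_cL2 (sF n)))).
  have -> : N2 (F n) = N2 (fun x => A x + - (A x - F n x)).
    by congr N2; apply/funext => x; rewrite opprB addrC subrK.
  apply: le_trans h2 _; rewrite lerD2l N2N ler_pM2l//; have [_ _ /le_trans] := hF n; apply.
  by rewrite ler_piMr ?(ltW d0)// invf_le1 ?ltr0n// ler1n.
Qed.

Lemma cL1_opp A : cL1 (lam3 R) A -> cL1 (lam3 R) (fun x : V => A (- (x : E3))).
Proof. exact: (scales_cL1 ltr01 (scales3_opp R)). Qed.

(** With [B] Schwartz the identity is the multiplication formula. The error [D n] enters both sides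
    linearly and tends to 0 in L^2, hence also its transform, so both error pairings vanish in the
    limit. *)
Lemma parseval A B : cL1 (lam3 R) A -> cL2 A -> cL1 (lam3 R) B -> cL2 B ->
  cint (lam3 R) (fun x => inv_fourier A x * inv_fourier B x) = cint (lam3 R) (fun x : V => A x * B (- (x : E3))).
Proof.
move=> A1 A2 B1 B2.
have en n : 0 < (n.+1%:R^-1 : R) by rewrite invr_gt0 ltr0n.
pose F n := projT1 (cid (density_L12 B1 B2 (en n))).
have hF n : [/\ csch (F n), \int[lam3 R]_x cabs (B x - F n x) <= n.+1%:R^-1
     & N2 (fun x => B x - F n x) <= n.+1%:R^-1] by rewrite /F; case: cid.
have sF n : csch (F n) by case: (hF n).
pose D n x := B x - F n x.
have D1 n : cL1 (lam3 R) (D n) by apply: cL1B => //; exact: csch_cL1.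
have D2 n : cL2 (D n) by apply: cL2B => //; exact: csch_cL2.
have e n : cint (lam3 R) (fun x => inv_fourier A x * inv_fourier B x) - cint (lam3 R) (fun x : V => A x * B (- (x : E3))) =
   cint (lam3 R) (fun x => inv_fourier A x * inv_fourier (D n) x) - cint (lam3 R) (fun x : V => A x * D n (- (x : E3))).
  have -> : (fun x => inv_fourier A x * inv_fourier B x) =
     (fun x => inv_fourier A x * inv_fourier (D n) x + inv_fourier A x * inv_fourier (F n) x).
    apply/funext => x; rewrite -mulrDr -inv_fourierD//; last exact: csch_cL1.
    by congr (_ * inv_fourier _ x); apply/funext => y; rewrite /D subrK.
  have -> : (fun x : V => A x * B (- (x : E3))) = (fun x : V => A x * D n (- (x : E3)) + A x * F n (- (x : E3))).
    by apply/funext => x; rewrite -mulrDr /D subrK.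
  have FL2 := csch_cL2 (sF n).
  rewrite !cintD.
  - by rewrite (inv_fourier_mult_schwartz A1 (sF n)) opprD addrACA subrr addr0.
  - by apply: cL2M => //; exact: cL2_opp.
  - by apply: cL2M => //; exact: (cL2_opp FL2).
  - by apply: cL2M; [exact: (inv_fourier_cL2 A1 A2).1|exact: (inv_fourier_cL2 (D1 n) (D2 n)).1].
  - by apply: cL2M; [exact: (inv_fourier_cL2 A1 A2).1|exact/csch_cL2/csch_inv_fourier].
have c2 : (fun n => N2 (D n)) @ \oo --> (0 : R).
  apply: (@cvg_invn_scale 1) => n; rewrite N2_ge0 mul1r/=; by case: (hF n).
apply/eqP; rewrite -subr_eq0; apply/eqP/cabs_cvg0_unique.
apply: (squeeze0 (b := fun n => cabs (cint (lam3 R) (fun x => inv_fourier A x * inv_fourier (D n) x)) +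
   cabs (cint (lam3 R) (fun x : V => A x * D n (- (x : E3)))))).
- by move=> n; exact: cabs_ge0.
- by move=> n; rewrite (e n); exact: cabsB.
apply: cvg0D.
  apply: cint_small; first exact: (inv_fourier_cL2 A1 A2).1.
    by move=> n; exact: (inv_fourier_cL2 (D1 n) (D2 n)).1.
  apply: squeeze0 (cvg0Z 2 c2) => n; first exact: N2_ge0.
  exact: (inv_fourier_cL2 (D1 n) (D2 n)).2.
apply: cint_small => //; first by move=> n; exact: cL2_opp.
by under eq_fun do rewrite N2_opp//.
Qed.

End square_integrable_fourier.

(** * Completeness of L^2 *)

Section riesz_fischer.
Variable R : realType.
Notation E3 := (R * R * R)%type.
Notation V := (mspace R).
Implicit Types f g h : V -> R[i].

(** A limit that is measurable unconditionally: the upper limit, made real by [fine], which equals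
    the limit wherever the sequence converges. *)
Definition esup_lim (u : nat -> V -> R) (x : V) : R := fine (limn_esup (fun n => (u n x)%:E)).

Lemma measurable_esup_lim (u : nat -> V -> R) : (forall n, measurable_fun setT (u n)) ->
  measurable_fun setT (esup_lim u).
Proof.
move=> mu; apply: (measurableT_comp (@fine_measurable _ setT _)) => //.
by apply: measurable_fun_limn_esup => n; exact: measurable_RE.
Qed.

Lemma esup_limE (u : nat -> V -> R) x l : u ^~ x @ \oo --> l -> esup_lim u x = l.
Proof.
move=> c; have cE : (fun n => (u n x)%:E) @ \oo --> l%:E by apply: cvg_EFin => //; near=> n.
by rewrite /esup_lim (cvg_limn_einf_sup cE).
Unshelve. all: by end_near. Qed.

Lemma cvg_of_geometric (a : nat -> R) M : (forall k, `|a k.+1 - a k| <= M * 2^-1 ^+ k) -> cvgn a.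
Proof.
move=> h.
have h2 : `|2^-1 : R| < 1 by rewrite ger0_norm// invf_lt1//; lra.
have c : cvgn [normed series (fun k => a k.+1 - a k)].
  apply: (@series_le_cvg _ _ (geometric M 2^-1)) => [k|k|k|]; first exact: normr_ge0.
  - by apply: le_trans (h k); exact: normr_ge0.
  - exact: h.
  - exact: is_cvg_geometric_series.
have := normed_cvg c; rewrite /series /= => c'.
have -> : a = fun n => a 0%N + \sum_(0 <= k < n) (a k.+1 - a k).
  by apply/funext => n; rewrite telescope_sumr// addrC subrK.
by apply: is_cvgD => //; exact: is_cvg_cst.
Qed.

Lemma ae_bounded_series (d : nat -> V -> R) c : (forall k, measurable_fun setT (d k)) ->
  (forall k x, 0 <= d k x) -> (forall n, (nint (lam3 R) (fun x => \sum_(k < n) d k x)%R <= c%:E)%E) ->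
  {ae lam3 R, forall x, exists M, forall k, d k x <= M}.
Proof.
move=> md d0 hc; pose S n x := \sum_(k < n) d k x.
have mS n : measurable_fun setT (S n) by apply: measurable_sum.
have S0 n x : 0 <= S n x by apply: sumr_ge0.
have Sm x : {homo (fun n => (S n x)%:E) : n m / (n <= m)%N >-> (n <= m)%E}.
  move=> n m nm; rewrite lee_fin /S -(big_mkord xpredT (fun k => d k x)) -(big_mkord xpredT (fun k => d k x)).
  by rewrite (big_cat_nat (leq0n n) nm)/= lerDl sumr_ge0.
have mcv := @cvg_monotone_convergence _ _ _ (lam3 R) setT measurableT (fun n x => (S n x)%:E)
  (fun n => measurable_RE (mS n)) (fun n x _ => ltac:(rewrite lee_fin; exact: S0)) (fun x _ => Sm x).
have cS x : cvgn (fun n => (S n x)%:E) by apply: ereal_nondecreasing_is_cvgn; exact: Sm.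
have mL : measurable_fun setT (fun x => limn (fun n => (S n x)%:E)).
  apply: (@emeasurable_fun_cvg _ V R setT (fun n x => (S n x)%:E)); first by move=> n; exact: measurable_RE.
  by move=> x _; exact: cS.
have L0 x : (0 <= limn (fun n => (S n x)%:E))%E.
  by apply: lime_ge; [exact: cS|near=> n; rewrite lee_fin].
have iL : (lam3 R).-integrable setT (fun x => limn (fun n => (S n x)%:E)).
  apply/integrableP; split => //; apply: le_lt_trans (ltry c).
  under eq_integral do rewrite gee0_abs//.
  rewrite -(cvg_lim _ mcv)//; apply: lime_le; first by apply/cvg_ex; eexists; exact: mcv.
  by near=> n; exact: hc.
have := integrable_ae measurableT iL; apply: filterS => x /(_ I) fx.
exists (fine (limn (fun n => (S n x)%:E))) => k.
rewrite -lee_fin fineK//; apply: (@le_trans _ _ (S k.+1 x)%:E).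
  by rewrite lee_fin /S big_ord_recr /= lerDr sumr_ge0.
by apply: lime_ge; [exact: cS|near=> n; apply: Sm; near: n; exact: nbhs_infty_ge].
Unshelve. all: by end_near. Qed.

(** Along a subsequence the squared increments have integral at most 16^-k. Weighted by 4^k they
    remain summable in mean, so almost everywhere 4^k times the squared increment is bounded, the
    increments are O(2^-k), and the subsequence converges. *)
Lemma riesz_fischer (a : nat -> V -> R[i]) : (forall n, cL2 (a n)) ->
  (forall e, 0 < e -> exists N, forall n m, (N <= n)%N -> (N <= m)%N -> N2 (fun x => a n x - a m x) <= e) ->
  exists h, cL2 h /\ (fun n => N2 (fun x => a n x - h x)) @ \oo --> (0 : R).
Proof.
move=> ha ca; have e16 k : 0 < (16^-1 ^+ k : R) by rewrite exprn_gt0// invr_gt0.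
pose ph0 k := projT1 (cid (ca _ (e16 k))).
have hph0 k : forall n m, (ph0 k <= n)%N -> (ph0 k <= m)%N -> N2 (fun x => a n x - a m x) <= 16^-1 ^+ k.
  by rewrite /ph0; case: cid.
(* Summing the thresholds makes the sequence of indices monotone. *)
pose ph k := (\sum_(i < k.+1) ph0 i)%N.
have phge k : (ph0 k <= ph k)%N by rewrite /ph big_ord_recr /= leq_addl.
have phS k : (ph k <= ph k.+1)%N by rewrite /ph [X in (_ <= X)%N]big_ord_recr /= leq_addr.
have phm k j : (k <= j)%N -> (ph k <= ph j)%N.
  by elim: j => [|j IH]; [rewrite leqn0 => /eqP->|rewrite leq_eqVlt => /orP[/eqP->//|/IH/leq_trans]; apply].
pose b k := a (ph k).
have hb k : cL2 (b k) by exact: ha.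
have mb k : cmeas (b k) by case: (hb k).
pose d k (x : V) := 4 ^+ k * cabs (b k.+1 x - b k x) ^+ 2.
have md k : measurable_fun setT (d k).
  by apply: measurable_funM => //; apply: measurable_sqr; exact: cmeasB.
have d0 k x : 0 <= d k x by rewrite mulr_ge0 ?exprn_ge0 ?cabs_ge0.
have S2 n : (nint (lam3 R) (fun x => \sum_(k < n) d k x)%R <= (2 * (1 - 2^-1 ^+ n))%:E)%E.
  elim: n => [|n IH].
    rewrite expr0 subrr mulr0 /nint; under eq_integral do rewrite big_ord0.
    by rewrite integral0.
  have -> : nint (lam3 R) (fun x => \sum_(k < n.+1) d k x) =
     (nint (lam3 R) (fun x => \sum_(k < n) d k x)%R + nint (lam3 R) (d n))%E.
    rewrite -nintD//; [|by apply: measurable_sum|by move=> x; exact: sumr_ge0].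
    by apply: eq_integral => x _; rewrite big_ord_recr.
  have hn : (nint (lam3 R) (d n) <= (2^-1 ^+ n)%:E)%E.
    rewrite nintZ//; [|by apply: measurable_sqr; exact: cmeasB|by move=> x; rewrite exprn_ge0 ?cabs_ge0].
    have [_ iB] := cL2B (hb n.+1) (hb n).
    rewrite nint_Rintegral// -EFinM lee_fin.
    apply: (@le_trans _ _ (4 ^+ n * 16^-1 ^+ n)).
      by rewrite ler_pM2l ?exprn_gt0//; apply: hph0; [exact: leq_trans (phge n) (phS n)|exact: phge].
    rewrite -exprMn; have -> : 4 * 16^-1 = 4^-1 :> R by field.
    by rewrite lerXn2r ?nnegrE ?invr_ge0// lef_pV2 ?posrE// ler_nat.
  apply: le_trans (leeD IH hn) _; rewrite -EFinD lee_fin exprS; lra.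
have bd : {ae lam3 R, forall x, exists M, forall k, d k x <= M}.
  apply: (@ae_bounded_series d 2) => // n; apply: le_trans (S2 n) _.
  have p0 : 0 <= (2^-1 ^+ n : R) by rewrite exprn_ge0 ?invr_ge0.
  by rewrite lee_fin; lra.
pose h x : R[i] := esup_lim (fun k x => Re (b k x)) x +i* esup_lim (fun k x => Im (b k x)) x.
have mh : cmeas h.
  by split => /=; apply: measurable_esup_lim => k; case: (mb k).
have cb : {ae lam3 R, forall x, ccvg (b ^~ x) (h x)}.
  apply: filterS bd => x [M hM].
  have dk k : cabs (b k.+1 x - b k x) <= (M + 1) * 2^-1 ^+ k.
    have := hM k; rewrite /d => {}hM.
    have t0 : 0 < (2 ^+ k : R) by rewrite exprn_gt0.
    rewrite exprVn ler_pdivlMr//; move: hM (cabs_ge0 (b k.+1 x - b k x)).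
    have -> : 4 ^+ k = 2 ^+ k * 2 ^+ k :> R by rewrite -exprMn; congr (_ ^+ _); ring.
    move: (cabs _) (2 ^+ k) t0 => c t t0 hM c00.
    have := sqr_ge0 (c * t - 1); nra.
  apply: ccvg_ReIm.
    have c : cvgn (fun k => Re (b k x)).
      apply: (@cvg_of_geometric _ (M + 1)) => k; apply: le_trans (dk k).
      by rewrite -ReN -ReD; exact: Re_le_cabs.
    by rewrite /= (esup_limE (u := fun k x => Re (b k x)) c).
  have c : cvgn (fun k => Im (b k x)).
    apply: (@cvg_of_geometric _ (M + 1)) => k; apply: le_trans (dk k).
    by rewrite -ImN -ImD; exact: Im_le_cabs.
  by rewrite /= (esup_limE (u := fun k x => Im (b k x)) c).
(* Fatou's lemma in the second index converts the Cauchy estimate into a distance to the limit. *)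
have key k n : (ph k <= n)%N -> cL2 (fun x => a n x - h x) /\ N2 (fun x => a n x - h x) <= 16^-1 ^+ k.
  move=> kn; have man : cmeas (a n) by case: (ha n).
  apply: cL2_nint; first exact: cmeasB.
  apply: (@fatou_le _ _ _ (lam3 R) (fun m x => cabs (a n x - b (m + k)%N x) ^+ 2)).
  - by move=> m; apply: measurable_sqr; exact: cmeasB.
  - by apply: measurable_sqr; exact: cmeasB.
  - by move=> m x; rewrite exprn_ge0 ?cabs_ge0.
  - by move=> x; rewrite exprn_ge0 ?cabs_ge0.
  - apply: filterS cb => x cx.
    have c1 : (fun m => cabs (a n x - b (m + k)%N x)) @ \oo --> cabs (a n x - h x).
      apply/subr_cvg0; apply/norm_cvg0P.
      have cs : (fun m => cabs (b (m + k)%N x - h x)) @ \oo --> (0 : R).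
        by rewrite (cvg_shiftn k (fun m => cabs (b m x - h x))).
      apply: squeeze0 cs => m; first exact: normr_ge0.
      rewrite ler_norml; apply/andP; split.
        rewrite lerNl opprB lerBlDr; have := cabsD (b (m + k)%N x - h x) (a n x - b (m + k)%N x).
        by rewrite addrC addrA subrK.
      rewrite lerBlDr -cabsN opprB; have := cabsD (b (m + k)%N x - h x) (h x - a n x).
      by rewrite addrA subrK -(cabsN (h x - _)) opprB.
    by rewrite expr2; under eq_fun do rewrite expr2; exact: cvgM.
  - move=> m; have [_ iB] := cL2B (ha n) (hb (m + k)%N).
    rewrite nint_Rintegral// lee_fin; apply: hph0; first exact: leq_trans (phge k) kn.
    by apply: leq_trans (phge k) _; apply: phm; exact: leq_addl.
have hh : cL2 h.
  have [l _] := key 0%N (ph 0%N) (leqnn _).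
  have -> : h = fun x => a (ph 0%N) x - (a (ph 0%N) x - h x) by apply/funext => x; rewrite subKr.
  exact: cL2B.
exists h; split => //; apply/cvgrPdist_le => e e0.
have c16 : (fun k => 16^-1 ^+ k : R) @ \oo --> (0 : R) by apply: cvg_expr; rewrite ger0_norm// invf_lt1//; lra.
have [k hk] : exists k : nat, 16^-1 ^+ k <= e.
  move/cvgrPdist_le: c16 => /(_ _ e0) [k _ hk]; exists k; have := hk k (leqnn k).
  by rewrite sub0r normrN ger0_norm// ltW.
exists (ph k) => // n /= kn; rewrite sub0r normrN ger0_norm ?N2_ge0//.
exact: le_trans (key _ _ kn).2 hk.
Qed.

End riesz_fischer.

(** * The Fourier transform on L^2 and functions representing distributions *)

Section fourier_square_integrable.
Variable R : realType.
Notation E3 := (R * R * R)%type.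
Notation V := (mspace R).
Variables (psi : E3 -> R) (hpsi : lp_cutoff psi).
Implicit Types A B G H h : V -> R[i].

Lemma cL2_sub_trans A B H : cL2 A -> cL2 B -> cL2 H ->
  N2 (fun x => A x - B x) <= 2 * N2 (fun x => A x - H x) + 2 * N2 (fun x => B x - H x).
Proof.
move=> hA hB hH; apply: le_trans (N2B (cL2B hA hH) (cL2B hB hH)).
by rewrite le_eqVlt; apply/orP; left; apply/eqP; congr N2; apply/funext => x; rewrite opprB addrA subrK.
Qed.

Lemma cint_cvg2 (a b : nat -> V -> R[i]) A B : (forall n, cL2 (a n)) -> (forall n, cL2 (b n)) ->
  cL2 A -> cL2 B -> (fun n => N2 (fun x => a n x - A x)) @ \oo --> (0 : R) ->
  (fun n => N2 (fun x => b n x - B x)) @ \oo --> (0 : R) ->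
  ccvg (fun n => cint (lam3 R) (fun x => a n x * b n x)) (cint (lam3 R) (fun x => A x * B x)).
Proof.
move=> ha hb hA hB ca cb.
have dA n := cL2B (ha n) hA; have dB n := cL2B (hb n) hB.
have e n : cint (lam3 R) (fun x => a n x * b n x) - cint (lam3 R) (fun x => A x * B x) =
   cint (lam3 R) (fun x => A x * (b n x - B x)) + cint (lam3 R) (fun x => B x * (a n x - A x)) +
   cint (lam3 R) (fun x => (a n x - A x) * (b n x - B x)).
  rewrite -cintB; [|exact: cL2M|exact: cL2M].
  rewrite -cintD; [|exact: cL2M|exact: cL2M]; rewrite -cintD; [|by apply: cL1D; exact: cL2M|exact: cL2M].
  by congr (cint _ _); apply/funext => x; ring.
apply: (squeeze0 (b := fun n => (cabs (cint (lam3 R) (fun x => A x * (b n x - B x))) +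
   cabs (cint (lam3 R) (fun x => B x * (a n x - A x)))) +
   (1 * N2 (fun x => a n x - A x) + 1^-1 * N2 (fun x => b n x - B x)))).
- by move=> n; exact: cabs_ge0.
- move=> n; rewrite e; apply: le_trans (cabsD _ _) _; apply: lerD; first exact: cabsD.
  exact: cint_amgm.
apply: cvg0D; first by apply: cvg0D; exact: cint_small.
by apply: cvg0D; exact: cvg0Z.
Qed.

(* [h] is the L^2 inverse Fourier transform of [G]. *)
Definition ft2 G h := [/\ cL2 G, cL2 h &
  (fun n => N2 (fun x => inv_fourier (trunc n G) x - h x)) @ \oo --> (0 : R)].

Lemma cL2_inv_fourier_trunc n G : cL2 G -> cL2 (inv_fourier (trunc n G)).
Proof. by move=> hG; exact: (inv_fourier_cL2 hpsi (cL1_trunc hpsi n hG) (cL2_trunc n hG)).1. Qed.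

Lemma inv_fourierB_fun A B : cL1 (lam3 R) A -> cL1 (lam3 R) B ->
  (fun x => inv_fourier A x - inv_fourier B x) = inv_fourier (fun x => A x - B x).
Proof. by move=> hA hB; apply/funext => x; rewrite inv_fourierB. Qed.

Lemma ft2_exists G : cL2 G -> exists h, ft2 G h.
Proof.
move=> hG; have [|h [hh c]] := @riesz_fischer R (fun n => inv_fourier (trunc n G)) (fun n => cL2_inv_fourier_trunc n hG).
  move=> e e0; have e8 : 0 < e / 8 by rewrite divr_gt0.
  move: (N2_trunc hG) => /cvgrPdist_le /(_ _ e8) [N _ hN]; exists N => n m nN mN.
  have := hN n nN; have := hN m mN; rewrite !sub0r !normrN !ger0_norm ?N2_ge0// => h1 h2.
  rewrite inv_fourierB_fun; try exact: (cL1_trunc hpsi).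
  apply: le_trans (inv_fourier_cL2 hpsi _ _).2 _; first by apply: cL1B; exact: (cL1_trunc hpsi).
    by apply: cL2B; exact: cL2_trunc.
  have := cL2_sub_trans (cL2_trunc n hG) (cL2_trunc m hG) hG; lra.
by exists h; split.
Qed.

Lemma N2_opp_trunc n G : (fun x : V => trunc n G (- (x : E3))) = trunc n (fun x : V => G (- (x : E3))).
Proof. by apply/funext => x; rewrite /trunc enormN. Qed.

Lemma ft2_parseval G h G' h' : ft2 G h -> ft2 G' h' ->
  cint (lam3 R) (fun x => h x * h' x) = cint (lam3 R) (fun x : V => G x * G' (- (x : E3))).
Proof.
move=> [hG hh ch] [hG' hh' ch'].
apply: (@ccvg_unique _ (fun n => cint (lam3 R) (fun x => inv_fourier (trunc n G) x * inv_fourier (trunc n G') x))).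
  by apply: cint_cvg2 => // n; exact: cL2_inv_fourier_trunc.
have -> : (fun n => cint (lam3 R) (fun x => inv_fourier (trunc n G) x * inv_fourier (trunc n G') x)) =
    (fun n => cint (lam3 R) (fun x : V => trunc n G x * trunc n (fun x : V => G' (- (x : E3))) x)).
  apply/funext => n; rewrite (parseval hpsi); try exact: (cL1_trunc hpsi); try exact: cL2_trunc.
  by rewrite -N2_opp_trunc.
have hG'o := cL2_opp hG'.
by apply: cint_cvg2 => //; try (by move=> n; exact: cL2_trunc); exact: N2_trunc.
Qed.

Lemma ft2_L1 G : cL1 (lam3 R) G -> cL2 G -> ft2 G (inv_fourier G).
Proof.
move=> G1 G2; have [l _] := inv_fourier_cL2 hpsi G1 G2; split => //.
apply: squeeze0 (cvg0Z 2 (N2_trunc G2)) => n; first exact: N2_ge0.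
have t1 := cL1_trunc hpsi n G2; rewrite inv_fourierB_fun//.
exact: (inv_fourier_cL2 hpsi (cL1B t1 G1) (cL2B (cL2_trunc n G2) G2)).2.
Qed.

Lemma ft2_conj G h : ft2 G h -> ft2 (fun x : V => (G (- (x : E3)))^*) (fun x => (h x)^*).
Proof.
move=> [hG hh c]; split; [exact: cL2_conj (cL2_opp hG)|exact: cL2_conj|].
have -> // : (fun n => N2 (fun x => inv_fourier (trunc n (fun x : V => (G (- (x : E3)))^*)) x - (h x)^*)) =
   (fun n => N2 (fun x => inv_fourier (trunc n G) x - h x)).
apply/funext => n.
have -> : trunc n (fun x : V => (G (- (x : E3)))^*) = fun x => (trunc n G (- (x : E3)))^*.
  by apply/funext => x; rewrite /trunc enormN; case: ifP => // _; apply: ReIm_eq; rewrite //= oppr0.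
have e x : inv_fourier (fun x => (trunc n G (- (x : E3)))^*) x - (h x)^* = (inv_fourier (trunc n G) x - h x)^*.
  by rewrite rmorphB /= conj_inv_fourier//; exact: (cL1_trunc hpsi).
by rewrite /N2 /Rintegral; congr fine; apply: eq_integral => x _; rewrite e cabs_conj.
Qed.

Lemma ft2_norm G h : ft2 G h -> N2 h = N2 G.
Proof.
move=> hf; have [hG hh _] := hf; have := ft2_parseval hf (ft2_conj hf).
under [X in _ = cint _ X]eq_fun do rewrite opprK.
by rewrite !cint_sqr// => /(congr1 (@Re R)).
Qed.

Lemma ft2_mult G h (f : E3 -> R[i]) : ft2 G h -> csch f ->
  cint (lam3 R) (fun x => h x * f x) = cint (lam3 R) (fun x => G x * inv_fourier f x).
Proof.
move=> hf sf; have sF := csch_fourier sf.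
have := ft2_parseval hf (ft2_L1 (csch_cL1 sF) (csch_cL2 sF)); rewrite (inv_fourierK sf) => ->.
by congr (cint _ _); apply/funext => x; rewrite fourierE opprK.
Qed.

Lemma lint3_dom (g : E3 -> R[i]) (h : V -> R) : cmeas (g : V -> R[i]) ->
  (lam3 R).-integrable setT (fun x => (h x)%:E) -> (forall x, cabs (g x) <= 1 + h x) ->
  locally_integrable3 g.
Proof.
move=> mg ih hb r; have i1 := integrable_indic_eball hpsi r; have me := measurable_eball (R := R) r.
have i2 := integrable_RD i1 (integrable_abse ih).
have P (p : R[i] -> R) : measurable_fun setT (fun x : V => p (g x)) -> (forall z, `|p z| <= cabs z) ->
    (lam3 R).-integrable (eball r) (fun x => (p (g x))%:E).
  move=> mp pb; apply: (@le_integrable _ _ _ _ _ me _ (fun x : V => (\1_(eball r) x + `|h x|)%:E)).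
  - by apply/measurable_EFinP; exact: measurable_funS mp.
  - move=> x rx; rewrite /= lee_fin indicE mem_set//; apply: le_trans (pb _) _.
    by apply: le_trans (hb x) _; rewrite (le_trans _ (ler_norm _))// lerD2l ler_norm.
  - exact: (integrableS measurableT me (@subsetT _ _) i2).
by split; apply: P; [case: mg|exact: Re_le_cabs|case: mg|exact: Im_le_cabs].
Qed.

Lemma cL2_loc (g : E3 -> R[i]) : cL2 g -> locally_integrable3 g.
Proof.
move=> [mg ig]; apply: (lint3_dom mg ig) => x.
by have := sqr_ge0 (cabs (g x) - 2^-1); nra.
Qed.

Lemma cL1_loc (g : E3 -> R[i]) : cL1 (lam3 R) g -> locally_integrable3 g.
Proof. by move=> [mg ig]; apply: (lint3_dom mg ig) => x; rewrite lerDr. Qed.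

Lemma lint3_comb (f g : E3 -> R[i]) (a b : R) : locally_integrable3 f -> locally_integrable3 g ->
  locally_integrable3 (fun x => a%:C * f x + b%:C * g x).
Proof.
move=> hf hg r; have [fr fi] := hf r; have [gr gi] := hg r; have me := measurable_eball (R := R) r.
split.
  have := integrableD me (integrableZl me a fr) (integrableZl me b gr).
  by congr (_.-integrable _ _); apply/funext => x; rewrite -!EFinM -EFinD !ReD !ReM /= !mul0r !subr0.
have := integrableD me (integrableZl me a fi) (integrableZl me b gi).
by congr (_.-integrable _ _); apply/funext => x; rewrite -!EFinM -EFinD !ImD !ImM /= !mul0r !addr0.
Qed.

Lemma lint3D (f g : E3 -> R[i]) : locally_integrable3 f -> locally_integrable3 g ->
  locally_integrable3 (fun x => f x + g x).
Proof.
move=> hf hg; have := lint3_comb 1 1 hf hg.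
by congr locally_integrable3; apply/funext => x; rewrite !mul1r.
Qed.

Lemma lint3B (f g : E3 -> R[i]) : locally_integrable3 f -> locally_integrable3 g ->
  locally_integrable3 (fun x => f x - g x).
Proof.
move=> hf hg; have := lint3_comb 1 (-1) hf hg.
by congr locally_integrable3; apply/funext => x; rewrite mul1r rmorphN1 mulN1r.
Qed.

Lemma lint3_cmeas (g : E3 -> R[i]) : locally_integrable3 g -> cmeas (g : V -> R[i]).
Proof.
move=> lg.
have P (p : V -> R) : (forall r, (lam3 R).-integrable (eball r) (fun x => (p x)%:E)) -> measurable_fun setT p.
  move=> ip; apply: (@measurable_fun_cvg _ _ _ setT (fun n => p \_ (eball n%:R : set V))).
    move=> n; apply/measurable_restrict => //; first exact: measurable_eball.
    rewrite setTI; have /measurable_int /measurable_EFinP := ip n%:R; exact.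
  move=> x _; apply: cvg_near_cst; have [m hm] := enorm_le_nat x.
  near=> n; rewrite /patch mem_set//= /eball /=; apply: le_trans hm _.
  by rewrite ler_nat; near: n; exact: nbhs_infty_ge.
by split; apply: P => r; case: (lg r).
Unshelve. all: by end_near. Qed.

Lemma represents_ae (T : dist R) (f g : E3 -> R[i]) : represents T f -> represents T g ->
  {ae lam3 R, forall x : V, f x = g x}.
Proof.
move=> [lf hf] [lg hg].
suff H : {ae lam3 R, forall x : V, f x - g x = 0}.
  by apply: filterS H => x /eqP; rewrite subr_eq0 => /eqP.
apply: (lint3_unique hpsi (lint3B lf lg)) => t tt; under eq_fun do rewrite mulrBl.
have ct : cpart (fun x => (t x)%:C) (@test_function R).
  by split => //=; split; [exact: smooth_cst|exists 0].
rewrite cintB; try exact: lint3_test.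
have := hf _ ct; rewrite hg// /dist_of !cintegralE => ->; exact: subrr.
Qed.

Lemma fun_of_represents (T : dist R) (g : E3 -> R[i]) : represents T g ->
  represents T (fun_of T) /\ {ae lam3 R, forall x : V, fun_of T x = g x}.
Proof.
move=> hg; have hf : represents T (fun_of T) by exact: (xgetPex _ (ex_intro _ g hg)).
by split => //; exact: represents_ae hf hg.
Qed.

Lemma ft2_represents G h : ft2 G h -> represents (dinv_fourier (dist_of G)) h.
Proof.
move=> hf; have [_ hh _] := hf; split; first exact: cL2_loc.
move=> f tf; rewrite /dinv_fourier /dist_of !cintegralE.
by rewrite (ft2_mult hf (csch_test tf)).
Qed.

End fourier_square_integrable.

(** * Trilinear integrals over xi + eta + zeta = 0 *)

Section product_maps.
Context d (T : measurableType d) (R : realType) (m : {sigma_finite_measure set T -> \bar R}).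

Lemma scales_swap : scales (sfprod m m) 1 (fun z => (z.2, z.1)).
Proof.
have ms : measurable_fun setT (fun z : T * T => (z.2, z.1)).
  by apply/measurable_fun_pairP; split; [exact: measurable_snd|exact: measurable_fst].
split => // k mk k0; rewrite mul1e.
rewrite (fubini_tonelli1 (fun z => k (z.2, z.1)))//; last exact: (measurableT_comp mk ms).
by rewrite fubini_tonelli2.
Qed.

Lemma scales_shear (p : T -> T -> T) : measurable_fun setT (fun z : T * T => (z.1, p z.1 z.2)) ->
  (forall x, scales m 1 (p x)) -> scales (sfprod m m) 1 (fun z => (z.1, p z.1 z.2)).
Proof.
move=> mp hp; split => // k mk k0; rewrite mul1e.
rewrite (fubini_tonelli1 (fun z => k (z.1, p z.1 z.2)))//; last exact: (measurableT_comp mk mp).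
rewrite fubini_tonelli1//; apply: eq_integral => x _; rewrite /fubini_F /=.
have [_ /(_ (fun y => k (x, y)))] := hp x; rewrite mul1e; apply => //.
exact: (measurableT_comp mk (measurable_pair1 _)).
Qed.

End product_maps.

Section trilinear_integrability.
Variable R : realType.
Notation E3 := (R * R * R)%type.
Notation V := (mspace R).
Notation VV := (V * V)%type.
Variables (psi : E3 -> R) (hpsi : lp_cutoff psi).
Local Transparent lam33.

Lemma measurable_addV d (T : measurableType d) (p q : T -> V) :
  measurable_fun setT p -> measurable_fun setT q ->
  measurable_fun setT (fun z => ((p z : E3) + (q z : E3)) : V).
Proof.
move=> mp mq; apply/measurable_fun_pairP; split; first apply/measurable_fun_pairP; try split.
- by apply: measurable_funD; apply: (measurableT_comp (@measurable_c1 R)).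
- by apply: measurable_funD; apply: (measurableT_comp (@measurable_c2 R)).
- by apply: measurable_funD; apply: (measurableT_comp (@measurable_c3 R)).
Qed.

Lemma measurable_oppV d (T : measurableType d) (p : T -> V) :
  measurable_fun setT p -> measurable_fun setT (fun z => (- (p z : E3)) : V).
Proof. by move=> mp; exact: (measurableT_comp (scales3_opp R).1 mp). Qed.

(** A point of xi + eta + zeta = 0 is coded by (xi, eta), and this is zeta. The maps [swap] and
    [refl] exchange xi with eta and eta with zeta; they preserve the measure and generate all
    permutations. *)
Definition third (z : VV) : V := - (z.1 : E3) - (z.2 : E3).

Lemma measurable_third : measurable_fun setT third.
Proof.
by apply: measurable_addV; apply: measurable_oppV; [exact: measurable_fst|exact: measurable_snd].
Qed.

Definition swap (z : VV) : VV := (z.2, z.1).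
Definition refl (z : VV) : VV := (z.1, third z).

Lemma third_swap z : third (swap z) = third z.
Proof. by rewrite /third addrC. Qed.

Lemma third_refl z : third (refl z) = z.2.
Proof. by rewrite /third /= opprB opprK addrCA addNr addr0. Qed.

Lemma scales_swap33 : scales (lam33 R) 1 swap.
Proof. exact: scales_swap. Qed.

Lemma scales_refl33 : scales (lam33 R) 1 refl.
Proof.
have mr : measurable_fun setT refl.
  by apply/measurable_fun_pairP; split; [exact: measurable_fst|exact: measurable_third].
exact: (@scales_shear _ V R (lam3 R) (fun x y => (- (x : E3) - (y : E3)) : V) mr (fun x => scales3_refl (- (x : E3)))).
Qed.

Lemma integrable_tensor33 (f g : V -> R) :
  (lam3 R).-integrable setT (fun x => (f x)%:E) -> (lam3 R).-integrable setT (fun x => (g x)%:E) ->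
  (lam33 R).-integrable setT (fun z => (f z.1 * g z.2)%:E).
Proof. exact: integrable_tensor. Qed.

Lemma integrable_swap (h : VV -> R) : (lam33 R).-integrable setT (fun z => (h z)%:E) ->
  (lam33 R).-integrable setT (fun z => (h (swap z))%:E).
Proof. exact: (scales_integrable ltr01 scales_swap33). Qed.

Lemma integrable_refl (h : VV -> R) : (lam33 R).-integrable setT (fun z => (h z)%:E) ->
  (lam33 R).-integrable setT (fun z => (h (refl z))%:E).
Proof. exact: (scales_integrable ltr01 scales_refl33). Qed.

Lemma integrable_le d (T : measurableType d) (mu : {measure set T -> \bar R}) (f h : T -> R) :
  measurable_fun setT f -> (forall x, `|f x| <= h x) ->
  mu.-integrable setT (fun x => (h x)%:E) -> mu.-integrable setT (fun x => (f x)%:E).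
Proof.
move=> mf hf ih; apply: (le_integrable measurableT _ _ ih); first exact: measurable_RE.
by move=> x _; rewrite /= lee_fin; exact: le_trans (hf x) (ler_norm _).
Qed.

Lemma integrable_meas (f : V -> R) : (lam3 R).-integrable setT (fun x => (f x)%:E) -> measurable_fun setT f.
Proof. by move=> /measurable_int /measurable_EFinP. Qed.

Lemma measurable_tri (a b c : V -> R) : measurable_fun setT a -> measurable_fun setT b ->
  measurable_fun setT c -> measurable_fun setT (fun z : VV => a z.1 * b z.2 * c (third z)).
Proof.
move=> ma mb mc; apply: measurable_funM; last exact: (measurableT_comp mc measurable_third).
by apply: measurable_funM; [exact: (measurableT_comp ma measurable_fst)|exact: (measurableT_comp mb measurable_snd)].
Qed.

Definition sqi (a : V -> R) := measurable_fun setT a /\ (lam3 R).-integrable setT (fun x => (a x ^+ 2)%:E).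

(** Since |b c| <= b^2 + c^2, the product splits into two tensor products, one in the variables (xi,
    eta) and one in (xi, zeta). *)
Lemma tri_integrable1 (a b c : V -> R) : (forall x, 0 <= a x) ->
  (lam3 R).-integrable setT (fun x => (a x)%:E) -> sqi b -> sqi c ->
  (lam33 R).-integrable setT (fun z => (a z.1 * b z.2 * c (third z))%:E).
Proof.
move=> a0 ia [mb ib] [mc ic].
have i1 := integrable_tensor33 ia ib; have i2 := integrable_refl (integrable_tensor33 ia ic).
apply: (integrable_le _ _ (integrable_RD i1 i2)); first by apply: measurable_tri => //; exact: integrable_meas.
move=> z /=; rewrite -mulrA -mulrDr !normrM (ger0_norm (a0 _)) ler_wpM2l//.
rewrite -(real_normK (num_real (b _))) -(real_normK (num_real (c _))).
by have := @mul_amgm _ `|b z.2| `|c (third z)| 1 ltr01; rewrite invr1 !mul1r.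
Qed.

Lemma tri_integrable2 (a b c : V -> R) : (forall x, 0 <= b x) ->
  (lam3 R).-integrable setT (fun x => (b x)%:E) -> sqi a -> sqi c ->
  (lam33 R).-integrable setT (fun z => (a z.1 * b z.2 * c (third z))%:E).
Proof.
move=> b0 ib qa qc; have := integrable_swap (tri_integrable1 b0 ib qa qc).
by congr (_.-integrable _ _); apply/funext => z; rewrite third_swap /= [b _ * _]mulrC.
Qed.

Lemma tri_integrable3 (a b c : V -> R) : (forall x, 0 <= c x) ->
  (lam3 R).-integrable setT (fun x => (c x)%:E) -> sqi a -> sqi b ->
  (lam33 R).-integrable setT (fun z => (a z.1 * b z.2 * c (third z))%:E).
Proof.
move=> c0 ic qa qb; have := integrable_refl (tri_integrable2 c0 ic qa qb).
by congr (_.-integrable _ _); apply/funext => z; rewrite third_refl /= mulrAC.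
Qed.

(** The volume stays symbolic; the estimates rest on its scaling by r^3. *)
Definition ball_volume : R := \int[lam3 R]_x \1_(eball 1) x.

Lemma ball_volume_ge0 : 0 <= ball_volume.
Proof. by apply: Rintegral_ge0 => x _; rewrite indicE. Qed.

Lemma nint_eball (r : R) : 0 < r ->
  nint (lam3 R) (fun x : V => \1_(eball r) x : R) = (r ^+ 3 * ball_volume)%:E.
Proof.
move=> r0; have i1 := integrable_indic_eball hpsi 1.
have ri : 0 < r^-1 by rewrite invr_gt0.
have r3 : 0 < r^-1 ^- 3 by rewrite invr_gt0 exprn_gt0.
have := scales_integral r3 (scales3_mul ri) i1.
have -> : (\int[lam3 R]_x (\1_(eball 1) x)%:E = ball_volume%:E)%E.
  by rewrite /ball_volume -nint_Rintegral.
rewrite -EFinM exprVn invrK => <-; apply: eq_integral => x _; congr (_%:E).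
rewrite !indicE; congr (_%:R); congr nat_of_bool; apply/idP/idP; rewrite !inE /eball /= enormZ (gtr0_norm ri).
  by move=> h; rewrite ler_pdivrMl// mulr1.
by rewrite ler_pdivrMl// mulr1.
Qed.

(** The exponent 5/6 at work. With a <= b <= 2 c, the factor a x is at most b^(1/6) X, while y and z
    each lose b^(-5/6); together they leave b^(-3/2). In the AM-GM inequality this becomes the b^-3
    that compensates the volume of the ball |xi| <= |eta|. *)
Lemma kernel_amgm (a b c x y z : R) : 0 < a -> 0 <= x -> 0 <= y -> 0 <= z -> a <= b -> b <= 2 * c ->
  a * x * y * z <= (a `^ (5 / 6) * x) ^+ 2 * (c `^ (5 / 6) * z) ^+ 2 + (b `^ (5 / 6) * y) ^+ 2 / b ^+ 3.
Proof.
move=> a0 x0 y0 z0 ab bc; have b0 : 0 < b by exact: lt_le_trans ab.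
have c0 : 0 < c by rewrite -(pmulr_rgt0 c (ltr0n R 2)) (lt_le_trans b0).
set X := a `^ (5 / 6) * x; set Y := b `^ (5 / 6) * y; set Z := c `^ (5 / 6) * z.
have p (t : R) (e : R) : 0 < t -> t `^ e != 0 by move=> t0; rewrite gt_eqF// powR_gt0.
have hx : a * x <= b `^ (1 / 6) * X.
  have -> : a * x = a `^ (1 / 6) * X.
    rewrite /X mulrA -powRD; last by rewrite (gt_eqF a0) implybT.
    have -> : 1 / 6 + 5 / 6 = 1 :> R by field.
    by rewrite powRr1// ltW.
  rewrite ler_wpM2r ?mulr_ge0 ?powR_ge0//; apply: ge0_ler_powR => //; rewrite ?nnegrE ?(ltW a0) ?(ltW b0)//.
have hy : y = b `^ (- (5 / 6)) * Y.
  by rewrite /Y mulrA powRN mulVf ?mul1r// p.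
have hz : z <= 2 * b `^ (- (5 / 6)) * Z.
  have -> : z = c `^ (- (5 / 6)) * Z by rewrite /Z mulrA powRN mulVf ?mul1r// p.
  rewrite ler_wpM2r ?mulr_ge0 ?powR_ge0// !powRN.
  rewrite ler_pdivlMr ?powR_gt0// ler_pdivrMl ?powR_gt0//.
  apply: (@le_trans _ _ ((2 * c) `^ (5 / 6))).
    by rewrite ge0_ler_powR ?nnegrE ?divr_ge0// ?mulr_ge0// ltW.
  rewrite powRM ?(ltW c0)// mulrC ler_wpM2l ?powR_ge0//.
  rewrite -[leRHS]powRr1// ler_powR ?ler1n// ler_pdivrMr// mul1r ler_nat//.
set B := b `^ (- (3 / 2)).
have X0 : 0 <= X by rewrite mulr_ge0 ?powR_ge0.
have Y0 : 0 <= Y by rewrite mulr_ge0 ?powR_ge0.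
have Z0 : 0 <= Z by rewrite mulr_ge0 ?powR_ge0.
have eB : b `^ (1 / 6) * b `^ (- (5 / 6)) * b `^ (- (5 / 6)) = B.
  rewrite -!powRD ?(gt_eqF b0) ?implybT//; congr (b `^ _); by field.
have B2 : B ^+ 2 = (b ^+ 3)^-1.
  rewrite -powR_mulrn ?powR_ge0// -powRrM; have -> : - (3 / 2) * 2%:R = - 3%:R :> R by field.
  by rewrite powRN powR_mulrn// ltW.
apply: (@le_trans _ _ (2 * (X * Z) * (B * Y))).
  apply: (@le_trans _ _ ((b `^ (1 / 6) * X) * (b `^ (- (5 / 6)) * Y) * (2 * b `^ (- (5 / 6)) * Z))).
    rewrite {1}hy; apply: ler_pM => //; last first.
      by rewrite ler_wpM2r// mulr_ge0 ?powR_ge0.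
    by rewrite !mulr_ge0 ?powR_ge0// ltW.
  by rewrite -eB le_eqVlt; apply/orP; left; apply/eqP; ring.
have -> : X ^+ 2 * Z ^+ 2 + Y ^+ 2 / b ^+ 3 = (X * Z) ^+ 2 + (B * Y) ^+ 2.
  have -> : (B * Y) ^+ 2 = B ^+ 2 * Y ^+ 2 by rewrite exprMn.
  by rewrite B2 [X in _ = X + _]exprMn; congr (_ + _); rewrite mulrC.
have := sqr_ge0 (X * Z - B * Y); clearbody X Y Z B; move: (X * Z) (B * Y) => u v; nra.
Qed.

Lemma measurable_enorm : measurable_fun setT (fun x : V => enorm (x : E3)).
Proof. by apply: measurable_continuous3; exact: continuous_enorm. Qed.

Lemma measurable_fle d (T : measurableType d) (f g : T -> R) : measurable_fun setT f ->
  measurable_fun setT g -> measurable_fun setT (fun x => ((f x <= g x)%R)%:R : R).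
Proof.
move=> mf mg; set E := [set x | 0 <= g x - f x].
have mE : measurable E.
  have -> : E = (fun x => g x - f x) @^-1` `[0, +oo[%classic by apply/seteqP; split => x /=; rewrite in_itv/= andbT.
  by rewrite -[X in measurable X]setTI; exact: measurable_funB.
have -> : (fun x => ((f x <= g x)%R)%:R : R) = \1_E.
  apply/funext => x; rewrite indicE; congr (_%:R); congr nat_of_bool.
  by apply/idP/idP; rewrite inE /E /= subr_ge0.
exact: measurable_indic.
Qed.

Definition kernel2 (X : V -> R) (z : VV) : R :=
  X z.2 ^+ 2 / enorm (z.2 : E3) ^+ 3 * ((enorm (z.1 : E3) <= enorm (z.2 : E3))%R)%:R.

Lemma kernel2_ge0 X z : 0 <= kernel2 X z.
Proof.
rewrite /kernel2; apply: mulr_ge0; last exact: ler0n.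
by apply: divr_ge0; [exact: sqr_ge0|apply: exprn_ge0; exact: enorm_ge0].
Qed.

(** Integrating first over xi in the ball |xi| <= |eta| produces |eta|^3 times the unit volume,
    which cancels the denominator and leaves the integral of X^2. *)
Lemma integrable_kernel2 X : sqi X -> (lam33 R).-integrable setT (fun z => (kernel2 X z)%:E).
Proof.
move=> [mX iX].
have m1 : measurable_fun setT (fun z : VV => enorm (z.1 : E3)) by exact: (measurableT_comp measurable_enorm measurable_fst).
have m2 : measurable_fun setT (fun z : VV => enorm (z.2 : E3)) by exact: (measurableT_comp measurable_enorm measurable_snd).
have mk : measurable_fun setT (kernel2 X).
  apply: measurable_funM; last exact: measurable_fle.
  apply: (measurableT_comp (f := fun x : V => X x ^+ 2 / enorm (x : E3) ^+ 3)) measurable_snd.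
  apply: measurable_funM; first exact: measurable_funX.
  have -> : (fun x : V => (enorm (x : E3) ^+ 3)^-1) = (fun x : V => enorm (x : E3) `^ (- 3%:R)).
    apply/funext => x; rewrite powRN powR_mulrn ?enorm_ge0//.
  exact: (measurableT_comp (measurable_powR (- 3%:R)) measurable_enorm).
have k0 := kernel2_ge0 X.
have [|//] := @nint_integrable _ _ _ (lam33 R) (kernel2 X) (ball_volume * \int[lam3 R]_x (X x ^+ 2)) mk k0.
rewrite /nint tonelli33_2//.
have iv := integrable_RZ ball_volume iX.
rewrite -RintegralZl// -(nint_Rintegral iv).
apply: ge0_le_integral => //.
- by move=> y _; apply: integral_ge0 => x _; rewrite lee_fin.
- have := @measurable_fun_fubini_tonelli_G _ _ _ _ _ (lam3 R) (fun z => (kernel2 X z)%:E) (measurable_RE mk).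
  by apply => z; rewrite lee_fin.
- by case/integrableP: iv.
move=> y _; have [y0|y0] := eqVneq (enorm (y : E3)) 0.
  under eq_integral do rewrite /kernel2 /= y0 expr0n /= invr0 mulr0 mul0r.
  by rewrite integral0 lee_fin mulr_ge0 ?ball_volume_ge0// sqr_ge0.
have yp : 0 < enorm (y : E3) by rewrite lt_neqAle eq_sym y0 enorm_ge0.
have -> : (\int[lam3 R]_x (kernel2 X (x, y))%:E =
   nint (lam3 R) (fun x : V => (X y ^+ 2 / enorm (y : E3) ^+ 3) * \1_(eball (enorm (y : E3))) x)%R)%E.
  apply: eq_integral => x _; congr (_%:E); rewrite /kernel2 /= indicE; congr (_ * _%:R); congr nat_of_bool.
  by apply/idP/idP; rewrite inE.
rewrite nintZ//; last 2 first.
- by apply: measurable_indic; exact: measurable_eball.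
- by apply: divr_ge0; [exact: sqr_ge0|apply: exprn_ge0; exact: enorm_ge0].
rewrite nint_eball// -EFinM lee_fin le_eqVlt; apply/orP; left; apply/eqP.
by field; rewrite gt_eqF.
Qed.

Definition min3 (z : VV) : R :=
  Num.min (Num.min (enorm (z.1 : E3)) (enorm (z.2 : E3))) (enorm (third z : E3)).

(** When the smallest frequency plays the role of [a], the triangle inequality gives b <= 2 c for
    the other two in suitable order, and [kernel_amgm] applies. [K] and its images under [swap] and
    under [swap] after [refl] cover the three positions of the minimum. *)
Lemma integrable_min3 (w : V -> R) : measurable_fun setT w -> (forall x, 0 <= w x) -> w 0 = 0 ->
  sqi (fun x : V => enorm (x : E3) `^ (5 / 6) * w x) ->
  (lam33 R).-integrable setT (fun z => (min3 z * (w z.1 * w z.2 * w (third z)))%:E).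
Proof.
move=> mw w0 w00 qX; set X := (fun x : V => _) in qX; have [mX iX] := qX.
pose K (z : VV) := X z.1 ^+ 2 * X (third z) ^+ 2 + kernel2 X z.
have iK : (lam33 R).-integrable setT (fun z => (K z)%:E).
  apply: integrable_RD; last exact: integrable_kernel2.
  exact: (integrable_refl (integrable_tensor33 iX iX)).
have K0 z : 0 <= K z.
  by rewrite addr_ge0 ?kernel2_ge0// mulr_ge0 ?sqr_ge0.
have iK2 := integrable_swap iK; have iK3 := integrable_refl (integrable_swap iK).
apply: (integrable_le _ _ (integrable_RD iK (integrable_RD iK2 iK3))).
  apply: measurable_funM; last exact: measurable_tri.
  have m3 : measurable_fun setT (fun z : VV => enorm (third z : E3)) by exact: (measurableT_comp measurable_enorm measurable_third).
  apply: measurable_minr => //; apply: measurable_minr.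
    exact: (measurableT_comp measurable_enorm measurable_fst).
  exact: (measurableT_comp measurable_enorm measurable_snd).
have key (x y t : V) : enorm (x : E3) <= enorm (y : E3) -> enorm (y : E3) <= 2 * enorm (t : E3) ->
    enorm (x : E3) * w x * w y * w t <= X x ^+ 2 * X t ^+ 2 + X y ^+ 2 / enorm (y : E3) ^+ 3.
  move=> xy yt; have [x0|x0] := eqVneq (enorm (x : E3)) 0.
    rewrite x0 !mul0r; apply: addr_ge0; first by apply: mulr_ge0; exact: sqr_ge0.
    by apply: divr_ge0; [exact: sqr_ge0|apply: exprn_ge0; exact: enorm_ge0].
  by apply: kernel_amgm => //; rewrite lt_neqAle eq_sym x0; exact: enorm_ge0.
have e1 (z : VV) : (z.1 : E3) = - (z.2 : E3) - (third z : E3) by rewrite /third opprB opprK addrA addNr add0r.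
have e2 (z : VV) : (z.2 : E3) = - (z.1 : E3) - (third z : E3) by rewrite /third opprB opprK addrCA addNr addr0.
have b2 (x y t : E3) : x = - y - t -> enorm x <= enorm y + enorm t.
  by move=> ->; apply: le_trans (enormB _ _) _; rewrite enormN.
move=> z; set a := enorm (z.1 : E3); set b := enorm (z.2 : E3); set c := enorm (third z : E3).
have abc : a <= b + c by exact: b2.
have bac : b <= a + c by exact: b2.
have P0 (x y t : V) (r : R) : 0 <= r -> 0 <= r * (w x * w y * w t) by move=> r0; rewrite !mulr_ge0.
have m0 : 0 <= min3 z by rewrite !le_min !enorm_ge0.
rewrite ger0_norm; last by rewrite !mulr_ge0.
have [k1 k2 k3] : [/\ 0 <= K z, 0 <= K (swap z) & 0 <= K (swap (refl z))] by [].
have [ab|ba] := leP a b.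
  have [ac|ca] := leP a c.
    have -> : min3 z = a by rewrite /min3 (min_idPl ab); exact/min_idPl.
    apply: le_trans (_ : K z <= _); last by rewrite lerDl addr_ge0.
    rewrite /K /kernel2 ab mulr1; apply: le_trans (key z.1 z.2 (third z) ab _); first by rewrite -!mulrA.
    by apply: le_trans bac _; rewrite mulr2n mulrDl !mul1r lerD2r.
  have -> : min3 z = c by rewrite /min3 (min_idPl ab); apply/min_idPr/ltW.
  apply: le_trans (_ : K (swap (refl z)) <= _); last by rewrite addrA lerDr addr_ge0.
  have tz : third (swap (refl z)) = z.2 by rewrite third_swap third_refl.
  rewrite /K /kernel2 tz /= (ltW ca) mulr1; apply: le_trans (key (third z) z.1 z.2 (ltW ca) _).
    by rewrite -/c le_eqVlt; apply/orP; left; apply/eqP; ring.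
  by apply: le_trans ab _; rewrite mulr2n mulrDl !mul1r lerDl enorm_ge0.
have [bc|cb] := leP b c.
  have -> : min3 z = b by rewrite /min3 (min_idPr (ltW ba)); exact/min_idPl.
  apply: le_trans (_ : K (swap z) <= _); last by rewrite addrCA lerDl addr_ge0.
  rewrite /K /kernel2 third_swap /= (ltW ba) mulr1; apply: le_trans (key z.2 z.1 (third z) (ltW ba) _).
    by rewrite -/b le_eqVlt; apply/orP; left; apply/eqP; ring.
  by apply: le_trans abc _; rewrite mulr2n mulrDl !mul1r lerD2r.
have -> : min3 z = c by rewrite /min3 (min_idPr (ltW ba)); apply/min_idPr/ltW.
apply: le_trans (_ : K (swap (refl z)) <= _); last by rewrite addrA lerDr addr_ge0.
have tz : third (swap (refl z)) = z.2 by rewrite third_swap third_refl.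
have ca := lt_trans cb ba.
rewrite /K /kernel2 tz /= (ltW ca) mulr1; apply: le_trans (key (third z) z.1 z.2 (ltW ca) _).
  by rewrite -/c le_eqVlt; apply/orP; left; apply/eqP; ring.
by apply: le_trans abc _; rewrite mulr2n mulrDl !mul1r lerD2l ltW.
Qed.

End trilinear_integrability.

(** * Locally integrable functions, multipliers and sections *)

Section local_integrability.
Variable R : realType.
Notation E3 := (R * R * R)%type.
Notation V := (mspace R).
Notation VV := (V * V)%type.
Variables (psi : E3 -> R) (hpsi : lp_cutoff psi).

Definition locb (m : E3 -> R) := measurable_fun setT (m : V -> R) /\
  forall r, exists B, forall x, enorm x <= r -> `|m x| <= B.

Lemma locbM m n : locb m -> locb n -> locb (fun x => m x * n x).
Proof.
move=> [mm hm] [mn hn]; split; first exact: measurable_funM.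
move=> r; have [B hB] := hm r; have [C hC] := hn r; exists (B * C) => x xr.
by rewrite normrM ler_pM ?hB ?hC.
Qed.

Lemma locb_coord i : locb (fun x => coord x i).
Proof.
split; first by apply: measurable_continuous3; exact: continuous_coord.
by move=> r; exists r => x xr; apply: le_trans (norm_coord_le _ _) xr.
Qed.

Lemma locb_powR (e : R) : 0 <= e -> locb (fun x => enorm x `^ e).
Proof.
move=> e0; split; first exact: (measurableT_comp (measurable_powR e) (@measurable_enorm R)).
move=> r; exists (r `^ e) => x xr; rewrite ger0_norm ?powR_ge0//.
by apply: ge0_ler_powR => //; rewrite nnegrE ?enorm_ge0//; exact: le_trans (enorm_ge0 x) xr.
Qed.

Lemma powR_double (x e : R) : x `^ (2 * e) = x `^ e * x `^ e.
Proof. by rewrite -expr2 -[in RHS]powR_mulrn ?powR_ge0// -powRrM mulrC. Qed.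

Lemma enorm_powR_le (e : R) (x : E3) : 0 < e -> e < 1 -> enorm x `^ e <= 1 + enorm x.
Proof.
move=> e0 e1; have [h|h] := leP (enorm x) 1.
  apply: (@le_trans _ _ 1); last exact: one_enorm_ge1.
  have [->|x0] := eqVneq (enorm x) 0; first by rewrite powR0// gt_eqF.
  by rewrite -(powRr0 (enorm x)); apply: ger_powR; rewrite ?(ltW e0)// lt_def x0 enorm_ge0.
by apply: (@le_trans _ _ (enorm x)); [apply: ler1_powR; exact: ltW|rewrite lerDr].
Qed.

Lemma locb_enorm : locb (@enorm R).
Proof.
split; first exact: measurable_enorm.
by move=> r; exists r => x xr; rewrite ger0_norm ?enorm_ge0.
Qed.

Lemma eball_gt r (x : E3) : r < enorm x -> \1_(eball r) x = 0 :> R.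
Proof. by move=> h; rewrite indicE memNset// /eball /= leNgt h. Qed.

Lemma indic_le1 (A : set V) x : `|\1_A x : R| <= 1.
Proof. by rewrite indicE; case: (_ \in _); rewrite ?normr1 ?normr0. Qed.

Lemma loc_cL1_eball (g : E3 -> R[i]) r : locally_integrable3 g ->
  cL1 (lam3 R) (fun x : V => g x * (\1_(eball r) x)%:C).
Proof.
move=> lg; apply: (lint3_mulr (r := r) (B := 1) lg).
- exact: measurable_indic (measurable_eball _).
- by move=> x; exact: indic_le1.
- exact: eball_gt.
Qed.

Lemma loc_of_cL1 (g : E3 -> R[i]) :
  (forall n : nat, cL1 (lam3 R) (fun x : V => g x * (\1_(eball n%:R) x)%:C)) -> locally_integrable3 g.
Proof.
move=> hg r; have me := measurable_eball (R := R) r.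
pose n := (Num.truncn r).+1; have rn : r <= n%:R by apply/ltW/truncnS_gt.
have hn := hg n.
have e (x : V) : eball r x -> g x * (\1_(eball n%:R) x)%:C = g x.
  by move=> rx; rewrite indicE mem_set ?mulr1//; exact: le_trans rx rn.
split.
  apply: (eq_integrable me (fun x : V => (Re (g x * (\1_(eball n%:R) x)%:C))%:E)).
    by move=> x; rewrite inE => rx; rewrite e.
  exact: integrableS measurableT me (@subsetT _ _) (cL1_Re hn).
apply: (eq_integrable me (fun x : V => (Im (g x * (\1_(eball n%:R) x)%:C))%:E)).
  by move=> x; rewrite inE => rx; rewrite e.
exact: integrableS measurableT me (@subsetT _ _) (cL1_Im hn).
Qed.

Lemma loc_mulr (g : E3 -> R[i]) m : locally_integrable3 g -> locb m ->
  locally_integrable3 (fun x => (m x)%:C * g x).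
Proof.
move=> lg [mm hm]; apply: loc_of_cL1 => n; have [B hB] := hm n%:R.
have := @lint3_mulr R g (fun x => m x * \1_(eball n%:R) x) n%:R `|B| lg; case.
- by apply: measurable_funM => //; exact: measurable_indic (measurable_eball _).
- move=> x; rewrite normrM indicE; have [h|h] := pselect (eball n%:R x).
    by rewrite (mem_set h) normr1 mulr1; apply: le_trans (hB x h) (ler_norm _).
  by rewrite (memNset h) normr0 mulr0.
- by move=> x /eball_gt ->; rewrite mulr0.
move=> h1 h2; split; first by move: h1; congr cmeas; apply/funext => x; rewrite rmorphM /=; ring.
by move: h2; congr (_.-integrable _ _); apply/funext => x; congr (cabs _)%:E; rewrite rmorphM /=; ring.
Qed.

Lemma locZ (g : E3 -> R[i]) c : locally_integrable3 g -> locally_integrable3 (fun x => c * g x).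
Proof.
move=> lg; apply: loc_of_cL1 => n; have := cL1Z c (loc_cL1_eball n%:R lg).
by congr (cL1 _ _); apply/funext => x; rewrite mulrA.
Qed.

Lemma loc0 : locally_integrable3 (fun _ : E3 => 0 : R[i]).
Proof.
by apply: loc_of_cL1 => n; have := @cL10 _ _ _ (lam3 R); congr (cL1 _ _); apply/funext => x; rewrite mul0r.
Qed.

Lemma loc_sum (F : 'I_3 -> E3 -> R[i]) : (forall i, locally_integrable3 (F i)) ->
  locally_integrable3 (fun x => \sum_i F i x).
Proof.
move=> hF.
have -> : (fun x => \sum_i F i x) = (fun x => F ord0 x + (F (lift ord0 ord0) x + (F (lift ord0 (lift ord0 ord0)) x + 0))).
  by apply/funext => x; rewrite !big_ord_recl big_ord0.
by apply: lint3D => //; apply: lint3D => //; apply: lint3D => //; exact: loc0.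
Qed.

Lemma loc_opp (g : E3 -> R[i]) : locally_integrable3 g -> locally_integrable3 (fun x => g (- x)).
Proof.
move=> lg; apply: loc_of_cL1 => n; have := cL1_opp (loc_cL1_eball n%:R lg).
congr (cL1 _ _); apply/funext => x; congr (_ * (_)%:C).
by rewrite !indicE; congr (_%:R); congr nat_of_bool; apply/idP/idP; rewrite !inE /eball /= enormN.
Qed.

Lemma cL1_test (g f : E3 -> R[i]) : locally_integrable3 g -> cpart f (@test_function R) ->
  cL1 (lam3 R) (fun x => g x * f x).
Proof.
move=> lg [tr ti]; have := cL1D (lint3_test lg tr) (cL1Z (ii R) (lint3_test lg ti)).
congr (cL1 _ _); apply/funext => x; rewrite mulrCA -mulrDr; congr (_ * _).
by apply: ReIm_eq; rewrite ?ReD ?ImD ?ReM ?ImM /= ?mul0r ?mulr0 ?mul1r ?subr0 ?addr0 ?add0r.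
Qed.

Lemma cL1_section_ae (F : VV -> R[i]) : cL1 (lam33 R) F ->
  {ae lam3 R, forall y, cL1 (lam3 R) (fun x => F (x, y))}.
Proof.
move=> [mF iF]; have mc := measurable_cabs mF.
have c0 z : 0 <= cabs (F z) by exact: cabs_ge0.
have lt : (\int[lam3 R]_y \int[lam3 R]_x (cabs (F (x, y)))%:E < +oo)%E.
  by rewrite -(tonelli33_2 mc)//; exact: (cL1_fin (conj mF iF)).
have mG : measurable_fun setT (fun y => (\int[lam3 R]_x (cabs (F (x, y)))%:E)%E).
  have := @measurable_fun_fubini_tonelli_G _ _ _ _ _ (lam3 R) (fun z => (cabs (F z))%:E) (measurable_RE mc).
  by apply => z; rewrite lee_fin.
have iG : (lam3 R).-integrable setT (fun y => (\int[lam3 R]_x (cabs (F (x, y)))%:E)%E).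
  apply/integrableP; split => //; apply: le_lt_trans lt.
  rewrite le_eqVlt; apply/orP; left; apply/eqP; apply: eq_integral => y _.
  by rewrite gee0_abs// integral_ge0// => x _; rewrite lee_fin.
have := integrable_ae measurableT iG; apply: filterS => y /(_ I) fy.
apply: cL1_lty; last by rewrite ltey_eq fy.
exact: (cmeas_comp (measurable_pair2 y) mF).
Qed.

End local_integrability.

(** * The energy identity in frequency space *)

Section stationary_system.
Variable R : realType.
Notation E3 := (R * R * R)%type.
Notation V := (mspace R).
Notation VV := (V * V)%type.
Variables (psi : E3 -> R) (hpsi : lp_cutoff psi) (s : R).

(** The integrability part stands alone because it is an input to the derivation of the weak
    equation required in [ns_system]. *)
Record ns_pre (g : 'I_3 -> E3 -> R[i]) : Prop := NsPre {
  ns_loc : forall i, locally_integrable3 (g i);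
  ns_sqr : forall i, cL2 (fun xi : V => (enorm (xi : E3) `^ s)%:C * g i xi) }.

(* The properties of the Fourier transform [g] of a weak solution that the energy
   identity uses, after a modification on a null set. *)
Record ns_system (g : 'I_3 -> E3 -> R[i]) : Prop := NsSystem {
  ns_pre_of :> ns_pre g;
  ns_div : forall xi, \sum_j (coord xi j)%:C * g j xi = 0;
  ns_conj : forall i xi, g i (- xi) = (g i xi)^*;
  ns_zero : forall i, g i 0 = 0;
  ns_weak : forall th : 'I_3 -> E3 -> R[i], (forall i, cpart (th i) (@test_function R)) ->
    (forall x, \sum_i (coord x i)%:C * th i x = 0) ->
    \sum_i cint (lam3 R) (fun x : V => (enorm (x : E3) `^ (2 * s))%:C * g i x * th i x) =
    (c0 R)%:C * \sum_i \sum_j cint (lam33 R) (fun z : VV => g j z.1 * g i z.2 *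
      (- ii R * (coord ((z.1 : E3) + (z.2 : E3)) j)%:C * th i ((z.1 : E3) + (z.2 : E3)))) }.

Hypotheses (s56 : 5 / 6 <= s) (s1 : s < 1).
Variables (g : 'I_3 -> E3 -> R[i]) (hg : ns_pre g).

Lemma s_gt0 : 0 < s. Proof. by apply: lt_le_trans s56; rewrite divr_gt0. Qed.

(** All integrability questions are settled on this scalar majorant. Its part [lo r] is integrable,
    [g] being locally integrable, and its part [hi r] is square integrable with any weight |x|^e, 0
    <= e <= s. *)
Definition w (x : V) : R := \sum_i cabs (g i x).
Definition lo r (x : V) : R := if enorm (x : E3) <= r then w x else 0.
Definition hi r (x : V) : R := if enorm (x : E3) <= r then 0 else w x.

Lemma w_ge0 x : 0 <= w x. Proof. by apply: sumr_ge0 => i _; exact: cabs_ge0. Qed.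
Lemma lo_ge0 r x : 0 <= lo r x. Proof. by rewrite /lo; case: ifP => // _; exact: w_ge0. Qed.
Lemma hi_ge0 r x : 0 <= hi r x. Proof. by rewrite /hi; case: ifP => // _; exact: w_ge0. Qed.
Lemma lo_hi r x : w x = lo r x + hi r x.
Proof. by rewrite /lo /hi; case: ifP; rewrite ?addr0 ?add0r. Qed.
Lemma lo_le r x : lo r x <= w x. Proof. by rewrite (lo_hi r) lerDl hi_ge0. Qed.
Lemma cmeas_g i : cmeas (g i : V -> R[i]).
Proof. exact: lint3_cmeas (ns_loc hg i). Qed.

Lemma measurable_w : measurable_fun setT w.
Proof. by apply: measurable_sum => i; apply: measurable_cabs; exact: cmeas_g. Qed.

Lemma loE r x : lo r x = w x * \1_(eball r) x.
Proof.
rewrite /lo indicE; case: ifPn => h; first by rewrite mem_set// mulr1.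
by rewrite memNset ?mulr0//; exact/negP.
Qed.

Lemma measurable_lo r : measurable_fun setT (lo r).
Proof.
have -> : lo r = fun x => w x * \1_(eball r) x by apply/funext => x; exact: loE.
apply: measurable_funM; first exact: measurable_w.
exact: measurable_indic (measurable_eball _).
Qed.

Lemma measurable_hi r : measurable_fun setT (hi r).
Proof.
have -> : hi r = fun x => w x - lo r x by apply/funext => x; rewrite (lo_hi r x) addrAC subrr add0r.
by apply: measurable_funB; [exact: measurable_w|exact: measurable_lo].
Qed.

Lemma integrable_lo r : (lam3 R).-integrable setT (fun x => (lo r x)%:E).
Proof.
have h i := (loc_cL1_eball r (ns_loc hg i)).2.
have e : (fun x => (lo r x)%:E) = (fun x : V => (\sum_i cabs (g i x * (\1_(eball r) x)%:C))%:E).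
  apply/funext => x; congr (_%:E); rewrite loE /w mulr_suml; apply: eq_bigr => i _.
  by rewrite cabsM cabs_real ger0_norm// indicE.
rewrite e; under eq_fun do rewrite !big_ord_recl big_ord0 addr0.
by apply: integrable_RD => //; exact: integrable_RD.
Qed.

Lemma sqr_sum3 (F : 'I_3 -> R) : (\sum_i F i) ^+ 2 <= 3 * \sum_i F i ^+ 2.
Proof.
rewrite !big_ord_recl !big_ord0; move: (F _) (F _) (F _) => a b c.
by have := sqr_ge0 (a - b); have := sqr_ge0 (a - c); have := sqr_ge0 (b - c); nra.
Qed.

Lemma sqi_w : sqi (fun x : V => enorm (x : E3) `^ s * w x).
Proof.
have m : measurable_fun setT (fun x : V => enorm (x : E3) `^ s * w x).
  by apply: measurable_funM; [exact: (locb_powR (ltW s_gt0)).1|exact: measurable_w].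
split => //.
have i3 : (lam3 R).-integrable setT (fun x : V => (3 * \sum_i cabs ((enorm (x : E3) `^ s)%:C * g i x) ^+ 2)%:E).
  apply: integrable_RZ; under eq_fun do rewrite !big_ord_recl big_ord0 addr0.
  by apply: integrable_RD; [|apply: integrable_RD]; exact: (ns_sqr hg _).2.
apply: (integrable_le _ _ i3); first exact: measurable_funX.
move=> x; rewrite ger0_norm ?sqr_ge0//; apply: le_trans (sqr_sum3 _).
rewrite /w mulr_sumr le_eqVlt; apply/orP; left; apply/eqP; congr (_ ^+ 2); apply: eq_bigr => i _.
by rewrite cabsM cabs_real ger0_norm// powR_ge0.
Qed.

Lemma sqi_le (a b : V -> R) C : measurable_fun setT a -> sqi b -> (forall x, `|a x| <= C * `|b x|) -> sqi a.
Proof.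
move=> ma [mb ib] h; split => //; apply: (integrable_le _ _ (integrable_RZ (C ^+ 2) ib)); first exact: measurable_funX.
move=> x; rewrite normrX -[b x ^+ 2]real_normK ?num_real// -exprMn lerXn2r ?nnegrE//.
exact: le_trans (normr_ge0 _) (h x).
Qed.

Lemma sqi_hi (rho e : R) : 0 < rho -> 0 <= e <= s -> sqi (fun x : V => enorm (x : E3) `^ e * hi rho x).
Proof.
move=> r0 /andP[e0 es]; apply: (sqi_le (C := rho `^ (e - s))) sqi_w _.
  by apply: measurable_funM; [exact: (locb_powR e0).1|exact: measurable_hi].
move=> x; rewrite !ger0_norm ?mulr_ge0 ?powR_ge0 ?w_ge0 ?hi_ge0//.
rewrite /hi; have [h|h] := leP (enorm (x : E3)) rho; first by rewrite mulr0 !mulr_ge0 ?powR_ge0 ?w_ge0.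
have x0 := lt_trans r0 h.
rewrite mulrA ler_wpM2r ?w_ge0//.
have -> : enorm (x : E3) `^ e = enorm (x : E3) `^ (e - s) * enorm (x : E3) `^ s.
  by rewrite -powRD ?subrK// (gt_eqF x0) implybT.
rewrite ler_wpM2r ?powR_ge0// -[e - s]opprB !powRN lef_pV2 ?posrE ?powR_gt0//.
by apply: ge0_ler_powR; rewrite ?nnegrE ?subr_ge0 ?(ltW r0) ?(ltW x0)// ltW.
Qed.

Lemma sqi_hi0 rho : 0 < rho -> sqi (hi rho).
Proof.
move=> r0; have := @sqi_hi rho 0 r0; rewrite lexx (ltW s_gt0) => /(_ isT).
by congr sqi; apply/funext => x; rewrite powRr0 mul1r.
Qed.

Lemma third_eq1 (z : VV) : (z.1 : E3) = - (z.2 : E3) - (third z : E3).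
Proof. by rewrite /third opprB opprK addrA addNr add0r. Qed.

Lemma third_eq2 (z : VV) : (z.2 : E3) = - (z.1 : E3) - (third z : E3).
Proof. by rewrite /third opprB opprK addrCA addNr addr0. Qed.

Lemma enorm_tri1 (z : VV) : enorm (z.1 : E3) <= enorm (z.2 : E3) + enorm (third z : E3).
Proof. by rewrite {1}third_eq1; apply: le_trans (enormB _ _) _; rewrite enormN. Qed.

Lemma enorm_tri2 (z : VV) : enorm (z.2 : E3) <= enorm (z.1 : E3) + enorm (third z : E3).
Proof. by rewrite {1}third_eq2; apply: le_trans (enormB _ _) _; rewrite enormN. Qed.

Lemma enorm_tri3 (z : VV) : enorm (third z : E3) <= enorm (z.1 : E3) + enorm (z.2 : E3).
Proof. by rewrite /third; apply: le_trans (enormB _ _) _; rewrite enormN. Qed.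

(** If |zeta| <= r then |xi| and |eta| differ by at most r. Either both exceed 1, giving two square
    integrable factors against an indicator, or one is at most 1 and the other at most |r| + 1,
    giving two integrable factors. *)
Lemma conv_integrable r : (lam33 R).-integrable setT (fun z => (w z.1 * w z.2 * \1_(eball r) (third z))%:E).
Proof.
pose r' := `|r| + 1.
have i1 := integrable_tensor33 (integrable_lo 1) (integrable_lo 1).
have i2 := integrable_tensor33 (integrable_lo 1) (integrable_lo r').
have i3 := integrable_tensor33 (integrable_lo r') (integrable_lo 1).
have mi := @measurable_indic _ V R setT _ (measurable_eball r).
have i4 : (lam33 R).-integrable setT (fun z => (hi 1 z.1 * hi 1 z.2 * \1_(eball r) (third z))%:E).
  apply: tri_integrable3; [by move=> x; rewrite indicE|exact: integrable_indic_eball hpsi r|exact: sqi_hi0|exact: sqi_hi0].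
apply: (integrable_le _ _ (integrable_RD (integrable_RD i1 i2) (integrable_RD i3 i4))).
  by apply: measurable_tri => //; exact: measurable_w.
move=> z; have i0 x : 0 <= \1_(eball r) x :> R by rewrite indicE.
rewrite ger0_norm ?mulr_ge0 ?w_ge0//.
have p1 : 0 <= lo 1 z.1 * lo 1 z.2 by rewrite mulr_ge0 ?lo_ge0.
have p2 : 0 <= lo 1 z.1 * lo r' z.2 by rewrite mulr_ge0 ?lo_ge0.
have p3 : 0 <= lo r' z.1 * lo 1 z.2 by rewrite mulr_ge0 ?lo_ge0.
have p4 : 0 <= hi 1 z.1 * hi 1 z.2 * \1_(eball r) (third z) by rewrite !mulr_ge0 ?hi_ge0.
have [h|h] := pselect (eball r (third z)); last first.
  by rewrite [X in w z.1 * w z.2 * X]indicE (memNset h) mulr0 !addr_ge0.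
have e1 : \1_(eball r) (third z) = 1 :> R by rewrite indicE (mem_set h).
rewrite e1 !mulr1 in p4 *; rewrite /eball /= in h.
have rr := ler_norm r; have t1 := enorm_tri1 z; have t2 := enorm_tri2 z.
have [h1|h1] := leP (enorm (z.1 : E3)) 1.
  have e2 : lo r' z.2 = w z.2 by rewrite /lo ifT//; apply: le_trans t2 _; rewrite addrC lerD// (le_trans h).
  have e3 : lo 1 z.1 = w z.1 by rewrite /lo h1.
  by rewrite e2 e3 in p2 *; rewrite -addrA addrCA lerDl !addr_ge0// -e3.
have [h2|h2] := leP (enorm (z.2 : E3)) 1.
  have e2 : lo r' z.1 = w z.1 by rewrite /lo ifT//; apply: le_trans t1 _; rewrite addrC lerD// (le_trans h).
  have e3 : lo 1 z.2 = w z.2 by rewrite /lo h2.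
  by rewrite e2 e3 in p3 *; rewrite addrCA lerDl !addr_ge0// -e3.
have e2 : hi 1 z.1 = w z.1 by rewrite /hi leNgt h1.
have e3 : hi 1 z.2 = w z.2 by rewrite /hi leNgt h2.
by rewrite e2 e3 addrA lerDr !addr_ge0.
Qed.

Lemma cabs_g_le i x : cabs (g i x) <= w x.
Proof. by rewrite /w (bigD1 i)//= lerDl sumr_ge0// => j _; exact: cabs_ge0. Qed.

Lemma cmeas_g1 i : cmeas (fun z : VV => g i z.1).
Proof. exact: (cmeas_comp measurable_fst (cmeas_g i)). Qed.
Lemma cmeas_g2 i : cmeas (fun z : VV => g i z.2).
Proof. exact: (cmeas_comp measurable_snd (cmeas_g i)). Qed.
Lemma cmeas_g3 i : cmeas (fun z : VV => g i (third z)).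
Proof. exact: (cmeas_comp (@measurable_third R) (cmeas_g i)). Qed.

Lemma cL1_conv i j (m : V -> R[i]) r C : cmeas m -> (forall x, cabs (m x) <= C * \1_(eball r) x) ->
  cL1 (lam33 R) (fun z : VV => g j z.1 * g i (third z) * m z.2).
Proof.
move=> mm hm; apply: (cL1_dom (h := fun z : VV => C * (w z.1 * w (third z) * \1_(eball r) z.2))).
- apply: cmeasM; first by apply: cmeasM; [exact: cmeas_g1|exact: cmeas_g3].
  exact: (cmeas_comp measurable_snd mm).
- move=> z; rewrite !cabsM mulrCA; apply: ler_pM; rewrite ?mulr_ge0 ?cabs_ge0//.
  by apply: ler_pM; rewrite ?cabs_ge0//; exact: cabs_g_le.
- apply: integrable_RZ; have := integrable_refl (conv_integrable r).
  by congr (_.-integrable _ _); apply/funext => z; rewrite third_refl.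
Qed.

(** The convolution of g_j and g_i at the point -y. *)
Definition conv i j (y : V) : R[i] := cint (lam3 R) (fun x : V => g j x * g i (third (x, y))).

Lemma cL1_indic (r : R) : cmeas (fun x : V => (\1_(eball r) x : R)%:C) /\
  forall x : V, cabs ((\1_(eball r) x : R)%:C) <= 1 * \1_(eball r) x.
Proof.
split; first by apply: cmeas_real; exact: measurable_indic (measurable_eball _).
by move=> x; rewrite mul1r cabs_real ger0_norm// indicE.
Qed.

(** Absolute convergence holds for almost every y in each ball of integer radius, hence almost
    everywhere. *)
Lemma conv_section_ae :
  {ae lam3 R, forall y, forall i j, cL1 (lam3 R) (fun x : V => g j x * g i (third (x, y)))}.
Proof.
have h (n : nat) : cL1 (lam33 R) (fun z : VV => (w z.1 * w (third z) * \1_(eball n%:R) z.2)%:C).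
  have := integrable_refl (conv_integrable n%:R).
  under eq_fun do rewrite third_refl /=.
  move=> ih; have mh : measurable_fun setT (fun z : VV => w z.1 * w (third z) * \1_(eball n%:R) z.2).
    by have /measurable_int /measurable_EFinP := ih.
  apply: (cL1_dom (h := fun z : VV => w z.1 * w (third z) * \1_(eball n%:R) z.2) (cmeas_real mh) _ ih) => z.
  by rewrite cabs_real ger0_norm// indicE !mulr_ge0 ?w_ge0.
have := ae_foralln (fun n => cL1_section_ae (h n)); apply: filterS => y hy i j; have [n yn] := enorm_le_nat y.
apply: cL1_le (hy n) _.
  apply: cmeasM; first exact: cmeas_g.
  exact: (cmeas_comp (measurable_pair2 y) (cmeas_g3 i)).
move=> x; rewrite cabsM cabs_real indicE mem_set// mulr1 ger0_norm ?mulr_ge0 ?w_ge0//.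
by apply: ler_pM; rewrite ?cabs_ge0 ?cabs_g_le.
Qed.

Lemma loc_conv i j : locally_integrable3 (conv i j).
Proof.
apply: loc_of_cL1 => n.
have := cL1_cint33_1 (cL1_conv i j (cL1_indic n%:R).1 (cL1_indic n%:R).2).
congr (cL1 _ _); apply/funext => y /=; rewrite indicE; case: (y \in _) => /=.
  by rewrite mulr1; congr (cint _ _); apply/funext => x; rewrite mulr1.
by rewrite mulr0 -[RHS](cint0 (lam3 R)); congr (cint _ _); apply/funext => x; rewrite mulr0.
Qed.

Lemma cint_conv i j (m : V -> R[i]) : cmeas m ->
  cL1 (lam33 R) (fun z : VV => g j z.1 * g i (third z) * m z.2) ->
  cint (lam33 R) (fun z : VV => g j z.1 * g i (third z) * m z.2) = cint (lam3 R) (fun y => m y * conv i j y).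
Proof.
move=> mm l; rewrite (cfubini33_2 l).
apply: ae_eq_cint.
- exact: (cL1_cint33_1 l).1.
- exact: cmeasM mm (lint3_cmeas (loc_conv i j)).
have := conv_section_ae; apply: filterS => y /(_ i j) hy.
by rewrite /= cintZr// mulrC.
Qed.

Lemma coordN (x : E3) i : coord (- x) i = - coord x i.
Proof. by rewrite -scaleN1r coordZ mulN1r. Qed.

Lemma test_bound (h : E3 -> R) : test_function h ->
  exists r C, forall x, `|h x| <= C * \1_(eball r) x.
Proof.
move=> th; have [B hB] := test_function_bounded th; have [_ [r hr]] := th.
exists r, B => x; have [h1|h1] := pselect (eball r x).
  by rewrite indicE (mem_set h1) mulr1.
rewrite indicE (memNset h1) mulr0 hr ?normr0//.
by rewrite ltNge; apply/negP => h2; exact: h1.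
Qed.

Lemma ctest_real (h : E3 -> R) : test_function h -> cpart (fun x => (h x)%:C) (@test_function R).
Proof. by move=> th; split => //=; split; [exact: smooth_cst|exists 0]. Qed.

Lemma test_opp (h : E3 -> R) : test_function h -> test_function (fun x => h (- x)).
Proof.
move=> [sh [r hr]]; split.
  have -> : (fun x => h (- x)) = (fun x => h ((-1) *: x + 0)) by apply/funext => x; rewrite scaleN1r addr0.
  exact: smooth_comp_affine (axis_affine_scale (-1) 0) sh.
by exists r => x hx; apply: hr; rewrite enormN.
Qed.

Definition nsq (x : E3) : R := \sum_i coord x i * coord x i.

Lemma enorm_sqrE (x : E3) : enorm x ^+ 2 = nsq x.
Proof. by rewrite /enorm sqr_sqrtr// sumr_ge0// => i _; rewrite -expr2 sqr_ge0. Qed.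

Lemma smooth_sqr : smooth nsq.
Proof.
have -> : nsq = (fun x : E3 => coord x ord0 * coord x ord0 +
   (coord x (lift ord0 ord0) * coord x (lift ord0 ord0) +
    coord x (lift ord0 (lift ord0 ord0)) * coord x (lift ord0 (lift ord0 ord0)))).
  by apply/funext => x; rewrite /nsq !big_ord_recl big_ord0 addr0.
have c i := smoothM (smooth_coord R i) (smooth_coord R i).
exact: smoothD (c _) (smoothD (c _) (c _)).
Qed.

(** The momentum balance at frequency -y without its pressure term, so a vector expected to be
    parallel to y. [nsX] is its component orthogonal to y, that is the Leray projection multiplied
    by |y|^2 to clear the denominator. *)
Definition nsW i (y : E3) : R[i] := (enorm y `^ (2 * s))%:C * g i (- y) -
  (c0 R)%:C * ii R * \sum_j (coord y j)%:C * conv i j y.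

Definition nsX i (y : E3) : R[i] := (nsq y)%:C * nsW i y -
  (coord y i)%:C * \sum_l (coord y l)%:C * nsW l y.

Lemma s2_ge0 : 0 <= 2 * s. Proof. by rewrite mulr_ge0 ?(ltW s_gt0). Qed.

Lemma loc_nsW i : locally_integrable3 (nsW i).
Proof.
apply: lint3B.
  by apply: loc_mulr; [exact: loc_opp (ns_loc hg i)|exact: locb_powR s2_ge0].
apply: locZ; apply: loc_sum => j; apply: loc_mulr; first exact: loc_conv.
exact: locb_coord.
Qed.

Lemma locb_sqr : locb nsq.
Proof.
have -> : nsq = fun x => enorm x * enorm x.
  by apply/funext => x; rewrite -enorm_sqrE expr2.
by apply: locbM; exact: locb_enorm.
Qed.

Lemma loc_nsX i : locally_integrable3 (nsX i).
Proof.
apply: lint3B; first by apply: loc_mulr; [exact: loc_nsW|exact: locb_sqr].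
apply: loc_mulr; last exact: locb_coord.
by apply: loc_sum => l; apply: loc_mulr; [exact: loc_nsW|exact: locb_coord].
Qed.

Hypothesis hs : ns_system g.

Section tested.
Variables (i0 : 'I_3) (sg : E3 -> R) (tsg : test_function sg).

(* For every test [sg], the field [|y|^2 e_i0 - y_i0 y] is orthogonal to [y], so that the
   pressure disappears. *)
Definition dirt i (y : E3) : R :=
  (nsq y * (i == i0)%:R - coord y i0 * coord y i) * sg y.

Lemma test_dirt i : test_function (dirt i).
Proof.
apply: test_functionM => //; apply: smoothB; first exact: smoothM smooth_sqr (smooth_cst _).
exact: smoothM (smooth_coord R _) (smooth_coord R _).
Qed.

Lemma dirt_div y : \sum_i coord y i * dirt i y = 0.
Proof.
rewrite /dirt; under eq_bigr do rewrite mulrA mulrBr.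
rewrite -mulr_suml big_split/= sumrN (bigD1 i0)//= eqxx mulr1 big1 ?addr0; last first.
  by move=> i /negPf ->; rewrite !mulr0.
have -> : \sum_i coord y i * (coord y i0 * coord y i) = coord y i0 * nsq y.
  by rewrite /nsq mulr_sumr; apply: eq_bigr => i _; ring.
by rewrite subrr mul0r.
Qed.

Lemma nsX_tested : cint (lam3 R) (fun y => nsX i0 y * (sg y)%:C) = 0.
Proof.
(* The field is reflected because [nsX] reads [g] at -y. *)
pose th i (x : E3) : R[i] := (dirt i (- x))%:C.
have tth i : cpart (th i) (@test_function R) by apply: ctest_real; apply: test_opp; exact: test_dirt.
have dth x : \sum_i (coord x i)%:C * th i x = 0.
  transitivity ((- \sum_i coord (- x) i * dirt i (- x))%:C); last by rewrite dirt_div oppr0.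
  rewrite -sumrN rmorph_sum /=; apply: eq_bigr => i _.
  by rewrite /th -[in RHS]mulNr coordN opprK [in RHS]rmorphM.
have h := ns_weak hs tth dth.
have lL i : cL1 (lam3 R) (fun y : V => (enorm (y : E3) `^ (2 * s))%:C * g i (- (y : E3)) * (dirt i y)%:C).
  apply: lint3_test (test_dirt i).
  by apply: loc_mulr; [exact: loc_opp (ns_loc hg i)|exact: locb_powR s2_ge0].
have eL i : cint (lam3 R) (fun x : V => (enorm (x : E3) `^ (2 * s))%:C * g i x * th i x) =
    cint (lam3 R) (fun y : V => (enorm (y : E3) `^ (2 * s))%:C * g i (- (y : E3)) * (dirt i y)%:C).
  have := scales_cint ltr01 (scales3_opp R) (lL i); rewrite mul1r => <-.
  apply: (congr1 (cint (lam3 R))); apply/funext => x.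
  have e : - - (x : E3) = x := opprK (x : E3).
  rewrite enormN /th.
  by rewrite e.
have tm i j : test_function (fun y => coord y j * dirt i y).
  by apply: test_functionM; [exact: smooth_coord|exact: test_dirt].
have lR i j : cL1 (lam3 R) (fun y : V => conv i j y * (coord (y : E3) j * dirt i y)%:C).
  by apply: lint3_test (tm i j); exact: loc_conv.
have eR i j : cint (lam33 R) (fun z : VV => g j z.1 * g i z.2 *
      (- ii R * (coord ((z.1 : E3) + (z.2 : E3)) j)%:C * th i ((z.1 : E3) + (z.2 : E3)))) =
    ii R * cint (lam3 R) (fun y : V => conv i j y * (coord (y : E3) j * dirt i y)%:C).
  have [r [C hC]] := test_bound (tm i j).
  have mm : cmeas (fun y : V => ii R * (coord (y : E3) j * dirt i y)%:C).
    apply: cmeasM; first exact: cmeas_cst.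
    by apply: cmeas_real; exact: smooth_measurable (tm i j).1.
  have hm (x : V) : cabs (ii R * (coord (x : E3) j * dirt i x)%:C) <= C * \1_(eball r) x.
    by rewrite cabsM cabs_ii mul1r cabs_real.
  have := cint_conv mm (cL1_conv i j mm hm).
  have := scales_cint ltr01 (@scales_refl33 R) (cL1_conv i j mm hm); rewrite mul1r => <- e.
  rewrite -cintZ//; transitivity (cint (lam3 R) (fun y => ii R * (coord (y : E3) j * dirt i y)%:C * conv i j y)).
    rewrite -e; congr (cint _ _); apply/funext => z; rewrite third_refl /= /th.
    have -> : (z.1 : E3) + (z.2 : E3) = - (third z : E3) by rewrite /third opprB opprK addrC.
    by rewrite opprK coordN !rmorphM rmorphN /=; ring.
  by congr (cint _ _); apply/funext => y; ring.
move: h; under [X in X = _ -> _]eq_bigr do rewrite eL.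
under [X in _ = _ * X -> _]eq_bigr do under eq_bigr do rewrite eR.
move=> h.
have eX : (fun y : V => nsX i0 y * (sg y)%:C) =
  (fun y : V => \sum_i ((enorm (y : E3) `^ (2 * s))%:C * g i (- (y : E3)) * (dirt i y)%:C -
     (c0 R)%:C * ii R * \sum_j conv i j y * (coord (y : E3) j * dirt i y)%:C)).
  apply/funext => y; transitivity (\sum_i nsW i y * (dirt i y)%:C).
    rewrite /nsX /dirt; under [RHS]eq_bigr do rewrite rmorphM rmorphB mulrA mulrBr !rmorphM /=.
    rewrite -[RHS]mulr_suml; congr (_ * _); rewrite [RHS]big_split/= sumrN; congr (_ - _).
      rewrite (bigD1 i0)//= eqxx mulr1n mulr1 big1 ?addr0; first by rewrite mulrC.
      by move=> i /negPf ->; rewrite mulr0n rmorph0 !mulr0.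
    by rewrite mulr_sumr; apply: eq_bigr => l _; ring.
  apply: eq_bigr => i _; rewrite /nsW mulrBl; congr (_ - _); rewrite -[LHS]mulrA mulr_suml; congr (_ * _).
  by apply: eq_bigr => j _; move: (dirt i y) => t; rewrite rmorphM /=; ring.
have lS i : cL1 (lam3 R) (fun y : V => \sum_j conv i j y * (coord (y : E3) j * dirt i y)%:C).
  by apply: cL1_sum => j; exact: lR.
have eS i : cint (lam3 R) (fun y : V => (enorm (y : E3) `^ (2 * s))%:C * g i (- (y : E3)) * (dirt i y)%:C -
     (c0 R)%:C * ii R * \sum_j conv i j y * (coord (y : E3) j * dirt i y)%:C) =
   cint (lam3 R) (fun y : V => (enorm (y : E3) `^ (2 * s))%:C * g i (- (y : E3)) * (dirt i y)%:C) -
   (c0 R)%:C * \sum_j ii R * cint (lam3 R) (fun y : V => conv i j y * (coord (y : E3) j * dirt i y)%:C).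
  rewrite cintB//; last exact: cL1Z.
  by rewrite cintZ// cint_sum// -mulr_sumr mulrA.
rewrite eX cint_sum; last by move=> i; apply: cL1B => //; exact: cL1Z.
by under eq_bigr do rewrite eS; rewrite big_split/= sumrN -mulr_sumr h subrr.
Qed.

End tested.

Lemma nsX_ae i : {ae lam3 R, forall y : V, nsX i y = 0}.
Proof.
apply: (lint3_unique hpsi (loc_nsX i)) => f tf; exact: nsX_tested.
Qed.

(** Pairing [nsX] with g(y) removes the term along y, since y is orthogonal to g(y), and leaves
    |y|^2 times the pairing with [nsW]. The factor |y|^2 is cancelled off the origin, and g(0) = 0
    settles the origin. *)
Lemma energy_density : {ae lam3 R, forall y : V,
  (enorm (y : E3) `^ (2 * s))%:C * \sum_i g i (- (y : E3)) * g i y =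
  (c0 R)%:C * ii R * \sum_i \sum_j (coord (y : E3) j)%:C * conv i j y * g i y}.
Proof.
have h0 := nsX_ae ord0; have h1 := nsX_ae (lift ord0 ord0); have h2 := nsX_ae (lift ord0 (lift ord0 ord0)).
move: h0 h1 h2; apply: filterS3 => y h0 h1 h2.
have hX i : nsX i y = 0.
  by case: i => [[|[|[|//]]]] hi; [rewrite -h0|rewrite -h1|rewrite -h2]; congr (nsX _ y); exact: val_inj.
suff hW : \sum_i nsW i y * g i y = 0.
  apply/eqP; rewrite -subr_eq0 -[X in _ == X]hW; apply/eqP.
  rewrite !mulr_sumr -sumrB; apply: eq_bigr => i _; rewrite /nsW mulrBl -!mulrA; congr (_ - _ * (_ * _)).
  by rewrite mulr_suml.
have [->|y0] := eqVneq (y : E3) 0.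
  by rewrite big1// => i _; rewrite (ns_zero hs) mulr0.
have n0 : (nsq y)%:C != 0 :> R[i].
  rewrite -enorm_sqrE; apply/negP => /eqP /(congr1 (@Re R)) /= /eqP.
  by rewrite sqrf_eq0 => /eqP /enorm_eq0 /eqP; rewrite (negPf y0).
apply: (mulfI n0); rewrite mulr0.
have := congr1 (fun F => \sum_i F i * g i y) (funext hX); rewrite [RHS]big1 => [|i _]; last by rewrite mul0r.
rewrite /nsX; under eq_bigr do rewrite mulrBl; rewrite big_split/= sumrN => E; rewrite -[RHS]E.
have -> : \sum_i (coord y i)%:C * (\sum_l (coord y l)%:C * nsW l y) * g i y =
   (\sum_l (coord y l)%:C * nsW l y) * \sum_i (coord y i)%:C * g i y.
  by rewrite mulr_sumr; apply: eq_bigr => i _; ring.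
rewrite (ns_div hs) mulr0 subr0 mulr_sumr; apply: eq_bigr => i _; by rewrite mulrA.
Qed.

End stationary_system.

Section energy_identity.
Variable R : realType.
Notation E3 := (R * R * R)%type.
Notation V := (mspace R).
Notation VV := (V * V)%type.
Variables (psi : E3 -> R) (hpsi : lp_cutoff psi) (s : R).
Hypotheses (s56 : 5 / 6 <= s) (s1 : s < 1).
Variables (g : 'I_3 -> E3 -> R[i]) (hg : ns_system s g).
Notation w := (w g).
Notation lo := (lo g).
Notation hi := (hi g).

(** For z = (xi, eta) this is g(xi) . eta and [pairing] is g(eta) . g(zeta). Formally [c0 * ii]
    times the integral of their product [triform] is the integral of u . grad u . u. *)
Definition advect (z : VV) : R[i] := \sum_j (coord (z.2 : E3) j)%:C * g j z.1.
Definition pairing (z : VV) : R[i] := \sum_i g i z.2 * g i (third z).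
Definition triform (z : VV) : R[i] := advect z * pairing z.

(** Because g(xi) . xi = 0 and zeta = -xi - eta, replacing eta by zeta changes the sign. The
    advection factor is consequently bounded through either |eta| or |zeta|, hence through the
    smaller of the two. *)
Lemma advect_refl z : advect (refl z) = - advect z.
Proof.
rewrite /advect /refl /= -sumrN.
have := ns_div hg z.1 => h; rewrite -[RHS]subr0 -[X in _ = _ - X]h -sumrB; apply: eq_bigr => j _.
by rewrite /third coordD !coordN rmorphD !rmorphN /=; ring.
Qed.

Lemma pairing_refl z : pairing (refl z) = pairing z.
Proof. by rewrite /pairing third_refl; apply: eq_bigr => i _; rewrite mulrC. Qed.

Lemma cabs_advect_le z : cabs (advect z) <= enorm (z.2 : E3) * w z.1.
Proof.
apply: le_trans (cabs_sum _ _ _) _; rewrite /w mulr_sumr; apply: ler_sum => j _.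
by rewrite cabsM cabs_real ler_wpM2r ?cabs_ge0// norm_coord_le.
Qed.

Lemma cabs_advect_le3 z : cabs (advect z) <= enorm (third z : E3) * w z.1.
Proof. by have := cabs_advect_le (refl z); rewrite advect_refl cabsN. Qed.

Lemma cabs_pairing_le z : cabs (pairing z) <= w z.2 * w (third z).
Proof.
apply: le_trans (cabs_sum _ _ _) _; rewrite {1}/w mulr_suml; apply: ler_sum => i _.
by rewrite cabsM ler_wpM2l ?cabs_ge0// cabs_g_le.
Qed.

Lemma cmeas_advect : cmeas advect.
Proof.
apply: cmeas_sum => j; apply: cmeasM; last exact: cmeas_g1 hg _.
apply: cmeas_real; exact: (measurableT_comp (locb_coord R j).1 measurable_snd).
Qed.

Lemma cmeas_pairing : cmeas pairing.
Proof. by apply: cmeas_sum => i; apply: cmeasM; [exact: cmeas_g2 hg _|exact: cmeas_g3 hg _]. Qed.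

Lemma cmeas_triform : cmeas triform.
Proof. exact: cmeasM cmeas_advect cmeas_pairing. Qed.

Lemma cabs_triform_le z : cabs (triform z) <= enorm (z.2 : E3) * (w z.1 * w z.2 * w (third z)).
Proof.
rewrite cabsM -mulrA mulrA; apply: ler_pM; rewrite ?cabs_ge0//; first exact: cabs_advect_le.
exact: cabs_pairing_le.
Qed.

Lemma cabs_triform_le3 z : cabs (triform z) <= enorm (third z : E3) * (w z.1 * w z.2 * w (third z)).
Proof.
rewrite cabsM -mulrA mulrA; apply: ler_pM; rewrite ?cabs_ge0//; first exact: cabs_advect_le3.
exact: cabs_pairing_le.
Qed.

Definition mid r r' (x : V) : R := hi r x * \1_(eball r') x.

Lemma mid_ge0 r r' x : 0 <= mid r r' x.
Proof. by rewrite mulr_ge0 ?hi_ge0// indicE. Qed.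

Lemma measurable_mid r r' : measurable_fun setT (mid r r').
Proof.
by apply: measurable_funM; [exact: measurable_hi hg _|exact: measurable_indic (measurable_eball _)].
Qed.

Lemma hiE r x : r < enorm (x : E3) -> hi r x = w x.
Proof. by move=> h; rewrite /hi leNgt h. Qed.

Lemma loE' r x : enorm (x : E3) <= r -> lo r x = w x.
Proof. by move=> h; rewrite /lo h. Qed.

Lemma hi0 r x : enorm (x : E3) <= r -> hi r x = 0.
Proof. by move=> h; rewrite /hi h. Qed.

Lemma tri_ge0 (a b c : V -> R) (z : VV) : (forall x, 0 <= a x) -> (forall x, 0 <= b x) -> (forall x, 0 <= c x) ->
  0 <= a z.1 * b z.2 * c (third z).
Proof. by move=> a0 b0 c0; rewrite !mulr_ge0. Qed.

(** If |zeta| > r then |xi| or |eta| exceeds r / 2. In either case one factor is integrable and two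
    are square integrable away from 0. *)
Lemma integrable_low r r' : 0 < r ->
  (lam33 R).-integrable setT (fun z => (w z.1 * lo r' z.2 * hi r (third z))%:E).
Proof.
move=> r0; pose e := r / 2; have e0 : 0 < e by rewrite divr_gt0.
have [He Hr] := (sqi_hi0 s56 hg e0, sqi_hi0 s56 hg r0).
have i1 := tri_integrable1 (lo_ge0 g e) (integrable_lo hg e) He Hr.
have i2 := tri_integrable2 (lo_ge0 g r') (integrable_lo hg r') He Hr.
apply: (integrable_le _ _ (integrable_RD i1 i2)).
  by apply: measurable_tri; [exact: measurable_w hg|exact: measurable_lo hg _|exact: measurable_hi hg _].
move=> z; have p1 := tri_ge0 z (lo_ge0 g e) (hi_ge0 g e) (hi_ge0 g r).
have p2 := tri_ge0 z (hi_ge0 g e) (lo_ge0 g r') (hi_ge0 g r).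
rewrite ger0_norm; last exact: tri_ge0 (w_ge0 g) (lo_ge0 g r') (hi_ge0 g r).
have [h3|h3] := leP (enorm (third z : E3)) r.
  have m0 : w z.1 * lo r' z.2 * hi r (third z) = 0 by rewrite (hi0 h3) mulr0.
  by rewrite m0 addr_ge0.
have t3 := enorm_tri3 z; have re : r = e + e by rewrite /e -splitr.
have [h1|h1] := leP (enorm (z.1 : E3)) e; last first.
  by rewrite -{1}(hiE h1) lerDr.
have h2 : e < enorm (z.2 : E3) by rewrite -(ltrD2l e) -re; apply: lt_le_trans h3 (le_trans t3 _); rewrite lerD2r.
apply: (@le_trans _ _ (lo e z.1 * hi e z.2 * hi r (third z))); last by rewrite lerDl.
by rewrite (loE' h1) (hiE h2) ler_wpM2r ?hi_ge0// ler_wpM2l ?w_ge0// lo_le.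
Qed.

Lemma integrable_mid r r' : 0 < r ->
  (lam33 R).-integrable setT (fun z => (w z.1 * w z.2 * mid r r' (third z))%:E).
Proof.
move=> r0; pose e := r / 2; have e0 : 0 < e by rewrite divr_gt0.
have i1 : (lam33 R).-integrable setT (fun z : VV => (w z.1 * lo r' (third z) * hi e z.2)%:E).
  have := integrable_refl (integrable_low r' e0); congr (_.-integrable _ _).
  by apply/funext => z; rewrite third_refl.
have i2 : (lam33 R).-integrable setT (fun z : VV => (w z.2 * lo r' (third z) * hi e z.1)%:E).
  by have := integrable_swap i1; congr (_.-integrable _ _); apply/funext => z; rewrite third_swap.
apply: (integrable_le _ _ (integrable_RD i1 i2)).
  by apply: measurable_tri; [exact: measurable_w hg|exact: measurable_w hg|exact: measurable_mid].
move=> z; have W := w_ge0 g; have L := lo_ge0 g r'; have H := hi_ge0 g e.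
have p1 : 0 <= w z.1 * lo r' (third z) * hi e z.2 by rewrite !mulr_ge0.
have p2 : 0 <= w z.2 * lo r' (third z) * hi e z.1 by rewrite !mulr_ge0.
rewrite ger0_norm; last by rewrite mulr_ge0 ?mid_ge0// mulr_ge0.
have [h3|h3] := leP (enorm (third z : E3)) r.
  by rewrite /mid (hi0 h3) mul0r mulr0 addr_ge0.
have -> : mid r r' (third z) = lo r' (third z) by rewrite /mid (hiE h3) loE.
have [h2|h2] := leP (enorm (z.2 : E3)) e; last first.
  by rewrite (hiE h2) mulrAC lerDl.
have h1 : e < enorm (z.1 : E3).
  have := enorm_tri3 z; have : r = e + e by rewrite /e -splitr.
  lra.
have -> : w z.1 * w z.2 * lo r' (third z) = w z.2 * lo r' (third z) * hi e z.1 by rewrite (hiE h1); ring.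
by rewrite lerDr.
Qed.

(** * The energy balance for one low-frequency cutoff *)

Section localized.
Variables (P : E3 -> R) (r r' B : R).
Hypotheses (r0 : 0 < r) (mP : measurable_fun setT (P : V -> R)) (BP : forall x, `|P x| <= B)
  (Bq : forall x, `|1 - P x| <= B) (P1 : forall x, enorm x <= r -> P x = 1)
  (P0 : forall x, r' < enorm x -> P x = 0).

Lemma bound_ge0 : 0 <= B. Proof. exact: le_trans (normr_ge0 _) (BP 0). Qed.

Lemma measurable_q : measurable_fun setT (fun x : V => 1 - P x).
Proof. exact: measurable_funB. Qed.

Definition clamp (a : R) : R := Num.min 1 (Num.max 0 a).

Lemma clamp01 a : 0 <= clamp a <= 1.
Proof. by rewrite /clamp le_min ler01 le_max lexx/= ge_min lexx. Qed.

Lemma clamp_lip a b : `|clamp a - clamp b| <= `|a - b|.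
Proof.
have h1 := ler_norm (a - b); have h2 := ler_norm (- (a - b)); rewrite normrN in h2.
rewrite /clamp /Num.min /Num.max ler_norml.
by case: (ltP 0 a) => ha; case: (ltP 0 b) => hb; case: ltP => hc; case: ltP => hd; apply/andP; split; lra.
Qed.

(** It equals 1 up to |x| = N + 1, vanishes from 2 (N + 1) on and is Lipschitz with constant 1 / (N
    + 1). Being a function of |x|, it takes close values at eta and zeta when xi is small, although
    zeta is then close to -eta. *)
Definition chi (N : nat) (x : E3) : R := clamp (2 - enorm x / N.+1%:R).

Lemma N_gt0 (N : nat) : 0 < N.+1%:R :> R. Proof. by rewrite ltr0n. Qed.

Lemma chi_eq0 N x : 2 * N.+1%:R <= enorm x -> chi N x = 0.
Proof.
move=> h; have h2 : 2 <= enorm x / N.+1%:R by rewrite ler_pdivlMr ?N_gt0.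
by rewrite /chi /clamp (max_idPl _) ?subr_le0//; apply/min_idPr.
Qed.

Lemma chi_eq1 N x : enorm x <= N.+1%:R -> chi N x = 1.
Proof.
move=> h; have h2 : enorm x / N.+1%:R <= 1 by rewrite ler_pdivrMr ?N_gt0// mul1r.
rewrite /chi /clamp; apply/min_idPl; rewrite le_max; apply/orP; right.
by move: h2; move: (_ / _) => t ht; lra.
Qed.

Lemma chi_lip N (x y : E3) : `|chi N x - chi N y| <= `|enorm x - enorm y| / N.+1%:R.
Proof.
apply: le_trans (clamp_lip _ _) _.
have -> : 2 - enorm x / N.+1%:R - (2 - enorm y / N.+1%:R) = - ((enorm x - enorm y) / N.+1%:R) by rewrite mulrBl; ring.
by rewrite normrN normrM normfV (ger0_norm (ler0n _ _)).
Qed.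

Lemma measurable_chi N : measurable_fun setT (chi N : V -> R).
Proof.
apply: measurable_minr; first exact: measurable_cst.
apply: measurable_maxr; first exact: measurable_cst.
apply: measurable_funB => //; apply: measurable_funM => //; exact: measurable_enorm.
Qed.

Lemma chi_norm N x : `|chi N x| <= 1.
Proof. by have /andP[? ?] := clamp01 (2 - enorm x / N.+1%:R); rewrite ger0_norm. Qed.

Lemma chi_cvg (x : E3) : \forall N \near \oo, chi N x = 1.
Proof.
have [m hm] := enorm_le_nat x; near=> N; apply: chi_eq1; apply: le_trans hm _; rewrite ler_nat.
by apply: leqW; near: N; exact: nbhs_infty_ge.
Unshelve. all: by end_near. Qed.

Definition wt N (x : V) : R := (1 - P x) * chi N x.

Lemma measurable_wt N : measurable_fun setT (wt N).
Proof. by apply: measurable_funM; [exact: measurable_q|exact: measurable_chi]. Qed.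

Lemma wt_bound N (x : V) : `|wt N x| <= B.
Proof. by rewrite normrM -[leRHS]mulr1 ler_pM// chi_norm. Qed.

Lemma wt_mid N (x : V) : enorm (x : E3) * w x * `|wt N x| <= 2 * N.+1%:R * B * mid r (2 * N.+1%:R) x.
Proof.
have n0 := N_gt0 N; have b0 := bound_ge0.
have rhs0 : 0 <= 2 * N.+1%:R * B * mid r (2 * N.+1%:R) x.
  by rewrite mulr_ge0 ?mid_ge0// mulr_ge0// mulr_ge0// ltW.
have [h|h] := leP (enorm (x : E3)) r; first by rewrite /wt P1// subrr mul0r normr0 mulr0.
have [h2|h2] := leP (enorm (x : E3)) (2 * N.+1%:R); last by rewrite /wt (chi_eq0 (ltW h2)) mulr0 normr0 mulr0.
rewrite /mid (hiE h) indicE mem_set//= mulr1 mulrAC ler_wpM2r ?w_ge0//.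
by apply: ler_pM; rewrite ?enorm_ge0//; exact: wt_bound.
Qed.

Lemma cL1_F N : cL1 (lam33 R) (fun z => triform z * (wt N (third z))%:C).
Proof.
apply: (cL1_dom (h := fun z => 2 * N.+1%:R * B * (w z.1 * w z.2 * mid r (2 * N.+1%:R) (third z)))).
- apply: cmeasM; first exact: cmeas_triform.
  by apply: cmeas_real; exact: (measurableT_comp (measurable_wt N) (@measurable_third R)).
- move=> z; rewrite cabsM cabs_real; apply: le_trans (ler_wpM2r (normr_ge0 _) (cabs_triform_le3 z)) _.
  have := wt_mid N (third z); move: (`|wt N _|) (mid _ _ _) (enorm _) => a b e h.
  have ww : 0 <= w z.1 * w z.2 by rewrite mulr_ge0 ?w_ge0.
  have := ler_wpM2l ww h; lra.
- by apply: integrable_RZ; exact: integrable_mid.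
Qed.

(** By the symmetry [ns_conj] this is |y|^{2s} |g(y)|^2, the energy density in frequency. *)
Definition dens (y : V) : R[i] := (enorm (y : E3) `^ (2 * s))%:C * \sum_i g i (- (y : E3)) * g i y.

Lemma cmeas_dens : cmeas dens.
Proof.
apply: cmeasM; first by apply: cmeas_real; exact: (locb_powR (s2_ge0 s56)).1.
apply: cmeas_sum => i; apply: cmeasM; last exact: cmeas_g hg i.
exact: (cmeas_comp (scales3_opp R).1 (cmeas_g hg i)).
Qed.

Lemma cL1_dens : cL1 (lam3 R) dens.
Proof.
have [_ i2] := sqi_w s56 hg; apply: cL1_dom cmeas_dens _ i2 => y.
rewrite exprMn [(_ `^ _) ^+ 2]expr2 -powR_double.
rewrite cabsM cabs_real ger0_norm ?powR_ge0// ler_wpM2l ?powR_ge0//.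
apply: le_trans (cabs_sum _ _ _) _; rewrite expr2 {1}/w mulr_suml; apply: ler_sum => i _.
by rewrite cabsM (ns_conj hg) cabs_conj ler_wpM2l ?cabs_ge0// cabs_g_le.
Qed.

(** [refl] moves the weight from zeta to eta, so that for fixed eta = y the integral over xi is a
    combination of the convolutions in [energy_density]. The sign is that of [advect_refl]. *)
Lemma localized_balance N : cint (lam3 R) (fun y => dens y * (wt N y)%:C) =
  - ((c0 R)%:C * ii R) * cint (lam33 R) (fun z => triform z * (wt N (third z))%:C).
Proof.
have lF := cL1_F N.
pose H (z : VV) := triform (refl z) * (wt N z.2)%:C.
have eH : (fun z => triform (refl z) * (wt N (third (refl z)))%:C) = H.
  by apply/funext => z; rewrite third_refl.
have lH : cL1 (lam33 R) H by have := scales_cL1 ltr01 (@scales_refl33 R) lF; rewrite eH.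
have cH : cint (lam33 R) H = cint (lam33 R) (fun z => triform z * (wt N (third z))%:C).
  by have := scales_cint ltr01 (@scales_refl33 R) lF; rewrite eH mul1r.
rewrite -cH (cfubini33_2 lH) -cintZ; last exact: cL1_cint33_1 lH.
apply: ae_eq_cint.
- by apply: cmeasM; [exact: cmeas_dens|apply: cmeas_real; exact: measurable_wt].
- by apply: cmeasM; [exact: cmeas_cst|exact: (cL1_cint33_1 lH).1].
have h1 := conv_section_ae hpsi s56 hg; have h2 := energy_density hpsi s56 hg hg.
move: h1 h2; apply: filterS2 => y hc he; rewrite /dens he.
have -> : cint (lam3 R) (fun x => H (x, y)) = cint (lam3 R) (fun x : V => \sum_i \sum_j
    (- ((coord (y : E3) j)%:C * g i y * (wt N y)%:C)) * (g j x * g i (third (x, y)))).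
  apply: (congr1 (cint (lam3 R))); apply/funext => x; rewrite /H /triform advect_refl pairing_refl.
  rewrite /advect /pairing /= !mulNr big_distrlr /= exchange_big /= mulr_suml -sumrN.
  apply: eq_bigr => i _; rewrite mulr_suml -sumrN; apply: eq_bigr => j _; ring.
have hs i j : cL1 (lam3 R) (fun x : V => (- ((coord (y : E3) j)%:C * g i y * (wt N y)%:C)) * (g j x * g i (third (x, y)))).
  exact: cL1Z (hc i j).
rewrite cint_sum; last by move=> i; apply: cL1_sum => j; exact: hs.
rewrite mulNr -mulrN -[LHS]mulrA; congr (_ * _); rewrite mulr_suml -sumrN; apply: eq_bigr => i _.
rewrite cint_sum; last by move=> j; exact: hs.
rewrite mulr_suml -sumrN; apply: eq_bigr => j _; rewrite cintZ; last exact: hc.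
by rewrite /conv; ring.
Qed.

Definition near_part N (z : VV) : R[i] := triform z * (P z.2 * wt N (third z))%:C.
Definition far_part N (z : VV) : R[i] := triform z * ((1 - P z.2) * wt N (third z))%:C.
Definition commut N (z : VV) : R[i] :=
  triform z * ((1 - P z.2) * (1 - P (third z)) * (chi N (third z) - chi N z.2))%:C.

Let mP2 : measurable_fun setT (fun z : VV => P z.2).
Proof. exact: (measurableT_comp mP measurable_snd). Qed.
Lemma cL1_bounded_mul (F : VV -> R[i]) (a : VV -> R) : cL1 (lam33 R) F -> measurable_fun setT a ->
  (forall z, `|a z| <= B) -> cL1 (lam33 R) (fun z => F z * (a z)%:C).
Proof.
move=> lF ma ha; apply: (cL1_le _ (cL1Z B%:C lF)).
  by apply: cmeasM; [exact: lF.1|exact: cmeas_real].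
by move=> z; rewrite !cabsM !cabs_real mulrC ler_wpM2r ?cabs_ge0// (le_trans (ha z) (ler_norm _)).
Qed.

Lemma near_far N z : triform z * (wt N (third z))%:C = near_part N z + far_part N z.
Proof. by rewrite /near_part /far_part -mulrDr -rmorphD /=; congr (_ * (_)%:C); ring. Qed.

Lemma cL1_near N : cL1 (lam33 R) (near_part N).
Proof.
have := cL1_bounded_mul (cL1_F N) mP2 (fun z => BP z.2).
by congr (cL1 _ _); apply/funext => z; rewrite /near_part; move: (triform z) (P _) (wt _ _) => a b c; rewrite rmorphM /=; ring.
Qed.

Lemma cL1_far N : cL1 (lam33 R) (far_part N).
Proof.
have := cL1_bounded_mul (cL1_F N) (measurable_funB (measurable_cst _) mP2) (fun z => Bq z.2).
by congr (cL1 _ _); apply/funext => z; rewrite /far_part; move: (triform z) (wt _ _) => a c; rewrite [in RHS]rmorphM /=; ring.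
Qed.

(* The substitution exchanging eta and zeta changes the sign of [advect]. *)
Lemma far_commut N : 2 * cint (lam33 R) (far_part N) = cint (lam33 R) (commut N).
Proof.
have lF := cL1_far N; have lG := scales_cL1 ltr01 (@scales_refl33 R) lF.
have := scales_cint ltr01 (@scales_refl33 R) lF; rewrite mul1r => e.
transitivity (cint (lam33 R) (far_part N) + cint (lam33 R) (far_part N)).
  by move: (cint _ _) => x; ring.
rewrite -{2}e -cintD; [|exact: lF|exact: lG].
apply: (congr1 (cint (lam33 R))); apply/funext => z; rewrite /far_part /commut /triform.
rewrite advect_refl pairing_refl third_refl /= /wt.
by rewrite !(rmorphM, rmorphB) /=; ring.
Qed.

Lemma chi_diff_le N (x y : E3) : `|chi N x - chi N y| <= 1.
Proof.
have := clamp01 (2 - enorm x / N.+1%:R); have := clamp01 (2 - enorm y / N.+1%:R).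
rewrite -/(chi N x) -/(chi N y) ler_norml => /andP[a b] /andP[c d]; apply/andP; split; lra.
Qed.

Lemma min3_le1 (z : VV) : min3 z <= enorm (z.1 : E3).
Proof. by rewrite /min3 !ge_min lexx. Qed.

Lemma min3_ge0 (z : VV) : 0 <= min3 z.
Proof. by rewrite /min3 !le_min !enorm_ge0. Qed.

(* Where both frequencies exceed 2(N+1) the difference vanishes; elsewhere the Lipschitz
   constant 1/(N+1) of [chi N] compensates the factor min(|eta|,|zeta|). *)
Lemma min_chi_le N (z : VV) : Num.min (enorm (z.2 : E3)) (enorm (third z : E3)) *
  `|chi N (third z) - chi N z.2| <= 2 * min3 z.
Proof.
set m := Num.min _ _; set D := `|_|.
have m0 : 0 <= m by rewrite /m le_min !enorm_ge0.
have D1 : D <= 1 by exact: chi_diff_le.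
have D0 : 0 <= D by exact: normr_ge0.
have em : min3 z = Num.min (enorm (z.1 : E3)) m by rewrite /min3 minA.
have n0 := N_gt0 N.
have [h|h] := leP (2 * N.+1%:R) m.
  have -> : D = 0.
    have : 2 * N.+1%:R <= m := h; rewrite /m le_min => /andP[h1 h2].
    by rewrite /D (chi_eq0 h1) (chi_eq0 h2) subrr normr0.
  by rewrite mulr0 mulr_ge0 ?min3_ge0.
have DL : D <= enorm (z.1 : E3) / N.+1%:R.
  apply: le_trans (chi_lip _ _ _) _; rewrite ler_pM2r ?invr_gt0// ler_norml.
  have t2 := enorm_tri2 z; have t3 := enorm_tri3 z; apply/andP; split; lra.
rewrite em minr_pMr// le_min; apply/andP; split.
  apply: (@le_trans _ _ (2 * N.+1%:R * (enorm (z.1 : E3) / N.+1%:R))); first by apply: ler_pM => //; exact: ltW.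
  by rewrite -mulrA [N.+1%:R * _]mulrC divfK ?gt_eqF.
apply: (@le_trans _ _ m); first by rewrite ler_piMr.
by rewrite ler_peMl// ler1n.
Qed.

(** A majorant free of N, split according to |xi|. For |xi| <= r the minimum is at most r and the
    factor at xi is integrable; otherwise all three frequencies are high and [integrable_min3] is
    available. *)
Definition commut_dom (z : VV) : R := B * B * (2 * (r * (lo r z.1 * hi r z.2 * hi r (third z)) +
  min3 z * (hi r z.1 * hi r z.2 * hi r (third z)))).

Lemma q_hi (x : V) : `|1 - P x| * w x <= B * hi r x.
Proof.
have [h|h] := leP (enorm (x : E3)) r; first by rewrite P1// subrr normr0 mul0r mulr_ge0 ?bound_ge0 ?hi_ge0.
by rewrite (hiE h) ler_wpM2r ?w_ge0.
Qed.

Lemma cabs_commut_le N z : cabs (commut N z) <= commut_dom z.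
Proof.
rewrite /commut /triform !cabsM cabs_real !normrM /commut_dom.
have hA : cabs (advect z) <= Num.min (enorm (z.2 : E3)) (enorm (third z : E3)) * w z.1.
  by rewrite /Num.min; case: ifP => _; [exact: cabs_advect_le|exact: cabs_advect_le3].
have hB := cabs_pairing_le z; have hC := min_chi_le N z.
have q2 := q_hi z.2; have q3 := q_hi (third z).
apply: (@le_trans _ _ ((2 * min3 z * w z.1) * ((B * hi r z.2) * (B * hi r (third z))))).
  apply: (@le_trans _ _ ((Num.min (enorm (z.2 : E3)) (enorm (third z : E3)) * `|chi N (third z) - chi N z.2| * w z.1) *
     ((`|1 - P z.2| * w z.2) * (`|1 - P (third z)| * w (third z))))).
    have -> : cabs (advect z) * cabs (pairing z) * (`|1 - P z.2| * `|1 - P (third z)| * `|chi N (third z) - chi N z.2|) =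
      (cabs (advect z) * cabs (pairing z)) * (`|chi N (third z) - chi N z.2| * `|1 - P z.2| * `|1 - P (third z)|) by ring.
    have -> : Num.min (enorm (z.2 : E3)) (enorm (third z : E3)) * `|chi N (third z) - chi N z.2| * w z.1 *
     ((`|1 - P z.2| * w z.2) * (`|1 - P (third z)| * w (third z))) =
     (Num.min (enorm (z.2 : E3)) (enorm (third z : E3)) * w z.1) * (w z.2 * w (third z)) *
     (`|chi N (third z) - chi N z.2| * `|1 - P z.2| * `|1 - P (third z)|) by ring.
    rewrite ler_wpM2r//.
    by apply: ler_pM; rewrite ?cabs_ge0.
  have mn : 0 <= Num.min (enorm (z.2 : E3)) (enorm (third z : E3)) by rewrite le_min !enorm_ge0.
  apply: ler_pM; [by rewrite !mulr_ge0 ?w_ge0|by rewrite !mulr_ge0 ?w_ge0|by rewrite ler_wpM2r ?w_ge0|].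
  by apply: ler_pM; rewrite ?mulr_ge0 ?w_ge0.
have hh : 0 <= hi r z.2 * hi r (third z) by rewrite mulr_ge0 ?hi_ge0.
have -> : 2 * min3 z * w z.1 * (B * hi r z.2 * (B * hi r (third z))) =
  B * B * (2 * (min3 z * lo r z.1 * (hi r z.2 * hi r (third z)) + min3 z * (hi r z.1 * hi r z.2 * hi r (third z)))).
  by rewrite (lo_hi g r z.1); ring.
rewrite ler_wpM2l ?mulr_ge0 ?bound_ge0// ler_wpM2l// lerD2r.
have -> : r * (lo r z.1 * hi r z.2 * hi r (third z)) = r * lo r z.1 * (hi r z.2 * hi r (third z)) by ring.
rewrite ler_wpM2r//.
rewrite /lo; case: ifP => h; last by rewrite !mulr0.
by rewrite ler_wpM2r ?w_ge0//; apply: le_trans (min3_le1 z) h.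
Qed.

(** Here the lower bound on s is decisive: with 5/6 <= s the high part remains square integrable
    with the weight |x|^(5/6). *)
Lemma integrable_commut_dom : (lam33 R).-integrable setT (fun z => (commut_dom z)%:E).
Proof.
have Hr := sqi_hi0 s56 hg r0.
apply: integrable_RZ; apply: integrable_RZ; apply: integrable_RD.
  by apply: integrable_RZ; exact: (tri_integrable1 (lo_ge0 g r) (integrable_lo hg r) Hr Hr).
have h0 : hi r 0 = 0 by apply: hi0; rewrite enorm0 ltW.
have h5 : sqi (fun x : V => enorm (x : E3) `^ (5 / 6) * hi r x) by apply: (sqi_hi s56 hg r0); rewrite divr_ge0.
exact: (integrable_min3 hpsi (measurable_hi hg r) (hi_ge0 g r) h0 h5).
Qed.

Lemma cmeas_commut N : cmeas (commut N).
Proof.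
apply: cmeasM; first exact: cmeas_triform.
apply: cmeas_real; apply: measurable_funM.
  apply: measurable_funM; first by apply: measurable_funB.
  exact: (measurableT_comp measurable_q (@measurable_third R)).
apply: measurable_funB; first exact: (measurableT_comp (measurable_chi N) (@measurable_third R)).
exact: (measurableT_comp (measurable_chi N) measurable_snd).
Qed.

Lemma ccvg_near (z_ : nat -> R[i]) z : (\forall N \near \oo, z_ N = z) -> ccvg z_ z.
Proof.
move=> h; apply: cvg_near_cst; move: h; apply: filterS => N ->.
by rewrite subrr cabs0.
Qed.

Lemma commut_cvg0 : ccvg (fun N => cint (lam33 R) (commut N)) 0.
Proof.
rewrite -(cint0 (lam33 R)); apply: cint_dct integrable_commut_dom _ _.
- exact: cmeas_commut.
- exact: cmeas_cst.
- move=> z; apply: ccvg_near; move: (chi_cvg (third z)) (chi_cvg z.2); apply: filterS2 => N e1 e2.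
  by rewrite /commut e1 e2 subrr mulr0 mulr0.
- by move=> z N; exact: cabs_commut_le.
Qed.

Lemma far_cvg0 : ccvg (fun N => cint (lam33 R) (far_part N)) 0.
Proof.
have := ccvgZ 2^-1 commut_cvg0; rewrite mulr0; congr ccvg; apply/funext => N.
by rewrite -far_commut mulKf// pnatr_eq0.
Qed.

Definition balance_form (z : VV) : R[i] := triform z * (P z.2 * (1 - P (third z)))%:C.

Lemma cmeas_balance_form : cmeas balance_form.
Proof.
apply: cmeasM; first exact: cmeas_triform.
apply: cmeas_real; apply: measurable_funM => //.
exact: (measurableT_comp measurable_q (@measurable_third R)).
Qed.

Definition near_dom (z : VV) : R := `|r'| * B * B * (w z.1 * lo r' z.2 * hi r (third z)).

Lemma cabs_near_le (z : VV) (a : R) : `|a| <= 1 ->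
  cabs (triform z * (P z.2 * ((1 - P (third z)) * a))%:C) <= near_dom z.
Proof.
move=> a1; rewrite cabsM cabs_real !normrM /near_dom.
have b0 := bound_ge0.
have p2 : enorm (z.2 : E3) * w z.2 * `|P z.2| <= `|r'| * B * lo r' z.2.
  have [h|h] := leP (enorm (z.2 : E3)) r'; last by rewrite P0// normr0 mulr0 !mulr_ge0 ?lo_ge0.
  rewrite (loE' h) mulrAC ler_wpM2r ?w_ge0//; apply: ler_pM; rewrite ?enorm_ge0//.
  exact: le_trans h (ler_norm _).
have q3 : `|1 - P (third z)| * `|a| * w (third z) <= B * hi r (third z).
  apply: le_trans (q_hi _); rewrite ler_wpM2r ?w_ge0//; by rewrite ler_piMr.
apply: (@le_trans _ _ (w z.1 * ((enorm (z.2 : E3) * w z.2 * `|P z.2|) * (`|1 - P (third z)| * `|a| * w (third z))))).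
  have -> : w z.1 * ((enorm (z.2 : E3) * w z.2 * `|P z.2|) * (`|1 - P (third z)| * `|a| * w (third z))) =
    (enorm (z.2 : E3) * (w z.1 * w z.2 * w (third z))) * (`|P z.2| * (`|1 - P (third z)| * `|a|)) by ring.
  by rewrite ler_wpM2r ?mulr_ge0//; exact: cabs_triform_le.
have -> : `|r'| * B * B * (w z.1 * lo r' z.2 * hi r (third z)) = w z.1 * ((`|r'| * B * lo r' z.2) * (B * hi r (third z))) by ring.
rewrite ler_wpM2l ?w_ge0//; apply: ler_pM => //; by rewrite !mulr_ge0 ?enorm_ge0 ?w_ge0.
Qed.

Lemma integrable_near_dom : (lam33 R).-integrable setT (fun z => (near_dom z)%:E).
Proof. by apply: integrable_RZ; exact: integrable_low. Qed.

Lemma cL1_balance_form : cL1 (lam33 R) balance_form.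
Proof.
apply: (cL1_dom (h := near_dom) cmeas_balance_form _ integrable_near_dom) => z.
by have := @cabs_near_le z 1; rewrite mulr1 normr1 => /(_ (lexx _)).
Qed.

Lemma near_cvg : ccvg (fun N => cint (lam33 R) (near_part N)) (cint (lam33 R) balance_form).
Proof.
apply: cint_dct integrable_near_dom _ _.
- by move=> N; exact: (cL1_near N).1.
- exact: cmeas_balance_form.
- move=> z; apply: ccvg_near; move: (chi_cvg (third z)); apply: filterS => N e1.
  by rewrite /near_part /balance_form /wt e1 mulr1.
- by move=> z N; apply: cabs_near_le; exact: chi_norm.
Qed.

(** Dominated convergence as N -> oo in the localised balance: the far part vanishes by
    antisymmetry, and in the near part eta is confined to a bounded ball. *)
Theorem energy_balance : cint (lam3 R) (fun y => dens y * (1 - P y)%:C) =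
  - ((c0 R)%:C * ii R) * cint (lam33 R) balance_form.
Proof.
have h1 : ccvg (fun N => cint (lam3 R) (fun y => dens y * (wt N y)%:C)) (cint (lam3 R) (fun y => dens y * (1 - P y)%:C)).
  apply: (cint_dct (h := fun y => B * cabs (dens y))).
  - by move=> N; apply: cmeasM; [exact: cmeas_dens|apply: cmeas_real; exact: measurable_wt].
  - by apply: cmeasM; [exact: cmeas_dens|apply: cmeas_real; exact: measurable_q].
  - by apply: integrable_RZ; exact: cL1_dens.2.
  - move=> y; apply: ccvg_near; move: (chi_cvg y); apply: filterS => N e1.
    by rewrite /wt e1 mulr1.
  - by move=> y N; rewrite cabsM cabs_real mulrC ler_wpM2r ?cabs_ge0// wt_bound.
apply: ccvg_unique h1 _.
have := ccvgZ (- ((c0 R)%:C * ii R)) (ccvgD near_cvg far_cvg0); rewrite addr0.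
congr ccvg; apply/funext => N; rewrite localized_balance; congr (_ * _).
rewrite -cintD; [|exact: cL1_near|exact: cL1_far].
by apply: (congr1 (cint (lam33 R))); apply/funext => z; rewrite near_far.
Qed.

End localized.

End energy_identity.

(** * The Littlewood-Paley flux *)

Section trilinear_formula.
Variable R : realType.
Notation E3 := (R * R * R)%type.
Notation V := (mspace R).
Notation VV := (V * V)%type.
Variables (psi : E3 -> R) (hpsi : lp_cutoff psi).
Implicit Types A B C : V -> R[i].

Definition tri A B C (z : VV) : R[i] := A z.1 * B z.2 * C (third z).

Lemma cL2_sqi A : cL2 A -> sqi (fun x => cabs (A x)).
Proof. by move=> [mA iA]; split => //; exact: measurable_cabs. Qed.

Lemma cmeas_tri A B C : cmeas A -> cmeas B -> cmeas C -> cmeas (tri A B C).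
Proof.
move=> mA mB mC; apply: cmeasM; last exact: (cmeas_comp (@measurable_third R) mC).
by apply: cmeasM; [exact: (cmeas_comp measurable_fst mA)|exact: (cmeas_comp measurable_snd mB)].
Qed.

Lemma cL1_tri A B C : cL1 (lam3 R) A -> cL2 B -> cL2 C -> cL1 (lam33 R) (tri A B C).
Proof.
move=> A1 B2 C2; apply: (cL1_dom (h := fun z : VV => cabs (A z.1) * cabs (B z.2) * cabs (C (third z)))).
- by apply: cmeas_tri; [exact: A1.1|exact: B2.1|exact: C2.1].
- by move=> z; rewrite !cabsM.
- exact: (tri_integrable1 (fun x => cabs_ge0 (A x)) A1.2 (cL2_sqi B2) (cL2_sqi C2)).
Qed.

Lemma tri_swap A B C z : tri A B C (swap z) = tri B A C z.
Proof. by rewrite /tri third_swap /= [A _ * _]mulrC. Qed.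

Lemma cL1_tri2 A B C : cL2 A -> cL1 (lam3 R) B -> cL2 C -> cL1 (lam33 R) (tri A B C).
Proof.
move=> A2 B1 C2; have := scales_cL1 ltr01 (@scales_swap33 R) (cL1_tri B1 A2 C2).
by under eq_fun do rewrite tri_swap.
Qed.

Lemma cL2_shift A (a : E3) : cL2 A -> cL2 (fun y : V => A ((y : E3) + a)).
Proof.
move=> [mA iA]; split; first exact: (cmeas_comp (scales3_shift a).1 mA).
exact: (scales_integrable ltr01 (scales3_shift a) iA).
Qed.

Lemma cL2_reflv A (a : E3) : cL2 A -> cL2 (fun y : V => A (a - (y : E3))).
Proof.
move=> [mA iA]; split; first exact: (cmeas_comp (scales3_refl a).1 mA).
exact: (scales_integrable ltr01 (scales3_refl a) iA).
Qed.

(** The phase at xi is absorbed into a translation of [B], after which the integral is a Parseval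
    pairing. *)
Lemma inv_fourier_product B C (xi : E3) : cL1 (lam3 R) B -> cL2 B -> cL1 (lam3 R) C -> cL2 C ->
  inv_fourier (fun x => inv_fourier B x * inv_fourier C x) xi =
  (c0 R)%:C * cint (lam3 R) (fun y : V => B y * C (- xi - (y : E3))).
Proof.
move=> B1 B2 C1 C2; rewrite inv_fourierE; congr (_ * _).
have B1' := scales_cL1 ltr01 (scales3_shift (- xi)) B1.
have B2' := cL2_shift (- xi) B2.
transitivity (cint (lam3 R) (fun x => inv_fourier (fun y : V => B ((y : E3) - xi)) x * inv_fourier C x)).
  apply: (congr1 (cint (lam3 R))); apply/funext => x.
  by rewrite (inv_fourier_shift (- xi) x B1) dotpNr opprK mulrA [dotp x xi]dotpC.
rewrite (parseval hpsi B1' B2' C1 C2).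
have l : cL1 (lam3 R) (fun y : V => B ((y : E3) - xi) * C (- (y : E3))) by apply: cL2M => //; exact: cL2_opp.
have := scales_cint ltr01 (scales3_shift xi) l; rewrite mul1r => <-.
apply: (congr1 (cint (lam3 R))); apply/funext => y; congr (B _ * C _).
  exact: addrK.
by rewrite opprD addrC.
Qed.

Lemma inv_fourier_trilinear A B C : cL1 (lam3 R) A -> cL1 (lam3 R) B -> cL2 B ->
    cL1 (lam3 R) C -> cL2 C ->
  cint (lam3 R) (fun x => inv_fourier A x * (inv_fourier B x * inv_fourier C x)) =
  (c0 R)%:C * cint (lam33 R) (tri A B C).
Proof.
move=> A1 B1 B2 C1 C2.
have h1 : cL1 (lam3 R) (fun x => inv_fourier B x * inv_fourier C x).
  by apply: cL2M; [exact: (inv_fourier_cL2 hpsi B1 B2).1|exact: (inv_fourier_cL2 hpsi C1 C2).1].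
rewrite (fourier_mult A1 h1) (cfubini33_1 (cL1_tri A1 B2 C2)) -cintZ; last first.
  exact: cL1_cint33_2 (cL1_tri A1 B2 C2).
apply: (congr1 (cint (lam3 R))); apply/funext => xi.
rewrite (inv_fourier_product xi B1 B2 C1 C2) mulrCA; congr (_ * _).
rewrite -cintZ; last by apply: cL2M => //; exact: cL2_reflv.
by apply: (congr1 (cint (lam3 R))); apply/funext => y; rewrite /tri /third /= mulrA.
Qed.

Lemma cmeas_bounded_cL1 A B (K : R) : cmeas A -> (forall x, cabs (A x) <= K) ->
  cL1 (lam3 R) B -> cL1 (lam3 R) (fun x => A x * B x).
Proof.
move=> mA hA B1; apply: (cL1_le _ (cL1Z K%:C B1)); first exact: cmeasM mA B1.1.
by move=> x; rewrite !cabsM cabs_real ler_wpM2r ?cabs_ge0// (le_trans (hA x) (ler_norm _)).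
Qed.

Lemma cL1_inv_fourier3 A B C : cL1 (lam3 R) A -> cL1 (lam3 R) B -> cL2 B ->
    cL1 (lam3 R) C -> cL2 C ->
  cL1 (lam3 R) (fun x => inv_fourier A x * (inv_fourier B x * inv_fourier C x)).
Proof.
move=> A1 B1 B2 C1 C2; apply: (cmeas_bounded_cL1 (cmeas_inv_fourier A1.1)).
  by move=> x; exact: inv_fourier_bound.
by apply: cL2M; [exact: (inv_fourier_cL2 hpsi B1 B2).1|exact: (inv_fourier_cL2 hpsi C1 C2).1].
Qed.

(** A block of [g] reaching frequency 0 is integrable without being square integrable. In the flux
    one of the first two factors may be such a block, and the disjunction tells which one is not. *)
Lemma trilinear A B C : cL1 (lam3 R) A -> cL1 (lam3 R) B -> cL1 (lam3 R) C -> cL2 C ->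
  cL2 A \/ cL2 B ->
  [/\ cL1 (lam3 R) (fun x => inv_fourier A x * inv_fourier B x * inv_fourier C x),
      cL1 (lam33 R) (tri A B C) &
      cint (lam3 R) (fun x => inv_fourier A x * inv_fourier B x * inv_fourier C x) =
      (c0 R)%:C * cint (lam33 R) (tri A B C)].
Proof.
move=> A1 B1 C1 C2 [A2|B2].
  have e : (fun x => inv_fourier A x * inv_fourier B x * inv_fourier C x) =
    (fun x => inv_fourier B x * (inv_fourier A x * inv_fourier C x)).
    by apply/funext => x; rewrite mulrA [inv_fourier A x * _]mulrC.
  rewrite e; split; [exact: cL1_inv_fourier3|exact: cL1_tri2|].
  rewrite inv_fourier_trilinear//; congr (_ * _).
  have := scales_cint ltr01 (@scales_swap33 R) (cL1_tri B1 A2 C2); rewrite mul1r => <-.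
  by apply: (congr1 (cint (lam33 R))); apply/funext => z; rewrite tri_swap.
have e : (fun x => inv_fourier A x * inv_fourier B x * inv_fourier C x) =
    (fun x => inv_fourier A x * (inv_fourier B x * inv_fourier C x)).
  by apply/funext => x; rewrite mulrA.
rewrite e; split; [exact: cL1_inv_fourier3|exact: cL1_tri|].
exact: inv_fourier_trilinear.
Qed.

End trilinear_formula.

(** * Distributions whose Fourier transform is an integrable function *)

Section spectra.
Variable R : realType.
Notation E3 := (R * R * R)%type.
Notation V := (mspace R).
Variables (psi : E3 -> R) (hpsi : lp_cutoff psi).
Implicit Types (T : dist R) (G : E3 -> R[i]) (m : E3 -> R).

(** [T] is the inverse Fourier transform of the integrable function [G]. The identity is tested on
    Schwartz functions because they, unlike test functions, are stable under the Fourier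
    transform. *)
Definition spectrum T G := cL1 (lam3 R) (G : V -> R[i]) /\
  forall f, csch f -> T f = cint (lam3 R) (fun x => G x * inv_fourier f x).

Lemma loc_bounded G (K : R) : cmeas (G : V -> R[i]) -> (forall x, cabs (G x) <= K) -> locally_integrable3 G.
Proof.
move=> mG hG; apply: loc_of_cL1 => n.
have := integrable_RZ K (integrable_indic_eball hpsi n%:R).
apply: cL1_dom; first by apply: cmeasM => //; exact: (cL1_indic n%:R).1.
by move=> x; rewrite cabsM cabs_real ger0_norm ?indicE// ler_wpM2r.
Qed.

Lemma spectrum_represents T G : spectrum T G -> represents T (inv_fourier G).
Proof.
move=> [G1 hT]; split.
  by apply: loc_bounded; [exact: cmeas_inv_fourier G1.1|move=> x; exact: inv_fourier_bound].
move=> f tf; have sf := csch_test tf; rewrite (hT f sf) /dist_of cintegralE.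
by rewrite (fourier_mult G1 (csch_cL1 sf)).
Qed.

Lemma spectrum_fun_of T G : spectrum T G -> cmeas (fun_of T : V -> R[i]) /\
  {ae lam3 R, forall x : V, fun_of T x = inv_fourier G x}.
Proof.
move=> /spectrum_represents /(fun_of_represents hpsi) [[l _] ?]; split => //.
exact: lint3_cmeas.
Qed.

Lemma spectrum_dfourier T G : spectrum T G -> represents (dfourier T) G.
Proof.
move=> [G1 hT]; split; first exact: (cL1_loc hpsi G1).
move=> f tf; have sf := csch_test tf.
by rewrite /dfourier (hT _ (csch_fourier sf)) (inv_fourierK sf).
Qed.

Lemma ctest_mul m (f : E3 -> R[i]) : test_function m -> csmooth f ->
  cpart (fun x => (m x)%:C * f x) (@test_function R).
Proof.
move=> tm [sr si].
have er : (fun x => Re ((m x)%:C * f x)) = fun x => Re (f x) * m x.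
  by apply/funext => x; rewrite ReM /= mul0r subr0 mulrC.
have ei : (fun x => Im ((m x)%:C * f x)) = fun x => Im (f x) * m x.
  by apply/funext => x; rewrite ImM /= mul0r addr0 mulrC.
by split; rewrite ?er ?ei; exact: test_functionM.
Qed.

Lemma multiplier_spectrum m T G : test_function m -> represents (dfourier T) G ->
  spectrum (dinv_fourier (dmul m (dfourier T))) (fun x => G x * (m x)%:C).
Proof.
move=> tm [lG hG]; split; first exact: lint3_test lG tm.
move=> f sf; rewrite /dinv_fourier /dmul hG; last exact: ctest_mul tm (csmooth_inv_fourier sf).
rewrite /dist_of cintegralE; apply: (congr1 (cint (lam3 R))); apply/funext => x.
by rewrite mulrA.
Qed.

Lemma spectrum_sum (I : Type) (r : seq I) (T : I -> dist R) (G : I -> E3 -> R[i]) :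
  (forall i, spectrum (T i) (G i)) ->
  spectrum (fun f => \sum_(i <- r) T i f) (fun x => \sum_(i <- r) G i x).
Proof.
move=> h; split; first by apply: cL1_sum => i; exact: (h i).1.
move=> f sf; have hb i : cL1 (lam3 R) (fun x : V => G i x * inv_fourier f x).
  have := cmeas_bounded_cL1 (cmeas_inv_fourier (csch_cL1 sf).1) (fun x => inv_fourier_bound x (csch_cL1 sf)) (h i).1.
  by under eq_fun do rewrite mulrC.
rewrite -[LHS](_ : \sum_(i <- r) cint (lam3 R) (fun x => G i x * inv_fourier f x) = _).
  rewrite -cint_sum//; apply: (congr1 (cint (lam3 R))); apply/funext => x.
  by rewrite mulr_suml.
by apply: eq_bigr => i _; rewrite (h i).2.
Qed.

Lemma spectrum_dpartial j T G : spectrum T G -> cL1 (lam3 R) (fun x : V => ii R * (coord (x : E3) j)%:C * G x) ->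
  spectrum (dpartial j T) (fun x => ii R * (coord x j)%:C * G x).
Proof.
move=> [G1 hT] h1; split => // f sf; rewrite /dpartial hT; last exact: csch_cpartial.
have l : cL1 (lam3 R) (fun x : V => ii R * (coord (x : E3) j)%:C * G x * inv_fourier f x).
  have := cmeas_bounded_cL1 (cmeas_inv_fourier (csch_cL1 sf).1) (fun x => inv_fourier_bound x (csch_cL1 sf)) h1.
  by under eq_fun do rewrite mulrC.
have -> : (fun x : V => G x * inv_fourier (cpartial j f) x) =
    (fun x : V => - (ii R * (coord (x : E3) j)%:C * G x * inv_fourier f x)).
  apply/funext => x.
  by rewrite (inv_fourier_cpartial j x sf); move: (inv_fourier f x) => t; ring.
by rewrite (cintN l) opprK.
Qed.

(** The multiplier of the high part is not compactly supported, so its product with [G] is merely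
    locally integrable and the conclusion is a representation rather than a [spectrum]. *)
Lemma represents_high k T G : test_function (fun xi => psi ((2 ^ (- k) : R) *: xi)) ->
  represents (dfourier T) G ->
  represents (dfourier (lp_high psi k T)) (fun x => G x * (1 - psi ((2 ^ (- k) : R) *: x))%:C).
Proof.
move=> tm hG; have [lG eG] := hG; have [S1 hS] := multiplier_spectrum tm hG.
have e : (fun x => G x * (1 - psi ((2 ^ (- k) : R) *: x))%:C) =
  (fun x => G x - G x * (psi ((2 ^ (- k) : R) *: x))%:C).
  by apply/funext => x; rewrite rmorphB /= mulrBr mulr1.
rewrite e; split; first by apply: lint3B => //; exact: (@cL1_loc R psi hpsi _ S1).
move=> f tf; have sf := csch_test tf; rewrite /dfourier /lp_high.
have := eG f tf; rewrite /dfourier => ->.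
have := hS _ (csch_fourier sf); rewrite (inv_fourierK sf) /lp_S => ->.
rewrite /dist_of !cintegralE -cintB.
- by apply: (congr1 (cint (lam3 R))); apply/funext => x; rewrite mulrBl.
- exact: cL1_test.
- by apply: cL1_test => //; exact: (@cL1_loc R psi hpsi _ S1).
Qed.

End spectra.

(** * The flux as a trilinear Fourier multiplier *)

Section flux_multiplier.
Variable R : realType.
Notation E3 := (R * R * R)%type.
Notation V := (mspace R).
Notation VV := (V * V)%type.
Variables (psi : E3 -> R) (hpsi : lp_cutoff psi) (s : R).
Hypotheses (s56 : 5 / 6 <= s).
Variables (g : 'I_3 -> E3 -> R[i]) (hg : ns_system s g).

Definition psik (k : int) (x : E3) : R := psi ((2 ^ (- k) : R) *: x).
Definition phik (k : int) (x : E3) : R := lp_phi psi ((2 ^ (- k) : R) *: x).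
Definition qk (k : int) (x : E3) : R := 1 - psik k x.

Lemma pow2_gt0 (k : int) : 0 < (2 : R) ^ k.
Proof. by rewrite exprz_gt0. Qed.

Lemma pow2S (k : int) : (2 : R) ^ (k + 1) = 2 * 2 ^ k.
Proof. by rewrite expfzDr ?pnatr_eq0// mulrC. Qed.

Lemma pow2_le (k l : int) : k <= l -> (2 : R) ^ k <= 2 ^ l.
Proof. by move=> kl; rewrite ler_weXz2l// ler1n. Qed.

Lemma enorm_psik k (x : E3) : enorm ((2 ^ (- k) : R) *: x) = enorm x / 2 ^ k.
Proof. by rewrite enormZ ger0_norm ?(ltW (pow2_gt0 _))// -invr_expz mulrC. Qed.

Lemma psik_eq0 k x : 2 ^ k < enorm x -> psik k x = 0.
Proof.
by move=> h; apply: (cutoff_eq0_gt hpsi); rewrite enorm_psik ltr_pdivlMr ?pow2_gt0// mul1r.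
Qed.

Lemma psik_eq1 k x : enorm x <= 2 ^ (k - 1) -> psik k x = 1.
Proof.
move=> h; apply: (cutoff_eq1 hpsi); rewrite enorm_psik ler_pdivrMr ?pow2_gt0//.
by rewrite -[k in leRHS](subrK 1) pow2S mulKf ?pnatr_eq0.
Qed.

Lemma phikE k x : phik k x = psik (k + 1) x - psik k x.
Proof.
rewrite /phik /lp_phi scalerA /psik; congr (psi (_ *: _) - _).
by rewrite opprD expfzDr ?pnatr_eq0// mulrC.
Qed.

Lemma test_psik k : test_function (psik k).
Proof.
split.
  have -> : psik k = fun x => psi ((2 ^ (- k) : R) *: x + 0) by apply/funext => x; rewrite addr0.
  exact: smooth_comp_affine (axis_affine_scale _ 0) (cutoff_smooth hpsi).
by exists (2 ^ k) => x; exact: psik_eq0.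
Qed.

Lemma test_functionB (f h : E3 -> R) : test_function f -> test_function h -> test_function (fun x => f x - h x).
Proof.
move=> [sf [r hr]] [sh [t ht]]; split; first exact: smoothB.
exists (Num.max r t) => x; rewrite gt_max => /andP[rx tx].
by rewrite (hr x rx) (ht x tx) subr0.
Qed.

Lemma test_phik k : test_function (phik k).
Proof.
have -> : phik k = fun x => psik (k + 1) x - psik k x by apply/funext => x; exact: phikE.
exact: test_functionB (test_psik _) (test_psik _).
Qed.

Lemma smooth_qk k : smooth (qk k).
Proof. exact: smoothB (smooth_cst 1) (test_psik k).1. Qed.

Lemma qk_eq0 k x : enorm x <= 2 ^ (k - 1) -> qk k x = 0.
Proof. by move=> h; rewrite /qk psik_eq1// subrr. Qed.

(** Vanishing near the origin is what makes a compactly supported multiple of [g] square integrable: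
    there |x|^s is bounded below. *)
Definition offzero (m : E3 -> R) := exists2 rho, 0 < rho & forall x, enorm x <= rho -> m x = 0.

Lemma phik_eq0_le k x : enorm x <= 2 ^ (k - 1) -> phik k x = 0.
Proof.
move=> h; rewrite phikE psik_eq1 ?psik_eq1 ?subrr// addrK.
by apply: le_trans h (pow2_le _); rewrite gerDl.
Qed.

Lemma phik_eq0_gt k x : 2 ^ (k + 1) < enorm x -> phik k x = 0.
Proof.
move=> h; rewrite phikE psik_eq0 ?psik_eq0 ?subrr//.
by apply: le_lt_trans h; apply: pow2_le; rewrite lerDl.
Qed.

Lemma offzero_phik k : offzero (phik k).
Proof. by exists (2 ^ (k - 1)); [exact: pow2_gt0|exact: phik_eq0_le]. Qed.

Lemma offzero_qk k : offzero (qk k).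
Proof. by exists (2 ^ (k - 1)); [exact: pow2_gt0|exact: qk_eq0]. Qed.

Lemma offzeroMr m n : offzero n -> offzero (fun x => m x * n x).
Proof. by move=> [r r0 h]; exists r => // x xr; rewrite h ?mulr0. Qed.

Lemma cL1_mult i m : test_function m -> cL1 (lam3 R) (fun x : V => g i x * (m x)%:C).
Proof. exact: lint3_test (ns_loc hg i). Qed.

Lemma cL2_mult i m : test_function m -> offzero m -> cL2 (fun x : V => g i x * (m x)%:C).
Proof.
move=> tm [rho r0 hm]; have [B hB] := test_function_bounded tm.
have mm := (cL1_mult i tm).1; split => //.
suff sq : sqi (fun x : V => cabs (g i x * (m x)%:C)) by exact: sq.2.
apply: (sqi_le (C := B) (measurable_cabs mm) (sqi_hi0 s56 hg r0)) => x; rewrite (ger0_norm (cabs_ge0 _)) (ger0_norm (hi_ge0 _ _ _)) cabsM cabs_real.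
have [h|h] := leP (enorm (x : E3)) rho.
  by rewrite (hi0 _ h) hm// ?normr0 !mulr0.
by rewrite (hiE _ h) [leLHS]mulrC; apply: ler_pM; rewrite ?cabs_ge0 ?cabs_g_le.
Qed.

(** The constant [c0] comes from the transform of a triple product and [ii] from the one derivative;
    [triform] carries the vector structure, and only the scalar multiplier [K] varies. *)
Definition fluxval (v : R[i]) (K : VV -> R) :=
  cL1 (lam33 R) (fun z => triform g z * (K z)%:C) /\
  v = (c0 R)%:C * ii R * cint (lam33 R) (fun z => triform g z * (K z)%:C).

Lemma fluxvalD v v' K K' : fluxval v K -> fluxval v' K' -> fluxval (v + v') (fun z => K z + K' z).
Proof.
move=> [l e] [l' e'].
have eK : (fun z => triform g z * (K z + K' z)%:C) = (fun z => triform g z * (K z)%:C + triform g z * (K' z)%:C).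
  by apply/funext => z; rewrite rmorphD mulrDr.
split; rewrite eK; first exact: cL1D.
by rewrite cintD// mulrDr -e -e'.
Qed.

Definition fluxpair (F : V -> R[i]) (K : VV -> R) :=
  [/\ cL1 (lam3 R) F, cL1 (lam33 R) (fun z => triform g z * (K z)%:C) &
   cint (lam3 R) F = (c0 R)%:C * ii R * cint (lam33 R) (fun z => triform g z * (K z)%:C)].

Lemma fluxpair_val F K : fluxpair F K -> fluxval (cint (lam3 R) F) K.
Proof. by case. Qed.

Lemma fluxpair_sum (I : Type) (r : seq I) (F : I -> V -> R[i]) (K : I -> VV -> R) :
  (forall i, fluxpair (F i) (K i)) ->
  fluxpair (fun x => \sum_(i <- r) F i x) (fun z => \sum_(i <- r) K i z).
Proof.
move=> h.
have e : (fun z => triform g z * (\sum_(i <- r) K i z)%:C) = (fun z => \sum_(i <- r) triform g z * (K i z)%:C).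
  by apply/funext => z; rewrite rmorph_sum mulr_sumr.
have l1 i : cL1 (lam3 R) (F i) by have [] := h i.
have l2 i : cL1 (lam33 R) (fun z => triform g z * (K i z)%:C) by have [] := h i.
split; first by apply: cL1_sum.
  by rewrite e; apply: cL1_sum.
rewrite e cint_sum// cint_sum// mulr_sumr; apply: eq_bigr => i _.
by have [_ _ ->] := h i.
Qed.

(** Two grades of Fourier multiplier: [multiplies] admits the noncompact multiplier of the high
    part, while [band] is compactly supported, so that the distribution is a genuine bounded
    function that can enter a triple product. *)
Record multiplies (T : 'I_3 -> dist R) (m : E3 -> R) : Prop := Multiplies {
  mult_smooth : smooth m;
  mult_repr : forall i, represents (dfourier (T i)) (fun x => g i x * (m x)%:C) }.

Record band (T : 'I_3 -> dist R) (m : E3 -> R) : Prop := Band {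
  band_test : test_function m;
  band_spectrum : forall i, spectrum (T i) (fun x => g i x * (m x)%:C) }.

Lemma band_multiplies T m : band T m -> multiplies T m.
Proof.
move=> [[sm _] h]; split => // i; exact: (spectrum_dfourier hpsi (h i)).
Qed.

Lemma band_multiplier T m n : multiplies T m -> test_function n ->
  band (fun i => dinv_fourier (dmul n (dfourier (T i)))) (fun x => m x * n x).
Proof.
move=> [sm h] tn; split; first exact: test_functionM.
move=> i; have := multiplier_spectrum tn (h i); congr spectrum; apply/funext => x.
by rewrite rmorphM /= mulrA.
Qed.

Lemma test_sum (I : Type) (r : seq I) (f : I -> E3 -> R) : (forall i, test_function (f i)) ->
  test_function (fun x => \sum_(i <- r) f i x).
Proof.
move=> h; elim: r => [|i r IH].
  have -> : (fun x => \sum_(i <- [::]) f i x) = fun=> 0 by apply/funext => x; rewrite big_nil.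
  by split; [exact: smooth_cst|exists 0].
have -> : (fun x => \sum_(j <- i :: r) f j x) = fun x => f i x - (0 - \sum_(j <- r) f j x).
  by apply/funext => x; rewrite big_cons sub0r opprK.
apply: test_functionB (h i) (test_functionB _ IH).
by split; [exact: smooth_cst|exists 0].
Qed.

Lemma band_sum (I : Type) (r : seq I) (T : I -> 'I_3 -> dist R) (m : I -> E3 -> R) :
  (forall l, band (T l) (m l)) ->
  band (fun i f => \sum_(l <- r) T l i f) (fun x => \sum_(l <- r) m l x).
Proof.
move=> h; split; first by apply: test_sum => l; exact: band_test (h l).
move=> i; have := spectrum_sum r (fun l => band_spectrum (h l) i); congr spectrum; apply/funext => x.
by rewrite rmorph_sum mulr_sumr.
Qed.

Lemma cmeas_mul3 (a b c : V -> R[i]) : cmeas a -> cmeas b -> cmeas c -> cmeas (fun x => a x * b x * c x).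
Proof. by move=> ma mb mc; apply: cmeasM => //; exact: cmeasM. Qed.

Lemma fluxpair_trilin a b c ma mb mc : band a ma -> band b mb -> band c mc -> offzero mc ->
  offzero ma \/ offzero mb ->
  fluxpair (trilin a b c) (fun z => ma z.1 * mb z.2 * mc (third z)).
Proof.
move=> [ta ha] [tb hb] [tc hc] oc oab.
pose A j (x : V) := g j x * (ma x)%:C.
pose B i j (x : V) := ii R * (coord (x : E3) j)%:C * (g i x * (mb x)%:C).
pose C i (x : V) := g i x * (mc x)%:C.
have tj j : test_function (fun x => coord x j * mb x) by apply: test_functionM tb; exact: smooth_coord.
have eB i j : B i j = fun x : V => ii R * (g i x * (coord (x : E3) j * mb x)%:C).
  by apply/funext => x; rewrite /B rmorphM /=; ring.
have B1 i j : cL1 (lam3 R) (B i j) by rewrite eB; apply: cL1Z; exact: cL1_mult.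
have hAB i j : cL2 (A j) \/ cL2 (B i j).
  case: oab => [oa|ob]; [left; exact: cL2_mult|right].
  have h2 : cL2 (fun x : V => g i x * (coord (x : E3) j * mb x)%:C) by apply: cL2_mult => //; exact: offzeroMr.
  apply: cL2_dom (B1 i j).1 h2 _ => x.
  by have := eB i j => /(congr1 (fun F => F x)) ->; rewrite cabsM cabs_ii mul1r.
have tri_ij i j := trilinear hpsi (cL1_mult j ta) (B1 i j) (cL1_mult i tc) (cL2_mult i tc oc) (hAB i j).
have ij_ae i j : cmeas (fun x : V => fun_of (a j) x * fun_of (dpartial j (b i)) x * fun_of (c i) x) /\
  {ae lam3 R, forall x : V, inv_fourier (A j) x * inv_fourier (B i j) x * inv_fourier (C i) x =
     fun_of (a j) x * fun_of (dpartial j (b i)) x * fun_of (c i) x}.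
  have [m1 a1] := spectrum_fun_of hpsi (ha j).
  have [m2 a2] := spectrum_fun_of hpsi (spectrum_dpartial (hb i) (B1 i j)).
  have [m3 a3] := spectrum_fun_of hpsi (hc i).
  split; first exact: cmeas_mul3.
  move: a1 a2 a3; apply: filterS3 => x e1 e2 e3.
  by rewrite e1 e2 e3.
have l1 i j : cL1 (lam3 R) (fun x : V => fun_of (a j) x * fun_of (dpartial j (b i)) x * fun_of (c i) x).
  have [m ae] := ij_ae i j; have [l _ _] := tri_ij i j.
  exact: cL1_ae m ae l.
have l2 i j : cL1 (lam33 R) (tri (A j) (B i j) (C i)) by have [] := tri_ij i j.
(* The gradient contributes the factor [ii] inside [B]; the prefactor [- ii] removes it, as - i * i
   = 1. *)
have e2 : (fun z : VV => triform g z * (ma z.1 * mb z.2 * mc (third z))%:C) =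
  fun z => - ii R * \sum_i \sum_j tri (A j) (B i j) (C i) z.
  apply/funext => z; rewrite /triform /advect /pairing big_distrlr /= exchange_big /= mulr_suml mulr_sumr.
  apply: eq_bigr => i _; rewrite mulr_suml mulr_sumr; apply: eq_bigr => j _.
  rewrite /tri /A /B /C !rmorphM /=.
  have i2 : - ii R * ii R = 1 by rewrite /ii; simpc.
  have -> : forall p q t u v w : R[i], - ii R * (p * q * (ii R * t * (u * v)) * w) = (- ii R * ii R) * (t * p * u * q * v * w).
    by move=> *; ring.
  by rewrite i2 mul1r; ring.
have lS p : cL1 (lam33 R) (fun z => \sum_j tri (A j) (B p j) (C p) z) by apply: cL1_sum; exact: l2.
have lSS : cL1 (lam33 R) (fun z => \sum_i \sum_j tri (A j) (B i j) (C i) z) by apply: cL1_sum; exact: lS.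
split.
- by do 2!(apply: cL1_sum => ?); exact: l1.
- by rewrite e2; exact: cL1Z.
rewrite e2 cintZ//.
have -> : (c0 R)%:C * ii R * (- ii R * cint (lam33 R) (fun z => \sum_i \sum_j tri (A j) (B i j) (C i) z)) =
   (c0 R)%:C * cint (lam33 R) (fun z => \sum_i \sum_j tri (A j) (B i j) (C i) z).
  have i2 : ii R * - ii R = 1 by rewrite /ii; simpc.
  by move: (cint _ _) => t; rewrite -mulrA; congr (_ * _); rewrite mulrA i2 mul1r.
pose F i j (x : V) := fun_of (a j) x * fun_of (dpartial j (b i)) x * fun_of (c i) x.
have eL : cint (lam3 R) (trilin a b c) = \sum_i \sum_j cint (lam3 R) (F i j).
  rewrite -[LHS]/(cint (lam3 R) (fun x => \sum_i \sum_j F i j x)) cint_sum.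
    by apply: eq_bigr => i _; rewrite cint_sum//; exact: l1.
  by move=> i; apply: cL1_sum => j; exact: l1.
rewrite eL [in RHS]cint_sum// mulr_sumr; apply: eq_bigr => i _.
rewrite [in RHS]cint_sum; last by move=> j; exact: l2.
rewrite mulr_sumr; apply: eq_bigr => j _.
have [m ae] := ij_ae i j; have [l _ <-] := tri_ij i j.
apply: ae_eq_cint m l.1 _; by move: ae; apply: filterS => x ->.
Qed.

Variables (u : 'I_3 -> dist R) (hu : forall i, represents (dfourier (u i)) (g i)).

(** Each operator of [flux] is replaced by its multiplier at the frequency it acts on: xi for the
    advecting field, eta for the differentiated one, zeta for the last. *)
Definition flux_mult (k : int) (z : VV) : R :=
  \sum_(l <- zrange (k - 1) (k + 2)) \sum_(l' <- zrange (l - 2) (k - 1))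
    psik k z.1 * psik (l - 2) z.1 * phik l' z.2 * (qk k (third z) * phik l (third z))
  + \sum_(l <- zrange (k - 3) k) psik k z.1 * phik l z.1 * psik k z.2 *
    (\sum_(l' <- zrange (l - 2) (l + 2)) qk k (third z) * phik l' (third z))
  + \sum_(l <- zrange (k - 1) (k %/ 2)%Z) qk k z.1 * phik l z.1 * psik k z.2 *
    (\sum_(l' <- zrange (l - 2) (l + 2)) qk k (third z) * phik l' (third z)).

Lemma flux_multP k : fluxval (flux psi u k) (flux_mult k).
Proof.
have Bu n : test_function n -> band (fun i => dinv_fourier (dmul n (dfourier (u i)))) n.
  by move=> tn; split => // i; exact: multiplier_spectrum tn (hu i).
have MS := band_multiplies (Bu _ (test_psik k)).
have MK : multiplies (fun i => lp_high psi k (u i)) (qk k).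
  by split; [exact: smooth_qk|move=> i; exact: (represents_high hpsi (test_psik k) (hu i))].
have tD l : band (fun i => lp_tDelta psi l (lp_high psi k (u i)))
    (fun x => \sum_(l' <- zrange (l - 2) (l + 2)) qk k x * phik l' x).
  exact: (band_sum _ (fun l' => band_multiplier MK (test_phik l'))).
have otD l : offzero (fun x => \sum_(l' <- zrange (l - 2) (l + 2)) qk k x * phik l' x).
  have [r r0 h] := offzero_qk k; exists r => // x xr; rewrite big1// => l' _.
  by rewrite (h x xr) mul0r.
have op l n : offzero (fun x => n x * phik l x) := offzeroMr n (offzero_phik l).
apply: fluxvalD; first apply: fluxvalD.
- apply: fluxpair_val; apply: fluxpair_sum => l; apply: fluxpair_sum => l'.
  exact: (fluxpair_trilin (band_multiplier MS (test_psik _)) (Bu _ (test_phik _)) (band_multiplier MK (test_phik _))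
    (op _ _) (or_intror (offzero_phik _))).
- apply: fluxpair_val; apply: fluxpair_sum => l.
  exact: (fluxpair_trilin (band_multiplier MS (test_phik _)) (Bu _ (test_psik _)) (tD l) (otD l) (or_introl (op _ _))).
- apply: fluxpair_val; apply: fluxpair_sum => l.
  exact: (fluxpair_trilin (band_multiplier MK (test_phik _)) (Bu _ (test_psik _)) (tD l) (otD l) (or_introl (op _ _))).
Qed.

End flux_multiplier.

(** * Telescoping of the flux multiplier *)

Section multiplier_identity.
Variable R : realType.
Notation E3 := (R * R * R)%type.
Notation V := (mspace R).
Notation VV := (V * V)%type.
Variables (psi : E3 -> R) (hpsi : lp_cutoff psi).
Notation psik := (psik psi).
Notation phik := (phik psi).
Notation qk := (qk psi).

Lemma big_zrange (F : int -> R) (a : int) (n : nat) :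
  \sum_(l <- zrange a (a + n%:Z - 1)) F l = \sum_(i < n) F (a + i%:Z).
Proof.
case: n => [|n]; rewrite /zrange.
  by rewrite addr0 ifF ?big_nil ?big_ord0//; apply/negbTE; rewrite -ltNge; lia.
rewrite ifT; last by lia.
have -> : absz (a + n.+1%:Z - 1 - a)%R = n by lia.
by rewrite big_map -[iota _ _]/(index_iota 0 n.+1) big_mkord.
Qed.

(** The hypothesis includes the empty range b = a - 1, which occurs for l = k + 2 in the first sum
    of the flux. *)
Lemma zrange_psi_tele (a b : int) x : a <= b + 1 ->
  \sum_(l <- zrange a b) phik l x = psik (b + 1) x - psik a x.
Proof.
move=> ab; pose n := absz (b + 1 - a)%R.
have -> : b = a + n%:Z - 1 by rewrite /n; lia.
rewrite subrK big_zrange; elim: n => [|n IH]; first by rewrite big_ord0 addr0 subrr.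
rewrite big_ord_recr /= IH phikE (_ : a + n.+1%:Z = a + n%:Z + 1); last by lia.
ring.
Qed.

Lemma sum_zrange0 (F : int -> R) a b : (forall l, a <= l <= b -> F l = 0) -> \sum_(l <- zrange a b) F l = 0.
Proof.
move=> h; rewrite /zrange; case: ifP => ab; last by rewrite big_nil.
rewrite big_map big_seq big1// => i; rewrite mem_iota => /andP[_ ib]; apply: h; lia.
Qed.

Lemma eq_zrange (F G : int -> R) a b : (forall l, a <= l <= b -> F l = G l) ->
  \sum_(l <- zrange a b) F l = \sum_(l <- zrange a b) G l.
Proof.
move=> h; apply/eqP; rewrite -subr_eq0 -sumrB; apply/eqP; apply: sum_zrange0 => l hl.
by rewrite h// subrr.
Qed.

Lemma zrange_last (F : int -> R) a b : a <= b -> \sum_(l <- zrange a b) F l = \sum_(l <- zrange a (b - 1)) F l + F b.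
Proof.
move=> ab; pose n := absz (b - a)%R.
have -> : b = a + n.+1%:Z - 1 by rewrite /n; lia.
have -> : a + n.+1%:Z - 1 - 1 = a + n%:Z - 1 by lia.
by rewrite !big_zrange big_ord_recr /=; congr (_ + F _); lia.
Qed.

Definition high_mult (k : int) (z : VV) : R := \sum_(l <- zrange (k - 1) (k %/ 2)%Z) phik l z.1 *
    (\sum_(l' <- zrange (l - 2) (l + 2)) phik l' (third z)).

Lemma tphiE l x : \sum_(l' <- zrange (l - 2) (l + 2)) phik l' x = psik (l + 3) x - psik (l - 2) x.
Proof. by rewrite zrange_psi_tele; [congr (psik _ _ - _); lia|lia]. Qed.

Lemma psik_low k j x : 2 ^ (k - 1) < enorm x -> j <= - 1 -> psik (k + j) x = 0.
Proof. by move=> h hj; apply: (psik_eq0 hpsi); apply: le_lt_trans h; apply: pow2_le; lia. Qed.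

Lemma psik_high k j x : enorm x <= 2 ^ k -> 1 <= j -> psik (k + j) x = 1.
Proof. by move=> h hj; apply: (psik_eq1 hpsi); apply: le_trans h _; apply: pow2_le; lia. Qed.

Lemma psik_neq0 k x : psik k x != 0 -> enorm x <= 2 ^ k.
Proof. by move=> h; rewrite leNgt; apply/negP => /(psik_eq0 hpsi) e; rewrite e eqxx in h. Qed.

Lemma qk_neq0 k x : qk k x != 0 -> 2 ^ (k - 1) < enorm x.
Proof. by move=> h; rewrite ltNge; apply/negP => /(qk_eq0 hpsi) e; rewrite e eqxx in h. Qed.

Lemma pow2D (k : int) : (2 : R) ^ k + 2 ^ k = 2 ^ (k + 1).
Proof. by rewrite pow2S; ring. Qed.

(** With l = k + j: if |xi| and |eta| are at most 2^(l-2) then |zeta| <= 2^(l-1), where the block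
    [phik l] vanishes. This disposes of the subtracted end of the inner telescoping sum. *)
Lemma low_low k (z : VV) j : psik (k + j - 2) z.1 * phik (k + j) (third z) * psik (k + j - 2) z.2 = 0.
Proof.
have [->|/psik_neq0 h1] := eqVneq (psik (k + j - 2) z.1) 0; first by rewrite !mul0r.
have [->|/psik_neq0 h2] := eqVneq (psik (k + j - 2) z.2) 0; first by rewrite mulr0.
rewrite (phik_eq0_le hpsi) ?mulr0 ?mul0r//; apply: le_trans (enorm_tri3 z) _; apply: le_trans (lerD h1 h2) _.
by rewrite pow2D; apply: pow2_le; lia.
Qed.

(* Paraproduct decomposition; the sums telescope once the supports are taken into account. *)
Lemma flux_multE k z : flux_mult psi k z =
  psik k z.2 * qk k (third z) * (psik k z.1 + qk k z.1 * high_mult k z).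
Proof.
rewrite /flux_mult.
have -> : \sum_(l <- zrange (k - 1) (k %/ 2)%Z) qk k z.1 * phik l z.1 * psik k z.2 *
    (\sum_(l' <- zrange (l - 2) (l + 2)) qk k (third z) * phik l' (third z)) =
    psik k z.2 * qk k (third z) * (qk k z.1 * high_mult k z).
  rewrite /high_mult !mulr_sumr; apply: eq_bigr => l _; rewrite -mulr_sumr; ring.
rewrite [RHS]mulrDr; congr (_ + _).
have [q0|/qk_neq0 q0] := eqVneq (qk k (third z)) 0.
  rewrite q0 mulr0 mul0r big1 => [|l _]; last by rewrite big1// => l' _; rewrite mul0r mulr0.
  by rewrite add0r big1// => l _; rewrite big1 ?mulr0// => l' _; rewrite mul0r.
have [x0|/psik_neq0 x0] := eqVneq (psik k z.1) 0.
  rewrite x0 mulr0 big1 => [|l _]; last by rewrite big1// => l' _; rewrite !mul0r.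
  by rewrite add0r big1// => l _; rewrite !mul0r.
have T1 : \sum_(l <- zrange (k - 1) (k + 2)) \sum_(l' <- zrange (l - 2) (k - 1))
    psik k z.1 * psik (l - 2) z.1 * phik l' z.2 * (qk k (third z) * phik l (third z)) =
  psik k z.1 * qk k (third z) * psik k z.2 *
    \sum_(l <- zrange (k - 1) (k + 2)) psik (l - 2) z.1 * phik l (third z).
  rewrite mulr_sumr; apply: eq_zrange => l hl.
  transitivity (psik k z.1 * qk k (third z) * (psik (l - 2) z.1 * phik l (third z)) * \sum_(l' <- zrange (l - 2) (k - 1)) phik l' z.2).
    by rewrite mulr_sumr; apply: eq_bigr => l' _; ring.
  rewrite zrange_psi_tele; last by lia.
  rewrite subrK; have := low_low k z (l - k); rewrite subrKC => e.
  by rewrite mulrBr -[X in _ - X]mulrA e mulr0 subr0; ring.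
have T2 : \sum_(l <- zrange (k - 3) k) psik k z.1 * phik l z.1 * psik k z.2 *
    (\sum_(l' <- zrange (l - 2) (l + 2)) qk k (third z) * phik l' (third z)) =
   psik k z.1 * qk k (third z) * psik k z.2 *
    \sum_(l <- zrange (k - 3) k) phik l z.1 * (psik (l + 3) (third z) - psik (l - 2) (third z)).
  rewrite mulr_sumr; apply: eq_bigr => l _; rewrite -mulr_sumr tphiE; ring.
rewrite T1 T2 -mulrDr.
have [y0|/psik_neq0 y0] := eqVneq (psik k z.2) 0; first by rewrite y0 mulr0 !mul0r.
have zk : enorm (third z : E3) <= 2 ^ (k + 1).
  by apply: le_trans (enorm_tri3 z) _; rewrite pow2S mulr_natl mulr2n lerD.
suff -> : \sum_(l <- zrange (k - 1) (k + 2)) psik (l - 2) z.1 * phik l (third z) +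
   \sum_(l <- zrange (k - 3) k) phik l z.1 * (psik (l + 3) (third z) - psik (l - 2) (third z)) = 1 by ring.
(* Summation by parts. The support conditions make [Z j] equal to 0 for j <= -1 and to 1 for j >= 2,
   and [X 1] equal to 1; the eight products then collapse to 1. *)
pose X j := psik (k + j) z.1; pose Z j := psik (k + j) (third z).
have S1 : \sum_(l <- zrange (k - 1) (k + 2)) psik (l - 2) z.1 * phik l (third z) =
    X (- 3) * (Z 0 - Z (- 1)) + (X (- 2) * (Z 1 - Z 0) + (X (- 1) * (Z 2 - Z 1) + (X 0 * (Z 3 - Z 2) + 0))).
  have -> : k + 2 = (k - 1) + 4%:Z - 1 by lia.
  rewrite big_zrange !big_ord_recl big_ord0 !phikE /= /bump /=.
  by congr (_ * (_ - _) + (_ * (_ - _) + (_ * (_ - _) + (_ * (_ - _) + _)))); congr (psik _ _); lia.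
have S2 : \sum_(l <- zrange (k - 3) k) phik l z.1 * (psik (l + 3) (third z) - psik (l - 2) (third z)) =
    (X (- 2) - X (- 3)) * (Z 0 - Z (- 5)) + ((X (- 1) - X (- 2)) * (Z 1 - Z (- 4)) +
    ((X 0 - X (- 1)) * (Z 2 - Z (- 3)) + ((X 1 - X 0) * (Z 3 - Z (- 2)) + 0))).
  have -> : zrange (k - 3) k = zrange (k - 3) ((k - 3) + 4%:Z - 1) by congr zrange; lia.
  rewrite big_zrange !big_ord_recl big_ord0 !phikE /= /bump /=.
  by congr ((_ - _) * (_ - _) + ((_ - _) * (_ - _) + ((_ - _) * (_ - _) + ((_ - _) * (_ - _) + _)))); congr (psik _ _); lia.
have zl j : j <= - 1 -> Z j = 0 by exact: psik_low.
have zh j : 2 <= j -> Z j = 1.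
  by move=> hj; rewrite /Z (_ : k + j = k + 1 + (j - 1)); [apply: psik_high => //; lia|lia].
have xh j : 1 <= j -> X j = 1 by exact: psik_high.
rewrite S1 S2 (zl (- 1))// (zl (- 5))// (zl (- 4))// (zl (- 3))// (zl (- 2))// (zh 2)// (zh 3)// (xh 1)//.
ring.
Qed.

(** If [phik l] does not vanish at xi, then |xi| is of size 2^l while |eta| <= 2^k. This forces
    2^(l-2) < |zeta| <= 2^(l+2), so the widened block at zeta is 1. What remains telescopes to 1 at
    the upper end and to 0 at the lower one, as |xi| > 2^(k-1). *)
Lemma high_mult_eq1 k z : k - 1 <= (k %/ 2)%Z -> enorm (z.1 : E3) < 2 ^ (k %/ 2)%Z ->
  psik k z.2 != 0 -> qk k (third z) != 0 -> qk k z.1 != 0 -> high_mult k z = 1.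
Proof.
move=> kK xK /psik_neq0 y0 /qk_neq0 z0 /qk_neq0 x0; rewrite /high_mult.
have -> : \sum_(l <- zrange (k - 1) (k %/ 2)%Z) phik l z.1 * (\sum_(l' <- zrange (l - 2) (l + 2)) phik l' (third z)) =
   \sum_(l <- zrange (k - 1) (k %/ 2)%Z) phik l z.1.
  apply: eq_zrange => l /andP[l1 l2]; rewrite tphiE.
  have [hl|hl] := leP (enorm (z.1 : E3)) (2 ^ (l - 1)); first by rewrite (phik_eq0_le hpsi hl) mul0r.
  have [hh|hh] := ltP (2 ^ (l + 1)) (enorm (z.1 : E3)); first by rewrite (phik_eq0_gt hpsi hh) mul0r.
  have kl : (2 : R) ^ k <= 2 ^ (l + 1) by apply: pow2_le; lia.
  rewrite (psik_eq1 hpsi (k := l + 3)); last first.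
    apply: le_trans (enorm_tri3 z) _; apply: le_trans (lerD hh (le_trans y0 kl)) _.
    by rewrite pow2D; apply: pow2_le; lia.
  rewrite (psik_eq0 hpsi (k := l - 2)) ?subr0 ?mulr1//.
  have [lk|lk] := leP (k + 2) l; last by apply: le_lt_trans z0; apply: pow2_le; lia.
  have kl2 : (2 : R) ^ k <= 2 ^ (l - 2) by apply: pow2_le; lia.
  have e2 : (2 : R) ^ (l - 1) = 2 * 2 ^ (l - 2) by rewrite -pow2S; congr (_ ^ _); lia.
  have := enorm_tri1 z; lra.
rewrite zrange_psi_tele; last by lia.
rewrite (psik_eq1 hpsi) ?addrK ?(ltW xK)// (psik_eq0 hpsi) ?subr0//.
Qed.

(** When |xi| >= 2^[k/2] at most the two last blocks of the sum are active, and each of them is a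
    product of two differences of values of [psi], hence at most 4 B^2. *)
Lemma high_mult_bound (B : R) k z : 1 <= B -> (forall x, psi x <= B) -> k - 1 <= (k %/ 2)%Z ->
  2 ^ (k %/ 2)%Z <= enorm (z.1 : E3) -> `|high_mult k z| <= 8 * B ^+ 2.
Proof.
move=> B1 hB kK xK; have B0 : 0 <= B := le_trans ler01 B1; set K := (k %/ 2)%Z in kK xK *; rewrite /high_mult -/K.
have b i x : `|psik i x| <= B by rewrite ger0_norm ?hB ?(cutoff_ge0 hpsi).
have bD (p q : R) : `|p| <= B -> `|q| <= B -> `|p - q| <= 2 * B.
  by move=> hp hq; apply: le_trans (ler_normB _ _) _; rewrite mulr_natl mulr2n lerD.
have bF l : `|phik l z.1 * (\sum_(l' <- zrange (l - 2) (l + 2)) phik l' (third z))| <= 4 * B ^+ 2.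
  rewrite tphiE phikE normrM; have -> : 4 * B ^+ 2 = (2 * B) * (2 * B) by ring.
  by apply: ler_pM; rewrite ?normr_ge0 ?bD.
have F0 l : l <= K - 2 -> phik l z.1 * (\sum_(l' <- zrange (l - 2) (l + 2)) phik l' (third z)) = 0.
  move=> lK; rewrite (phik_eq0_gt hpsi) ?mul0r//; apply: lt_le_trans xK.
  by rewrite ltr_eXz2l ?ltr1n//; lia.
rewrite zrange_last//.
apply: le_trans (ler_normD _ _) _.
have -> : 8 * B ^+ 2 = 4 * B ^+ 2 + 4 * B ^+ 2 by ring.
apply: lerD (bF K).
have [h|h] := leP (k - 1) (K - 1); last first.
  by rewrite sum_zrange0 ?normr0 ?mulr_ge0 ?sqr_ge0// => l hl; lia.
rewrite zrange_last// sum_zrange0 ?add0r// => l hl; apply: F0; lia.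
Qed.

(** By [flux_multE] the discrepancy carries the factor [high_mult - 1], which vanishes for |xi|
    below 2^[k/2] on the support of the others. The constant is independent of k. *)
Lemma flux_mult_error : exists2 C : R, 0 <= C & forall k z, k - 1 <= (k %/ 2)%Z ->
  `|flux_mult psi k z - psik k z.2 * qk k (third z)| <= C /\
  (flux_mult psi k z - psik k z.2 * qk k (third z) != 0 ->
    2 ^ (k %/ 2)%Z <= enorm (z.1 : E3) /\ enorm (z.2 : E3) <= 2 ^ k).
Proof.
have [B [B1 hB]] := cutoff_bounded hpsi; have B0 : 0 <= B by exact: le_trans B1.
have b i x : `|psik i x| <= B by rewrite ger0_norm ?hB ?(cutoff_ge0 hpsi).
have bq i x : `|qk i x| <= 1 + B by apply: le_trans (ler_normB _ _) _; rewrite normr1 lerD2l.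
exists (B * (1 + B) * ((1 + B) * (1 + 8 * B ^+ 2))).
  by rewrite !mulr_ge0 ?addr_ge0 ?mulr_ge0 ?sqr_ge0.
move=> k z kK.
have e : flux_mult psi k z - psik k z.2 * qk k (third z) =
  psik k z.2 * qk k (third z) * (qk k z.1 * (high_mult k z - 1)).
  by rewrite flux_multE /qk; ring.
rewrite e.
have H : qk k z.1 * psik k z.2 * qk k (third z) != 0 -> enorm (z.1 : E3) < 2 ^ (k %/ 2)%Z -> high_mult k z = 1.
  rewrite !mulf_eq0 !negb_or => /andP[/andP[h1 h2] h3] h; exact: high_mult_eq1.
split.
  have [h|h] := leP (2 ^ (k %/ 2)%Z) (enorm (z.1 : E3)).
    rewrite !normrM; apply: ler_pM; rewrite ?mulr_ge0//; first by apply: ler_pM.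
    apply: ler_pM => //; apply: le_trans (ler_normB _ _) _; rewrite normr1 addrC lerD2l.
    exact: high_mult_bound.
  have [h0|h0] := eqVneq (qk k z.1 * psik k z.2 * qk k (third z)) 0.
    have -> : psik k z.2 * qk k (third z) * (qk k z.1 * (high_mult k z - 1)) =
      (qk k z.1 * psik k z.2 * qk k (third z)) * (high_mult k z - 1) by ring.
    by rewrite h0 mul0r normr0 !mulr_ge0 ?addr_ge0 ?mulr_ge0 ?sqr_ge0.
  by rewrite H// subrr !mulr0 normr0 !mulr_ge0 ?addr_ge0 ?mulr_ge0 ?sqr_ge0.
rewrite !mulf_eq0 !negb_or => /andP[/andP[h1 h2] /andP[h3 h4]]; split; last exact: psik_neq0.
rewrite leNgt; apply/negP => h; move: h4; rewrite H ?subrr ?eqxx//.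
by rewrite !mulf_eq0 !negb_or h1 h2 h3.
Qed.

End multiplier_identity.

Lemma squeeze_near0 (R : realType) (a b : nat -> R) : (forall n, 0 <= a n) ->
  (\forall n \near \oo, a n <= b n) -> b @ \oo --> (0 : R) -> a @ \oo --> (0 : R).
Proof.
move=> a0 ab b0; apply: squeeze_cvgr (cvg_cst 0) b0; move: ab; apply: filterS => n ->.
by rewrite a0.
Qed.

(** * Smallness of the remainder and the limit of the flux *)

Section flux_limit.
Variable R : realType.
Notation E3 := (R * R * R)%type.
Notation V := (mspace R).
Notation VV := (V * V)%type.
Variables (psi : E3 -> R) (hpsi : lp_cutoff psi) (s : R).
Hypotheses (s56 : 5 / 6 <= s) (s1 : s < 1).
Variables (g : 'I_3 -> E3 -> R[i]) (hg : ns_system s g).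
Notation w := (w g).
Notation psik := (psik psi).
Notation qk := (qk psi).

Lemma Rintegral_scales d (T : measurableType d) (mu : {measure set T -> \bar R}) phi (h : T -> R) :
  scales mu 1 phi -> mu.-integrable setT (fun x => (h x)%:E) ->
  \int[mu]_x h (phi x) = \int[mu]_x h x.
Proof. by move=> hs ih; rewrite /Rintegral (scales_integral ltr01 hs ih) mul1e. Qed.

Lemma Rintegral_tensor33 (a b : V -> R) : (lam3 R).-integrable setT (fun x => (a x)%:E) ->
  (lam3 R).-integrable setT (fun x => (b x)%:E) ->
  \int[lam33 R]_z (a z.1 * b z.2) = (\int[lam3 R]_x a x) * (\int[lam3 R]_x b x).
Proof.
move=> ia ib; have ca (h : V -> R) : (lam3 R).-integrable setT (fun x => (h x)%:E) -> cL1 (lam3 R) (fun x => (h x)%:C).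
  move=> ih; split; first by apply: cmeas_real; have /measurable_int /measurable_EFinP := ih.
  have := integrable_norm ih; congr (_.-integrable _ _); apply/funext => x.
  by rewrite cabs_real.
have := congr1 (@Re R) (cint_tensor33 (ca _ ia) (ca _ ib)).2.
rewrite ReM /= => e; transitivity (\int[lam33 R]_z (Re ((a z.1)%:C * (b z.2)%:C))).
  by apply: eq_Rintegral => z _; rewrite ReM /= mulr0 subr0.
rewrite e; rewrite [X in _ - _ * X](_ : _ = 0) ?mulr0 ?subr0//.
by rewrite /Rintegral integral0.
Qed.

Definition G (x : V) : R := enorm (x : E3) `^ s * w x.
(** The factor at the low frequency eta, on which the derivative falls. For rho <= 1 it is dominated
    by [G], since |x| <= |x|^s there, and so becomes integrable on a ball. *)
Definition low_adv (rho : R) (x : V) : R := enorm (x : E3) * w x * \1_(eball rho) x.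

Lemma low_adv_ge0 rho x : 0 <= low_adv rho x.
Proof. by rewrite !mulr_ge0 ?enorm_ge0 ?w_ge0// indicE. Qed.

Lemma w_le_G (r : R) x : 0 < r <= 1 -> r <= enorm (x : E3) -> w x <= r^-1 * G x.
Proof.
move=> /andP[r0 r1] rx; rewrite ler_pdivlMl// /G ler_wpM2r ?w_ge0//.
apply: le_trans (_ : r `^ s <= _); first by rewrite -[leLHS](powRr1 (ltW r0)); apply: ger_powR; rewrite ?r0 ?(ltW s1).
by apply: ge0_ler_powR; rewrite ?nnegrE ?enorm_ge0 ?(ltW r0)// ltW// (s_gt0 s56).
Qed.

Lemma low_adv_le_G rho x : rho <= 1 -> low_adv rho x <= G x * \1_(eball rho) x.
Proof.
move=> r1; rewrite /low_adv indicE; have [h|h] := boolP (x \in eball rho); last by rewrite !mulr0.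
rewrite !mulr1 /G ler_wpM2r ?w_ge0//; move: h; rewrite inE /eball /= => h.
have x1 : enorm (x : E3) <= 1 by exact: le_trans h r1.
have [->|x0] := eqVneq (enorm (x : E3)) 0; first by rewrite powR_ge0.
have xp : 0 < enorm (x : E3) by rewrite lt_def x0 enorm_ge0.
by rewrite -[leLHS](powRr1 (ltW xp)); apply: ger_powR; rewrite ?xp ?(ltW s1).
Qed.

Lemma measurable_low_adv rho : measurable_fun setT (low_adv rho).
Proof.
apply: measurable_funM; last exact: measurable_indic (measurable_eball _).
by apply: measurable_funM; [exact: measurable_enorm|exact: measurable_w hg].
Qed.

Lemma low_adv_amgm rho (t : R) x : rho <= 1 -> 0 < t -> low_adv rho x <= t * G x ^+ 2 + t^-1 * \1_(eball rho) x.
Proof.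
move=> r1 t0; apply: le_trans (low_adv_le_G x r1) _; apply: le_trans (mul_amgm _ _ t0) _.
rewrite lerD2l ler_wpM2l ?invr_ge0 ?(ltW t0)// indicE; case: (_ \in _); by rewrite ?expr1n ?expr0n.
Qed.

Lemma integrable_low_adv rho : rho <= 1 -> (lam3 R).-integrable setT (fun x => (low_adv rho x)%:E).
Proof.
move=> r1; have [_ iG] := sqi_w s56 hg.
apply: (integrable_le (measurable_low_adv rho) (h := fun x => 1 * G x ^+ 2 + 1^-1 * \1_(eball rho) x)).
  by move=> x; rewrite ger0_norm ?low_adv_ge0//; exact: low_adv_amgm.
apply: integrable_RD; first exact: integrable_RZ.
by apply: integrable_RZ; exact: integrable_indic_eball hpsi rho.
Qed.

Lemma Rintegral_indic_eball rho : 0 < rho ->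
  \int[lam3 R]_x (\1_(eball rho) x : R) = rho ^+ 3 * ball_volume R.
Proof.
move=> r0; have := nint_eball hpsi r0; rewrite nint_Rintegral; last exact: integrable_indic_eball hpsi rho.
by case.
Qed.

(** AM-GM with parameter t = r^3: the ball of radius 2 r^2 has volume 8 r^6 times the unit volume,
    and division by r^3 balances both terms at order r^3. *)
Lemma Rintegral_low_adv (r : R) : 0 < r -> 2 * r ^+ 2 <= 1 ->
  \int[lam3 R]_x low_adv (2 * r ^+ 2) x <= r ^+ 3 * (\int[lam3 R]_x (G x ^+ 2) + 8 * ball_volume R).
Proof.
move=> r0 r1; have [_ iG] := sqi_w s56 hg; have r3 : 0 < r ^+ 3 by rewrite exprn_gt0.
have i2 := integrable_indic_eball hpsi (2 * r ^+ 2).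
have i1 := integrable_RZ (r ^+ 3) iG; have i3 := integrable_RZ (r ^- 3) i2.
apply: (@le_trans _ _ (\int[lam3 R]_x (r ^+ 3 * G x ^+ 2 + r ^- 3 * \1_(eball (2 * r ^+ 2)) x))).
  apply: le_Rintegral => //; first exact: integrable_low_adv.
    exact: integrable_RD.
  by move=> x _; exact: low_adv_amgm.
rewrite RintegralD// !RintegralZl// mulrDr lerD2l Rintegral_indic_eball ?mulr_gt0 ?exprn_gt0//.
rewrite le_eqVlt; apply/orP; left; apply/eqP; field.
by rewrite gt_eqF.
Qed.

Definition err_dom (rho : R) (z : VV) : R :=
  G z.1 ^+ 2 * low_adv rho z.2 + low_adv rho z.2 * G (third z) ^+ 2.

Lemma err_dom_integral rho : rho <= 1 ->
  (lam33 R).-integrable setT (fun z => (err_dom rho z)%:E) /\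
  \int[lam33 R]_z err_dom rho z = 2 * ((\int[lam3 R]_x (G x ^+ 2)) * (\int[lam3 R]_x low_adv rho x)).
Proof.
move=> r1; have [_ iG] := sqi_w s56 hg; have iA := integrable_low_adv r1.
have i1 := integrable_tensor33 iG iA; have i2 := integrable_tensor33 iA iG.
pose F (z : VV) := low_adv rho z.1 * G z.2 ^+ 2.
have i3 : (lam33 R).-integrable setT (fun z => (F (refl z))%:E) := scales_integrable ltr01 (@scales_refl33 R) i2.
have i4 : (lam33 R).-integrable setT (fun z => (F (refl (swap z)))%:E) := scales_integrable ltr01 (@scales_swap33 R) i3.
have e : (fun z : VV => low_adv rho z.2 * G (third z) ^+ 2) = (fun z => F (refl (swap z))).
  by apply/funext => z; rewrite /F -/(third (swap z)) /refl /= third_swap.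
have i5 : (lam33 R).-integrable setT (fun z : VV => (low_adv rho z.2 * G (third z) ^+ 2)%:E).
  by have := i4; congr (_.-integrable _ _); apply/funext => z; rewrite -(congr1 (fun f => f z) e).
split; first exact: integrable_RD.
have -> : \int[lam33 R]_z err_dom rho z = \int[lam33 R]_z (G z.1 ^+ 2 * low_adv rho z.2) + \int[lam33 R]_z F (refl (swap z)).
  by rewrite -[X in _ = _ + Rintegral _ _ X]e -RintegralD.
rewrite (Rintegral_tensor33 iG iA) mulr_natl mulr2n; congr (_ + _).
rewrite (Rintegral_scales (h := fun z => F (refl z)) (@scales_swap33 R) i3) (Rintegral_scales (@scales_refl33 R) i2).
by rewrite (Rintegral_tensor33 iA iG) mulrC.
Qed.

(** From 4 r <= 1 one gets |eta| <= 2 r^2 <= r / 2, hence |zeta| >= r / 2. Replacing [w] by [G] at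
    xi and zeta costs 1 / r and 2 / r. Against the r^3 of [Rintegral_low_adv] this loss of r^-2
    leaves a factor r. *)
Lemma triform_tail (r : R) (z : VV) : 0 < r -> 4 * r <= 1 -> r <= enorm (z.1 : E3) -> enorm (z.2 : E3) <= 2 * r ^+ 2 ->
  cabs (triform g z) <= 2 * r ^- 2 * err_dom (2 * r ^+ 2) z.
Proof.
move=> r0 r4 x1 x2; apply: le_trans (cabs_triform_le g z) _.
have r1 : r <= 1 by lra.
have w1 : w z.1 <= r^-1 * G z.1 by apply: w_le_G => //; rewrite r0.
have t1 := enorm_tri1 z.
have rr : 2 * r ^+ 2 <= r / 2.
  by rewrite expr2 mulrA; have := ler_wpM2r (ltW r0) r4; lra.
have w3 : w (third z) <= (r / 2)^-1 * G (third z).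
  apply: w_le_G; first by apply/andP; split; [rewrite divr_gt0|lra].
  lra.
have ea : enorm (z.2 : E3) * w z.2 = low_adv (2 * r ^+ 2) z.2 by rewrite /low_adv indicE mem_set ?mulr1.
have a0 := low_adv_ge0 (2 * r ^+ 2) z.2.
have -> : enorm (z.2 : E3) * (w z.1 * w z.2 * w (third z)) = low_adv (2 * r ^+ 2) z.2 * (w z.1 * w (third z)).
  by rewrite -ea; ring.
apply: (@le_trans _ _ (low_adv (2 * r ^+ 2) z.2 * ((r^-1 * G z.1) * ((r / 2)^-1 * G (third z))))).
  by rewrite ler_wpM2l//; apply: ler_pM; rewrite ?w_ge0.
have -> : low_adv (2 * r ^+ 2) z.2 * (r^-1 * G z.1 * ((r / 2)^-1 * G (third z))) =
   2 * r ^- 2 * (low_adv (2 * r ^+ 2) z.2 * (G z.1 * G (third z))).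
  by field; rewrite gt_eqF.
apply: ler_wpM2l; first by rewrite mulr_ge0// invr_ge0 exprn_ge0// ltW.
rewrite /err_dom [G z.1 ^+ 2 * _]mulrC -mulrDr ler_wpM2l//.
by have := mul_amgm (G z.1) (G (third z)) ltr01; rewrite invr1 !mul1r.
Qed.

Definition Efun (k : int) (y : V) : R[i] := dens s g y * (1 - psik k y)%:C.

Lemma psik_bounds : exists2 B : R, (forall k x, `|psik k x| <= B) & (forall k x, `|qk k x| <= B).
Proof.
have [B [B1 hB]] := cutoff_bounded hpsi.
have b k x : `|psik k x| <= B by rewrite ger0_norm ?hB ?(cutoff_ge0 hpsi).
exists (1 + B) => k x; first by apply: le_trans (b k x) _; rewrite lerDr.
by apply: le_trans (ler_normB _ _) _; rewrite normr1 lerD2l.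
Qed.

Variables (u : 'I_3 -> dist R) (hu : forall i, represents (dfourier (u i)) (g i)).

Lemma flux_energy k : cL1 (lam33 R) (fun z => triform g z * (flux_mult psi k z - psik k z.2 * qk k (third z))%:C) /\
  flux psi u k + cint (lam3 R) (Efun k) =
  (c0 R)%:C * ii R * cint (lam33 R) (fun z => triform g z * (flux_mult psi k z - psik k z.2 * qk k (third z))%:C).
Proof.
have [B b1 b2] := psik_bounds.
have mp : measurable_fun setT (psik k : V -> R) by exact: smooth_measurable (test_psik hpsi k).1.
have r0 : 0 < (2 : R) ^ (k - 1) by exact: pow2_gt0.
have P1 x : enorm x <= 2 ^ (k - 1) -> psik k x = 1 by exact: psik_eq1.
have P0 x : 2 ^ k < enorm x -> psik k x = 0 by exact: psik_eq0.
have eb := energy_balance hpsi s56 hg r0 mp (b1 k) (b2 k) P1 P0.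
have lb := cL1_balance_form s56 hg r0 mp (b1 k) (b2 k) P1 P0.
have [lf ef] := flux_multP hpsi s56 hg hu k.
have eD : (fun z => triform g z * (flux_mult psi k z - psik k z.2 * qk k (third z))%:C) =
  (fun z => triform g z * (flux_mult psi k z)%:C - balance_form g (psik k) z).
  apply/funext => z; rewrite /balance_form -mulrBr; congr (_ * _).
  by rewrite -rmorphB.
split; first by rewrite eD; exact: cL1B.
rewrite eD cintB// mulrBr -ef; congr (_ + _).
by rewrite /Efun eb mulNr.
Qed.

Lemma pow2N_le (n : nat) : (2 : R) ^ (- n%:Z) <= n.+1%:R^-1.
Proof.
by rewrite -invr_expz lef_pV2 ?posrE ?exprz_gt0 ?ltr0n// -exprnP -natrX ler_nat ltn_expl.
Qed.

Lemma Efun_cvg : ccvg (fun n : nat => cint (lam3 R) (Efun (- n%:Z))) (cint (lam3 R) (dens s g)).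
Proof.
have [B b1 b2] := psik_bounds; have ld := cL1_dens s56 hg.
apply: (cint_dct (h := fun y => B * cabs (dens s g y))).
- move=> n; apply: cmeasM; first exact: ld.1.
  by apply: cmeas_real; apply: measurable_funB => //; exact: smooth_measurable (test_psik hpsi _).1.
- exact: ld.1.
- by apply: integrable_RZ; exact: ld.2.
- move=> y; apply: ccvg_near.
  have [y0|y0] := eqVneq (y : E3) 0.
    have d0 : dens s g y = 0.
      by rewrite /dens big1 ?mulr0// => i _; rewrite y0 (ns_zero hg) mulr0.
    by apply: nearW => n; rewrite /Efun d0 mul0r.
  have yp : 0 < enorm (y : E3).
    by rewrite lt_def enorm_ge0 andbT; apply: contra_neq y0; exact: enorm_eq0.
  move: (nbhs_infty_gtr (enorm (y : E3))^-1); apply: filterS => n hn.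
  rewrite /Efun (psik_eq0 hpsi) ?subr0 ?mulr1//; apply: le_lt_trans (pow2N_le n) _.
  rewrite invf_plt ?posrE ?ltr0n//; apply: lt_le_trans hn _.
  by rewrite ler_nat.
- by move=> y n; rewrite cabsM cabs_real mulrC ler_wpM2r ?cabs_ge0//; exact: b2.
Qed.

Lemma flux_error : exists2 C : R, 0 <= C & forall n : nat, 4 * (2 : R) ^ (- n%:Z %/ 2)%Z <= 1 ->
  cabs (flux psi u (- n%:Z) + cint (lam3 R) (Efun (- n%:Z))) <= C * 2 ^ (- n%:Z %/ 2)%Z.
Proof.
have [C C0 hC] := flux_mult_error hpsi.
pose N := \int[lam3 R]_x (G x ^+ 2).
have N0 : 0 <= N by apply: Rintegral_ge0 => x _; rewrite sqr_ge0.
have v0 := ball_volume_ge0 R.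
exists (c0 R * (C * (4 * (N * (N + 8 * ball_volume R))))).
  by rewrite !mulr_ge0 ?addr_ge0 ?mulr_ge0// ltW// c0_gt0.
move=> n; set k := - n%:Z; set r := (2 : R) ^ _ => r4.
have kK : k - 1 <= (k %/ 2)%Z by rewrite /k; lia.
have r0 : 0 < r by exact: pow2_gt0.
(* Rounding down loses at most one: k <= 2 [k/2] + 1, whence the factor 2. *)
have kr : (2 : R) ^ k <= 2 * r ^+ 2.
  rewrite /r exprnP exprz_exp -pow2S; apply: pow2_le; rewrite /k; lia.
have r1 : 2 * r ^+ 2 <= 1 by rewrite expr2 mulrA; have := ler_wpM2r (ltW r0) r4; lra.
have [lD eD] := flux_energy k; rewrite eD !cabsM cabs_ii cabs_real mulr1 ger0_norm ?(ltW (c0_gt0 R))//.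
rewrite -mulrA ler_wpM2l ?(ltW (c0_gt0 R))//.
have [iE eE] := err_dom_integral r1.
have iE2 := integrable_RZ (C * (2 * r ^- 2)) iE.
apply: le_trans (cabs_cint_le lD.1 _ iE2) _.
  move=> z; rewrite cabsM cabs_real.
  have E0 : 0 <= err_dom (2 * r ^+ 2) z by apply: addr_ge0; apply: mulr_ge0; rewrite ?sqr_ge0 ?low_adv_ge0.
  have [h1 h2] := hC k z kK.
  have [->|h3] := eqVneq (flux_mult psi k z - psik k z.2 * qk k (third z)) 0.
    by rewrite normr0 mulr0 !mulr_ge0// invr_ge0 exprn_ge0// ltW.
  have [x1 x2] := h2 h3; rewrite mulrC -mulrA; apply: ler_pM; rewrite ?cabs_ge0//.
  by apply: triform_tail => //; exact: le_trans x2 kr.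
rewrite RintegralZl// eE.
have hA := Rintegral_low_adv r0 r1.
apply: (@le_trans _ _ (C * (2 * r ^- 2) * (2 * (N * (r ^+ 3 * (N + 8 * ball_volume R)))))).
  rewrite ler_wpM2l ?mulr_ge0 ?invr_ge0 ?exprn_ge0 ?(ltW r0)// ler_wpM2l// ler_wpM2l//.
by rewrite le_eqVlt; apply/orP; left; apply/eqP; field; rewrite gt_eqF.
Qed.

Lemma pow2_half_cvg : (fun n : nat => (2 : R) ^ (- n%:Z %/ 2)%Z) @ \oo --> (0 : R).
Proof.
apply/cvgrPdist_le => e e0.
move: (nbhs_infty_gtr (e ^- 2)); apply: filterS => n hn.
rewrite sub0r normrN ger0_norm ?(ltW (pow2_gt0 _ _))//.
rewrite -(ler_pXn2r (n := 2)) ?nnegrE ?(ltW e0) ?(ltW (pow2_gt0 _ _))//.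
apply: (@le_trans _ _ (2 ^ (- n%:Z))).
  by rewrite exprnP exprz_exp; apply: pow2_le; lia.
apply: le_trans (pow2N_le n) _; rewrite -[leRHS]invrK lef_pV2 ?posrE ?invr_gt0 ?exprn_gt0 ?ltr0n//.
by apply: le_trans (ltW hn) _; rewrite ler_nat.
Qed.

(** Flux plus energy above the cutoff equals the remainder, which is O(2^[k/2]), and the energy
    above the cutoff tends to the total one. The limit therefore exists along the whole sequence k =
    -n. *)
Theorem flux_cvg : (fun n : nat => Re (flux psi u (- n%:Z))) @ \oo -->
  - Re (cint (lam3 R) (dens s g)).
Proof.
have [C C0 hC] := flux_error.
have h0 : ccvg (fun n : nat => flux psi u (- n%:Z) + cint (lam3 R) (Efun (- n%:Z))) 0.
  apply: (@squeeze_near0 _ _ (fun n : nat => C * 2 ^ (- n%:Z %/ 2)%Z)).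
  - by move=> n; rewrite subr0; exact: cabs_ge0.
  - have e4 : 0 < (4^-1 : R) by rewrite invr_gt0.
    move/cvgrPdist_le: pow2_half_cvg => /(_ _ e4); apply: filterS => n.
    rewrite sub0r normrN ger0_norm ?(ltW (pow2_gt0 _ _))// => hn.
    by rewrite subr0; apply: hC; rewrite -ler_pdivlMl// mulr1.
  - by rewrite -[X in _ --> X](mulr0 C); apply: cvgMr; exact: pow2_half_cvg.
have := ccvg_Re (ccvgD h0 (ccvgN Efun_cvg)); rewrite add0r => h.
have -> : - Re (cint (lam3 R) (dens s g)) = Re (- cint (lam3 R) (dens s g)) by rewrite raddfN.
have e : (fun n : nat => Re (flux psi u (- n%:Z) + cint (lam3 R) (Efun (- n%:Z)) + - cint (lam3 R) (Efun (- n%:Z)))) =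
  (fun n : nat => Re (flux psi u (- n%:Z))) by apply/funext => n; rewrite addrK.
by rewrite e in h.
Qed.

End flux_limit.

Lemma integral_leb3 (R : realType) (h : measurableTypeR R * measurableTypeR R * measurableTypeR R -> \bar R) :
  (\int[@leb3 R]_x h x = \int[lam3 R]_x h x)%E.
Proof. by with_strategy transparent [lam3] reflexivity. Qed.

(** * From weak solutions to frequency functions *)

Section tempered_functions.
Variable R : realType.
Notation E3 := (R * R * R)%type.
Notation V := (mspace R).
Variables (psi : E3 -> R) (hpsi : lp_cutoff psi).
Implicit Types (F f : E3 -> R[i]).

Definition weight (M : nat) (x : E3) : R := ((1 + enorm x) ^+ M)^-1.

Lemma weight_gt0 M x : 0 < weight M x.
Proof. by rewrite invr_gt0 exprn_gt0// one_enorm_gt0. Qed.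

Lemma weight_le1 M x : weight M x <= 1.
Proof. by rewrite invf_le1 ?exprn_gt0 ?one_enorm_gt0// exprn_ege1// one_enorm_ge1. Qed.

Lemma measurable_weight M : measurable_fun setT (weight M : V -> R).
Proof.
apply: measurable_continuous3 => x; apply: cvgV; first by rewrite gt_eqF// exprn_gt0// one_enorm_gt0.
apply: (@continuous_comp _ _ _ (fun x : E3 => 1 + enorm x) (fun t : R => t ^+ M)).
  by apply: cvgD; [exact: cvg_cst|exact: continuous_enorm].
exact: exprn_continuous.
Qed.

(** Integrability against some negative power of 1 + |x|: such functions pair with Schwartz
    functions and the pairing is continuous, so identities extend from test functions by
    truncation. *)
Definition tfun F := cmeas (F : V -> R[i]) /\
  exists M (h : V -> R), (lam3 R).-integrable setT (fun x => (h x)%:E) /\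
    forall x : V, cabs (F x) * weight M x <= h x.

Definition cscvg (f_ : nat -> E3 -> R[i]) f := csnull (fun n x => f_ n x - f x).

Lemma tfun_bound F f M (h : V -> R) c : (forall x : V, cabs (F x) * weight M x <= h x) -> csbd M f c ->
  forall x : V, cabs (F x * f x) <= c * h x.
Proof.
move=> hF hc x; have c0 := csbd_ge0 hc; have := hc [::] (leq0n _) x; rewrite /= => hx.
have w0 := weight_gt0 M x.
rewrite cabsM; apply: le_trans (ler_wpM2l c0 (hF x)).
rewrite mulrCA ler_wpM2l ?cabs_ge0// /weight ler_pdivlMr ?exprn_gt0 ?one_enorm_gt0// mulrC.
exact: hx.
Qed.

Lemma tfun_cL1 F f : tfun F -> csch f -> cL1 (lam3 R) (fun x : V => F x * f x).
Proof.
move=> [mF [M [h [ih hF]]]] [sf hf]; have [c hc] := hf M.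
apply: (cL1_dom (h := fun x => c * h x)); last exact: integrable_RZ.
  by apply: cmeasM => //; exact: cmeas_csmooth.
exact: tfun_bound.
Qed.

Lemma tfun_cvg F (f_ : nat -> E3 -> R[i]) f : tfun F -> (forall n, csch (f_ n)) -> csch f -> cscvg f_ f ->
  ccvg (fun n => cint (lam3 R) (fun x : V => F x * f_ n x)) (cint (lam3 R) (fun x : V => F x * f x)).
Proof.
move=> tF sf_ sf nf; have [mF [M [h [ih hF]]]] := tF; have [c_ [c0 hc]] := nf M.
have e n : cint (lam3 R) (fun x : V => F x * f_ n x) - cint (lam3 R) (fun x : V => F x * f x) =
  cint (lam3 R) (fun x : V => F x * (f_ n x - f x)).
  rewrite -cintB; [|exact: tfun_cL1|exact: tfun_cL1].
  by apply: (congr1 (cint (lam3 R))); apply/funext => x; rewrite mulrBr.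
apply: (@squeeze0 _ _ (fun n => (\int[lam3 R]_x h x) * c_ n)).
- by move=> n; exact: cabs_ge0.
- move=> n; rewrite e mulrC -RintegralZl//; apply: cabs_cint_le.
  + by apply: cmeasM => //; apply: cmeas_csmooth; exact: (cschB (sf_ n) sf).1.
  + exact: tfun_bound (hc n).
  + exact: integrable_RZ.
- exact: cvg0Z.
Qed.

Lemma cscvg_cpartial (f_ : nat -> E3 -> R[i]) f j : (forall n, csch (f_ n)) -> csch f -> cscvg f_ f ->
  cscvg (fun n => cpartial j (f_ n)) (cpartial j f).
Proof.
move=> sf_ sf /(csnull_cpartial j); rewrite /cscvg; congr csnull; apply/funext => n; apply/funext => x.
have -> : (fun x => f_ n x - f x) = (fun x => f_ n x + -1 * f x) by apply/funext => y; rewrite mulN1r.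
rewrite cpartialD; [|exact: (sf_ n).1|exact: csmoothZ sf.1].
by rewrite cpartialZ ?mulN1r//; exact: sf.1.
Qed.

Lemma cscvg_inv_fourier (f_ : nat -> E3 -> R[i]) f : (forall n, csch (f_ n)) -> csch f -> cscvg f_ f ->
  cscvg (fun n => inv_fourier (f_ n)) (inv_fourier f).
Proof.
move=> sf_ sf nf; have := csnull_inv_fourier (fun n => cschB (sf_ n) sf) nf.
rewrite /cscvg; congr csnull; apply/funext => n; apply/funext => x.
by rewrite inv_fourierB//; exact: csch_cL1.
Qed.

Lemma cscvg_fourier (f_ : nat -> E3 -> R[i]) f : (forall n, csch (f_ n)) -> csch f -> cscvg f_ f ->
  cscvg (fun n => fourier (f_ n)) (fourier f).
Proof.
move=> sf_ sf nf; have := csnull_fourier (fun n => cschB (sf_ n) sf) nf.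
rewrite /cscvg; congr csnull; apply/funext => n; apply/funext => x.
by rewrite !fourierE inv_fourierB//; exact: csch_cL1.
Qed.

Lemma cscvgD (f_ h_ : nat -> E3 -> R[i]) f h : (forall n, csch (f_ n)) -> csch f -> (forall n, csch (h_ n)) -> csch h ->
  cscvg f_ f -> cscvg h_ h -> cscvg (fun n x => f_ n x + h_ n x) (fun x => f x + h x).
Proof.
move=> sf_ sf sh_ sh nf nh N; have [c [c0 hc]] := nf N; have [d [d0 hd]] := nh N.
exists (fun n => c n + d n); split; first by rewrite -[X in _ --> X]addr0; exact: cvgD.
move=> n; have := csbdD (cschB (sf_ n) sf).1 (cschB (sh_ n) sh).1 (hc n) (hd n).
by congr csbd; apply/funext => x; ring.
Qed.

Lemma integrable_cauchy3v : (lam3 R).-integrable setT (fun x : V => (cauchy3 (x : E3))%:E).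
Proof. exact: integrable_cauchy3. Qed.

Lemma weight6 x : weight 6 x <= cauchy3 x.
Proof. exact: cauchy3_enorm. Qed.

Section homogeneous_sobolev.
Variables (s : R) (s0 : 0 < s) (s1 : s < 1) (T : dist R) (hT : Hdot s T).
Let f := fun_of (dfourier T).

Lemma hdot_tempered : tempered T. Proof. by case: hT. Qed.

Lemma hdot_represents : represents (dfourier T) f.
Proof. by case: hT => _ [h hh] _; exact: (fun_of_represents hpsi hh).1. Qed.

Lemma cmeas_hdot : cmeas (f : V -> R[i]).
Proof. exact: lint3_cmeas hdot_represents.1. Qed.

Lemma hdot_sqr : cL2 (fun x : V => (enorm (x : E3) `^ s)%:C * f x).
Proof.
have m : cmeas (fun x : V => (enorm (x : E3) `^ s)%:C * f x).
  by apply: cmeasM cmeas_hdot; apply: cmeas_real; exact: (locb_powR (ltW s0)).1.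
split => //; apply/integrableP; split; first by apply/measurable_EFinP; exact: measurable_sqr.
case: hT => _ _; rewrite /hdot_norm.
set I := (\int[_]_xi _)%E => hI.
have I0 : (0 <= I)%E.
  by apply: integral_ge0 => x _; rewrite lee_fin mulr_ge0 ?powR_ge0// sqr_ge0.
have If : (I < +oo)%E.
  by apply: lty_poweRy hI; rewrite invr_neq0.
suff -> : (\int[lam3 R]_x `|(cabs ((enorm (x : E3) `^ s)%:C * f x) ^+ 2)%:E|)%E = I by [].
rewrite /I integral_leb3; apply: eq_integral => x _.
rewrite gee0_abs ?lee_fin ?sqr_ge0//; congr (_%:E).
rewrite cabsM cabs_real ger0_norm ?powR_ge0// exprMn [(_ `^ _) ^+ 2]expr2.
by rewrite powR_double.
Qed.

Definition hsq (x : V) : R := cabs ((enorm (x : E3) `^ s)%:C * f x) ^+ 2.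

Lemma amgm_weight (q : R) x : 0 <= q -> q * weight 6 x <= q ^+ 2 + cauchy3 x.
Proof.
move=> q0; have := mul_amgm q (weight 6 x) ltr01; rewrite invr1 !mul1r => h; apply: le_trans h _.
rewrite lerD2l; apply: le_trans (weight6 x); rewrite expr2 ler_piMr ?weight_le1//.
exact: ltW (weight_gt0 _ _).
Qed.

Lemma cabs_hsq (x : V) : enorm (x : E3) `^ s * cabs (f x) = cabs ((enorm (x : E3) `^ s)%:C * f x).
Proof. by rewrite cabsM cabs_real ger0_norm// powR_ge0. Qed.

Lemma tfun_hdot : tfun f.
Proof.
split; first exact: cmeas_hdot.
have i1 := (loc_cL1_eball 1 hdot_represents.1).2; have i2 := hdot_sqr.2.
exists 6%N, (fun x => cabs (f x * (\1_(eball 1) (x : E3))%:C) + (hsq x + cauchy3 (x : E3))); split.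
  by apply: integrable_RD => //; apply: integrable_RD => //; exact: integrable_cauchy3v.
move=> x; have w0 := weight_gt0 6 x; have c0 : 0 < cauchy3 (x : E3) by exact: cauchy3_gt0.
have [h|h] := leP (enorm (x : E3)) 1.
  rewrite indicE mem_set//= mulr1; apply: (@le_trans _ _ (cabs (f x))).
    by rewrite ler_piMr ?cabs_ge0// weight_le1.
  by rewrite lerDl addr_ge0 ?sqr_ge0// ltW.
apply: (@le_trans _ _ (hsq x + cauchy3 (x : E3))); last by rewrite lerDr cabs_ge0.
apply: le_trans (amgm_weight x (cabs_ge0 _)); rewrite ler_wpM2r ?(ltW w0)// -cabs_hsq ler_peMl ?cabs_ge0//.
by rewrite -(powRr0 (enorm (x : E3))) ler_powR ?(ltW h)// ltW.
Qed.

(** One factor |x|^s belongs to the square integrable function; the other is at most 1 + |x| because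
    s < 1 and costs one weight, whence 7 = 6 + 1. *)
Lemma tfun_hdot2 : tfun (fun x => (enorm x `^ (2 * s))%:C * f x).
Proof.
split; first by apply: cmeasM cmeas_hdot; apply: cmeas_real; apply: (locb_powR _).1; rewrite mulr_ge0// ltW.
exists 7%N, (fun x => hsq x + cauchy3 (x : E3)); split.
  by apply: integrable_RD; [exact: hdot_sqr.2|exact: integrable_cauchy3v].
move=> x; apply: le_trans (amgm_weight x (cabs_ge0 _)).
rewrite powR_double -cabs_hsq cabsM cabs_real ger0_norm ?mulr_ge0 ?powR_ge0//.
have -> : weight 7 x = (1 + enorm (x : E3))^-1 * weight 6 x by rewrite /weight exprS invfM.
set a := enorm (x : E3) `^ s.
have a1 : a * (1 + enorm (x : E3))^-1 <= 1.
  by rewrite ler_pdivrMr ?one_enorm_gt0// mul1r; exact: enorm_powR_le.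
have -> : a * a * cabs (f x) * ((1 + enorm (x : E3))^-1 * weight 6 x) =
   (a * (1 + enorm (x : E3))^-1) * (a * cabs (f x) * weight 6 x) by ring.
by rewrite ler_piMl// !mulr_ge0 ?cabs_ge0 ?powR_ge0// ltW// weight_gt0.
Qed.

(** The representation of the transform is known on test functions only. Both sides are continuous
    along the truncations of a Schwartz function, which extends it. *)
Lemma hdot_pairing phi : csch phi -> T phi = cint (lam3 R) (fun x : V => f x * inv_fourier phi x).
Proof.
move=> sp; set th := inv_fourier phi; have st : csch th := csch_inv_fourier sp.
have ep : phi = fourier th by rewrite fourierK.
have sc n : csch (fun x => cutoffn psi n x * th x) := csch_cutoffM hpsi n st.
have c1 := tempered_cvg hdot_tempered (fun n => csch_fourier (sc n)) (csch_fourier st) (cscvg_fourier sc st (csnull_cutoff hpsi st)).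
have c2 := tfun_cvg tfun_hdot sc st (csnull_cutoff hpsi st).
rewrite ep; apply: ccvg_unique c1 _; move: c2; congr ccvg; apply/funext => n.
have := hdot_represents.2 _ (ctest_cutoffM hpsi n st.1); rewrite /dfourier => ->.
by rewrite /dist_of cintegralE.
Qed.

End homogeneous_sobolev.

End tempered_functions.

(** * Reality and function structure of the velocity *)

Section hdot_structure.
Variable R : realType.
Notation E3 := (R * R * R)%type.
Notation V := (mspace R).
Variables (psi : E3 -> R) (hpsi : lp_cutoff psi).

Lemma ccvg_Im (z_ : nat -> R[i]) z : ccvg z_ z -> (fun n => Im (z_ n)) @ \oo --> Im z.
Proof.
move=> /(ccvgZ (- ii R)) /ccvg_Re.
have e (y : R[i]) : Re (- ii R * y) = Im y.
  by rewrite ReM /= mulNr mul0r oppr0 sub0r mulN1r opprK.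
by rewrite e; under eq_fun do rewrite e.
Qed.

Lemma real_pairing (T : dist R) (phi : E3 -> R[i]) : tempered T -> real_dist T -> csch phi ->
  (forall x, Im (phi x) = 0) -> Im (T phi) = 0.
Proof.
move=> tT rT sp ip.
have c := ccvg_Im (tempered_cvg tT (fun n => csch_cutoffM hpsi n sp) sp (csnull_cutoff hpsi sp)).
have e n : Im (T (fun x => cutoffn psi n x * phi x)) = 0.
  pose h x := Re (cutoffn psi n x * phi x).
  have th : test_function h by exact: (ctest_cutoffM hpsi n sp.1).1.
  rewrite -(rT h th); congr (Im (T _)); apply/funext => x.
  apply: ReIm_eq => //=; rewrite ImM /= /cutoffn /= ip mul0r mulr0 addr0//.
have c' : (fun n => Im (T (fun x => cutoffn psi n x * phi x))) @ \oo --> (0 : R).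
  by under eq_fun do rewrite e; exact: cvg_cst.
exact: (cvg_unique (@Rhausdorff R) c c').
Qed.

(** Both phi + conj(phi) and i (phi - conj(phi)) are real-valued, so [T] takes real values on them;
    these two real equations determine its value at the conjugate. On the Fourier side this is
    Hermitian symmetry. *)
Lemma conj_pairing (T : dist R) (phi : E3 -> R[i]) : tempered T -> real_dist T -> csch phi ->
  T (fun x => (phi x)^*) = (T phi)^*.
Proof.
move=> tT rT sp; have sc := smooth_conj sp.
have hA : Im (T (fun x => 1 * phi x + (phi x)^*)) = 0.
  apply: real_pairing => //; first by apply: cschD => //; exact: cschZ.
  by move=> x; case: (phi x) => a b; rewrite mul1r /= subrr.
have hB : Im (T (fun x => ii R * phi x + (- ii R * (phi x)^*))) = 0.
  apply: real_pairing => //; first by apply: cschD; exact: cschZ.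
  by move=> x; case: (phi x) => a b; rewrite ImD !ImM /=; ring.
have tZ (a : R[i]) (f : E3 -> R[i]) : csch f -> T (fun x => a * f x) = a * T f.
  move=> sf; have := tempered_lin (a - 1) tT sf sf.
  by rewrite -[X in _ = _ + X]mul1r -mulrDl subrK => <-; congr T; apply/funext => x; ring.
rewrite (tempered_lin _ tT sp sc) mul1r in hA.
rewrite (tempered_lin _ tT sp (cschZ _ sc)) tZ// in hB.
move: hA hB; case: (T phi) => a b; case: (T _) => c d.
rewrite !ImD !ImM /= => hA hB; apply: ReIm_eq => /=; lra.
Qed.

Lemma loc_conj (g : E3 -> R[i]) : locally_integrable3 g -> locally_integrable3 (fun x => (g x)^*).
Proof.
move=> lg; apply: loc_of_cL1 => n; have [m i] := loc_cL1_eball n%:R lg.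
have e : (fun x : V => (g x)^* * (\1_(eball n%:R) (x : E3))%:C) = (fun x : V => (g x * (\1_(eball n%:R) (x : E3))%:C)^*).
  by apply/funext => x; rewrite [RHS]rmorphM; congr (_ * _); exact/esym/conj_real.
rewrite e; split; first exact: cmeas_conj.
by under eq_fun do rewrite cabs_conj.
Qed.

Section component.
Variables (s : R) (s0 : 0 < s) (s1 : s < 1) (T : dist R) (hT : Hdot s T).
Let f := fun_of (dfourier T).

Lemma hdot_conj : real_dist T -> {ae lam3 R, forall x : V, f (- (x : E3)) = (f x)^*}.
Proof.
move=> rT; have hf := hdot_represents hpsi hT.
suff H : represents (dfourier T) (fun x => (f (- x))^*).
  by move: (represents_ae hpsi hf H); apply: filterS => x e; rewrite /f e conjCK.
split; first by apply: loc_conj; apply: loc_opp; exact: hf.1.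
move=> th tt; have st := csch_test tt.
pose th' (x : E3) := (th (- x))^*.
have st' : csch th' by apply: smooth_conj; exact: csch_opp.
have ef : fourier th' = fun x => (fourier th x)^*.
  apply/funext => x; rewrite !fourierE (conj_inv_fourier _ (csch_cL1 st)).
  by [].
have h1 : T (fourier th') = cint (lam3 R) (fun x : V => f x * th' x).
  by rewrite (hdot_pairing hpsi s0 hT (csch_fourier st')) (inv_fourierK st').
have h2 : T (fourier th') = (T (fourier th))^*.
  by rewrite ef; apply: conj_pairing rT (csch_fourier st); exact: hdot_tempered hT.
have l1 : cL1 (lam3 R) (fun x : V => f x * th' x) := tfun_cL1 (tfun_hdot hpsi s0 hT) st'.
rewrite /dfourier -[LHS]conjCK -h2 h1 (cint_conj l1) /dist_of cintegralE.
have := scales_cint ltr01 (scales3_opp R) (f := fun x : V => (f x * th' x)^*).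
rewrite mul1r => <-; last by split; [exact: cmeas_conj l1.1|under eq_fun do rewrite cabs_conj; exact: l1.2].
apply: (congr1 (cint (lam3 R))); apply/funext => x.
rewrite [LHS]rmorphM; congr (_ * _); rewrite /th' opprK; exact: conjCK.
Qed.

(** The transform is integrable near 0 and square integrable away from 0, and neither globally in
    general. Splitting at |x| = 1 presents [T] as a bounded function plus an L^2 function. *)
Definition lowp (x : E3) : R[i] := f x * (\1_(eball 1) x)%:C.
Definition highp (x : E3) : R[i] := f x * (1 - \1_(eball 1) x)%:C.

Lemma low_highp x : f x = lowp x + highp x.
Proof. by rewrite /lowp /highp -mulrDr -rmorphD /= subrKC mulr1. Qed.

Lemma cL1_lowp : cL1 (lam3 R) (lowp : V -> R[i]).
Proof. exact: loc_cL1_eball (hdot_represents hpsi hT).1. Qed.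

Lemma cL2_highp : cL2 (highp : V -> R[i]).
Proof.
have m1 : measurable_fun setT (fun x : V => 1 - \1_(eball 1) (x : E3) : R).
  by apply: measurable_funB => //; exact: measurable_indic (measurable_eball _).
apply: cL2_dom (cmeasM (cmeas_hdot hpsi hT) (cmeas_real m1)) (hdot_sqr hpsi s0 hT) _.
move=> x; rewrite -cabs_hsq /highp indicE; have [h|h] := boolP ((x : E3) \in eball 1).
  by rewrite subrr mulr0 cabs0 mulr_ge0 ?powR_ge0 ?cabs_ge0.
rewrite subr0 mulr1 ler_peMl ?cabs_ge0//.
have x1 : 1 <= enorm (x : E3).
  by rewrite leNgt; apply/negP => h1; move/negP: h; apply; rewrite inE; exact: ltW.
by rewrite -(powRr0 (enorm (x : E3))) ler_powR// ltW.
Qed.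

Lemma hdot_function : exists2 h : E3 -> R[i], ft2 highp h &
  represents T (fun x => inv_fourier lowp x + h x).
Proof.
have [h hh] := ft2_exists hpsi cL2_highp; exists h => //; have [_ h2 _] := hh.
have l1 := cL1_lowp; split.
  have lh : locally_integrable3 h by exact: (cL2_loc hpsi h2).
  have ll : locally_integrable3 (inv_fourier lowp).
    by apply: (loc_bounded hpsi (cmeas_inv_fourier l1.1)) => x; exact: inv_fourier_bound.
  exact: lint3D ll lh.
move=> phi tp; have sp := csch_test tp; have p1 := csch_cL1 sp.
rewrite (hdot_pairing hpsi s0 hT sp) /dist_of cintegralE.
have sF := csch_inv_fourier sp.
have a1 : cL1 (lam3 R) (fun x : V => lowp x * inv_fourier phi x).
  have := cmeas_bounded_cL1 (cmeas_inv_fourier p1.1) (fun x => inv_fourier_bound x p1) l1.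
  by under eq_fun do rewrite mulrC.
have a2 : cL1 (lam3 R) (fun x : V => highp x * inv_fourier phi x) := cL2M cL2_highp (csch_cL2 sF).
have b1 : cL1 (lam3 R) (fun x : V => inv_fourier lowp x * phi x).
  exact: (cmeas_bounded_cL1 (cmeas_inv_fourier l1.1) (fun x => inv_fourier_bound x l1) p1).
have b2 : cL1 (lam3 R) (fun x : V => h x * phi x) := cL2M h2 (csch_cL2 sp).
have -> : (fun x : V => f x * inv_fourier phi x) = (fun x : V => lowp x * inv_fourier phi x + highp x * inv_fourier phi x).
  by apply/funext => x; rewrite low_highp mulrDl.
have -> : (fun x : V => (inv_fourier lowp x + h x) * phi x) = (fun x : V => inv_fourier lowp x * phi x + h x * phi x).
  by apply/funext => x; rewrite mulrDl.
by rewrite (cintD a1 a2) (cintD b1 b2) -(fourier_mult l1 p1) (ft2_mult hpsi hh sp).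
Qed.

End component.

(** The origin lies in balls of volume proportional to r^3, with r arbitrarily small. *)
Lemma ae_neq0 : {ae lam3 R, forall x : V, enorm (x : E3) != 0}.
Proof.
have mb : measurable [set x : V | enorm (x : E3) = 0].
  by have := measurable_enorm measurableT (measurable_set1 (0 : R)); rewrite setTI.
exists [set x : V | enorm (x : E3) = 0]; split => //; last by move=> x /= /negP; rewrite negbK => /eqP.
apply/eqP; rewrite eq_le measure_ge0 andbT; apply/lee_addgt0Pr => e e0; rewrite add0e.
pose r := Num.min 1 (e / (1 + ball_volume R)).
have v0 := ball_volume_ge0 R; have v1 : 0 < 1 + ball_volume R by rewrite ltr_pwDl.
have r0 : 0 < r by rewrite lt_min ltr01 divr_gt0.
have re : r <= e / (1 + ball_volume R) by rewrite ge_min lexx orbT.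
have r1 : r <= 1 by rewrite ge_min lexx.
have e2 : nint (lam3 R) (fun x : V => \1_(eball r) x : R) = lam3 R (eball r : set V).
  by rewrite /nint integral_indic ?setIT//; exact: measurable_eball.
have e3 : lam3 R (eball r : set V) = (r ^+ 3 * ball_volume R)%:E := etrans (esym e2) (nint_eball hpsi r0).
apply: (@le_trans _ _ (r ^+ 3 * ball_volume R)%:E).
  rewrite -e3; apply: le_measure; rewrite ?inE//; first exact: measurable_eball.
  move=> x /= h; rewrite /eball /=; apply: (@le_trans _ _ 0); last exact: ltW.
  by rewrite le_eqVlt; apply/orP; left; exact/eqP.
rewrite lee_fin; apply: (@le_trans _ _ (r * (1 + ball_volume R))).
  apply: ler_pM; rewrite ?exprn_ge0 ?(ltW r0) ?lerDr//.
  by rewrite -[leRHS]mulr1 exprS ler_wpM2l ?(ltW r0)// exprn_ile1// ltW.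
by rewrite -ler_pdivlMr.
Qed.

End hdot_structure.

(** * The Fourier transform of a product of velocity components *)

Section product_formula.
Variable R : realType.
Notation E3 := (R * R * R)%type.
Notation V := (mspace R).
Notation VV := (V * V)%type.
Variables (psi : E3 -> R) (hpsi : lp_cutoff psi).

Lemma inv_fourier_product_schwartz B C (xi : E3) : cL1 (lam3 R) (B : V -> R[i]) -> csch C ->
  inv_fourier (fun x => inv_fourier B x * inv_fourier C x) xi =
  (c0 R)%:C * cint (lam3 R) (fun y : V => B y * C (- xi - (y : E3))).
Proof.
move=> B1 sC; rewrite inv_fourierE; congr (_ * _).
have sI := csch_inv_fourier sC.
transitivity (cint (lam3 R) (fun x : V => inv_fourier B x * (cis (dotp xi (x : E3)) * inv_fourier C x))).
  by apply: (congr1 (cint (lam3 R))); apply/funext => x; rewrite mulrCA.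
rewrite (fourier_mult B1 (cL1_cis xi (csch_cL1 sI))).
apply: (congr1 (cint (lam3 R))); apply/funext => y; congr (_ * _).
have -> : C (- xi - (y : E3)) = inv_fourier (inv_fourier C) ((y : E3) + xi).
  by rewrite inv_fourier_inv_fourier// opprD addrC.
rewrite !inv_fourierE; congr (_ * _); apply: (congr1 (cint (lam3 R))); apply/funext => x.
by rewrite dotpDl cisD mulrA.
Qed.

Lemma trilinear_schwartz A B C : cL1 (lam3 R) (A : V -> R[i]) -> cL1 (lam3 R) (B : V -> R[i]) -> csch C ->
  cL1 (lam33 R) (tri A B C) ->
  cint (lam3 R) (fun x => inv_fourier A x * (inv_fourier B x * inv_fourier C x)) =
  (c0 R)%:C * cint (lam33 R) (tri A B C).
Proof.
move=> A1 B1 sC lT.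
have h1 : cL1 (lam3 R) (fun x => inv_fourier B x * inv_fourier C x).
  by apply: (cmeas_bounded_cL1 (cmeas_inv_fourier B1.1) (fun x => inv_fourier_bound x B1)); exact/csch_cL1/csch_inv_fourier.
rewrite (fourier_mult A1 h1) (cfubini33_1 lT) -cintZ; last exact: cL1_cint33_2 lT.
apply: (congr1 (cint (lam3 R))); apply/funext => xi.
rewrite (inv_fourier_product_schwartz xi B1 sC) mulrCA; congr (_ * _).
rewrite -cintZ; first by apply: (congr1 (cint (lam3 R))); apply/funext => y; rewrite /tri /third /= mulrA.
have [c hc] := sC.2 0%N.
have b y : cabs (C (- xi - (y : E3))) <= c by exact: csbd_sup0 hc.
have mC : cmeas (fun y : V => C (- xi - (y : E3))) := cmeas_comp (scales3_refl (- xi)).1 (cmeas_csmooth sC.1).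
have := cmeas_bounded_cL1 mC b B1.
by under eq_fun do rewrite mulrC.
Qed.

Lemma inv_fourier_ae A B x : cmeas (A : V -> R[i]) -> cmeas (B : V -> R[i]) -> {ae lam3 R, forall y : V, A y = B y} ->
  inv_fourier A x = inv_fourier B x.
Proof.
move=> mA mB ae; rewrite !inv_fourierE; congr (_ * _).
apply: ae_eq_cint; [exact: cmeasM (cmeas_cis_dot x) mA|exact: cmeasM (cmeas_cis_dot x) mB|].
by move: ae; apply: filterS => y ->.
Qed.

Lemma ccvg_shift1 (z_ : nat -> R[i]) z : ccvg z_ z -> ccvg (fun n => z_ n.+1) z.
Proof. by rewrite /ccvg => h; rewrite (cvg_shiftS (fun n => cabs (z_ n - z))). Qed.

Lemma N2_dom (A B : V -> R[i]) c : cmeas A -> cL2 B -> (forall x, cabs (A x) <= c * cabs (B x)) ->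
  cL2 A /\ N2 A <= c ^+ 2 * N2 B.
Proof.
move=> mA [mB iB] h.
have hs x : cabs (A x) ^+ 2 <= c ^+ 2 * cabs (B x) ^+ 2.
  by rewrite -exprMn lerXn2r ?nnegrE ?cabs_ge0// (le_trans (cabs_ge0 _) (h x)).
have ih := integrable_RZ (c ^+ 2) iB; have A2 := cL2_le mA hs ih; split => //.
rewrite /N2 -RintegralZl//; apply: le_Rintegral => //; first exact: A2.2.
Qed.

Lemma cL2_weight (F : V -> R[i]) K : cmeas F -> (forall x, cabs (F x) <= K) ->
  cL2 (fun x : V => F x * (weight 6 (x : E3))%:C).
Proof.
move=> mF hF.
have mw : cmeas (fun x : V => (weight 6 (x : E3))%:C) by apply: cmeas_real; exact: measurable_weight.
have hs (x : V) : cabs (F x * (weight 6 (x : E3))%:C) ^+ 2 <= K ^+ 2 * cauchy3 (x : E3).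
  have w0 := weight_gt0 6 (x : E3); have k0 : 0 <= K by exact: le_trans (cabs_ge0 (F x)) (hF x).
  rewrite cabsM cabs_real ger0_norm ?(ltW w0)// exprMn; apply: ler_pM; rewrite ?sqr_ge0//.
    by rewrite lerXn2r ?nnegrE ?cabs_ge0.
  by apply: le_trans (weight6 _); rewrite expr2 ler_piMr ?weight_le1// ltW.
exact: (cL2_le (cmeasM mF mw) hs (integrable_RZ (K ^+ 2) (integrable_cauchy3v R))).
Qed.

Variables (s : R) (s56 : 5 / 6 <= s) (s1 : s < 1) (u : 'I_3 -> dist R) (hH : forall i, Hdot s (u i)).
Variables (g : 'I_3 -> E3 -> R[i]) (hg : ns_pre s g).
Hypothesis gf : forall i, {ae lam3 R, forall x : V, g i x = fun_of (dfourier (u i)) x}.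

Let s0 : 0 < s := s_gt0 s56.

Lemma cL1_trunc_g n i : cL1 (lam3 R) (trunc n (g i : V -> R[i])).
Proof.
have := loc_cL1_eball n%:R (ns_loc hg i); congr (cL1 _ _).
by apply/funext => x; rewrite truncE mulrC.
Qed.

Lemma inv_fourier_trunc_g n i x : (0 < n)%N -> inv_fourier (trunc n (g i)) x =
  inv_fourier (lowp (u i)) x + inv_fourier (trunc n (highp (u i))) x.
Proof.
move=> n0; have l1 := cL1_lowp hpsi (hH i); have h1 := cL1_trunc hpsi n (cL2_highp hpsi s0 (hH i)).
rewrite -inv_fourierD//; apply: inv_fourier_ae.
- exact: (cL1_trunc_g n i).1.
- exact: (cL1D l1 h1).1.
move: (@gf i); apply: filterS => y e; rewrite /trunc; case: ifPn => [h|/negP h].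
  by rewrite e; exact: low_highp.
rewrite /lowp indicE memNset ?mulr0 ?addr0//; rewrite /eball /= => h1'; apply: h.
by apply: le_trans h1' _; rewrite ler1n.
Qed.

(** The frequencies are truncated at radius n. On the physical side the truncated factors converge
    in weighted L^2; on the frequency side the compact support of [Th] confines xi + eta, and
    [conv_integrable] dominates. The identity for truncations is [trilinear_schwartz]. *)
Lemma product_formula i j (Th : E3 -> R[i]) : cpart Th (@test_function R) ->
  cint (lam3 R) (fun x : V => fun_of (u i) x * fun_of (u j) x * fourier Th x) =
  (c0 R)%:C * cint (lam33 R) (fun z : VV => g j z.1 * g i z.2 * Th ((z.1 : E3) + (z.2 : E3))).
Proof.
move=> tT; have sT := csch_test tT; pose K := fourier Th; have sK : csch K := csch_fourier sT.
have [hi ft_i ri] := hdot_function hpsi s0 (hH i).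
have [hj ft_j rj] := hdot_function hpsi s0 (hH j).
have [mi aei] := fun_of_represents hpsi ri; have [mj aej] := fun_of_represents hpsi rj.
have mK := cmeas_csmooth sK.1.
have [c12 hc12] := sK.2 12%N.
have hK x : (1 + enorm x) ^+ 12 * cabs (K x) <= c12 := hc12 [::] isT x.
(* The rapidly decreasing kernel is factored as weight, bounded function [Y], weight. As 12 = 6 + 6,
   each velocity component receives a weight that makes its bounded part square integrable. *)
pose Y (x : V) : R[i] := K x * ((1 + enorm (x : E3)) ^+ 12)%:C.
have mY : cmeas Y.
  apply: cmeasM => //; apply: cmeas_real; apply: measurable_funX.
  by apply: measurable_funD => //; exact: measurable_enorm.
have bY x : cabs (Y x) <= c12.
  by rewrite cabsM cabs_real mulrC ger0_norm ?hK// exprn_ge0// ltW// one_enorm_gt0.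
have KY (x : V) : K x = (weight 6 (x : E3))%:C * Y x * (weight 6 (x : E3))%:C.
  have t0 : (1 + enorm (x : E3)) ^+ 6 != 0 by rewrite gt_eqF// exprn_gt0// one_enorm_gt0.
  have r1 : weight 6 (x : E3) * (1 + enorm (x : E3)) ^+ 12 * weight 6 (x : E3) = 1.
    by rewrite /weight -[12%N]/(6 + 6)%N exprD mulrA (mulVf t0) mul1r mulfV.
  transitivity (K x * (weight 6 (x : E3) * (1 + enorm (x : E3)) ^+ 12 * weight 6 (x : E3))%:C).
    by rewrite r1 mulr1.
  by rewrite /Y !rmorphM /=; ring.
pose W6 (x : V) : R[i] := (weight 6 (x : E3))%:C.
have mW : cmeas W6 by apply: cmeas_real; exact: measurable_weight.
have bW x : cabs (W6 x) <= 1 by rewrite cabs_real ger0_norm ?weight_le1// ltW// weight_gt0.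
pose L k := inv_fourier (lowp (u k)).
have mL k : cmeas (L k : V -> R[i]) := cmeas_inv_fourier (cL1_lowp hpsi (hH k)).1.
pose a k n := inv_fourier (trunc n (highp (u k))).
have a2 k n : cL2 (a k n) := cL2_inv_fourier_trunc hpsi n (cL2_highp hpsi s0 (hH k)).
have LW k : cL2 (fun x => L k x * W6 x) := cL2_weight (mL k) (fun x => inv_fourier_bound x (cL1_lowp hpsi (hH k))).
have bd (F M : V -> R[i]) (c : R) : cL2 F -> cmeas M -> (forall x, cabs (M x) <= c) -> cL2 (fun x => F x * M x) /\ N2 (fun x => F x * M x) <= c ^+ 2 * N2 F.
  move=> F2 mM bM; apply: N2_dom => //; first exact: cmeasM F2.1 mM.
  by move=> x; rewrite cabsM mulrC ler_wpM2r ?cabs_ge0.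
have [_ hi2 ci] := ft_i; have [_ hj2 cj] := ft_j.
pose An n (x : V) : R[i] := (L i x + a i n x) * W6 x * Y x.
pose A (x : V) : R[i] := (L i x + hi x) * W6 x * Y x.
pose Bn n (x : V) : R[i] := (L j x + a j n x) * W6 x.
pose B (x : V) : R[i] := (L j x + hj x) * W6 x.
have sumW k (F : V -> R[i]) : cL2 F -> cL2 (fun x => (L k x + F x) * W6 x).
  move=> F2; have := (cL2D (LW k) (bd _ _ _ F2 mW bW).1).1.
  by congr cL2; apply/funext => x; rewrite mulrDl.
have A2 : cL2 A := (bd _ _ _ (sumW i _ hi2) mY bY).1.
have An2 n : cL2 (An n) := (bd _ _ _ (sumW i _ (a2 i n)) mY bY).1.
have B2 : cL2 B := sumW j _ hj2.
have Bn2 n : cL2 (Bn n) := sumW j _ (a2 j n).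
have cA : (fun n => N2 (fun x => An n x - A x)) @ \oo --> (0 : R).
  apply: (squeeze0 _ _ (cvg0Z (c12 ^+ 2 * 1 ^+ 2) ci)) => n; first exact: N2_ge0.
  have -> : (fun x => An n x - A x) = (fun x => (a i n x - hi x) * W6 x * Y x).
    by apply/funext => x; rewrite /An /A; ring.
  have [d1 d2] := bd _ _ _ (cL2B (a2 i n) hi2) mW bW; have [_ e2] := bd _ _ _ d1 mY bY.
  by have := le_trans e2 (ler_wpM2l (sqr_ge0 c12) d2); rewrite mulrA.
have cB : (fun n => N2 (fun x => Bn n x - B x)) @ \oo --> (0 : R).
  apply: (squeeze0 _ _ (cvg0Z (1 ^+ 2) cj)) => n; first exact: N2_ge0.
  have -> : (fun x => Bn n x - B x) = (fun x => (a j n x - hj x) * W6 x).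
    by apply/funext => x; rewrite /Bn /B; ring.
  exact: (bd _ _ _ (cL2B (a2 j n) hj2) mW bW).2.
have lim1 := cint_cvg2 An2 Bn2 A2 B2 cA cB.
have eAB : cint (lam3 R) (fun x => A x * B x) = cint (lam3 R) (fun x : V => fun_of (u i) x * fun_of (u j) x * K x).
  apply: ae_eq_cint.
  - exact: cmeasM A2.1 B2.1.
  - by apply: cmeasM => //; apply: cmeasM; apply: lint3_cmeas; [exact: mi.1|exact: mj.1].
  by move: aei aej; apply: filterS2 => x -> ->; rewrite -/(L i) -/(L j) /A /B (KY x) -/(W6 x); ring.
rewrite -/K -eAB; apply: ccvg_unique (ccvg_shift1 lim1) _.
have [C tC] : exists C : E3 -> R[i], C = fun x => Th (- x) by eexists.
have sC : csch C by rewrite tC; exact: csch_opp.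
have eC : inv_fourier C = K.
  apply/funext => x; rewrite /K fourierE tC inv_fourier_opp//; exact: csch_cL1.
have [r [cT [cT0 hT]]] : exists r c, 0 <= c /\ forall x, cabs (Th x) <= c * \1_(eball r) x.
  have [r [r0 hr]] := ctest_support tT; have [c hc] := sT.2 0%N.
  exists r, c; split; first exact: csbd_ge0 hc.
  move=> x; have [h|h] := leP (enorm x) r.
    by rewrite indicE mem_set// mulr1; exact: csbd_sup0 hc.
  by rewrite hr// cabs0 mulr_ge0 ?(csbd_ge0 hc)// indicE.
pose D (z : VV) := cT * (w g z.1 * w g z.2 * \1_(eball r) (third z)).
have iD : (lam33 R).-integrable setT (fun z => (D z)%:E) := integrable_RZ cT (conv_integrable hpsi s56 hg r).
have eThird (z : VV) : C (third z) = Th ((z.1 : E3) + (z.2 : E3)).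
  by rewrite tC /third opprD !opprK.
have bT (z : VV) (p q : R[i]) : cabs p <= w g z.1 -> cabs q <= w g z.2 -> cabs (p * q * C (third z)) <= D z.
  move=> hp hq; rewrite !cabsM /D mulrCA mulrA; apply: le_trans (_ : _ <= w g z.1 * w g z.2 * (cT * \1_(eball r) (third z))) _; last first.
    by rewrite le_eqVlt; apply/orP; left; apply/eqP; ring.
  apply: ler_pM; rewrite ?mulr_ge0 ?cabs_ge0//; first by apply: ler_pM; rewrite ?cabs_ge0.
  rewrite tC; apply: le_trans (hT _) _; rewrite ler_wpM2l// !indicE.
  by rewrite le_eqVlt; apply/orP; left; apply/eqP; congr (_%:R); congr nat_of_bool; apply/idP/idP; rewrite !inE /eball /= enormN.
have mT n k : cmeas (trunc n (g k : V -> R[i])) by exact: (cL1_trunc_g n k).1.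
have mC3 : cmeas (fun z : VV => C (third z)) := cmeas_comp (@measurable_third R) (cmeas_csmooth sC.1).
have lt n : cL1 (lam33 R) (tri (trunc n (g j)) (trunc n (g i)) C).
  apply: (cL1_dom (h := D)) => //; first by apply: cmeas_tri => //; exact: cmeas_csmooth sC.1.
  by move=> z; apply: bT; apply: le_trans (cabs_trunc _ _ _) (cabs_g_le _ _ _).
(* The index starts at 1 because the truncation radius must contain the unit ball carrying
   [lowp]. *)
have eN n : cint (lam3 R) (fun x => An n.+1 x * Bn n.+1 x) = (c0 R)%:C * cint (lam33 R) (tri (trunc n.+1 (g j)) (trunc n.+1 (g i)) C).
  rewrite -(trilinear_schwartz (cL1_trunc_g _ j) (cL1_trunc_g _ i) sC (lt _)).
  apply: (congr1 (cint (lam3 R))); apply/funext => x; rewrite !inv_fourier_trunc_g// eC (KY x) /An /Bn -/(W6 x).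
  rewrite -/(L i) -/(L j) -/(a i n.+1) -/(a j n.+1); ring.
have lim2 : ccvg (fun n => (c0 R)%:C * cint (lam33 R) (tri (trunc n (g j)) (trunc n (g i)) C))
   ((c0 R)%:C * cint (lam33 R) (fun z : VV => g j z.1 * g i z.2 * Th ((z.1 : E3) + (z.2 : E3)))).
  apply: ccvgZ; apply: (cint_dct (h := D)) => //.
  - by move=> n; exact: (lt n).1.
  - under eq_fun do rewrite -eThird.
    by apply: cmeasM => //; apply: cmeasM; [exact: cmeas_g1 hg j|exact: cmeas_g2 hg i].
  - move=> z; apply: ccvg_near.
    have [m1 hm1] := enorm_le_nat (z.1 : E3); have [m2 hm2] := enorm_le_nat (z.2 : E3).
    exists (maxn m1 m2) => // n hn.
    have n1 : (m1 <= n)%N := leq_trans (leq_maxl m1 m2) hn; have n2 : (m2 <= n)%N := leq_trans (leq_maxr m1 m2) hn.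
    by rewrite /tri (trunc_cvg _ hm1 n1) (trunc_cvg _ hm2 n2) eThird.
  - by move=> z n; apply: bT; apply: le_trans (cabs_trunc _ _ _) (cabs_g_le _ _ _).
have := ccvg_shift1 lim2; congr ccvg; apply/funext => n; by rewrite eN.
Qed.

End product_formula.

(** * The weak equation in frequency variables *)

Section weak_form.
Variable R : realType.
Notation E3 := (R * R * R)%type.
Notation V := (mspace R).
Notation VV := (V * V)%type.
Variables (psi : E3 -> R) (hpsi : lp_cutoff psi).

Lemma tfun_of_cL1 (F : E3 -> R[i]) M : cmeas (F : V -> R[i]) ->
  cL1 (lam3 R) (fun x : V => F x * (weight M (x : E3))%:C) -> tfun F.
Proof.
move=> mF [_ i]; split => //; exists M, (fun x : V => cabs (F x * (weight M (x : E3))%:C)); split => // x.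
by rewrite cabsM cabs_real ger0_norm// ltW// weight_gt0.
Qed.

Lemma cint_comb (a : R[i]) (f h F : V -> R[i]) : cL1 (lam3 R) f -> cL1 (lam3 R) h ->
  (forall x, F x = a * f x + h x) -> cint (lam3 R) F = a * cint (lam3 R) f + cint (lam3 R) h.
Proof.
move=> lf lh e; rewrite -(cintZ a lf) -(cintD (cL1Z a lf) lh).
by apply: (congr1 (cint (lam3 R))); apply/funext.
Qed.

Lemma cL2_ae (A B : V -> R[i]) : cmeas B -> {ae lam3 R, forall x, A x = B x} -> cL2 A -> cL2 B.
Proof.
move=> mB ae [mA iA]; split => //.
have mA2 := cmeas_real (measurable_sqr mA); have mB2 := cmeas_real (measurable_sqr mB).
have lA : cL1 (lam3 R) (fun x => (cabs (A x) ^+ 2)%:C).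
  by split => //; under eq_fun do rewrite cabs_real ger0_norm ?sqr_ge0//.
have [_] : cL1 (lam3 R) (fun x => (cabs (B x) ^+ 2)%:C).
  by apply: cL1_ae lA => //; move: ae; apply: filterS => x ->.
by under eq_fun do rewrite cabs_real ger0_norm ?sqr_ge0//.
Qed.

Lemma ctestM (h th : E3 -> R[i]) : csmooth h -> cpart th (@test_function R) ->
  cpart (fun x => h x * th x) (@test_function R).
Proof.
move=> [hr hi] [tr ti]; split.
  have -> : (fun x => Re (h x * th x)) = (fun x => Re (h x) * Re (th x) - Im (h x) * Im (th x)).
    by apply/funext => x; rewrite ReM.
  exact: test_functionB (test_functionM hr tr) (test_functionM hi ti).
have -> : (fun x => Im (h x * th x)) = (fun x => Re (h x) * Im (th x) - - Im (h x) * Re (th x)).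
  by apply/funext => x; rewrite ImM mulNr opprK.
apply: test_functionB; first exact: test_functionM hr ti.
exact: test_functionM (smoothN hi) tr.
Qed.

Lemma csch_sum3 (F : 'I_3 -> E3 -> R[i]) : (forall i, csch (F i)) -> csch (fun x => \sum_i F i x).
Proof.
move=> h.
have -> : (fun x => \sum_i F i x) = (fun x => F ord0 x + (F (lift ord0 ord0) x + F (lift ord0 (lift ord0 ord0)) x)).
  by apply/funext => x; rewrite !big_ord_recl big_ord0 addr0.
by apply: cschD => //; exact: cschD.
Qed.

Lemma cscvg_sum3 (F_ : 'I_3 -> nat -> E3 -> R[i]) (F : 'I_3 -> E3 -> R[i]) : (forall i n, csch (F_ i n)) ->
  (forall i, csch (F i)) -> (forall i, cscvg (F_ i) (F i)) ->
  cscvg (fun n x => \sum_i F_ i n x) (fun x => \sum_i F i x).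
Proof.
move=> h_ h c.
have -> : (fun x => \sum_i F i x) = (fun x => F ord0 x + (F (lift ord0 ord0) x + F (lift ord0 (lift ord0 ord0)) x)).
  by apply/funext => x; rewrite !big_ord_recl big_ord0 addr0.
have -> : (fun n x => \sum_i F_ i n x) = (fun n x => F_ ord0 n x + (F_ (lift ord0 ord0) n x + F_ (lift ord0 (lift ord0 ord0)) n x)).
  by apply/funext => n; apply/funext => x; rewrite !big_ord_recl big_ord0 addr0.
by do 2?[apply: cscvgD => //]; [move=> n; exact: cschD|exact: cschD].
Qed.

Lemma cpartial_fourier j (f : E3 -> R[i]) : csch f ->
  cpartial j (fourier f) = fourier (fun x => (- ii R * (coord x j)%:C) * f x).
Proof.
move=> sf; have so := csch_opp sf.
have e1 : fourier f = inv_fourier (fun x => f (- x)).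
  by apply/funext => x; rewrite fourierE inv_fourier_opp//; exact: csch_cL1.
rewrite e1 cpartial_inv_fourier//; apply/funext => x.
have s2 : csch (fun x => (- ii R * (coord x j)%:C) * f x).
  have := cschZ (- ii R) (csch_coordM j sf); congr csch; apply/funext => y; exact: mulrA.
rewrite fourierE -inv_fourier_opp; last exact: csch_cL1.
congr (inv_fourier _ x); apply/funext => y; rewrite /mulX coordN rmorphN /=; ring.
Qed.

Lemma csch_powR_cL2 (s : R) (f : E3 -> R[i]) : 0 < s -> s < 1 -> csch f ->
  cL2 (fun x : V => (enorm (x : E3) `^ s)%:C * f x).
Proof.
move=> s0 s1 sf; have [c hc] := sf.2 7%N; have c0 := csbd_ge0 hc.
have m : cmeas (fun x : V => (enorm (x : E3) `^ s)%:C * f x).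
  apply: cmeasM; last exact: cmeas_csmooth sf.1.
  by apply: cmeas_real; exact: (locb_powR (ltW s0)).1.
apply: (cL2_le m _ (integrable_RZ (c ^+ 2) (integrable_cauchy3v R))) => x.
have hx : (1 + enorm (x : E3)) ^+ 7 * cabs (f x) <= c := hc [::] isT x.
have p1 := one_enorm_gt0 (x : E3).
have a1 := enorm_powR_le (x : E3) s0 s1.
have h6 : cabs ((enorm (x : E3) `^ s)%:C * f x) <= c * weight 6 (x : E3).
  rewrite cabsM cabs_real ger0_norm ?powR_ge0// /weight ler_pdivlMr ?exprn_gt0//.
  apply: le_trans hx; rewrite [_ ^+ 7]exprS mulrAC.
  by rewrite ler_wpM2r ?cabs_ge0// ler_wpM2r ?exprn_ge0// ltW.
apply: (@le_trans _ _ ((c * weight 6 (x : E3)) ^+ 2)).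
  by rewrite lerXn2r ?nnegrE ?cabs_ge0// mulr_ge0// ltW// weight_gt0.
rewrite exprMn ler_wpM2l ?sqr_ge0//; apply: le_trans (weight6 _).
by rewrite expr2 ler_piMr ?weight_le1// ltW// weight_gt0.
Qed.

Variables (s : R) (s56 : 5 / 6 <= s) (s1 : s < 1).
Let s0 : 0 < s := s_gt0 s56.

Lemma frac_lapE (T : dist R) : frac_lap (s / 2) T =
  dinv_fourier (dist_of (fun x => (enorm x `^ s)%:C * fun_of (dfourier T) x)).
Proof. by rewrite /frac_lap [2 * _]mulrC divfK// pnatr_eq0. Qed.

Lemma frac_function (T : dist R) : Hdot s T -> exists2 h : E3 -> R[i],
  ft2 (fun x : V => (enorm (x : E3) `^ s)%:C * fun_of (dfourier T) x) h & represents (frac_lap (s / 2) T) h.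
Proof.
move=> hT; have [h hh] := ft2_exists hpsi (hdot_sqr hpsi s0 hT); exists h => //.
by rewrite frac_lapE; exact: (ft2_represents hpsi hh).
Qed.

Lemma frac_test (f : E3 -> R[i]) : cpart f (@test_function R) -> exists2 h : E3 -> R[i],
  ft2 (fun x : V => (enorm (x : E3) `^ s)%:C * fun_of (dfourier (dist_of f)) x) h &
  represents (frac_lap (s / 2) (dist_of f)) h /\
  {ae lam3 R, forall x : V, fun_of (dfourier (dist_of f)) x = fourier f x}.
Proof.
move=> tf; have sf := csch_test tf; have sF := csch_fourier sf.
have hr : represents (dfourier (dist_of f)) (fourier f).
  split; first exact: (@cL1_loc R psi hpsi _ (csch_cL1 sF)).
  move=> th tth; have st := csch_test tth; rewrite /dfourier /dist_of !cintegralE.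
  have f1 := csch_cL1 sf; have t1 := csch_cL1 st.
  have e1 (F : E3 -> R[i]) : csch F -> fourier F = inv_fourier (fun x => F (- x)).
    by move=> sFF; apply/funext => x; rewrite fourierE inv_fourier_opp//; exact: csch_cL1.
  rewrite (e1 th st) (e1 f sf) -(fourier_mult f1 (csch_cL1 (csch_opp st))).
  have l := csch_cL1 (csch_opp sf).
  have st1 := csch_inv_fourier sf.
  have l2 : cL1 (lam3 R) (fun x : V => inv_fourier f x * th (- (x : E3))).
    exact: (cmeas_bounded_cL1 (cmeas_inv_fourier f1.1) (fun x => inv_fourier_bound x f1) (csch_cL1 (csch_opp st))).
  have := scales_cint ltr01 (scales3_opp R) l2; rewrite mul1r => <-.
  by apply: (congr1 (cint (lam3 R))); apply/funext => x; rewrite opprK inv_fourier_opp.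
have [rF aeF] := fun_of_represents hpsi hr.
have K2 : cL2 (fun x : V => (enorm (x : E3) `^ s)%:C * fun_of (dfourier (dist_of f)) x).
  apply: cL2_ae (csch_powR_cL2 s0 s1 sF).
    apply: cmeasM; last exact: lint3_cmeas rF.1.
    by apply: cmeas_real; exact: (locb_powR (ltW s0)).1.
  by move: aeF; apply: filterS => x ->.
have [h hh] := ft2_exists hpsi K2; exists h => //; split => //.
by rewrite frac_lapE; exact: (ft2_represents hpsi hh).
Qed.

(** Parseval moves both half powers of the Laplacian to the frequency side, where they combine into
    |x|^{2s}; the final reflection turns the Fourier transform of [f] into its inverse transform. *)
Lemma frac_pairing (T : dist R) (f : E3 -> R[i]) : Hdot s T -> cpart f (@test_function R) ->
  cL1 (lam3 R) (fun x : V => fun_of (frac_lap (s / 2) T) x * fun_of (frac_lap (s / 2) (dist_of f)) x) /\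
  cint (lam3 R) (fun x : V => fun_of (frac_lap (s / 2) T) x * fun_of (frac_lap (s / 2) (dist_of f)) x) =
  cint (lam3 R) (fun x : V => (enorm (x : E3) `^ (2 * s))%:C * fun_of (dfourier T) x * inv_fourier f x).
Proof.
move=> hT tf; have [h hh rh] := frac_function hT; have [k hk [rk aeF]] := frac_test tf.
have [qh aeh] := fun_of_represents hpsi rh; have [qk aek] := fun_of_represents hpsi rk.
have [hG h2 _] := hh; have [hK k2 _] := hk; have sf := csch_test tf; have sF := csch_fourier sf.
have lkh : cL1 (lam3 R) (fun x : V => h x * k x) := cL2M h2 k2.
have m : cmeas (fun x : V => fun_of (frac_lap (s / 2) T) x * fun_of (frac_lap (s / 2) (dist_of f)) x).
  by apply: cmeasM; apply: lint3_cmeas; [exact: qh.1|exact: qk.1].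
have ae2 : {ae lam3 R, forall x : V, h x * k x = fun_of (frac_lap (s / 2) T) x * fun_of (frac_lap (s / 2) (dist_of f)) x}.
  by move: aeh aek; apply: filterS2 => x -> ->.
split; first exact: cL1_ae m ae2 lkh.
rewrite -(ae_eq_cint lkh.1 m ae2).
have -> : (fun x : V => h x * k x) = (fun x : V => k x * h x) by apply/funext => x; exact: mulrC.
rewrite (ft2_parseval hpsi hk hh).
pose A (x : V) : R[i] := (enorm (x : E3) `^ s)%:C * fourier f x.
have A2 : cL2 A := csch_powR_cL2 s0 s1 sF.
pose B (x : V) : R[i] := (enorm (x : E3) `^ s)%:C * fun_of (dfourier T) x.
have lAB : cL1 (lam3 R) (fun x : V => A x * B (- (x : E3))) := cL2M A2 (cL2_opp hG).
transitivity (cint (lam3 R) (fun x : V => A x * B (- (x : E3)))).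
  apply: ae_eq_cint.
  - exact: cmeasM hK.1 (cL2_opp hG).1.
  - exact: lAB.1.
  - by move: aeF; apply: filterS => x ->.
have := scales_cint ltr01 (scales3_opp R) lAB; rewrite mul1r => <-.
apply: (congr1 (cint (lam3 R))); apply/funext => x.
rewrite powR_double /A /B opprK enormN fourierE opprK rmorphM /=; ring.
Qed.

Variables (u : 'I_3 -> dist R) (hH : forall i, Hdot s (u i)).

Definition uu i j (x : E3) : R[i] := fun_of (u i) x * fun_of (u j) x.

Lemma tfun_uu i j : tfun (uu i j).
Proof.
have [hi [_ hi2 _] ri] := hdot_function hpsi s0 (hH i); have [hj [_ hj2 _] rj] := hdot_function hpsi s0 (hH j).
have [mi aei] := fun_of_represents hpsi ri; have [mj aej] := fun_of_represents hpsi rj.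
have W (k : 'I_3) (h : E3 -> R[i]) : cL2 (h : V -> R[i]) ->
    cL2 (fun x : V => (inv_fourier (lowp (u k)) x + h x) * (weight 6 (x : E3))%:C).
  move=> h2; have l1 := cL1_lowp hpsi (hH k).
  have a2 := cL2_weight (cmeas_inv_fourier l1.1) (fun x => inv_fourier_bound x l1).
  have b2 : cL2 (fun x : V => h x * (weight 6 (x : E3))%:C).
    apply: (cL2_dom (cmeasM h2.1 (cmeas_real (@measurable_weight R 6))) h2) => x.
    by rewrite cabsM cabs_real ger0_norm ?(ltW (weight_gt0 _ _))// ler_piMr ?cabs_ge0// weight_le1.
  have := (cL2D a2 b2).1; congr cL2; apply/funext => x; by rewrite mulrDl.
have m : cmeas (uu i j : V -> R[i]).
  by apply: cmeasM; apply: lint3_cmeas; [exact: mi.1|exact: mj.1].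
apply: (@tfun_of_cL1 _ 12%N) => //.
apply: cL1_ae (cL2M (W i hi hi2) (W j hj hj2)).
  by apply: cmeasM => //; apply: cmeas_real; exact: measurable_weight.
move: aei aej; apply: filterS2 => x e1 e2; rewrite /uu e1 e2.
have -> : weight 12 (x : E3) = weight 6 (x : E3) * weight 6 (x : E3).
  by rewrite /weight -[12%N]/(6 + 6)%N exprD invfM.
rewrite rmorphM /=; ring.
Qed.

Variables (P : dist R) (tP : tempered P).
Hypothesis hW : forall phi : 'I_3 -> E3 -> R, (forall i, test_function (phi i)) ->
  cintegral (fun x => \sum_(i < 3)
          fun_of (frac_lap (s / 2) (u i)) x *
          fun_of (frac_lap (s / 2) (dist_of (fun y => (phi i y)%:C))) x)
        = cintegral (fun x => \sum_(i < 3) \sum_(j < 3)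
            fun_of (u i) x * fun_of (u j) x * (partial j (phi i) x)%:C)
          + P (fun x => (\sum_(i < 3) partial i (phi i) x)%:C).

Let f2 i (x : E3) : R[i] := (enorm x `^ (2 * s))%:C * fun_of (dfourier (u i)) x.

Let tf2 i : tfun (f2 i). Proof. exact: (tfun_hdot2 hpsi s0 s1 (hH i)). Qed.

(** The weak equation is recast as the vanishing of a functional, linear over C in the field, and
    extended in two steps: from real to complex test fields by linearity, then to Schwartz fields by
    truncation. This admits fields whose Fourier transform has compact support. *)
Definition res1 (phi : 'I_3 -> E3 -> R[i]) : R[i] :=
  \sum_i cint (lam3 R) (fun x : V => f2 i x * inv_fourier (phi i) x).
Definition res2 (phi : 'I_3 -> E3 -> R[i]) : R[i] :=
  \sum_i \sum_j cint (lam3 R) (fun x : V => uu i j x * cpartial j (phi i) x).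
Definition res3 (phi : 'I_3 -> E3 -> R[i]) : R[i] := P (fun x => \sum_i cpartial i (phi i) x).
Definition residual phi := res1 phi - res2 phi - res3 phi.

Section linearity.
Variables (a : R[i]) (phi chi : 'I_3 -> E3 -> R[i]).
Hypotheses (sp : forall i, csch (phi i)) (sc : forall i, csch (chi i)).
Let comb i x := a * phi i x + chi i x.

Lemma res1_lin : res1 comb = a * res1 phi + res1 chi.
Proof.
rewrite /res1 mulr_sumr -big_split; apply: eq_bigr => i _.
have p1 := csch_cL1 (sp i); have c1 := csch_cL1 (sc i).
have l1 := tfun_cL1 (tf2 i) (csch_inv_fourier (sp i)); have l2 := tfun_cL1 (tf2 i) (csch_inv_fourier (sc i)).
apply: (cint_comb l1 l2) => x.
rewrite (inv_fourierD x (cL1Z a p1) c1) (inv_fourierZ a x p1).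
by move: (inv_fourier _ x) (inv_fourier _ x) => p q; ring.
Qed.

Lemma cpartial_comb i j x : cpartial j (comb i) x = a * cpartial j (phi i) x + cpartial j (chi i) x.
Proof.
rewrite cpartialD; [|exact: csmoothZ (sp i).1|exact: (sc i).1].
by rewrite (cpartialZ _ _ _ (sp i).1).
Qed.

Lemma res2_lin : res2 comb = a * res2 phi + res2 chi.
Proof.
rewrite /res2 mulr_sumr -big_split; apply: eq_bigr => i _; rewrite mulr_sumr -big_split; apply: eq_bigr => j _.
have l1 := tfun_cL1 (tfun_uu i j) (csch_cpartial j (sp i)); have l2 := tfun_cL1 (tfun_uu i j) (csch_cpartial j (sc i)).
apply: (cint_comb l1 l2) => x.
by rewrite cpartial_comb; move: (cpartial _ _ _) (cpartial _ _ _) => p q; ring.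
Qed.

Lemma res3_lin : res3 comb = a * res3 phi + res3 chi.
Proof.
rewrite /res3 -(tempered_lin _ tP); [|by apply: csch_sum3 => i; exact: csch_cpartial..].
congr P; apply/funext => x; under eq_bigr do rewrite cpartial_comb.
by rewrite big_split/= mulr_sumr.
Qed.

Lemma residual_lin : residual comb = a * residual phi + residual chi.
Proof.
rewrite /residual res1_lin res2_lin res3_lin.
by move: (res1 _) (res1 _) (res2 _) (res2 _) (res3 _) (res3 _) => *; ring.
Qed.

End linearity.

Lemma residual_real (phi : 'I_3 -> E3 -> R) : (forall i, test_function (phi i)) ->
  residual (fun i x => (phi i x)%:C) = 0.
Proof.
move=> tp; have ct i := ctest_real (tp i).
have := hW tp; rewrite !cintegralE.
rewrite (@cint_sum _ _ _ (lam3 R) _ _ (fun i (x : V) => fun_of (frac_lap (s / 2) (u i)) x * fun_of (frac_lap (s / 2) (dist_of (fun y => (phi i y)%:C))) x)); last first.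
  by move=> i; exact: (frac_pairing (hH i) (ct i)).1.
under [LHS]eq_bigr do rewrite (frac_pairing (hH _) (ct _)).2.
have lu i j : cL1 (lam3 R) (fun x : V => fun_of (u i) x * fun_of (u j) x * (partial j (phi i) x)%:C).
  have := tfun_cL1 (tfun_uu i j) (csch_cpartial j (csch_test (ct i))).
  by congr (cL1 _ _); apply/funext => x; rewrite cpartial_real.
rewrite (@cint_sum _ _ _ (lam3 R) _ _ (fun i (x : V) => \sum_j fun_of (u i) x * fun_of (u j) x * (partial j (phi i) x)%:C)); last first.
  by move=> i; apply: cL1_sum => j; exact: lu.
under [X in _ = X + _]eq_bigr do rewrite cint_sum//.
move=> e.
have e3 : res3 (fun i x => (phi i x)%:C) = P (fun x => (\sum_i partial i (phi i) x)%:C).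
  congr P; apply/funext => x; rewrite rmorph_sum; apply: eq_bigr => i _; exact: cpartial_real.
have e2 : res2 (fun i x => (phi i x)%:C) =
    \sum_i \sum_j cint (lam3 R) (fun x : V => fun_of (u i) x * fun_of (u j) x * (partial j (phi i) x)%:C).
  apply: eq_bigr => i _; apply: eq_bigr => j _; apply: (congr1 (cint (lam3 R))); apply/funext => x.
  by rewrite cpartial_real.
have e1 : res1 (fun i x => (phi i x)%:C) =
   \sum_i cint (lam3 R) (fun x : V => (enorm (x : E3) `^ (2 * s))%:C * fun_of (dfourier (u i)) x * inv_fourier (fun y => (phi i y)%:C) x).
  by apply: eq_bigr => i _.
by rewrite /residual e1 e2 e3 e; ring.
Qed.

Lemma residual_test (phi : 'I_3 -> E3 -> R[i]) : (forall i, cpart (phi i) (@test_function R)) -> residual phi = 0.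
Proof.
move=> tp.
have -> : phi = (fun i x => ii R * (Im (phi i x))%:C + (Re (phi i x))%:C).
  apply/funext => i; apply/funext => x; apply: ReIm_eq.
    by rewrite ReD ReM /= mul0r mulr0 subr0 add0r.
  by rewrite ImD ImM /= mul0r mul1r add0r addr0.
rewrite (residual_lin (ii R) (fun i => csch_test (ctest_real (tp i).2)) (fun i => csch_test (ctest_real (tp i).1))).
rewrite (residual_real (fun i => (tp i).1)) (residual_real (fun i => (tp i).2)).
by rewrite mulr0 addr0.
Qed.

Lemma residual_schwartz (phi : 'I_3 -> E3 -> R[i]) : (forall i, csch (phi i)) -> residual phi = 0.
Proof.
move=> sp; pose p_ n i x := cutoffn psi n x * phi i x.
have s_ i n : csch (p_ n i) := csch_cutoffM hpsi n (sp i).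
have c i : cscvg (fun n => p_ n i) (phi i) := csnull_cutoff hpsi (sp i).
have z n : residual (p_ n) = 0 by apply: residual_test => i; exact: (ctest_cutoffM hpsi n (sp i).1).
have L : ccvg (fun n => residual (p_ n)) (residual phi).
  rewrite /residual; apply: ccvgD; first apply: ccvgD.
  - rewrite /res1; apply: ccvg_sum => i; apply: tfun_cvg (tf2 i) _ (csch_inv_fourier (sp i)) (cscvg_inv_fourier (s_ i) (sp i) (c i)).
    by move=> n; exact: csch_inv_fourier (s_ i n).
  - apply: ccvgN; rewrite /res2; apply: ccvg_sum => i; apply: ccvg_sum => j.
    apply: tfun_cvg (tfun_uu i j) _ (csch_cpartial j (sp i)) (cscvg_cpartial j (s_ i) (sp i) (c i)).
    by move=> n; exact: csch_cpartial (s_ i n).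
  - apply: ccvgN; apply: (tempered_cvg (f_ := fun n x => \sum_i cpartial i (p_ n i) x) tP).
    + by move=> n; apply: csch_sum3 => i; exact: csch_cpartial.
    + by apply: csch_sum3 => i; exact: csch_cpartial.
    + apply: (cscvg_sum3 (F_ := fun i n => cpartial i (p_ n i))).
      * by move=> i n; exact: csch_cpartial.
      * by move=> i; exact: csch_cpartial.
      * by move=> i; exact: cscvg_cpartial (s_ i) (sp i) (c i).
apply: (ccvg_unique L); under eq_fun do rewrite z; exact: ccvg_cst.
Qed.

Variables (g : 'I_3 -> E3 -> R[i]) (hg : ns_pre s g).
Hypothesis gf : forall i, {ae lam3 R, forall x : V, g i x = fun_of (dfourier (u i)) x}.

(** The equation is tested with the Fourier transform of [th]. Its divergence is the transform of a
    multiple of the sum of x_i th_i, which is zero, so the pressure is evaluated at the zero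
    function. *)
Lemma frequency_equation (th : 'I_3 -> E3 -> R[i]) : (forall i, cpart (th i) (@test_function R)) ->
  (forall x, \sum_i (coord x i)%:C * th i x = 0) ->
  \sum_i cint (lam3 R) (fun x : V => (enorm (x : E3) `^ (2 * s))%:C * g i x * th i x) =
    (c0 R)%:C * \sum_i \sum_j cint (lam33 R) (fun z : VV => g j z.1 * g i z.2 *
      (- ii R * (coord ((z.1 : E3) + (z.2 : E3)) j)%:C * th i ((z.1 : E3) + (z.2 : E3)))).
Proof.
move=> tth dth; have st i := csch_test (tth i).
have := @residual_schwartz (fun i => fourier (th i)) (fun i => csch_fourier (st i)).
have P0 : P (fun=> 0) = 0.
  have s00 : csch (fun _ : E3 => 0 : R[i]).
    by have := cschZ 0 (st ord0); congr csch; apply/funext => x; rewrite mul0r.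
  have := tempered_lin 1 tP s00 s00; rewrite !mul1r addr0 => e2.
  by apply: (addrI (P (fun=> 0))); rewrite -e2 addr0.
have dz : (fun x => \sum_i cpartial i (fourier (th i)) x) = fun=> 0.
  apply/funext => x; under eq_bigr do rewrite (cpartial_fourier _ (st _)).
  have hs i : cL1 (lam3 R) (fun y : V => cis (dotp (- x) y) * ((- ii R * (coord (y : E3) i)%:C) * th i y)).
    apply: cL1_cis; apply: csch_cL1; have := cschZ (- ii R) (csch_coordM i (st i)).
    by congr csch; apply/funext => y; exact: mulrA.
  under eq_bigr do rewrite fourierE inv_fourierE.
  rewrite -mulr_sumr -cint_sum//.
  rewrite (_ : (fun y : V => _) = fun=> 0) ?cint0 ?mulr0//; apply/funext => y.
  rewrite -mulr_sumr; under eq_bigr do rewrite -mulrA.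
  by rewrite -mulr_sumr dth !mulr0.
rewrite /residual /res3 dz P0 subr0 => /eqP; rewrite subr_eq0 => /eqP e.
have mg i := cmeas_g hg i.
have eL i : cint (lam3 R) (fun x : V => (enorm (x : E3) `^ (2 * s))%:C * g i x * th i x) =
  cint (lam3 R) (fun x : V => f2 i x * inv_fourier (fourier (th i)) x).
  rewrite inv_fourierK//; apply: ae_eq_cint.
  - apply: cmeasM; last exact: cmeas_csmooth (st i).1.
    by apply: cmeasM => //; apply: cmeas_real; apply: (locb_powR _).1; rewrite mulr_ge0// ltW.
  - exact: (tfun_cL1 (tf2 i) (st i)).1.
  - by move: (@gf i); apply: filterS => x ->.
transitivity (res1 (fun i => fourier (th i))); first by apply: eq_bigr => i _; exact: eL.
rewrite e /res2 mulr_sumr; apply: eq_bigr => i _.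
rewrite mulr_sumr; apply: eq_bigr => j _.
have tT : cpart (fun x : E3 => - ii R * (coord x j)%:C * th i x) (@test_function R).
  by apply: ctestM (tth i); apply: csmoothZ; exact: csmooth_coord.
rewrite (cpartial_fourier j (st i)).
exact: (product_formula hpsi s56 hH hg gf i j tT).
Qed.

End weak_form.

(** * Choice of frequency functions and the energy *)

Section weak_solutions.
Variable R : realType.
Notation E3 := (R * R * R)%type.
Notation V := (mspace R).
Notation VV := (V * V)%type.
Variables (psi : E3 -> R) (hpsi : lp_cutoff psi) (s : R) (s56 : 5 / 6 <= s) (s1 : s < 1).
Let s0 : 0 < s := s_gt0 s56.
Variables (u : 'I_3 -> dist R) (hu : weak_solution s u).

Let hH i : Hdot s (u i). Proof. by case: hu. Qed.
Let hR i : real_dist (u i). Proof. by case: hu. Qed.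
Let f i := fun_of (dfourier (u i)).
Let hf i : represents (dfourier (u i)) (f i). Proof. exact: (hdot_represents hpsi (hH i)). Qed.

Definition divg (x : E3) : R[i] := \sum_i (coord x i)%:C * f i x.

Lemma divergence_schwartz (phi : E3 -> R[i]) : csch phi -> \sum_i u i (cpartial i phi) = 0.
Proof.
move=> sp; have [_ _ hd _] := hu; have s_ n := csch_cutoffM hpsi n sp.
have L : ccvg (fun n => \sum_i u i (cpartial i (fun x => cutoffn psi n x * phi x))) (\sum_i u i (cpartial i phi)).
  apply: ccvg_sum => i; apply: (tempered_cvg (hdot_tempered (hH i))).
  - by move=> n; exact: csch_cpartial.
  - exact: csch_cpartial.
  - exact: cscvg_cpartial s_ sp (csnull_cutoff hpsi sp).
have z n : \sum_i u i (cpartial i (fun x => cutoffn psi n x * phi x)) = 0.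
  have := hd _ (ctest_cutoffM hpsi n sp.1); rewrite /dpartial sumrN => /eqP.
  by rewrite oppr_eq0 => /eqP.
by apply: (ccvg_unique L); under eq_fun do rewrite z; exact: ccvg_cst.
Qed.

Lemma divg_ae : {ae lam3 R, forall x : V, divg x = 0}.
Proof.
have ld : locally_integrable3 divg.
  by apply: loc_sum => i; apply: loc_mulr; [exact: (hf i).1|exact: locb_coord].
apply: (lint3_unique hpsi ld) => sg tsg.
have st := csch_test (ctest_real tsg); have sF := csch_fourier st.
have := divergence_schwartz sF.
have tc i : test_function (fun x => coord x i * sg x) by apply: test_functionM tsg; exact: smooth_coord.
have l i : cL1 (lam3 R) (fun x : V => f i x * (coord (x : E3) i * sg x)%:C) := lint3_test (hf i).1 (tc i).
have e i : u i (cpartial i (fourier (fun x => (sg x)%:C))) = - ii R * cint (lam3 R) (fun x : V => f i x * (coord (x : E3) i * sg x)%:C).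
  rewrite (hdot_pairing hpsi s0 (hH i) (csch_cpartial i sF)) -(cintZ _ (l i)).
  apply: (congr1 (cint (lam3 R))); apply/funext => x.
  rewrite (inv_fourier_cpartial i x sF) (inv_fourierK st) rmorphM /f /=; ring.
rewrite (eq_bigr _ (fun i _ => e i)) -mulr_sumr => /eqP; rewrite mulf_eq0 => /orP[|/eqP z].
  by rewrite oppr_eq0 => /eqP /(congr1 (@Im R)) /= /eqP; rewrite oner_eq0.
rewrite -[RHS]z -cint_sum//; apply: (congr1 (cint (lam3 R))); apply/funext => x.
rewrite /divg mulr_suml; apply: eq_bigr => i _; rewrite rmorphM /=; ring.
Qed.

(** A single nonnegative measurable function whose zeros are the points where both the divergence
    condition and Hermitian symmetry hold; the set [good] is measurable for this reason. *)
Definition defect (x : E3) : R := cabs (divg x) ^+ 2 + \sum_i cabs (f i (- x) - (f i x)^*) ^+ 2.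

Definition good : set V := [set x | defect x = 0] `&` [set x | enorm (x : E3) <> 0].

Lemma measurable_good : measurable good.
Proof.
have mf i : cmeas (f i : V -> R[i]) := lint3_cmeas (hf i).1.
have md : measurable_fun setT (defect : V -> R).
  apply: measurable_funD.
    apply: measurable_sqr; apply: cmeas_sum => i; apply: cmeasM (mf i).
    by apply: cmeas_real; exact: (locb_coord R i).1.
  apply: measurable_sum => i; apply: measurable_sqr; apply: cmeasB; last exact: cmeas_conj (mf i).
  exact: (cmeas_comp (scales3_opp R).1 (mf i)).
apply: measurableI.
  by have := md measurableT _ (measurable_set1 (0 : R)); rewrite setTI.
have := @measurable_enorm R measurableT _ (measurableC (measurable_set1 (0 : R))).
by rewrite setTI.
Qed.

Lemma goodP (x : E3) : good x -> [/\ divg x = 0, forall i, f i (- x) = (f i x)^* & enorm x <> 0].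
Proof.
move=> [/eqP + x0]; rewrite /defect paddr_eq0 ?sqr_ge0//; last by apply: sumr_ge0 => i _; exact: sqr_ge0.
rewrite sqrf_eq0 psumr_eq0 => [|i _]; last exact: sqr_ge0.
move=> /andP[/eqP /cabs_eq0 d /allP h]; split => // i.
have := h i (mem_index_enum i); rewrite /= sqrf_eq0 => /eqP /cabs_eq0 /eqP.
by rewrite subr_eq0 => /eqP.
Qed.

Lemma good_of (x : E3) : divg x = 0 -> (forall i, f i (- x) = (f i x)^*) -> enorm x <> 0 -> good x.
Proof.
move=> d h x0; split => //=; rewrite /defect d cabs0 expr0n /= add0r big1// => i _.
by rewrite h subrr cabs0 expr0n.
Qed.

Lemma good_opp (x : E3) : good x -> good (- x).
Proof.
move=> /goodP[d h x0]; apply: good_of; last by rewrite enormN.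
  have -> : divg (- x) = - (divg x)^*.
    rewrite /divg rmorph_sum -sumrN; apply: eq_bigr => i _.
    by rewrite coordN h rmorphN mulNr [in RHS]rmorphM; congr (- (_ * _)); exact/esym/conj_real.
  by rewrite d rmorph0 oppr0.
by move=> i; rewrite opprK h conjCK.
Qed.

Lemma good_ae : {ae lam3 R, forall x : V, good x}.
Proof.
have hc i : {ae lam3 R, forall x : V, f i (- (x : E3)) = (f i x)^*} := hdot_conj hpsi s0 (hH i) (hR i).
have hca : {ae lam3 R, forall x : V, forall i, f i (- (x : E3)) = (f i x)^*}.
  move: (hc ord0) (hc (lift ord0 ord0)) (hc (lift ord0 (lift ord0 ord0))); apply: filterS3 => x h0 h1 h2.
  case => [[|[|[|//]]]] hi; [move: h0|move: h1|move: h2]; congr (f _ _ = (f _ _)^*); exact: val_inj.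
move: divg_ae hca (ae_neq0 hpsi); apply: filterS3 => x d h x0.
by apply: good_of => //; exact/eqP.
Qed.

(** Setting the transform to 0 outside [good], a set of full measure that is symmetric and avoids 0,
    turns the almost everywhere identities into identities at every point. *)
Definition freq i (x : E3) : R[i] := (\1_good x)%:C * f i x.

Lemma freq_ae i : {ae lam3 R, forall x : V, freq i x = f i x}.
Proof.
by move: good_ae; apply: filterS => x gx; rewrite /freq indicE mem_set// mul1r.
Qed.

Lemma ns_pre_freq : ns_pre s freq.
Proof.
have mi : measurable_fun setT (\1_good : V -> R) := measurable_indic measurable_good.
split => i.
  apply: loc_mulr; first exact: (hf i).1.
  by split => // r; exists 1 => x _; exact: indic_le1.
have mfr : cmeas (freq i : V -> R[i]).
  by apply: cmeasM; [exact: cmeas_real|exact: lint3_cmeas (hf i).1].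
apply: (cL2_dom _ (hdot_sqr hpsi s0 (hH i))).
  by apply: cmeasM => //; apply: cmeas_real; exact: (locb_powR (ltW s0)).1.
move=> x; rewrite !cabsM ler_wpM2l ?cabs_ge0// cabs_real ler_piMl ?cabs_ge0//.
exact: indic_le1.
Qed.

Lemma ns_system_freq : ns_system s freq.
Proof.
have [_ _ _ [P [tP hW]]] := hu; split; first exact: ns_pre_freq.
- move=> x; have [gx|gx] := pselect (good x); last first.
    by rewrite big1// => i _; rewrite /freq indicE memNset// mul0r mulr0.
  have [d _ _] := goodP gx; rewrite -[RHS]d; apply: eq_bigr => i _.
  by rewrite /freq indicE mem_set// mul1r.
- move=> i x; rewrite /freq !indicE; have [gx|gx] := pselect (good x).
    have [_ h _] := goodP gx.
    by rewrite (mem_set gx) (mem_set (good_opp gx)) !mul1r h.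
  have gx' : ~ good (- x) by move=> /good_opp; rewrite opprK.
  by rewrite (memNset gx) (memNset gx') !mul0r rmorph0.
- move=> i; rewrite /freq indicE memNset ?mul0r// => /goodP[_ _].
  by rewrite enorm0.
- move=> th tth dth; exact: (frequency_equation hpsi s56 s1 hH tP hW ns_pre_freq freq_ae tth dth).
Qed.

Lemma freq_represents i : represents (dfourier (u i)) (freq i).
Proof.
split; first exact: ns_loc ns_pre_freq i.
move=> th tt; rewrite (hf i).2// /dist_of !cintegralE; apply: ae_eq_cint.
- exact: (cL1_test (hf i).1 tt).1.
- exact: (cL1_test (ns_loc ns_pre_freq i) tt).1.
- by move: (freq_ae i); apply: filterS => x ->.
Qed.

Lemma N2_ae (A B : V -> R[i]) : cmeas A -> cmeas B -> {ae lam3 R, forall x, A x = B x} -> N2 A = N2 B.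
Proof.
move=> mA mB ae.
have := congr1 (@Re R) (ae_eq_cint (cmeas_real (measurable_sqr mA)) (cmeas_real (measurable_sqr mB)) _).
by apply; move: ae; apply: filterS => x ->.
Qed.

Lemma Rintegral_sum3 (F : 'I_3 -> V -> R) : (forall i, (lam3 R).-integrable setT (fun x => (F i x)%:E)) ->
  (lam3 R).-integrable setT (fun x => (\sum_i F i x)%:E) /\
  \int[lam3 R]_x (\sum_i F i x) = \sum_i \int[lam3 R]_x F i x.
Proof.
move=> h.
have -> : (fun x => (\sum_i F i x)%:E) = (fun x => (F ord0 x + (F (lift ord0 ord0) x + F (lift ord0 (lift ord0 ord0)) x))%:E).
  by apply/funext => x; rewrite !big_ord_recl big_ord0 addr0.
have i1 := integrable_RD (h (lift ord0 ord0)) (h (lift ord0 (lift ord0 ord0))).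
split; first exact: integrable_RD.
have -> : \int[lam3 R]_x (\sum_i F i x) = \int[lam3 R]_x (F ord0 x + (F (lift ord0 ord0) x + F (lift ord0 (lift ord0 ord0)) x)).
  by apply: eq_Rintegral => x _; rewrite !big_ord_recl big_ord0 addr0.
rewrite (RintegralD measurableT (h _) i1) (RintegralD measurableT (h _) (h _)).
by rewrite !big_ord_recl big_ord0 addr0.
Qed.

(** Plancherel for each component, together with Hermitian symmetry, which turns g(-y) into the
    conjugate of g(y). *)
Lemma energy_dens : energy s u = (Re (cint (lam3 R) (dens s freq)))%:E.
Proof.
pose F i (x : V) : R[i] := (enorm (x : E3) `^ s)%:C * freq i x.
have F2 i : cL2 (F i) := ns_sqr ns_pre_freq i.
have [h hh hr] : exists2 h : 'I_3 -> E3 -> R[i], forall i, ft2 (fun x : V => (enorm (x : E3) `^ s)%:C * f i x) (h i)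
    & forall i, represents (frac_lap (s / 2) (u i)) (h i).
  pose H i := cid2 (frac_function hpsi s56 (hH i)).
  by exists (fun i => s2val (H i)) => i; [exact: s2valP (H i)|exact: s2valP' (H i)].
have h2 i : cL2 (h i : V -> R[i]) by have [] := hh i.
have nF i : N2 (h i) = N2 (F i).
  rewrite (ft2_norm hpsi (hh i)); apply: N2_ae.
  - by have [[]] := hh i.
  - exact: (F2 i).1.
  - by move: (freq_ae i); apply: filterS => x e; rewrite /F e.
have eD : cint (lam3 R) (dens s freq) = \sum_i (N2 (F i))%:C.
  under eq_bigr do rewrite -(cint_sqr (F2 _)).
  rewrite -cint_sum; last by move=> i; apply: cL2M (F2 i) (cL2_conj (F2 i)).
  apply: (congr1 (cint (lam3 R))); apply/funext => x; rewrite /dens mulr_sumr; apply: eq_bigr => i _.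
  rewrite (ns_conj ns_system_freq) /F.
  have -> : ((enorm (x : E3) `^ s)%:C * freq i x)^* = (enorm (x : E3) `^ s)%:C * (freq i x)^*.
    by rewrite rmorphM; congr (_ * _); exact: conj_real.
  by rewrite powR_double [(_ * _)%:C]rmorphM /=; move: (enorm _ `^ _)%:C (freq i x) (_^*) => a b c; ring.
rewrite eD raddf_sum /=.
have [iQ eQ] := Rintegral_sum3 (fun i => (h2 i).2).
have mh i : cmeas (fun_of (frac_lap (s / 2) (u i)) : V -> R[i]).
  by have [[l _] _] := fun_of_represents hpsi (hr i); exact: lint3_cmeas.
rewrite /energy integral_leb3.
transitivity (\int[lam3 R]_x (\sum_i cabs (h i x) ^+ 2)%:E)%E.
  apply: ae_eq_integral => //.
  - by apply/measurable_EFinP; apply: measurable_sum => i; exact: measurable_sqr.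
  - exact: measurable_int iQ.
  - have ae i : {ae lam3 R, forall x : V, fun_of (frac_lap (s / 2) (u i)) x = h i x} := (fun_of_represents hpsi (hr i)).2.
    move: (ae ord0) (ae (lift ord0 ord0)) (ae (lift ord0 (lift ord0 ord0))); apply: filterS3 => x e0 e1 e2 _.
    by rewrite !big_ord_recl !big_ord0 e0 e1 e2.
have := nint_Rintegral iQ; rewrite /nint => ->; rewrite eQ; congr (_%:E).
by apply: eq_bigr => i _; exact: nF.
Qed.

End weak_solutions.

Theorem theorem1p2 (R : realType) (psi : R * R * R -> R) (s : R)
    (u : 'I_3 -> dist R) :
  lp_cutoff psi ->
  5 / 6 <= s -> s < 1 ->
  weak_solution s u ->
  (energy s u < +oo)%E ->
  energy s u =
    (- limn_einf (fun n : nat => (complex.Re (flux psi u (- n%:Z)))%:E))%E.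
Proof.
move=> hpsi s56 s1 hu _.
have hs := ns_system_freq hpsi s56 s1 hu.
have := flux_cvg hpsi s56 s1 hs (freq_represents hpsi s56 hu) => c.
have ce : (fun n : nat => (complex.Re (flux psi u (- n%:Z)))%:E) @ \oo -->
  (- complex.Re (cint (lam3 R) (dens s (freq u))))%:E by apply/fine_cvgP; split; [exact: nearW|exact: c].
(* The sequence converges, so its lower limit is the limit already computed. *)
have [-> _] := cvg_limn_einf_sup ce.
by rewrite (energy_dens hpsi s56 s1 hu) EFinN oppeK.
Qed.
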